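(* Let $\Lambda=\{1,\ldots,n\}$ for some $n\ge 1$, or $\Lambda=\mathbb N$. Fix $I,J\in\mathbb S$ with $J\perp I$. Let $f_j\in H^\infty(\mathbb B)$, $j\in\Lambda$, satisfy $$\sum_{j\in\Lambda}|f_j(q)|^2\le1,\qquad q\in\mathbb B,$$ let $\mathcal M_{\mathbf f}:H^2(\mathbb B;\ell^2(\Lambda))\to H^2(\mathbb B)$, $\mathcal M_{\mathbf f}(h_j)_{j\in\Lambda}=\sum_{j\in\Lambda}f_j\star h_j$, be the associated row multiplier, and let $\eta>0$. Then the following statements are equivalent. (i) The Toeplitz lower bound $\mathcal M_{\mathbf f}\mathcal M_{\mathbf f}^*\ge\eta^2 I_{H^2(\mathbb B)}$ holds. (ii) There exist $g_j\in H^\infty(\mathbb B)$, $j\in\Lambda$, such that $$\sum_{j\in\Lambda}f_j\star g_j=1,$$ and the block column $$\Psi_{\mathbf g}(z)=\begin{pmatrix}\mathscr R_I(g_1)(z)\\ \mathscr R_I(g_2)(z)\\ \vdots\end{pmatrix}$$ belongs to $H^\infty(\mathbb D_I,\mathcal B(\mathbb C_I^2,E_\Lambda))$ and satisfies $\|\Psi_{\mathbf g}\|_\infty\le\eta^{-1}$. If $\Lambda=\mathbb N$, the series $\sum_{j\in\Lambda}f_j\star g_j$ in (ii) converges absolutely and uniformly on compact subsets of $\mathbb B$.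
   Context: $\mathbb H$ denotes the quaternions with the usual conjugation and modulus $|\cdot|$; $\mathbb B=\{q\in\mathbb H:|q|<1\}$; $\mathbb S=\{I\in\mathbb H:I^2=-1\}$. For $I\in\mathbb S$, $\mathbb C_I=\mathbb R+\mathbb R I$ (a copy of the complex plane) and $\mathbb D_I=\mathbb B\cap\mathbb C_I$; $J\perp I$ means $IJ=-JI$. A real-differentiable function $f:\mathbb B\to\mathbb H$ is (left) slice regular if for every $I\in\mathbb S$ one has $\frac12\bigl(\frac{\partial}{\partial x}+I\frac{\partial}{\partial y}\bigr)f(x+Iy)=0$ on $\mathbb D_I$; equivalently $f(q)=\sum_{m\ge0}q^m a_m$ with $a_m\in\mathbb H$, converging uniformly on compact subsets of $\mathbb B$. For $f(q)=\sum_m q^m a_m$ and $g(q)=\sum_m q^m b_m$, the slice regular product is $(f\star g)(q)=\sum_m q^m\bigl(\sum_{k=0}^m a_k b_{m-k}\bigr)$. $H^\infty(\mathbb B)$ is the space of bounded slice regular functions on $\mathbb B$ with the sup norm. Every slice regular $f$ has a unique splitting $f|_{\mathbb D_I}=F+GJ$ with $F,G:\mathbb D_I\to\mathbb C_I$ holomorphic. For a $\mathbb C_I$-valued holomorphic $U$ put $U^\#(z)=\overline{U(\overline z)}$, and define the fixed-slice matrix realization $$\mathscr R_I(f)(z)=\begin{pmatrix}F(z)&G(z)\\-G^\#(z)&F^\#(z)\end{pmatrix}.$$ $H^2(\mathbb B)$ is the right quaternionic Hilbert space of slice regular $h(q)=\sum_m q^m a_m$ with $\|h\|^2=\sum_m|a_m|^2<\infty$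 and inner product $\langle h,u\rangle=\sum_m\overline{a_m}b_m$ for $u(q)=\sum_m q^m b_m$. $H^2(\mathbb B;\ell^2(\Lambda))$ is the right quaternionic Hilbert space of families $(h_j)_{j\in\Lambda}$ in $H^2(\mathbb B)$ with $\|(h_j)\|^2=\sum_j\|h_j\|^2<\infty$. Under the hypothesis $\sum_j|f_j|^2\le1$ on $\mathbb B$, the row multiplier $\mathcal M_{\mathbf f}$ is a well-defined bounded operator (for $\Lambda=\mathbb N$ the series converges in $H^2$-norm). Adjoints are taken with respect to these inner products, and operator inequalities are in the sense of quadratic forms. $E_\Lambda=\ell^2(\Lambda;\mathbb C_I^2)$ (so $E_\Lambda=\mathbb C_I^{2n}$ if $\Lambda=\{1,\dots,n\}$). For complex Hilbert spaces $E,E_*$, $H^\infty(\mathbb D_I,\mathcal B(E,E_* ))$ is the space of bounded holomorphic functions on $\mathbb D_I$ with values in the bounded operators $E\to E_*$, with norm $\|A\|_\infty=\sup_{z\in\mathbb D_I}\|A(z)\|_{\mathrm{op}}$. *)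

(* Defs.v *)
From HB Require Import structures.
From mathcomp Require Import all_boot all_order all_algebra.
From mathcomp Require Import complex.
From mathcomp Require Import all_classical all_reals all_analysis.
From mathcomp Require Import ring.

Set Implicit Arguments.
Unset Strict Implicit.
Unset Printing Implicit Defensive.
Import Order.TTheory GRing.Theory Num.Theory.
Import numFieldNormedType.Exports.
Import ComplexField Normc.

Local Open Scope classical_set_scope.
Local Open Scope ring_scope.

(* Quaternions: [Quat a b c d] is a + b i + c j + d k. *)
Record quat (R : Type) := Quat { qre : R; qi : R; qj : R; qk : R }.

Section QuatRing.
Variable R : realType.
Implicit Types p q r : quat R.

Definition tuple_of_quat q := (qre q, qi q, qj q, qk q).
Definition quat_of_tuple (t : R * R * R * R) :=
  let: (a, b, c, d) := t in Quat a b c d.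
Lemma tuple_of_quatK : cancel tuple_of_quat quat_of_tuple.
Proof. by case. Qed.

HB.instance Definition _ := Choice.copy (quat R) (can_type tuple_of_quatK).

Lemma quat_ext p q :
  qre p = qre q -> qi p = qi q -> qj p = qj q -> qk p = qk q -> p = q.
Proof. by case: p q => ? ? ? ? [? ? ? ?] /= -> -> -> ->. Qed.

Definition quat_add p q :=
  Quat (qre p + qre q) (qi p + qi q) (qj p + qj q) (qk p + qk q).
Definition quat_opp p := Quat (- qre p) (- qi p) (- qj p) (- qk p).
Definition quat_zero : quat R := Quat 0 0 0 0.
Definition quat_one : quat R := Quat 1 0 0 0.
Definition quat_mul p q := Quat
  (qre p * qre q - qi p * qi q - qj p * qj q - qk p * qk q)
  (qre p * qi q + qi p * qre q + qj p * qk q - qk p * qj q)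
  (qre p * qj q - qi p * qk q + qj p * qre q + qk p * qi q)
  (qre p * qk q + qi p * qj q - qj p * qi q + qk p * qre q).
Definition quat_scale (a : R) q := Quat (a * qre q) (a * qi q) (a * qj q) (a * qk q).
Definition quat_conj q := Quat (qre q) (- qi q) (- qj q) (- qk q).
Definition quat_norm q : R :=
  Num.sqrt (qre q ^+ 2 + qi q ^+ 2 + qj q ^+ 2 + qk q ^+ 2).

Let addA : associative quat_add.
Proof. by move=> p q r; apply: quat_ext => /=; rewrite addrA. Qed.
Let addC : commutative quat_add.
Proof. by move=> p q; apply: quat_ext => /=; rewrite addrC. Qed.
Let add0 : left_id quat_zero quat_add.
Proof. by move=> p; apply: quat_ext => /=; rewrite add0r. Qed.
Let addN : left_inverse quat_zero quat_opp quat_add.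
Proof. by move=> p; apply: quat_ext => /=; rewrite addNr. Qed.

HB.instance Definition _ := GRing.isZmodule.Build (quat R) addA addC add0 addN.

Let mulA : associative quat_mul.
Proof. by move=> p q r; apply: quat_ext => /=; ring. Qed.
Let mul1 : left_id quat_one quat_mul.
Proof. by move=> p; apply: quat_ext => /=; ring. Qed.
Let mulq1 : right_id quat_one quat_mul.
Proof. by move=> p; apply: quat_ext => /=; ring. Qed.
Let mulDl : left_distributive quat_mul quat_add.
Proof. by move=> p q r; apply: quat_ext => /=; ring. Qed.
Let mulDr : right_distributive quat_mul quat_add.
Proof. by move=> p q r; apply: quat_ext => /=; ring. Qed.
Let one_neq0 : quat_one != 0.
Proof. by apply/eqP => -[] /eqP; rewrite oner_eq0. Qed.

HB.instance Definition _ := GRing.Zmodule_isNzRing.Build (quat R)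
  mulA mul1 mulq1 mulDl mulDr one_neq0.

Let scaleA (a b : R) q : quat_scale a (quat_scale b q) = quat_scale (a * b) q.
Proof. by apply: quat_ext => /=; rewrite mulrA. Qed.
Let scale1 : left_id 1 quat_scale.
Proof. by move=> p; apply: quat_ext => /=; rewrite mul1r. Qed.
Let scaleDr : right_distributive quat_scale +%R.
Proof. by move=> a p q; apply: quat_ext => /=; rewrite mulrDr. Qed.
Let scaleDl q : {morph quat_scale^~ q : a b / a + b}.
Proof. by move=> a b; apply: quat_ext => /=; rewrite mulrDl. Qed.

HB.instance Definition _ := GRing.Zmodule_isLmodule.Build R (quat R)
  scaleA scale1 scaleDr scaleDl.

Let scaleAl (a : R) p q : a *: (p * q) = a *: p * q.
Proof. by apply: quat_ext => /=; ring. Qed.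
HB.instance Definition _ := GRing.Lmodule_isLalgebra.Build R (quat R) scaleAl.
Let scaleAr (a : R) p q : a *: (p * q) = p * (a *: q).
Proof. by apply: quat_ext => /=; ring. Qed.
HB.instance Definition _ := GRing.Lalgebra_isAlgebra.Build R (quat R) scaleAr.

Let normD p q : quat_norm (p + q) <= quat_norm p + quat_norm q.
Proof.
case: p q => a b c d [a' b' c' d']; rewrite /quat_norm /=.
set P := a ^+ 2 + _ + _ + _; set Q := a' ^+ 2 + _ + _ + _.
have P0 : 0 <= P by rewrite !addr_ge0 ?sqr_ge0.
have Q0 : 0 <= Q by rewrite !addr_ge0 ?sqr_ge0.
have CS : a * a' + b * b' + c * c' + d * d' <= Num.sqrt P * Num.sqrt Q.
  rewrite -sqrtrM//; apply: le_trans (ler_norm _) _.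
  rewrite -sqrtr_sqr; apply: ler_wsqrtr.
  rewrite -subr_ge0.
  have -> : P * Q - (a * a' + b * b' + c * c' + d * d') ^+ 2 =
    (a * b' - b * a') ^+ 2 + (a * c' - c * a') ^+ 2 + (a * d' - d * a') ^+ 2 +
    (b * c' - c * b') ^+ 2 + (b * d' - d * b') ^+ 2 + (c * d' - d * c') ^+ 2.
    by rewrite /P /Q; ring.
  by rewrite !addr_ge0 ?sqr_ge0.
rewrite -[leRHS]ger0_norm ?addr_ge0 ?sqrtr_ge0// -sqrtr_sqr; apply: ler_wsqrtr.
rewrite [leRHS]sqrrD !sqr_sqrtr//.
have -> : (a + a') ^+ 2 + (b + b') ^+ 2 + (c + c') ^+ 2 + (d + d') ^+ 2 =
  P + (a * a' + b * b' + c * c' + d * d') *+ 2 + Q by rewrite /P /Q; ring.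
by rewrite lerD2r lerD2l lerMn2r CS.
Qed.
Let normZ (a : R) q : quat_norm (a *: q) = `|a| * quat_norm q.
Proof.
rewrite /quat_norm /= !exprMn -!mulrDr sqrtrM ?sqr_ge0//.
by rewrite sqrtr_sqr.
Qed.
Let norm0_eq0 q : quat_norm q = 0 -> q = 0.
Proof.
case: q => a b c d; rewrite /quat_norm /= => /eqP; rewrite sqrtr_eq0 => h.
have : a ^+ 2 + b ^+ 2 + c ^+ 2 + d ^+ 2 == 0.
  by rewrite eq_le h !addr_ge0 ?sqr_ge0.
rewrite !paddr_eq0 ?addr_ge0 ?sqr_ge0// !sqrf_eq0.
by case/andP => /andP[/andP[/eqP-> /eqP->] /eqP->] /eqP->.
Qed.

(* The norm `|q| is the usual modulus. *)
HB.instance Definition _ := Lmodule_isNormed.Build R (quat R)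
  normD normZ norm0_eq0.

End QuatRing.

Section Slice.
Variable R : realType.
Local Notation H := (quat R).
Local Notation C := R[i].
Implicit Types (f g h u : H -> H) (I J q : H) (Lambda : set nat).

Definition unit_ball : set H := [set q | `|q| < 1].

Definition imag_unit I := I ^+ 2 = -1.

Definition slice_orth J I := I * J = - (J * I).

(* 'D_1 f and 'D_I f at x + I y are the partial derivatives of
   (x, y) |-> f (x + I y).  As everywhere below, only the values of f on the
   unit ball matter. *)
Definition slice_regular f :=
  (forall q, unit_ball q -> differentiable f q) /\
  (forall I, imag_unit I -> forall x y : R, unit_ball (x%:A + I * y%:A) ->
     2^-1 *: ('D_1 f (x%:A + I * y%:A) + I * 'D_I f (x%:A + I * y%:A)) = 0).

Definition Hinf f :=
  slice_regular f /\ exists M : R, forall q, unit_ball q -> `|f q| <= M.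

Definition coeffs f : nat -> H := xget (fun=> 0)
  [set a | forall q, unit_ball q -> series (fun m => q ^+ m * a m) @ \oo --> f q].

Definition slice_mul f g : H -> H := fun q =>
  limn (series (fun m => q ^+ m * \sum_(k < m.+1) coeffs f k * coeffs g (m - k)%N)).

Definition H2_sqnorm h : \bar R := (\sum_(0 <= m <oo) (`|coeffs h m| ^+ 2)%:E)%E.

Definition H2 h := slice_regular h /\ (H2_sqnorm h < +oo)%E.

Definition H2_inner h u : H :=
  limn (series (fun m => quat_conj (coeffs h m) * coeffs u m)).

(* Families indexed by Lambda are represented by sequences, of which only the
   terms with index in Lambda matter. *)
Definition H2l2 Lambda (h : nat -> H -> H) :=
  (forall j, Lambda j -> H2 (h j)) /\
  (\sum_(0 <= j <oo | j \in Lambda) H2_sqnorm (h j) < +oo)%E.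

Definition H2l2_inner Lambda (h u : nat -> H -> H) : H :=
  limn (fun N => \sum_(0 <= j < N | j \in Lambda) H2_inner (h j) (u j)).

(* The sum of the family (f_j * h_j) in H^2-norm. *)
Definition row_mult Lambda (f h : nat -> H -> H) : H -> H := xget (fun=> 0)
  [set u | H2 u /\
    H2_sqnorm (fun q => \sum_(0 <= j < N | j \in Lambda) slice_mul (f j) (h j) q - u q)
      @[N --> \oo] --> 0%E].

Definition is_adjoint Lambda (M : (nat -> H -> H) -> H -> H)
    (Mstar : (H -> H) -> nat -> H -> H) :=
  forall u, H2 u -> H2l2 Lambda (Mstar u) /\
    forall h : nat -> H -> H, H2l2 Lambda h ->
      H2_inner (M h) u = H2l2_inner Lambda h (Mstar u).

(* The quadratic forms of the selfadjoint operators M M^* and I take real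
   values, hence are compared through their real parts. *)
Definition toeplitz_lower_bound Lambda (f : nat -> H -> H) (eta : R) :=
  exists2 Mstar, is_adjoint Lambda (row_mult Lambda f) Mstar &
    forall u, H2 u ->
      eta ^+ 2 * qre (H2_inner u u) <= qre (H2_inner (row_mult Lambda f (Mstar u)) u).

(* C_I = R + R I is identified with R[i], and D_I with the unit disc of R[i]. *)
Definition slice_emb I (z : C) : H := (complex.Re z)%:A + I * (complex.Im z)%:A.

Definition unit_disc : set C := [set z | `|z| < 1].

Definition holomorphic_on_disc (F : C -> C) :=
  forall z, unit_disc z -> derivable (F : C^o -> C^o) z 1.

Definition is_splitting I J f (FG : (C -> C) * (C -> C)) :=
  [/\ holomorphic_on_disc FG.1, holomorphic_on_disc FG.2 &
    forall z, unit_disc z ->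
      f (slice_emb I z) = slice_emb I (FG.1 z) + slice_emb I (FG.2 z) * J].

Definition splitting I J f : (C -> C) * (C -> C) :=
  xget (fun=> 0, fun=> 0) (is_splitting I J f).

Definition sharp (U : C -> C) : C -> C := fun z => ((U z^*%C)^*)%C.

Definition realization I J f (z : C) : 'M[C]_(1 + 1) :=
  let: (F, G) := splitting I J f in
  block_mx (F z)%:M (G z)%:M (- sharp G z)%:M (sharp F z)%:M.

Definition cV_sqnorm n (v : 'cV[C]_n) : R := \sum_i normc (v i 0) ^+ 2.

Definition l2_sqnorm Lambda n (w : nat -> 'cV[C]_n) : \bar R :=
  (\sum_(0 <= j <oo | j \in Lambda) (cV_sqnorm (w j))%:E)%E.

(* A linear map from C^2 to families of vectors of C^2 is a block column
   (A_j)_j of 2 x 2 matrices; it is a bounded operator from C^2 to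
   l^2(Lambda; C^2) iff the following norm is finite. *)
Definition op_norm Lambda (A : nat -> 'M[C]_2) : \bar R :=
  ereal_sup [set sqrte (l2_sqnorm Lambda (fun j => A j *m v))
            | v in [set v : 'cV[C]_2 | cV_sqnorm v <= 1]].

Definition bounded_op Lambda (A : nat -> 'M[C]_2) := (op_norm Lambda A < +oo)%E.

Definition op_holomorphic Lambda (A : C -> nat -> 'M[C]_2) :=
  forall z, unit_disc z -> exists2 A' : nat -> 'M[C]_2, bounded_op Lambda A' &
    op_norm Lambda (fun j => (w - z)^-1 *: (A w j - A z j) - A' j)
      @[w --> (z : C^o)^'] --> 0%E.

Definition op_sup_norm Lambda (A : C -> nat -> 'M[C]_2) : \bar R :=
  ereal_sup [set op_norm Lambda (A z) | z in unit_disc].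

Definition op_Hinf Lambda (A : C -> nat -> 'M[C]_2) :=
  [/\ forall z, unit_disc z -> bounded_op Lambda (A z),
      op_holomorphic Lambda A & (op_sup_norm Lambda A < +oo)%E].

Definition block_column I J (g : nat -> H -> H) : C -> nat -> 'M[C]_2 :=
  fun z j => realization I J (g j) z.

Definition corona_solution Lambda I J (f g : nat -> H -> H) (eta : R) :=
  [/\ forall j, Lambda j -> Hinf (g j),
      forall q, unit_ball q ->
        \sum_(0 <= j < N | j \in Lambda) slice_mul (f j) (g j) q @[N --> \oo] --> (1 : H),
      op_Hinf Lambda (block_column I J g) &
      (op_sup_norm Lambda (block_column I J g) <= (eta^-1)%:E)%E].

End Slice.

(* Main.v *)
(* Cauchy's formula on a slice, obtained from Goursat's lemma, turns slice
   regular functions into power series, so that the row multiplier becomes a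
   convolution by coefficients.  Tested on polynomials, the Toeplitz lower bound
   says that the finite sections satisfy [T T^* >= eta^2]; a quaternionic form
   of Leech's theorem (Douglas factorization of a lurking isometry) then yields
   columns [c] with [sum_j a_j * c_j = 1] up to degree [N] and multiplier norm
   close to [1 / eta], and an ultrafilter limit removes the truncation.
   Identifying C_I^2 with the quaternions, the realization of
   [g = sum q^m c_m] at [z] becomes [b |-> sum c_m b z^m], and the supremum of
   the norms of these maps is the norm of the column multiplier: one inequality
   tests it on the inputs [b z^(-l)], the other averages over circles.
   Conversely, a bounded column [c] gives
   [|u|^2 = sum_j <a_j * (c_j * u), u> <= eta^-1 |u| |M^* u|]. *)

Require Import Defs.
From HB Require Import structures.
From mathcomp Require Import all_boot all_order all_algebra.
From mathcomp Require Import complex.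
From mathcomp Require Import all_classical all_reals all_analysis.
From mathcomp Require Import ring lra.

Set Implicit Arguments.
Unset Strict Implicit.
Unset Printing Implicit Defensive.
Import Order.TTheory GRing.Theory Num.Theory.
Import numFieldNormedType.Exports.

Local Open Scope classical_set_scope.
Local Open Scope ring_scope.

(** * Quaternions *)

(** Evaluation is not multiplicative for the star product, so the pointwise hypothesis on the row
    bounds its multiplier only through the two slice components, at the price of a factor 4. This
    constant is harmless: it serves convergence and the existence of the adjoint, while the sharp
    constant [eta] is carried by the column, whose norm is computed exactly.

    Leech's theorem is run on finite matrices, so the degree and the number of rows are both cut
    off. Cutting an infinite row costs a little of the lower bound, whence [eta^2 (N + 1) / (N + 2)]
    at stage [N]. The columns so obtained are bounded on inputs of every length, not only up to
    degree [N], and this lets the limit keep the bound [1 / eta]. The equation survives the limit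
    because the tails in [j] are small uniformly in [N]: square-summable row coefficients meet
    uniformly square-summable column coefficients.

    Realizations are read on H as a right C_I-space: the powers of [z] stay on the right and the
    coefficients act on the left. *)

Section QuatAlgebra.
Variable R : realType.
Local Notation H := (quat R).
Implicit Types (p q : H) (x y : R).

Lemma normq_sqr q : `|q| ^+ 2 = qre q ^+ 2 + qi q ^+ 2 + qj q ^+ 2 + qk q ^+ 2.
Proof. by rewrite /Num.norm /= /quat_norm sqr_sqrtr // !addr_ge0 ?sqr_ge0. Qed.

Lemma qconjD p q : quat_conj (p + q) = quat_conj p + quat_conj q.
Proof. by apply: quat_ext => //=; rewrite opprD. Qed.

Lemma qconj0 : quat_conj (0 : H) = 0.
Proof. by apply: quat_ext => //=; rewrite oppr0. Qed.

Lemma qconj1 : quat_conj (1 : H) = 1.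
Proof. by apply: quat_ext => //=; rewrite oppr0. Qed.

Lemma qconjN q : quat_conj (- q) = - quat_conj q.
Proof. by apply: quat_ext. Qed.

Lemma qconjB p q : quat_conj (p - q) = quat_conj p - quat_conj q.
Proof. by rewrite qconjD qconjN. Qed.

Lemma qconjK : involutive (@quat_conj R).
Proof. by move=> q; apply: quat_ext => //=; rewrite opprK. Qed.

Lemma qconjM p q : quat_conj (p * q) = quat_conj q * quat_conj p.
Proof. by apply: quat_ext => //=; ring. Qed.

Lemma qconjZ x q : quat_conj (x *: q) = x *: quat_conj q.
Proof. by apply: quat_ext => //=; ring. Qed.

Lemma qconjX q n : quat_conj (q ^+ n) = quat_conj q ^+ n.
Proof. by elim: n => [|n IH]; rewrite ?expr0 ?qconj1 // exprS qconjM IH exprSr. Qed.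

Lemma qconj_sum (T : Type) (s : seq T) (P : pred T) (F : T -> H) :
  quat_conj (\sum_(i <- s | P i) F i) = \sum_(i <- s | P i) quat_conj (F i).
Proof. exact: (big_morph _ qconjD qconj0). Qed.

Lemma qre_sum (T : Type) (s : seq T) (P : pred T) (F : T -> H) :
  qre (\sum_(i <- s | P i) F i) = \sum_(i <- s | P i) qre (F i).
Proof. exact: (big_morph (@qre R)). Qed.

Lemma norm_qconj q : `|quat_conj q| = `|q|.
Proof.
by apply/eqP; rewrite -(eqrXn2 (n := 2)) // !normq_sqr /= !sqrrN.
Qed.

Lemma mul_qconj q : q * quat_conj q = (`|q| ^+ 2)%:A.
Proof. by apply: quat_ext => /=; rewrite ?normq_sqr; ring. Qed.

Lemma mul_conjq q : quat_conj q * q = (`|q| ^+ 2)%:A.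
Proof. by rewrite -{2}(qconjK q) mul_qconj norm_qconj. Qed.

Lemma normqM p q : `|p * q| = `|p| * `|q|.
Proof.
apply/eqP; rewrite -(eqrXn2 (n := 2)) ?mulr_ge0 // exprMn !normq_sqr /=.
by apply/eqP; ring.
Qed.

Lemma normqX q n : `|q ^+ n| = `|q| ^+ n.
Proof.
elim: n => [|n IH]; last by rewrite exprS normqM IH exprS.
apply/eqP; rewrite !expr0 -(eqrXn2 (n := 2)) // normq_sqr /=.
by rewrite expr1n !expr0n /= !addr0.
Qed.

Lemma normq1 : `|1 : H| = 1. Proof. by rewrite -(expr0 (1 : H)) normqX. Qed.

Lemma norm_alg x : `|x%:A : H| = `|x|.
Proof. by rewrite normrZ normq1 mulr1. Qed.

Lemma algq_comm x q : x%:A * q = q * x%:A.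
Proof. by rewrite mulr_algl mulr_algr. Qed.

Lemma alg_mul x y : (x * y)%:A = x%:A * y%:A :> H.
Proof. by rewrite mulr_algl scalerA. Qed.

Lemma normq_comps q :
  [/\ `|qre q| <= `|q|, `|qi q| <= `|q|, `|qj q| <= `|q| & `|qk q| <= `|q|].
Proof.
have sq (x : R) : x ^+ 2 <= `|q| ^+ 2 -> `|x| <= `|q|.
  by rewrite -real_normK ?num_real // ler_pXn2r ?nnegrE.
by split; apply: sq; rewrite normq_sqr;
  have := sqr_ge0 (qre q); have := sqr_ge0 (qi q); have := sqr_ge0 (qj q);
  have := sqr_ge0 (qk q); lra.
Qed.

Lemma normq_le_comps q :
  `|q| <= `|qre q| + `|qi q| + `|qj q| + `|qk q|.
Proof.
rewrite -(ler_pXn2r (n := 2)) ?nnegrE ?addr_ge0 // normq_sqr.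
rewrite -(real_normK (num_real (qre q))) -(real_normK (num_real (qi q))).
rewrite -(real_normK (num_real (qj q))) -(real_normK (num_real (qk q))).
have := normr_ge0 (qre q); have := normr_ge0 (qi q).
have := normr_ge0 (qj q); have := normr_ge0 (qk q).
set a := `|qre q|; set b := `|qi q|; set c := `|qj q|; set d := `|qk q|.
by move=> *; nra.
Qed.

(** The value at 0 is 0, so that [norm_qinv] holds for every quaternion. *)
Definition qinv q : H := (`|q| ^- 2) *: quat_conj q.

Lemma mulqVr q : q != 0 -> q * qinv q = 1.
Proof.
move=> q0; rewrite -scalerAr mul_qconj scalerA mulVf ?scale1r //.
by rewrite expf_eq0 normr_eq0.
Qed.

Lemma mulqVl q : q != 0 -> qinv q * q = 1.
Proof.
move=> q0; rewrite -scalerAl mul_conjq scalerA mulVf ?scale1r //.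
by rewrite expf_eq0 normr_eq0.
Qed.

Lemma norm_qinv q : `|qinv q| = `|q|^-1.
Proof.
have [->|q0] := eqVneq q 0; first by rewrite /qinv qconj0 scaler0 !normr0 invr0.
apply: (mulfI (x := `|q|)); first by rewrite normr_eq0.
by rewrite -normqM mulqVr // normq1 divff // normr_eq0.
Qed.

End QuatAlgebra.

(** * Sequences and series of quaternions *)

Section QuatSeries.
Variable R : realType.
Local Notation H := (quat R).
Implicit Types (u v : nat -> H) (l : H) (C : R).

Lemma cvg_seqP (V : normedModType R) (u : nat -> V) (l : V) : (u @ \oo --> l) <->
  forall e : R, 0 < e -> exists N, forall n, (N <= n)%N -> `|u n - l| < e.
Proof.
split=> [/cvgrPdist_lt h e /h[N _ hN]|h].
  by exists N => n Nn; rewrite distrC; exact: hN.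
by apply/cvgrPdist_lt => e /h[N hN]; exists N => // n /= /hN; rewrite distrC.
Qed.

Lemma cvg_quat u (a b c d : R) :
  @qre R \o u @ \oo --> a -> @qi R \o u @ \oo --> b ->
  @qj R \o u @ \oo --> c -> @qk R \o u @ \oo --> d -> u @ \oo --> Quat a b c d.
Proof.
move=> /cvg_seqP ha /cvg_seqP hb /cvg_seqP hc /cvg_seqP hd; apply/cvg_seqP => e e0.
have e40 : 0 < e / 4 by rewrite divr_gt0.
have [Na ha'] := ha _ e40; have [Nb hb'] := hb _ e40.
have [Nc hc'] := hc _ e40; have [Nd hd'] := hd _ e40.
exists (maxn (maxn Na Nb) (maxn Nc Nd)) => n.
rewrite !geq_max => /andP[/andP[/ha' + /hb' +] /andP[/hc' + /hd' +]] /=.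
have := normq_le_comps (u n - Quat a b c d) => /=; lra.
Qed.

Definition abs_bounded (V : normedModType R) (u : nat -> V) C :=
  forall n, \sum_(0 <= k < n) `|u k| <= C.

Lemma abs_bounded_cvg (u : nat -> R) C : abs_bounded u C ->
  exists l : R, series u @ \oo --> l.
Proof.
move=> hu; suff: cvgn (series u) by move=> ?; exists (limn (series u)).
apply: normed_cvg; apply: nondecreasing_is_cvgn.
  by apply: nondecreasing_series => n _ _; exact: normr_ge0.
exists C => _ [n _ <-]; exact: hu.
Qed.

(** Completeness comes from R: each of the four coordinates is additive and bounded by the modulus,
    so it yields an absolutely convergent real series. *)
Lemma qseries_cvg u C : abs_bounded u C -> exists l, series u @ \oo --> l.
Proof.
move=> hu.
have comp (c : H -> R) : (forall q, `|c q| <= `|q|) ->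
    (c 0 = 0) -> {morph c : p q / p + q} ->
    exists l : R, c \o series u @ \oo --> l.
  move=> cn c0 cD; have [|l hl] := @abs_bounded_cvg (c \o u) C.
    by move=> n; apply: le_trans (hu n); apply: ler_sum => i _; exact: cn.
  exists l; suff -> : c \o series u = series (c \o u) by [].
  by apply/funext => n; rewrite /series /= (big_morph c cD c0).
have [|//|//|a ha] := comp (@qre R); first by move=> q; have [] := normq_comps q.
have [|//|//|b hb] := comp (@qi R); first by move=> q; have [] := normq_comps q.
have [|//|//|c hc] := comp (@qj R); first by move=> q; have [] := normq_comps q.
have [|//|//|d hd] := comp (@qk R); first by move=> q; have [] := normq_comps q.
by exists (Quat a b c d); apply: cvg_quat.
Qed.

Lemma cvg_le_norm (V : normedModType R) (u : nat -> V) (l : V) C :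
  u @ \oo --> l -> (forall n, `|u n| <= C) -> `|l| <= C.
Proof.
move=> /cvg_seqP ul uC; apply/ler_addgt0Pr => e /ul[N /(_ N (leqnn N))].
have := uC N; have := ler_distD (u N) l 0; rewrite !subr0 distrC.
lra.
Qed.

Lemma series_le_norm (V : normedModType R) (u : nat -> V) (l : V) C :
  abs_bounded u C -> series u @ \oo --> l -> `|l| <= C.
Proof.
move=> uC /cvg_le_norm; apply => n.
by apply: le_trans (uC n); exact: ler_norm_sum.
Qed.

Lemma cvg_uniq (V : normedModType R) (u : nat -> V) (l l' : V) :
  u @ \oo --> l -> u @ \oo --> l' -> l = l'.
Proof. by move=> h h'; exact: (cvg_unique _ h h'). Qed.

Lemma cvgqMl (q : H) u l : u @ \oo --> l -> (fun n => q * u n) @ \oo --> q * l.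
Proof.
move=> /cvg_seqP ul; apply/cvg_seqP => e e0.
have q1 : 0 < `|q| + 1 by rewrite ltr_wpDl.
have [N hN] := ul _ (divr_gt0 e0 q1); exists N => n /hN h.
rewrite -mulrBr normqM; apply: le_lt_trans (_ : _ <= (`|q| + 1) * `|u n - l|) _.
  by rewrite ler_wpM2r // lerDl.
by rewrite mulrC -ltr_pdivlMr.
Qed.

Lemma cvgqMr (q : H) u l : u @ \oo --> l -> (fun n => u n * q) @ \oo --> l * q.
Proof.
move=> /cvg_seqP ul; apply/cvg_seqP => e e0.
have q1 : 0 < `|q| + 1 by rewrite ltr_wpDl.
have [N hN] := ul _ (divr_gt0 e0 q1); exists N => n /hN h.
rewrite -mulrBl normqM; apply: le_lt_trans (_ : _ <= `|u n - l| * (`|q| + 1)) _.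
  by rewrite ler_wpM2l // lerDl.
by rewrite -ltr_pdivlMr.
Qed.

Lemma cvgq_conj u l : u @ \oo --> l ->
  (fun n => quat_conj (u n)) @ \oo --> quat_conj l.
Proof.
move=> /cvg_seqP ul; apply/cvg_seqP => e /ul[N hN].
by exists N => n /hN; rewrite -qconjB norm_qconj.
Qed.

Lemma series_cvgMl (q : H) u l :
  series u @ \oo --> l -> series (fun n => q * u n) @ \oo --> q * l.
Proof.
move=> /(cvgqMl (q := q)).
by under eq_cvg do rewrite /series /= big_distrr.
Qed.

Lemma series_cvgMr (q : H) u l :
  series u @ \oo --> l -> series (fun n => u n * q) @ \oo --> l * q.
Proof.
move=> /(cvgqMr (q := q)).
by under eq_cvg do rewrite /series /= big_distrl.
Qed.

Lemma series_cvg_conj u l :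
  series u @ \oo --> l -> series (fun n => quat_conj (u n)) @ \oo --> quat_conj l.
Proof.
move=> /cvgq_conj; by under eq_cvg do rewrite /series /= qconj_sum.
Qed.

Lemma series_cvgD (V : normedModType R) (u v : nat -> V) (l l' : V) :
  series u @ \oo --> l -> series v @ \oo --> l' ->
  series (fun n => u n + v n) @ \oo --> l + l'.
Proof.
move=> hu hv; rewrite (_ : series _ = series u \+ series v); first exact: cvgD.
by apply/funext => n; rewrite /series /= big_split.
Qed.

Lemma series_cvgN (V : normedModType R) (u : nat -> V) (l : V) :
  series u @ \oo --> l -> series (fun n => - u n) @ \oo --> - l.
Proof.
move=> hu; rewrite (_ : series _ = \- series u); first exact: cvgN.
by apply/funext => n; rewrite /series /= sumrN.
Qed.

End QuatSeries.

(** * Goursat's lemma on rectangles *)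

Section Goursat.
Variable R : realType.
Implicit Types (a b c d x y w h e : R) (phi : R -> R) (p q : R -> R -> R).
Local Notation mu := (@lebesgue_measure R).

Definition itvint phi a b : R := \int[mu]_(x in `[a, b]) phi x.

Lemma itvint_integrable phi a b : continuous phi ->
  mu.-integrable `[a, b] (EFin \o phi).
Proof.
move=> cphi; apply: continuous_compact_integrable; first exact: segment_compact.
exact: continuous_subspaceT.
Qed.

Lemma itvint_split phi a b c : continuous phi -> a <= b -> b <= c ->
  itvint phi a c = itvint phi a b + itvint phi b c.
Proof.
move=> cphi ab bc.
have := @Rintegral_itvB R phi (BLeft a) (BRight c) b (itvint_integrable a c cphi).
rewrite !bnd_simp => /(_ ab bc) /eqP; rewrite subr_eq addrC => /eqP.
rewrite /itvint => ->; congr (_ + _).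
apply: (@Rintegral_itv_obnd_cbnd R b (BRight c) phi).
apply: integrableS (itvint_integrable b c cphi) => //.
by apply: subset_itv; rewrite bnd_simp.
Qed.

Lemma itvintD phi psi a b : continuous phi -> continuous psi ->
  itvint (fun x => phi x + psi x) a b = itvint phi a b + itvint psi a b.
Proof. by move=> ? ?; apply: RintegralD => //; exact: itvint_integrable. Qed.

Lemma itvintZ r phi a b : continuous phi ->
  itvint (fun x => r * phi x) a b = r * itvint phi a b.
Proof. by move=> ?; apply: RintegralZl => //; exact: itvint_integrable. Qed.

Lemma itvint_cst r a b : a <= b -> itvint (fun=> r) a b = r * (b - a).
Proof.
move=> ab; rewrite /itvint Rintegral_cst //; congr (_ * _).
suff: fine (@lebesgue_measure R `[a, b]) = b - a by [].
rewrite lebesgue_measure_itv /= lte_fin.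
by case: ltP => // ba; apply/esym/eqP; rewrite subr_eq0 eq_le ba ab.
Qed.

Lemma itvint_FTC phi F a b : a <= b -> continuous phi ->
  (forall x, is_derive x 1 F (phi x)) -> itvint phi a b = F b - F a.
Proof.
rewrite le_eqVlt => /predU1P[->|ab] cphi dF.
  by rewrite /itvint set_itv1 Rintegral_set1 subrr.
rewrite /itvint /Rintegral (@continuous_FTC2 R phi F a b) //.
- exact: continuous_subspaceT.
- have cF x : {for x, continuous F}.
    by apply: differentiable_continuous; apply/derivable1_diffP; case: (dF x).
  split=> [x _| |]; first by case: (dF x).
  + by apply: cvg_at_right_filter; exact: cF.
  + by apply: cvg_at_left_filter; exact: cF.
- by move=> x _; rewrite derive1E; case: (dF x).
Qed.

Lemma itvint_le_norm phi a b M : a <= b -> continuous phi ->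
  (forall x, a <= x <= b -> `|phi x| <= M) -> `|itvint phi a b| <= M * (b - a).
Proof.
move=> ab cphi hM; apply: le_trans (_ : _ <= \int[mu]_(x in `[a, b]) `|phi x|) _.
  by apply: le_normr_Rintegral => //; exact: itvint_integrable.
rewrite -itvint_cst //; apply: le_Rintegral => //.
- apply: (@itvint_integrable (fun x => `|phi x|)) => x.
  by apply: continuous_comp; [exact: cphi|exact: norm_continuous].
- by apply: (@itvint_integrable (fun=> M)) => x; exact: cvg_cst.
Qed.

Lemma itvint_affine r s a b : a <= b ->
  itvint (fun x => r + s * x) a b = r * (b - a) + s * ((b ^+ 2 - a ^+ 2) / 2).
Proof.
move=> ab; have cA : continuous (fun x => r + s * x).
  move=> x; apply: cvgD; first exact: cvg_cst.
  by apply: cvgM; [exact: cvg_cst|exact: cvg_id].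
have dF x : is_derive x 1 (fun x => r * x + s / 2 * x ^+ 2) (r + s * x).
  by apply: is_derive_eq; rewrite /GRing.scale /=; field.
by rewrite (itvint_FTC ab cA dF); field.
Qed.

Lemma itvint_approx phi r s a b M : a <= b -> continuous phi ->
  (forall x, a <= x <= b -> `|phi x - (r + s * x)| <= M) ->
  `|itvint phi a b - (r * (b - a) + s * ((b ^+ 2 - a ^+ 2) / 2))| <= M * (b - a).
Proof.
move=> ab cphi hM; rewrite -itvint_affine //.
have cA : continuous (fun x => r + s * x).
  move=> x; apply: cvgD; first exact: cvg_cst.
  by apply: cvgM; [exact: cvg_cst|exact: cvg_id].
rewrite -[X in `|_ - X|]mul1r -mulNr -itvintZ // -itvintD //; last first.
  by move=> x; apply: cvgM; [exact: cvg_cst|exact: cA].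
apply: itvint_le_norm => // [x|x /hM]; last by rewrite mulN1r.
by apply: cvgD; [exact: cphi|apply: cvgM; [exact: cvg_cst|exact: cA]].
Qed.

(** Total differentiability at a single point. No continuity of the partial derivatives is asked
    for, because a slice regular function is only known to be differentiable; this is why Goursat's
    bisection takes the place of Green's formula. *)
Definition diff2 p x0 y0 px py := forall e, 0 < e -> exists2 d, 0 < d &
  forall x y, `|x - x0| < d -> `|y - y0| < d ->
    `|p x y - p x0 y0 - px * (x - x0) - py * (y - y0)| <= e * (`|x - x0| + `|y - y0|).

Lemma diff2_contl p px py y : (forall x, diff2 p x y (px x) (py x)) ->
  continuous (p^~ y).
Proof.
move=> hp x0; apply/cvgrPdist_lt => e e0.
have [d d0 hd] := hp x0 1 ltr01.
have k0 : 0 < `|px x0| + 1 by rewrite ltr_wpDl.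
near=> x.
have xd : `|x - x0| < d.
  by rewrite distrC; near: x; apply: cvgr_dist_lt => //; exact: cvg_id.
have := hd x y xd; rewrite subrr normr0 => /(_ d0).
rewrite mul1r mulr0 subr0 addr0 => h.
have h2 : `|p x y - p x0 y| <= (`|px x0| + 1) * `|x - x0|.
  rewrite mulrDl mul1r -normrM; set u := px x0 * _ in h *.
  by have := ler_normD (p x y - p x0 y - u) u; rewrite subrK; lra.
rewrite distrC; apply: le_lt_trans h2 _; rewrite mulrC -ltr_pdivlMr //.
by rewrite distrC; near: x; apply: cvgr_dist_lt; [exact: cvg_id|exact: divr_gt0].
Unshelve. all: by end_near. Qed.

Lemma diff2_swap p x y px py : diff2 p x y px py -> diff2 (fun y x => p x y) y x py px.
Proof.
move=> hp e /hp[d d0 hd]; exists d => // y' x' hy hx.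
by rewrite addrAC [X in e * X]addrC; exact: hd.
Qed.

(** Circulation of the form [p dx + q dy], counterclockwise, along the boundary of the rectangle
    with lower left corner [(a, c)], width [w] and height [h]. *)
Definition rect_int p q a c w h : R :=
  itvint (p^~ c) a (a + w) + itvint (q (a + w)) c (c + h)
  - itvint (p^~ (c + h)) a (a + w) - itvint (q a) c (c + h).

Section Bisection.
Variables p q px py qx qy : R -> R -> R.
Hypothesis hp : forall x y, diff2 p x y (px x y) (py x y).
Hypothesis hq : forall x y, diff2 q x y (qx x y) (qy x y).
Hypothesis closed : forall x y, py x y = qx x y.

Let cp y : continuous (p^~ y).
Proof. exact: (@diff2_contl p (px^~ y) (py^~ y)). Qed.

Let cq x : continuous (q x).
Proof.
apply: (@diff2_contl (fun y x => q x y) (fun y => qy x y) (fun y => qx x y) x) => y.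
exact: diff2_swap.
Qed.

Lemma rect_int_split4 a c w h : 0 <= w -> 0 <= h ->
  rect_int p q a c (w + w) (h + h) =
  rect_int p q a c w h + rect_int p q (a + w) c w h +
  rect_int p q a (c + h) w h + rect_int p q (a + w) (c + h) w h.
Proof.
move=> w0 h0; rewrite /rect_int !(addrA a w w) !(addrA c h h).
have aw : a <= a + w by rewrite lerDl.
have aww : a + w <= a + w + w by rewrite lerDl.
have ch : c <= c + h by rewrite lerDl.
have chh : c + h <= c + h + h by rewrite lerDl.
rewrite (itvint_split (@cp c) aw aww) (itvint_split (@cp (c + h + h)) aw aww).
rewrite (itvint_split (@cq a) ch chh) (itvint_split (@cq (a + w + w)) ch chh).
ring.
Qed.

(** Near [(x0, y0)] both functions are affine up to [e / 2 * (w + h)]. By [closed] the affine parts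
    have zero circulation, and the errors are integrated along a perimeter of length
    [2 * (w + h)]. *)
Lemma rect_int_small x0 y0 e : 0 < e -> exists2 d, 0 < d &
  forall a c w h, 0 <= w -> 0 <= h -> w + h < d ->
    a <= x0 <= a + w -> c <= y0 <= c + h ->
    `|rect_int p q a c w h| <= e * (w + h) ^+ 2.
Proof.
move=> e0; have e20 : 0 < e / 2 by rewrite divr_gt0.
have [d1 d10 h1] := hp x0 y0 e20; have [d2 d20 h2] := hq x0 y0 e20.
exists (Num.min d1 d2); first by rewrite lt_min d10.
move=> a c w h w0 h0; rewrite lt_min => /andP[wd1 wd2] /andP[ax xa] /andP[cy yc].
have aw : a <= a + w by rewrite lerDl.
have ch : c <= c + h by rewrite lerDl.
have near x : a <= x <= a + w -> `|x - x0| <= w.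
  by move=> /andP[? ?]; rewrite ler_norml; lra.
have near' y : c <= y <= c + h -> `|y - y0| <= h.
  by move=> /andP[? ?]; rewrite ler_norml; lra.
have P y : c <= y <= c + h -> `|itvint (p^~ y) a (a + w) -
    ((p x0 y0 - px x0 y0 * x0 + py x0 y0 * (y - y0)) * (a + w - a)
     + px x0 y0 * (((a + w) ^+ 2 - a ^+ 2) / 2))| <= e / 2 * (w + h) * (a + w - a).
  move=> /near' yy; apply: itvint_approx => // x /near xx.
  have xd : `|x - x0| < d1 by apply: le_lt_trans xx _; lra.
  have yd : `|y - y0| < d1 by apply: le_lt_trans yy _; lra.
  rewrite (_ : _ - _ = p x y - p x0 y0 - px x0 y0 * (x - x0) - py x0 y0 * (y - y0));
    last by ring.
  by apply: le_trans (h1 x y xd yd) _; rewrite ler_pM2l // lerD.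
have Q x : a <= x <= a + w -> `|itvint (q x) c (c + h) -
    ((q x0 y0 - qy x0 y0 * y0 + qx x0 y0 * (x - x0)) * (c + h - c)
     + qy x0 y0 * (((c + h) ^+ 2 - c ^+ 2) / 2))| <= e / 2 * (w + h) * (c + h - c).
  move=> /near xx; apply: itvint_approx => // y /near' yy.
  have xd : `|x - x0| < d2 by apply: le_lt_trans xx _; lra.
  have yd : `|y - y0| < d2 by apply: le_lt_trans yy _; lra.
  rewrite (_ : _ - _ = q x y - q x0 y0 - qx x0 y0 * (x - x0) - qy x0 y0 * (y - y0));
    last by ring.
  by apply: le_trans (h2 x y xd yd) _; rewrite ler_pM2l // lerD.
have := P c; have := P (c + h); have := Q a; have := Q (a + w).
rewrite !lexx aw ch /= => /(_ isT) Q2 /(_ isT) Q1 /(_ isT) P2 /(_ isT) P1.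
move: Q2 Q1 P2 P1; rewrite /rect_int -closed.
set I1 := itvint _ _ _; set I2 := itvint _ _ _; set I3 := itvint _ _ _.
set I4 := itvint _ _ _.
rewrite !ler_norml => /andP[? ?] /andP[? ?] /andP[? ?] /andP[? ?].
by apply/andP; split; nra.
Qed.

Lemma rect_int_bisect a c w h K : 0 <= w -> 0 <= h ->
  K <= `|rect_int p q a c w h| -> exists a' c',
  [/\ a' = a \/ a' = a + w / 2, c' = c \/ c' = c + h / 2 &
      K / 4 <= `|rect_int p q a' c' (w / 2) (h / 2)|].
Proof.
move=> w0 h0 hK; have w20 : 0 <= w / 2 by lra.
have h20 : 0 <= h / 2 by lra.
apply: contrapT => no.
have lt a' c' : a' = a \/ a' = a + w / 2 -> c' = c \/ c' = c + h / 2 ->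
    `|rect_int p q a' c' (w / 2) (h / 2)| < K / 4.
  move=> ha hc; rewrite ltNge; apply/negP => le; apply: no.
  by exists a', c'.
have := rect_int_split4 a c w20 h20.
have -> : w / 2 + w / 2 = w by field.
have -> : h / 2 + h / 2 = h by field.
have := lt _ _ (or_introl erefl) (or_introl erefl).
have := lt _ _ (or_introl erefl) (or_intror erefl).
have := lt _ _ (or_intror erefl) (or_introl erefl).
have := lt _ _ (or_intror erefl) (or_intror erefl).
set r1 := rect_int _ _ _ _ _ _; set r2 := rect_int _ _ _ _ _ _.
set r3 := rect_int _ _ _ _ _ _; set r4 := rect_int _ _ _ _ _ _.
move=> l1 l2 l3 l4 E; move: hK; rewrite E.
have := ler_normD (r4 + r2 + r3) r1; have := ler_normD (r4 + r2) r3.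
have := ler_normD r4 r2.
lra.
Qed.

Lemma nested_itv (A : nat -> R) w : (forall n, A n <= A n.+1) ->
  (forall n, A n.+1 + w / 2 ^+ n.+1 <= A n + w / 2 ^+ n) -> 0 <= w ->
  exists x, forall n, A n <= x <= A n + w / 2 ^+ n.
Proof.
move=> A1 A2 w0.
have mono m n : (m <= n)%N -> A m <= A n.
  by move=> /subnKC <-; elim: (n - m)%N => [|k IH]; rewrite ?addn0 // addnS (le_trans IH).
have mono' m n : (m <= n)%N -> A n + w / 2 ^+ n <= A m + w / 2 ^+ m.
  by move=> /subnKC <-; elim: (n - m)%N => [|k IH]; rewrite ?addn0 // addnS (le_trans (A2 _)).
have wn n : 0 <= w / 2 ^+ n by rewrite divr_ge0 ?exprn_ge0.
have ub m n : A n <= A m + w / 2 ^+ m.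
  have [mn|/ltnW nm] := leqP m n.
    by apply: le_trans (mono' _ _ mn); rewrite lerDl.
  by apply: le_trans (mono _ _ nm) _; rewrite lerDl.
exists (sup (range A)) => n; apply/andP; split.
  by apply: ub_le_sup; [exists (A 0%N + w / 2 ^+ 0) => _ [k _ <-]|exists n].
by apply: ge_sup; [exists (A 0%N), 0%N|move=> _ [k _ <-]].
Qed.

Theorem goursat_rect a c w h : 0 <= w -> 0 <= h -> rect_int p q a c w h = 0.
Proof.
move=> w0 h0; apply/eqP; case: eqP => // /eqP rn0.
set K := `|rect_int p q a c w h|; have K0 : 0 < K by rewrite normr_gt0.
pose W n := w / 2 ^+ n; pose L n := h / 2 ^+ n.
have WS n : W n.+1 = W n / 2 by rewrite /W exprSr invfM mulrA.
have LS n : L n.+1 = L n / 2 by rewrite /L exprSr invfM mulrA.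
have W0 n : 0 <= W n by rewrite divr_ge0 ?exprn_ge0.
have L0 n : 0 <= L n by rewrite divr_ge0 ?exprn_ge0.
(* A state is the number of bisections together with the lower left corner of the current
   rectangle. *)
pose inv (s : nat * (R * R)) :=
  K / 4 ^+ s.1 <= `|rect_int p q s.2.1 s.2.2 (W s.1) (L s.1)|.
(* The invariant is assumed inside the existential, so that [choice] yields a successor defined on
   all states. *)
have step s : exists s', inv s -> [/\ inv s', s'.1 = s.1.+1,
    s'.2.1 = s.2.1 \/ s'.2.1 = s.2.1 + W s.1 / 2 &
    s'.2.2 = s.2.2 \/ s'.2.2 = s.2.2 + L s.1 / 2].
  have [si|nsi] := pselect (inv s); last by exists s => /nsi.
  have [a' [c' [ha hc hK]]] := rect_int_bisect (W0 s.1) (L0 s.1) si.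
  exists (s.1.+1, (a', c')) => _; split => //.
  by rewrite /inv /= WS LS exprSr invfM mulrA.
have [next hnext] := choice step.
pose S n := iter n next (0%N, (a, c)).
have SI n : inv (S n) /\ (S n).1 = n.
  elim: n => [|n [i1 i2]]; first by split=> //; rewrite /inv /W /L /= expr0 !divr1.
  by have [? -> _ _] := hnext _ i1; rewrite i2.
have Sa n : (S n.+1).2.1 = (S n).2.1 \/ (S n.+1).2.1 = (S n).2.1 + W n / 2.
  by have [i1 i2] := SI n; have [_ _ + _] := hnext _ i1; rewrite i2.
have Sc n : (S n.+1).2.2 = (S n).2.2 \/ (S n.+1).2.2 = (S n).2.2 + L n / 2.
  by have [i1 i2] := SI n; have [_ _ _ +] := hnext _ i1; rewrite i2.
have [x0 hx0] : exists x, forall n, (S n).2.1 <= x <= (S n).2.1 + w / 2 ^+ n.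
  apply: nested_itv => // n; rewrite -?/(W _) ?WS;
    by have [|] := Sa n => ->; have := W0 n; lra.
have [y0 hy0] : exists y, forall n, (S n).2.2 <= y <= (S n).2.2 + h / 2 ^+ n.
  apply: nested_itv => // n; rewrite -?/(L _) ?LS;
    by have [|] := Sc n => ->; have := L0 n; lra.
(* With this value, [rect_int_small] on the n-th rectangle gives [K / 4^n <= K (w + h)^2 / ((w +
   h)^2 + 1) / 4^n], which is impossible for [K > 0]. *)
have e0 : 0 < K / ((w + h) ^+ 2 + 1) by rewrite divr_gt0 // ltr_wpDl ?sqr_ge0.
have [d d0 hd] := rect_int_small x0 y0 e0.
have [n hn] : exists n, (w + h) / 2 ^+ n < d.
  have [n hn] : exists n : nat, (w + h) / d < n%:R.
    exists (Num.Def.archi_bound ((w + h) / d)).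
    by apply: archi_boundP; rewrite divr_ge0 ?addr_ge0 // ltW.
  exists n; rewrite ltr_pdivrMr ?exprn_gt0 // mulrC -ltr_pdivrMr //.
  apply: lt_le_trans hn _; rewrite -natrX ler_nat; exact/ltnW/ltn_expl.
have WL : W n + L n = (w + h) / 2 ^+ n by rewrite -mulrDl.
have := hd _ _ _ _ (W0 n) (L0 n); rewrite WL => /(_ _ _ hn (hx0 n) (hy0 n)).
have [+ Sn] := SI n; rewrite /inv Sn => h1 h2; have := le_trans h1 h2.
rewrite expr_div_n -exprM mulnC exprM (_ : 2 ^+ 2 = 4 :> R); last by ring.
rewrite mulrA.
rewrite ler_pM2r ?invr_gt0 ?exprn_gt0 //.
rewrite mulrAC ler_pdivlMr ?ltr_wpDl ?sqr_ge0 //.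
by rewrite ler_pM2l // gerDl ler10.
Qed.

End Bisection.

End Goursat.

(** * Differentiation of quaternion-valued functions of two real variables *)

Section Diff2.
Variable R : realType.
Local Notation H := (quat R).
Implicit Types (p q : R -> R -> H) (x y e d : R).

Definition qdiff2 p x0 y0 (px py : H) := forall e, 0 < e -> exists2 d, 0 < d &
  forall x y, `|x - x0| < d -> `|y - y0| < d ->
    `|p x y - p x0 y0 - ((x - x0) *: px + (y - y0) *: py)|
      <= e * (`|x - x0| + `|y - y0|).

Lemma qdiff2_lip p x0 y0 px py : qdiff2 p x0 y0 px py ->
  exists2 K, 0 < K & exists2 d, 0 < d & forall x y, `|x - x0| < d -> `|y - y0| < d ->
    `|p x y - p x0 y0| <= K * (`|x - x0| + `|y - y0|).
Proof.
move=> hp; have [d d0 hd] := hp 1 ltr01.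
exists (1 + `|px| + `|py|); first by rewrite -addrA ltr_pwDl ?addr_ge0.
exists d => // x y xd yd; have := hd x y xd yd.
set D := (x - x0) *: px + _ => h.
have hD : `|D| <= (`|px| + `|py|) * (`|x - x0| + `|y - y0|).
  apply: le_trans (ler_normD _ _) _; rewrite !normrZ.
  by have := normr_ge0 (x - x0); have := normr_ge0 (y - y0);
    have := normr_ge0 px; have := normr_ge0 py; nra.
have := ler_normD (p x y - p x0 y0 - D) D; rewrite subrK.
by rewrite -(addrA 1) mulrDl mul1r; lra.
Qed.

Lemma qdiff2_cst (c : H) x0 y0 : qdiff2 (fun _ _ => c) x0 y0 0 0.
Proof.
move=> e e0; exists 1 => // x y _ _.
by rewrite subrr !scaler0 addr0 subr0 normr0 mulr_ge0 ?addr_ge0 // ltW.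
Qed.

Lemma qdiff2D p q x0 y0 px py qx qy : qdiff2 p x0 y0 px py -> qdiff2 q x0 y0 qx qy ->
  qdiff2 (fun x y => p x y + q x y) x0 y0 (px + qx) (py + qy).
Proof.
move=> hp hq e e0; have e20 : 0 < e / 2 by rewrite divr_gt0.
have [d1 d10 h1] := hp _ e20; have [d2 d20 h2] := hq _ e20.
exists (Num.min d1 d2); first by rewrite lt_min d10.
move=> x y; rewrite !lt_min => /andP[xd1 xd2] /andP[yd1 yd2].
have {}h1 := h1 x y xd1 yd1; have {}h2 := h2 x y xd2 yd2.
set U := p x y - _ - _ in h1; set V := q x y - _ - _ in h2.
rewrite (_ : _ - _ = U + V); last by apply: quat_ext => /=; ring.
by apply: le_trans (ler_normD _ _) _; lra.
Qed.

Lemma qdiff2M p q x0 y0 px py qx qy : qdiff2 p x0 y0 px py -> qdiff2 q x0 y0 qx qy ->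
  qdiff2 (fun x y => p x y * q x y) x0 y0
    (px * q x0 y0 + p x0 y0 * qx) (py * q x0 y0 + p x0 y0 * qy).
Proof.
move=> hp hq e e0.
have [K K0 [d3 d30 h3]] := qdiff2_lip hp; have [L L0 [d4 d40 h4]] := qdiff2_lip hq.
set p0 := p x0 y0; set q0 := q x0 y0.
pose e1 := e / 3 / (`|p0| + `|q0| + 1).
have N0 : 0 < `|p0| + `|q0| + 1 by rewrite ltr_wpDl ?addr_ge0.
have e10 : 0 < e1 by rewrite !divr_gt0.
have [d1 d10 h1] := hp _ e10; have [d2 d20 h2] := hq _ e10.
pose d5 := e / 3 / (K * L) / 2.
have d50 : 0 < d5 by rewrite !divr_gt0 // mulr_gt0.
exists (Num.min (Num.min (Num.min d1 d2) (Num.min d3 d4)) d5).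
  by rewrite !lt_min d10 d20 d30 d40.
move=> x y; rewrite !lt_min => /andP[/andP[/andP[xd1 xd2] /andP[xd3 xd4]] xd5].
move=> /andP[/andP[/andP[yd1 yd2] /andP[yd3 yd4]] yd5].
have {}h1 := h1 x y xd1 yd1; have {}h2 := h2 x y xd2 yd2.
have {}h3 := h3 x y xd3 yd3; have {}h4 := h4 x y xd4 yd4.
set D := `|x - x0| + `|y - y0| in h1 h2 h3 h4 *.
have D0 : 0 <= D by rewrite addr_ge0.
have Dd : K * L * D <= e / 3.
  have : D <= d5 * 2 by rewrite /D; lra.
  by rewrite /d5 divfK // -ler_pdivlMl ?mulr_gt0 // [_ * (e / 3)]mulrC.
set dx := x - x0 in h1 h2 *; set dy := y - y0 in h1 h2 *.
set U := p x y - p0 - _ in h1; set V := q x y - q0 - _ in h2.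
(* Besides the two first-order remainders there is a product of increments, which is quadratic in
   [D] by the Lipschitz bounds; [d5] makes it at most [e / 3 * D]. *)
rewrite (_ : _ - _ = U * q0 + p0 * V + (p x y - p0) * (q x y - q0)); last first.
  by apply: quat_ext => /=; ring.
apply: le_trans (ler_normD _ _) _; apply: le_trans (lerD (ler_normD _ _) (lexx _)) _.
rewrite !normqM.
have e1N : e1 * (`|p0| + `|q0| + 1) = e / 3 by rewrite divfK ?gt_eqF.
have a1 : `|U| * `|q0| <= e1 * D * `|q0| by rewrite ler_wpM2r.
have a2 : `|p0| * `|V| <= `|p0| * (e1 * D) by rewrite ler_wpM2l.
have a3 : `|p x y - p0| * `|q x y - q0| <= (K * D) * (L * D) by rewrite ler_pM.
have a4 : (K * D) * (L * D) <= e / 3 * D.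
  by rewrite mulrACA mulrA ler_wpM2r.
have a5 : e1 * D * `|q0| + `|p0| * (e1 * D) <= e / 3 * D.
  rewrite -e1N; have := mulr_ge0 (ltW e10) D0; nra.
have : 0 <= e / 3 * D by rewrite mulr_ge0 // divr_ge0 // ltW.
have -> : e * D = e / 3 * D + e / 3 * D + e / 3 * D by field.
lra.
Qed.

Lemma qdiff2_inv p x0 y0 px py : p x0 y0 != 0 -> qdiff2 p x0 y0 px py ->
  qdiff2 (fun x y => qinv (p x y)) x0 y0
    (- (qinv (p x0 y0) * px * qinv (p x0 y0))) (- (qinv (p x0 y0) * py * qinv (p x0 y0))).
Proof.
set p0 := p x0 y0 => p00 hp e e0.
have n0 : 0 < `|p0| by rewrite normr_gt0.
have [K K0 [d3 d30 h3]] := qdiff2_lip hp.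
pose e1 := e / 2 * `|p0| ^+ 2.
have e10 : 0 < e1 by rewrite mulr_gt0 ?exprn_gt0 ?divr_gt0.
have [d1 d10 h1] := hp _ e10.
(* This keeps [p x y] within [|p0| / 2] of [p0], hence away from 0; [d4] makes the quadratic
   remainder at most [e / 2 * D]. *)
pose d2 := `|p0| / 2 / K / 2.
have d20 : 0 < d2 by rewrite !divr_gt0.
pose d4 := e / 2 * (`|p0| ^+ 3 / 2) / K ^+ 2 / 2.
have d40 : 0 < d4 by rewrite divr_gt0 // divr_gt0 ?exprn_gt0 // mulr_gt0 ?divr_gt0 ?exprn_gt0.
exists (Num.min (Num.min d1 d2) (Num.min d3 d4)).
  by rewrite !lt_min d10 d20 d30 d40.
move=> x y; rewrite !lt_min => /andP[/andP[xd1 xd2] /andP[xd3 xd4]].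
move=> /andP[/andP[yd1 yd2] /andP[yd3 yd4]].
have {}h1 := h1 x y xd1 yd1; have {}h3 := h3 x y xd3 yd3.
rewrite -/p0 in h1 h3 *.
set D := `|x - x0| + `|y - y0| in h1 h3 *.
have D0 : 0 <= D by rewrite addr_ge0.
have KD : K * D <= `|p0| / 2.
  have : D <= d2 * 2 by rewrite /D; lra.
  by rewrite /d2 divfK // -ler_pdivlMl // [K^-1 * _]mulrC.
have KD2 : K ^+ 2 * D <= e / 2 * (`|p0| ^+ 3 / 2).
  have : D <= d4 * 2 by rewrite /D; lra.
  by rewrite /d4 divfK // -ler_pdivlMl ?exprn_gt0 // [_^-1 * _]mulrC.
set w := p x y in h1 h3 *.
have wn : `|p0| / 2 <= `|w|.
  by have := ler_normD w (p0 - w); rewrite addrC subrK -(distrC w); lra.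
have w0 : w != 0 by rewrite -normr_gt0; lra.
set L := (x - x0) *: px + _ in h1.
set i0 := qinv p0.
(* Second-order resolvent identity: [w^-1 - p0^-1 = - p0^-1 (w - p0) p0^-1 + w^-1 (w - p0) p0^-1 (w
   - p0) p0^-1], from two uses of [w^-1 (w - p0) p0^-1 = p0^-1 - w^-1]. *)
have -> : qinv w - i0 - ((x - x0) *: - (i0 * px * i0) + (y - y0) *: - (i0 * py * i0)) =
    - (i0 * (w - p0 - L) * i0) + qinv w * (w - p0) * i0 * (w - p0) * i0.
  have E1 : qinv w - i0 = - (i0 * (w - p0) * i0) + qinv w * (w - p0) * i0 * (w - p0) * i0.
    have a : qinv w * (w - p0) * i0 = i0 - qinv w.
      by rewrite mulrBr mulrBl mulqVl // mul1r -mulrA mulqVr // mulr1.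
    rewrite a mulrBl mulrBl.
    have b : qinv w * (w - p0) * i0 = i0 - qinv w by [].
    rewrite b; apply: quat_ext => /=; ring.
  rewrite {}E1; set Z := qinv w * _ * _ * _ * _; rewrite /L; clearbody Z i0.
  by apply: quat_ext => /=; ring.
apply: le_trans (ler_normD _ _) _; rewrite normrN !normqM !norm_qinv.
set N := `|p0| in n0 e10 d20 d40 KD KD2 wn *.
have a1 : N^-1 * `|w - p0 - L| * N^-1 <= e / 2 * D.
  rewrite (_ : _ * _ / N = `|w - p0 - L| / N ^+ 2); last by field; rewrite gt_eqF.
  rewrite ler_pdivrMr ?exprn_gt0 //.
  by apply: le_trans h1 _; rewrite /e1 -/N; lra.
have a2 : `|w|^-1 * `|w - p0| * N^-1 * `|w - p0| * N^-1 <= e / 2 * D.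
  have E : `|w|^-1 * `|w - p0| * N^-1 * `|w - p0| * N^-1 = `|w - p0| ^+ 2 / (`|w| * N ^+ 2).
    by field; rewrite gt_eqF //= normr_eq0.
  rewrite E ler_pdivrMr; last by rewrite mulr_gt0 ?exprn_gt0 // normr_gt0.
  have s1 : `|w - p0| ^+ 2 <= (K * D) ^+ 2 by rewrite ler_pXn2r ?nnegrE // (le_trans _ h3).
  have s2 : (K * D) ^+ 2 <= e / 2 * (N ^+ 3 / 2) * D.
    by rewrite exprMn [D ^+ 2]expr2 mulrA ler_wpM2r.
  have s3 : e / 2 * (N ^+ 3 / 2) * D <= e / 2 * D * (`|w| * N ^+ 2).
    have -> : e / 2 * (N ^+ 3 / 2) * D = e / 2 * D * (N / 2 * N ^+ 2) by field.
    apply: ler_wpM2l; first by rewrite mulr_ge0 ?divr_ge0 // ltW.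
    by rewrite ler_wpM2r ?exprn_ge0 // ltW.
  lra.
have -> : e * D = e / 2 * D + e / 2 * D by field.
by rewrite lerD.
Qed.

Lemma diff_eps (V W : normedModType R) (f : V -> W) v : differentiable f v ->
  forall e : R, 0 < e -> exists2 d, 0 < d & forall h, `|h| < d ->
    `|f (h + v) - f v - 'd f v h| <= e * `|h|.
Proof.
move=> /diff_locallyP[_ /eqaddoP hf] e /hf /nbhs_ballP[d /= d0 hd].
exists d => // h hh; have := hd h; rewrite -ball_normE /= sub0r normrN => /(_ hh) /=.
by rewrite opprD addrA.
Qed.

Lemma qdiff2_fst (phi : R -> R) dphi x0 y0 : is_derive x0 1 phi dphi ->
  qdiff2 (fun x _ => (phi x)%:A) x0 y0 dphi%:A 0.
Proof.
move=> [dx dv] e e0.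
have dd : differentiable phi x0 by apply/derivable1_diffP.
have [d d0 hd] := diff_eps dd e0; exists d => // x y xd yd.
have := hd _ xd; rewrite subrK.
have -> : 'd phi x0 (x - x0) = (x - x0) * dphi.
  by rewrite -dv deriveE // -[X in 'd _ _ X = _]mulr1 -[X in 'd _ _ X]/((x - x0) *: 1) linearZ.
rewrite scaler0 addr0 scalerA -!scalerBl norm_alg => h; apply: le_trans h _.
by rewrite ler_pM2l // lerDl.
Qed.

Lemma qdiff2_swap p x0 y0 px py : qdiff2 p x0 y0 px py ->
  qdiff2 (fun y x => p x y) y0 x0 py px.
Proof.
move=> hp e /hp[d d0 hd]; exists d => // y x yd xd.
by rewrite [X in _ <= e * X]addrC [X in `|_ - X|]addrC; exact: hd.
Qed.

Lemma qdiff2_snd (phi : R -> R) dphi x0 y0 : is_derive y0 1 phi dphi ->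
  qdiff2 (fun _ y => (phi y)%:A) x0 y0 0 dphi%:A.
Proof. by move=> h; exact/qdiff2_swap/qdiff2_fst. Qed.

Lemma qdiff2_comps p x0 y0 px py : qdiff2 p x0 y0 px py ->
  [/\ diff2 (fun x y => qre (p x y)) x0 y0 (qre px) (qre py),
      diff2 (fun x y => qi (p x y)) x0 y0 (qi px) (qi py),
      diff2 (fun x y => qj (p x y)) x0 y0 (qj px) (qj py) &
      diff2 (fun x y => qk (p x y)) x0 y0 (qk px) (qk py)].
Proof.
move=> hp; split=> e /hp[d d0 hd]; exists d => // x y xd yd;
  apply: le_trans (hd x y xd yd);
  have [c1 c2 c3 c4] := normq_comps (p x y - p x0 y0 - ((x - x0) *: px + (y - y0) *: py)).
- by apply: le_trans c1; rewrite /= [qre px * _]mulrC [qre py * _]mulrC opprD addrA.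
- by apply: le_trans c2; rewrite /= [qi px * _]mulrC [qi py * _]mulrC opprD addrA.
- by apply: le_trans c3; rewrite /= [qj px * _]mulrC [qj py * _]mulrC opprD addrA.
- by apply: le_trans c4; rewrite /= [qk px * _]mulrC [qk py * _]mulrC opprD addrA.
Qed.

(** Increments are restricted to [D] and multiply the derivative on the left, as suits a function
    that is complex-differentiable along one slice only. *)
Definition diff_along (D : set H) (f : H -> H) z0 (f' : H) :=
  forall e, 0 < e -> exists2 d, 0 < d & forall z, D z -> `|z - z0| < d ->
    `|f z - f z0 - (z - z0) * f'| <= e * `|z - z0|.

Lemma qdiff2_comp (D : set H) f f' p x0 y0 px py : (forall x y, D (p x y)) ->
  diff_along D f (p x0 y0) f' -> qdiff2 p x0 y0 px py ->
  qdiff2 (fun x y => f (p x y)) x0 y0 (px * f') (py * f').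
Proof.
move=> Dp hf hp e e0; have [K K0 [d3 d30 h3]] := qdiff2_lip hp.
have eK : 0 < e / 2 / K by rewrite !divr_gt0.
have [d1 d10 h1] := hf _ eK.
have N0 : 0 < `|f'| + 1 by rewrite ltr_wpDl.
have e10 : 0 < e / 2 / (`|f'| + 1) by rewrite !divr_gt0.
have [d2 d20 h2] := hp _ e10.
have d40 : 0 < d1 / K / 2 by rewrite !divr_gt0.
exists (Num.min (Num.min d2 d3) (d1 / K / 2)); first by rewrite !lt_min d20 d30.
move=> x y; rewrite !lt_min => /andP[/andP[xd2 xd3] xd4] /andP[/andP[yd2 yd3] yd4].
have {}h2 := h2 x y xd2 yd2; have {}h3 := h3 x y xd3 yd3.
set N := `|x - x0| + `|y - y0| in h2 h3 *.
have Nd : K * N < d1.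
  have : N < d1 / K / 2 * 2 by rewrite /N; lra.
  by rewrite divfK // ltr_pdivlMr // mulrC.
have {}h1 := h1 _ (Dp x y) (le_lt_trans h3 Nd).
set U := f _ - _ - _ in h1; set V := p x y - _ - _ in h2.
rewrite (_ : _ - _ = U + V * f'); last by apply: quat_ext => /=; ring.
apply: le_trans (ler_normD _ _) _; rewrite normqM.
have a1 : `|U| <= e / 2 * N.
  apply: le_trans h1 _; rewrite -mulrA ler_pM2l ?divr_gt0 //.
  by rewrite ler_pdivrMl.
have a2 : `|V| * `|f'| <= e / 2 * N.
  apply: le_trans (_ : _ <= e / 2 / (`|f'| + 1) * N * (`|f'| + 1)) _.
    by apply: ler_pM => //; rewrite lerDl.
  by rewrite mulrAC divfK ?gt_eqF.
have -> : e * N = e / 2 * N + e / 2 * N by field.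
lra.
Qed.

End Diff2.

(** * Cauchy's formula on a slice *)

Section SliceAlgebra.
Variable R : realType.
Local Notation H := (quat R).
Variable I : H.
Hypothesis HI : imag_unit I.

Lemma imag_unit_norm : `|I| = 1.
Proof.
apply/eqP; rewrite -(eqrXn2 (n := 2)) // expr1n -normqX.
by have := HI; rewrite /imag_unit => ->; rewrite normrN normq1.
Qed.

Lemma imag_unit_conj : quat_conj I = - I.
Proof.
have I0 : I != 0 by rewrite -normr_eq0 imag_unit_norm oner_eq0.
have II : I * I = -1 by rewrite -expr2.
have: quat_conj I * I * I = - I * I * I.
  by rewrite mul_conjq imag_unit_norm expr1n scale1r mulNr II opprK.
move=> /(congr1 (fun q => q * qinv I)); rewrite -!mulrA mulqVr // !mulr1.
by move=> /(congr1 (fun q => q * qinv I)); rewrite -!mulrA mulqVr // !mulr1.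
Qed.

Definition cslice (x y : R) : H := x%:A + I * y%:A.

Definition slice : set H := [set z | exists x y, z = cslice x y].

Lemma csliceD x y x' y' : cslice x y + cslice x' y' = cslice (x + x') (y + y').
Proof. by rewrite /cslice addrACA -mulrDr -!scalerDl. Qed.

Lemma csliceZ a x y : a *: cslice x y = cslice (a * x) (a * y).
Proof. by rewrite /cslice scalerDr scalerA scalerAr scalerA. Qed.

Lemma csliceN x y : - cslice x y = cslice (- x) (- y).
Proof. by rewrite -scaleN1r csliceZ !mulN1r. Qed.

Lemma csliceM x y x' y' :
  cslice x y * cslice x' y' = cslice (x * x' - y * y') (x * y' + y * x').
Proof.
have II : I * I = -1 by rewrite -expr2.
rewrite /cslice !mulr_algr mulrDl !mulrDr -!(scalerAl, scalerAr) II !mul1r mulr1.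
by apply: quat_ext => /=; ring.
Qed.

Lemma cslice_conj x y : quat_conj (cslice x y) = cslice x (- y).
Proof.
by rewrite /cslice qconjD qconjM !qconjZ qconj1 imag_unit_conj algq_comm scaleNr mulrN mulNr.
Qed.

Lemma cslice_comm x y x' y' : cslice x y * cslice x' y' = cslice x' y' * cslice x y.
Proof. by rewrite !csliceM; congr cslice; ring. Qed.

Lemma slice_comm z w : slice z -> slice w -> z * w = w * z.
Proof. by move=> [x [y ->]] [x' [y' ->]]; exact: cslice_comm. Qed.

Lemma sliceD z w : slice z -> slice w -> slice (z + w).
Proof. by move=> [x [y ->]] [x' [y' ->]]; rewrite csliceD; do 2 eexists. Qed.

Lemma sliceM z w : slice z -> slice w -> slice (z * w).
Proof. by move=> [x [y ->]] [x' [y' ->]]; rewrite csliceM; do 2 eexists. Qed.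

Lemma sliceN z : slice z -> slice (- z).
Proof. by move=> [x [y ->]]; rewrite csliceN; do 2 eexists. Qed.

Lemma sliceB z w : slice z -> slice w -> slice (z - w).
Proof. by move=> hz hw; apply: sliceD => //; exact: sliceN. Qed.

Lemma slice_alg x : slice x%:A.
Proof. by exists x, 0; rewrite /cslice scale0r mulr0 addr0. Qed.

Lemma slice_unit : slice I.
Proof. by exists 0, 1; rewrite /cslice scale0r scale1r mulr1 add0r. Qed.

Lemma slice_qinv z : slice z -> slice (qinv z).
Proof.
by move=> [x [y ->]]; rewrite /qinv cslice_conj csliceZ; do 2 eexists.
Qed.

Lemma sliceX z n : slice z -> slice (z ^+ n).
Proof.
move=> hz; elim: n => [|n IH]; last by rewrite exprS; exact: sliceM.
by have := slice_alg 1; rewrite scale1r.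
Qed.

Lemma norm_cslice x y : `|cslice x y| ^+ 2 = x ^+ 2 + y ^+ 2.
Proof.
have E : (`|cslice x y| ^+ 2)%:A = (x ^+ 2 + y ^+ 2)%:A :> H.
  rewrite -mul_qconj cslice_conj csliceM (_ : x * x - y * - y = x ^+ 2 + y ^+ 2); last by ring.
  by rewrite (_ : x * - y + y * x = 0) ?/cslice ?scale0r ?mulr0 ?addr0 //; ring.
by have := congr1 (@qre R) E; rewrite /= !mulr1.
Qed.

End SliceAlgebra.

(** * The Cauchy form on a contracted circle *)

Section Cauchy.
Variable R : realType.
Local Notation H := (quat R).
Variables (I : H) (f : H -> H).
Hypothesis HI : imag_unit I.
Hypothesis Hf : slice_regular f.
Local Notation sl := (cslice I).

(** The Cauchy-Riemann equation says ['D_I f = I * 'D_1 f]; by linearity the differential along the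
    slice multiplies ['D_1 f] on the left by the increment. *)
Lemma slice_regular_diff_along z : slice I z -> unit_ball z ->
  diff_along (slice I) f z ('D_1 f z).
Proof.
move=> [x [y ->]] zB; have [hd hs] := Hf; have dz := hd _ zB.
have hDI : 'D_I f (sl x y) = I * 'D_1 f (sl x y).
  have := hs I HI x y zB; rewrite -/(sl x y) => /eqP.
  rewrite scaler_eq0 invr_eq0 pnatr_eq0 /= addr_eq0 => /eqP ->.
  by rewrite mulrN mulrA -expr2 HI mulN1r opprK.
move=> e e0; have [d d0 h] := diff_eps dz e0; exists d => // w [x' [y' wE]] wd.
have := h _ wd; rewrite subrK.
have lin (u v : R) : 'd f (sl x y) (sl u v) = sl u v * 'D_1 f (sl x y).
  rewrite [sl u v]/cslice mulr_algr linearD !linearZ /= -!deriveE // hDI.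
  by rewrite mulrDl mulr_algl scalerAl.
by rewrite wE csliceN csliceD lin.
Qed.

Variables (a : H) (r : R).
Hypotheses (ha : slice I a) (ar : `|a| < r) (r1 : r < 1).

Let r0 : 0 < r. Proof. exact: le_lt_trans ar. Qed.

Definition circ (t : R) : H := sl (r * cos t) (r * sin t).
(* [cone] contracts the circle to [a] as [rho] decreases to 0, and [kappa t dt]
   is the Cauchy kernel [dw / (w - a)]. *)
Definition rho (s : R) : R := (1 + s ^+ 2)^-1.
Definition lam (s : R) : R := - (s *+ 2) / (1 + s ^+ 2).
Definition cone s t : H := a + (rho s)%:A * (circ t - a).
Definition kappa t : H := I * circ t * qinv (circ t - a).

Lemma norm_circ t : `|circ t| = r.
Proof.
apply/eqP; rewrite -(eqrXn2 (n := 2)) ?(ltW r0) // norm_cslice //.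
by rewrite !exprMn -mulrDr cos2Dsin2 mulr1.
Qed.

Lemma slice_circ t : slice I (circ t).
Proof. by exists (r * cos t), (r * sin t). Qed.

Lemma norm_circB t : r - `|a| <= `|circ t - a|.
Proof. by rewrite -(norm_circ t); exact: lerB_dist. Qed.

Lemma circ_neq t : circ t - a != 0.
Proof. by rewrite -normr_gt0; apply: lt_le_trans (norm_circB t); rewrite subr_gt0. Qed.

Lemma rho_bounds s : 0 < rho s <= 1.
Proof.
have := sqr_ge0 s; rewrite /rho => ?; rewrite invr_gt0 invf_le1 ?lerDl //.
all: by rewrite ltr_wpDr.
Qed.

Lemma slice_cone s t : slice I (cone s t).
Proof.
apply: sliceD => //; apply: sliceM => //; first exact: slice_alg.
by apply: sliceB => //; exact: slice_circ.
Qed.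

Lemma cone_ball s t : unit_ball (cone s t).
Proof.
have /andP[h0 h1] := rho_bounds s.
rewrite /unit_ball /= /cone mulr_algl scalerBr addrCA addrC -[X in X - _]scale1r.
rewrite -scalerBl; apply: le_lt_trans (ler_normD _ _) _.
rewrite !normrZ norm_circ (gtr0_norm h0) ger0_norm ?subr_ge0 //.
apply: le_lt_trans (_ : _ <= r) r1; have := ar; nra.
Qed.

Lemma qdiff2_val (p : R -> R -> H) x y px py px' py' :
  qdiff2 p x y px py -> px = px' -> py = py' -> qdiff2 p x y px' py'.
Proof. by move=> h <- <-. Qed.

Lemma circ_diff s t : qdiff2 (fun _ t => circ t) s t 0 (I * circ t).
Proof.
have dc : is_derive t 1 (fun t : R => r * cos t) (- (r * sin t)).
  by apply: is_derive_eq; rewrite /GRing.scale /= mulrN.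
have ds : is_derive t 1 (fun t : R => r * sin t) (r * cos t).
  by apply: is_derive_eq.
apply: qdiff2_val (qdiff2D (qdiff2_snd s dc)
  (qdiff2M (qdiff2_cst I s t) (qdiff2_snd s ds))) _ _.
  by rewrite mulr0 mul0r !addr0.
rewrite mul0r add0r /circ /cslice mulrDr mulrA -expr2 HI mulN1r addrC.
by rewrite scaleNr.
Qed.

Let drho (s : R) : R := - (s *+ 2) / (1 + s ^+ 2) ^+ 2.

Lemma rho_derive (s : R) : is_derive s 1 rho (drho s).
Proof.
have n0 : 1 + s ^+ 2 != 0 by rewrite gt_eqF // ltr_pwDl ?sqr_ge0.
have h : is_derive s 1 (fun s : R => 1 + s ^+ 2) (s *+ 2).
  by apply: is_derive_eq; rewrite add0r /GRing.scale /= mulr1 ?expr1 mulr2n; ring.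
have hd : derivable (fun s : R => 1 + s ^+ 2) s 1 by case: h.
have k1 := @derivableV R R (fun s : R => 1 + s ^+ 2) s 1 n0 hd.
have k2 := @deriveV R R (fun s : R => 1 + s ^+ 2) s 1 n0 hd.
have E : 'D_1 (fun s : R => 1 + s ^+ 2) s = s *+ 2 by case: h.
rewrite /rho; apply: DeriveDef => //.
by rewrite k2 E /drho /GRing.scale /=; field.
Qed.

Lemma cone_diff s t : qdiff2 cone s t ((drho s)%:A * (circ t - a))
  ((rho s)%:A * (I * circ t)).
Proof.
apply: qdiff2_val (qdiff2D (qdiff2_cst a s t) (qdiff2M (qdiff2_fst t (rho_derive s))
  (qdiff2D (circ_diff s t) (qdiff2_cst (- a) s t)))) _ _.
  by rewrite add0r addr0 mulr0 addr0.
by rewrite mul0r !addr0 !add0r.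
Qed.

Lemma cone_comp_diff s t : qdiff2 (fun s t => f (cone s t)) s t
  ((drho s)%:A * (circ t - a) * 'D_1 f (cone s t))
  ((rho s)%:A * (I * circ t) * 'D_1 f (cone s t)).
Proof.
apply: (@qdiff2_comp _ (slice I `&` @unit_ball R)) (cone_diff s t).
  by move=> x y; split; [exact: slice_cone|exact: cone_ball].
have h := slice_regular_diff_along (slice_cone s t) (cone_ball s t).
by move=> e /h[d d0 hd]; exists d => // z [zs _]; exact: hd.
Qed.

Lemma lam_derive (s : R) : exists dl, is_derive s 1 lam dl.
Proof.
have n0 : 1 + s ^+ 2 != 0 by rewrite gt_eqF // ltr_pwDl ?sqr_ge0.
have h : is_derive s 1 (fun s : R => - (s *+ 2)) (- (1 *+ 2)).
  by apply: is_derive_eq.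
have hr := rho_derive s.
eexists; rewrite /lam; exact: (is_deriveM h hr).
Qed.

Lemma kappa_diff s t : exists dk, qdiff2 (fun _ t => kappa t) s t 0 dk.
Proof.
have h1 := qdiff2D (circ_diff s t) (qdiff2_cst (- a) s t).
have h2 := qdiff2_inv (circ_neq t) h1.
have h3 := qdiff2M (qdiff2M (qdiff2_cst I s t) (circ_diff s t)) h2.
eexists; apply: qdiff2_val h3 _ erefl.
by rewrite addr0 !mulr0 !mul0r !oppr0 !(mulr0, mul0r, addr0).
Qed.

Lemma kappa_circ t : kappa t * (circ t - a) = I * circ t.
Proof. by rewrite /kappa -mulrA mulqVl ?mulr1 // circ_neq. Qed.

Lemma slice_kappa t : slice I (kappa t).
Proof.
apply: sliceM => //; last first.
  by apply: slice_qinv => //; apply: sliceB => //; exact: slice_circ.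
by apply: sliceM => //; [exact: slice_unit|exact: slice_circ].
Qed.

(** [form1 ds + form2 dt] is the pullback by [cone] of the Cauchy form [dw / (w - a) * f w]: as
    [w - a = rho s * (circ t - a)], the coefficient of [ds] is [rho' / rho = lam]. Since [rho] takes
    its values in ]0, 1] on all of R, the form is defined on the whole plane and never meets the
    pole [a]. *)
Definition form1 s t : H := (lam s)%:A * f (cone s t).
Definition form2 s t : H := kappa t * f (cone s t).

(** As [lam] depends on [s] only and [kappa] on [t] only, each cross derivative differentiates [f]
    alone. Both equal [rho' * I * circ * 'D_1 f], by [lam * rho = rho'] and
    [kappa * (circ - a) = I * circ]. *)
Lemma form_closed : exists px py qx qy : R -> R -> H,
  [/\ forall s t, qdiff2 form1 s t (px s t) (py s t),
      forall s t, qdiff2 form2 s t (qx s t) (qy s t) &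
      forall s t, py s t = qx s t].
Proof.
have [dl hdl] := choice lam_derive; have [dk hdk] := choice (kappa_diff 0).
do 4 eexists; split=> s t.
- exact: qdiff2M (qdiff2_fst t (hdl s)) (cone_comp_diff s t).
- have hk : qdiff2 (fun _ t => kappa t) s t 0 (dk t).
    move=> e e0; have [d d0 hd] := hdk t _ e0; exists d => // x y xd yd.
    have := hd 0 y; rewrite subrr normr0 scaler0 add0r => /(_ d0 yd) h.
    rewrite scaler0 add0r; apply: le_trans h _.
    by rewrite ler_pM2l // lerD2r.
  exact: qdiff2M hk (cone_comp_diff s t).
rewrite /= !mul0r !add0r !mulrA; congr (_ * _).
rewrite -(algq_comm _ (kappa t)) -[in RHS]mulrA kappa_circ.
rewrite -alg_mul -mulrA; congr (_ * _); congr (_ *: _).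
by rewrite /lam /rho /drho; field; rewrite gt_eqF // ltr_pwDl ?sqr_ge0.
Qed.

End Cauchy.

(** * Integrals of quaternion-valued functions over a period *)

Section QuatIntegral.
Variable R : realType.
Local Notation H := (quat R).
Local Notation T := (@pi R *+ 2).
Implicit Types (phi psi : R -> H) (c : H).

Lemma T_ge0 : (0 : R) <= T. Proof. by rewrite mulrn_wge0 // pi_ge0. Qed.

Definition qint phi : H := Quat (itvint (fun t => qre (phi t)) 0 T)
  (itvint (fun t => qi (phi t)) 0 T) (itvint (fun t => qj (phi t)) 0 T)
  (itvint (fun t => qk (phi t)) 0 T).

Definition qcont phi := [/\ continuous (fun t => qre (phi t)),
  continuous (fun t => qi (phi t)), continuous (fun t => qj (phi t)) &
  continuous (fun t => qk (phi t))].

(** Written as a function of two variables that is constant in the first, so that the rules for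
    [qdiff2] apply; the base point 0 is arbitrary. *)
Definition qdiff1 phi := forall t, exists dphi, qdiff2 (fun _ t => phi t) 0 t 0 dphi.

Lemma qdiff1_cont phi : qdiff1 phi -> qcont phi.
Proof.
move=> /choice[dphi hphi].
have h (k : H -> R) : (forall t, diff2 (fun _ t => k (phi t)) 0 t (k 0) (k (dphi t))) ->
    continuous (fun t => k (phi t)).
  move=> hk; apply: (@diff2_contl R (fun t _ => k (phi t)) (fun t => k (dphi t)) (fun=> k 0) 0).
  by move=> t; exact: diff2_swap.
by split; apply: h => t; have [] := qdiff2_comps (hphi t).
Qed.

Lemma qdiff1M phi psi : qdiff1 phi -> qdiff1 psi -> qdiff1 (fun t => phi t * psi t).
Proof.
move=> h1 h2 t; have [d1 hd1] := h1 t; have [d2 hd2] := h2 t.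
exists (d1 * psi t + phi t * d2).
by apply: qdiff2_val (qdiff2M hd1 hd2) _ erefl; rewrite mul0r mulr0 addr0.
Qed.

Lemma qdiff1D phi psi : qdiff1 phi -> qdiff1 psi -> qdiff1 (fun t => phi t + psi t).
Proof.
move=> h1 h2 t; have [d1 hd1] := h1 t; have [d2 hd2] := h2 t.
by exists (d1 + d2); apply: qdiff2_val (qdiff2D hd1 hd2) _ erefl; rewrite addr0.
Qed.

Lemma qdiff1_cst c : qdiff1 (fun=> c).
Proof. by move=> t; exists 0; exact: qdiff2_cst. Qed.

Lemma qdiff1X phi n : qdiff1 phi -> qdiff1 (fun t => phi t ^+ n).
Proof.
move=> h; elim: n => [|n IH]; first exact: qdiff1_cst.
rewrite (_ : (fun t => phi t ^+ n.+1) = (fun t => phi t * phi t ^+ n)); last first.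
  by apply/funext => t; rewrite exprS.
exact: qdiff1M.
Qed.

Lemma qdiff1_real (phi : R -> R) : (forall t, derivable phi t 1) ->
  qdiff1 (fun t => (phi t)%:A).
Proof. by move=> h t; have /derivableP hd := h t; eexists; exact: (qdiff2_snd 0 hd). Qed.

Let lin4 (f0 f1 f2 f3 : R -> R) k0 k1 k2 k3 : continuous f0 -> continuous f1 ->
  continuous f2 -> continuous f3 ->
  itvint (fun t => k0 * f0 t + k1 * f1 t + k2 * f2 t + k3 * f3 t) 0 T =
  k0 * itvint f0 0 T + k1 * itvint f1 0 T + k2 * itvint f2 0 T + k3 * itvint f3 0 T.
Proof.
move=> h0 h1 h2 h3.
have cM k (g : R -> R) : continuous g -> continuous (fun t => k * g t).
  by move=> cg t; apply: cvgM; [exact: cvg_cst|exact: cg].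
have cD (g h : R -> R) : continuous g -> continuous h -> continuous (fun t => g t + h t).
  by move=> cg ch t; apply: cvgD; [exact: cg|exact: ch].
have a0 := cM k0 _ h0; have a1 := cM k1 _ h1; have a2 := cM k2 _ h2; have a3 := cM k3 _ h3.
have b1 := cD _ _ a0 a1; have b2 := cD _ _ b1 a2.
by rewrite (itvintD _ _ b2 a3) (itvintD _ _ b1 a2) (itvintD _ _ a0 a1) !itvintZ.
Qed.

Lemma qintMl c phi : qcont phi -> qint (fun t => c * phi t) = c * qint phi.
Proof.
move=> [h0 h1 h2 h3]; apply: quat_ext => /=.
- transitivity (qre c * itvint (fun t => qre (phi t)) 0 T +
    - qi c * itvint (fun t => qi (phi t)) 0 T + - qj c * itvint (fun t => qj (phi t)) 0 T +
    - qk c * itvint (fun t => qk (phi t)) 0 T); last by ring.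
  by rewrite -lin4 //; congr itvint; apply/funext => t /=; ring.
- transitivity (qi c * itvint (fun t => qre (phi t)) 0 T +
    qre c * itvint (fun t => qi (phi t)) 0 T + - qk c * itvint (fun t => qj (phi t)) 0 T +
    qj c * itvint (fun t => qk (phi t)) 0 T); last by ring.
  by rewrite -lin4 //; congr itvint; apply/funext => t /=; ring.
- transitivity (qj c * itvint (fun t => qre (phi t)) 0 T +
    qk c * itvint (fun t => qi (phi t)) 0 T + qre c * itvint (fun t => qj (phi t)) 0 T +
    - qi c * itvint (fun t => qk (phi t)) 0 T); last by ring.
  by rewrite -lin4 //; congr itvint; apply/funext => t /=; ring.
- transitivity (qk c * itvint (fun t => qre (phi t)) 0 T +
    - qj c * itvint (fun t => qi (phi t)) 0 T + qi c * itvint (fun t => qj (phi t)) 0 T +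
    qre c * itvint (fun t => qk (phi t)) 0 T); last by ring.
  by rewrite -lin4 //; congr itvint; apply/funext => t /=; ring.
Qed.

Lemma qintMr c phi : qcont phi -> qint (fun t => phi t * c) = qint phi * c.
Proof.
move=> [h0 h1 h2 h3]; apply: quat_ext => /=.
- transitivity (qre c * itvint (fun t => qre (phi t)) 0 T +
    - qi c * itvint (fun t => qi (phi t)) 0 T + - qj c * itvint (fun t => qj (phi t)) 0 T +
    - qk c * itvint (fun t => qk (phi t)) 0 T); last by ring.
  by rewrite -lin4 //; congr itvint; apply/funext => t /=; ring.
- transitivity (qi c * itvint (fun t => qre (phi t)) 0 T +
    qre c * itvint (fun t => qi (phi t)) 0 T + qk c * itvint (fun t => qj (phi t)) 0 T +
    - qj c * itvint (fun t => qk (phi t)) 0 T); last by ring.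
  by rewrite -lin4 //; congr itvint; apply/funext => t /=; ring.
- transitivity (qj c * itvint (fun t => qre (phi t)) 0 T +
    - qk c * itvint (fun t => qi (phi t)) 0 T + qre c * itvint (fun t => qj (phi t)) 0 T +
    qi c * itvint (fun t => qk (phi t)) 0 T); last by ring.
  by rewrite -lin4 //; congr itvint; apply/funext => t /=; ring.
- transitivity (qk c * itvint (fun t => qre (phi t)) 0 T +
    qj c * itvint (fun t => qi (phi t)) 0 T + - qi c * itvint (fun t => qj (phi t)) 0 T +
    qre c * itvint (fun t => qk (phi t)) 0 T); last by ring.
  by rewrite -lin4 //; congr itvint; apply/funext => t /=; ring.
Qed.

Lemma qintD phi psi : qcont phi -> qcont psi ->
  qint (fun t => phi t + psi t) = qint phi + qint psi.
Proof.
move=> [h0 h1 h2 h3] [k0 k1 k2 k3].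
by apply: quat_ext => /=; rewrite -itvintD.
Qed.

(** The factor 4 comes from bounding the four coordinates separately. It is crude but enough to show
    that remainders tend to 0. *)
Lemma qint_le_norm phi M : qcont phi -> (forall t, 0 <= t <= T -> `|phi t| <= M) ->
  `|qint phi| <= M * T *+ 4.
Proof.
move=> [h0 h1 h2 h3] hM; apply: le_trans (normq_le_comps _) _ => /=.
have hn (k : H -> R) : (forall q, `|k q| <= `|q|) -> continuous (fun t => k (phi t)) ->
    `|itvint (fun t => k (phi t)) 0 T| <= M * T.
  move=> kn ck; rewrite -[X in _ <= M * X]subr0; apply: itvint_le_norm => //.
    exact: T_ge0.
  by move=> t /hM; exact: le_trans (kn _).
have a0 := hn (@qre R) (fun q => let: And4 h _ _ _ := normq_comps q in h) h0.
have a1 := hn (@qi R) (fun q => let: And4 _ h _ _ := normq_comps q in h) h1.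
have a2 := hn (@qj R) (fun q => let: And4 _ _ h _ := normq_comps q in h) h2.
have a3 := hn (@qk R) (fun q => let: And4 _ _ _ h := normq_comps q in h) h3.
have -> : M * T *+ 4 = M * T + M * T + M * T + M * T by rewrite -mulr_natr; ring.
by rewrite !lerD.
Qed.

Lemma qcont_bounded phi : qcont phi -> exists M, forall t, 0 <= t <= T -> `|phi t| <= M.
Proof.
move=> [h0 h1 h2 h3].
have hb (g : R -> R) : continuous g -> exists M, forall t, 0 <= t <= T -> `|g t| <= M.
  move=> cg; have cg' : continuous (fun t => `|g t|).
    by move=> t; apply: continuous_comp; [exact: cg|exact: norm_continuous].
  have [c _ hc] := EVT_max T_ge0 (continuous_subspaceT (A := `[0, T]) cg').
  by exists `|g c| => t ht; apply: hc; rewrite in_itv.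
have [M0 m0] := hb _ h0; have [M1 m1] := hb _ h1.
have [M2 m2] := hb _ h2; have [M3 m3] := hb _ h3.
exists (M0 + M1 + M2 + M3) => t ht; apply: le_trans (normq_le_comps _) _.
by rewrite !lerD ?m0 ?m1 ?m2 ?m3.
Qed.

End QuatIntegral.

(** * Cauchy's formula and the power expansion on one slice *)

Section CauchyFormula.
Variable R : realType.
Local Notation H := (quat R).
Local Notation T := (@pi R *+ 2).
Variables (I : H).
Hypothesis HI : imag_unit I.
Local Notation sl := (cslice I).

Lemma sin_natT n : sin (n%:R * T) = 0 /\ cos (n%:R * T) = 1.
Proof.
elim: n => [|n [hs hc]]; first by rewrite mul0r sin0 cos0.
rewrite -natr1 mulrDl mul1r; split.
  by rewrite sinD hs hc cos2pi sin2pi; ring.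
by rewrite cosD hs hc cos2pi sin2pi; ring.
Qed.

Lemma qint_real (g : R -> R) : qint (fun t => (g t)%:A) = (itvint g 0 T)%:A.
Proof.
have z : itvint (fun t => g t * 0) 0 T = 0.
  rewrite (_ : (fun t => g t * 0) = fun=> 0); last by apply/funext => t; rewrite mulr0.
  by rewrite itvint_cst ?mul0r // T_ge0.
have o : (fun t => g t * 1) = g by apply/funext => t; rewrite mulr1.
by apply: quat_ext; rewrite /= ?z ?mulr0 // o mulr1.
Qed.

Lemma itvint_trig n : itvint (fun t => cos (n.+1%:R * t)) 0 T = 0 /\
  itvint (fun t => sin (n.+1%:R * t)) 0 T = 0.
Proof.
have n0 : n.+1%:R != 0 :> R by rewrite pnatr_eq0.
have [hs hc] := sin_natT n.+1.
move: n0 hs hc; set k : R := n.+1%:R => n0 hs hc.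
clearbody k.
have lin (t : R) : is_derive t 1 (fun t : R => k * t) k.
  by apply: is_derive_eq; rewrite /GRing.scale /= mulr1.
have cl : continuous (fun t : R => k * t).
  by move=> t; apply: cvgM; [exact: cvg_cst|exact: cvg_id].
have ds (t : R) : is_derive t 1 (fun t => k^-1 * sin (k * t)) (cos (k * t)).
  have h := is_derive1_comp (is_derive_sin (k * t)) (lin t).
  by apply: is_derive_eq; rewrite /GRing.scale /=; field.
have dc (t : R) : is_derive t 1 (fun t => - k^-1 * cos (k * t)) (sin (k * t)).
  have h := is_derive1_comp (is_derive_cos (k * t)) (lin t).
  by apply: is_derive_eq; rewrite /GRing.scale /=; field.
have cc : continuous (fun t => cos (k * t)).
  by move=> t; apply: continuous_comp; [exact: cl|exact: continuous_cos].
have cs : continuous (fun t => sin (k * t)).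
  by move=> t; apply: continuous_comp; [exact: cl|exact: continuous_sin].
rewrite (itvint_FTC (T_ge0 R) cc ds) (itvint_FTC (T_ge0 R) cs dc) hs hc.
by rewrite !mulr0 sin0 cos0 !mulr0 !subrr.
Qed.

Section Circle.
Variable r : R.
Hypothesis r0 : 0 < r.
Local Notation circ := (circ I r).
Local Notation w t := (qinv (circ t)).

Lemma norm_circle t : `|circ t| = r.
Proof. by apply: (@norm_circ R I HI 0 r); rewrite normr0. Qed.

Lemma qinv_circX n t : w t ^+ n = (r ^- n) *: sl (cos (n%:R * t)) (- sin (n%:R * t)).
Proof.
have E : w t = r^-1 *: sl (cos t) (- sin t).
  have cE : circ t = sl (r * cos t) (r * sin t) by [].
  rewrite /qinv norm_circle cE cslice_conj // -mulrN -csliceZ scalerA.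
  by congr (_ *: _); field; rewrite gt_eqF.
elim: n => [|n IH].
  by rewrite !expr0 mul0r cos0 sin0 oppr0 invr1 scale1r /cslice scale0r mulr0 addr0 scale1r.
rewrite exprS IH E -scalerAl -scalerAr scalerA csliceM //.
rewrite -invfM -exprS; congr (_ *: cslice _ _ _).
  by rewrite -natr1 mulrDl mul1r cosD; ring.
by rewrite -natr1 mulrDl mul1r sinD; ring.
Qed.

Lemma circ_neq0 t : circ t != 0.
Proof. by rewrite -normr_gt0 norm_circle. Qed.

Lemma qdiff1_qinv_circ : qdiff1 (fun t => w t).
Proof.
move=> t.
have h := @qdiff2_inv R (fun _ t => circ t) 0 t 0 _ (circ_neq0 t) (circ_diff HI r 0 t).
eexists; apply: qdiff2_val h _ erefl.
by rewrite mulr0 mul0r oppr0.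
Qed.

Lemma qint_qinv_circX n : qint (fun t => w t ^+ n) = if n is 0%N then T%:A else 0.
Proof.
case: n => [|n].
  rewrite (_ : (fun t => w t ^+ 0) = (fun=> 1%:A)); last first.
    by apply/funext => t; rewrite expr0 scale1r.
  by rewrite (qint_real (fun=> 1)) itvint_cst ?T_ge0 // mul1r subr0.
have [hc hs] := itvint_trig n.
have dcos : qdiff1 (fun t : R => (cos (n.+1%:R * t))%:A : H).
  by apply: qdiff1_real => t.
have dsin : qdiff1 (fun t : R => (- sin (n.+1%:R * t))%:A : H).
  by apply: qdiff1_real => t.
rewrite (_ : (fun t => _) = (fun t => (r ^- n.+1)%:A * ((cos (n.+1%:R * t))%:A +
   I * (- sin (n.+1%:R * t))%:A))); last first.
  by apply/funext => t; rewrite qinv_circX mulr_algl.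
have dI := qdiff1M (qdiff1_cst I) dsin.
rewrite qintMl; last exact/qdiff1_cont/qdiff1D.
rewrite qintD; [|exact: qdiff1_cont..].
rewrite qintMl; last exact: qdiff1_cont.
rewrite !qint_real hc.
have -> : itvint (fun t => - sin (n.+1%:R * t)) 0 T = 0.
  rewrite (_ : (fun t => _) = (fun t => -1 * sin (n.+1%:R * t))); last first.
    by apply/funext => t; rewrite mulN1r.
  rewrite itvintZ ?hs ?mulr0 // => t.
  apply: continuous_comp; last exact: continuous_sin.
  by apply: cvgM; [exact: cvg_cst|exact: cvg_id].
by rewrite scale0r mulr0 addr0 mulr0.
Qed.

End Circle.

Section Expansion.
Variables (a : H) (r : R).
Hypotheses (ha : slice I a) (ar : `|a| < r) (r1 : r < 1).
Local Notation circ := (circ I r).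
Local Notation kappa := (kappa I a r).
Local Notation w t := (qinv (circ t)).

Let r0 : 0 < r. Proof. exact: le_lt_trans ar. Qed.

Lemma qdiff1_kappa : qdiff1 kappa.
Proof. by move=> t; have [dk h] := kappa_diff HI ar 0 t; exists dk. Qed.

Lemma circ_T : circ T = circ 0.
Proof.
have E t : circ t = sl (r * cos t) (r * sin t) by [].
by rewrite !E cos2pi sin2pi cos0 sin0.
Qed.

(** Goursat's lemma on [[0, s] x [0, T]]: the sides [t = 0] and [t = T] cancel by periodicity, so
    the integral of [form2] over [t] is the same at [s = 0], where it runs over the circle, and for
    large [s], where [f] is close to [f a]. The value of [qint kappa] is found afterwards, in
    [qint_kappa]. *)
Lemma cauchy_formula f : slice_regular f ->
  qint (fun t => kappa t * f (circ t)) = qint kappa * f a.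
Proof.
move=> Hf.
have [px [py [qx [qy [hp hq hpq]]]]] := form_closed HI Hf ha ar r1.
set p := form1 I f a r in hp; set q := form2 I f a r in hq.
have pT s : p s T = p s 0 by rewrite /p /form1 /cone circ_T.
have comp (k : H -> R) (hpk : forall s t, diff2 (fun s t => k (p s t)) s t (k (px s t)) (k (py s t)))
    (hqk : forall s t, diff2 (fun s t => k (q s t)) s t (k (qx s t)) (k (qy s t))) s :
    0 <= s -> itvint (fun t => k (q s t)) 0 T = itvint (fun t => k (q 0 t)) 0 T.
  move=> s0.
  have := goursat_rect hpk hqk (fun x y => congr1 k (hpq x y)) 0 0 s0 (T_ge0 R).
  rewrite /rect_int !add0r.
  have -> : (fun s => k (p s T)) = (fun s => k (p s 0)) by apply/funext => x; rewrite pT.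
  lra.
have qs s : 0 <= s -> qint (q s) = qint (q 0).
  move=> s0; apply: quat_ext; rewrite /qint [LHS]/= [RHS]/=.
  - by apply: (comp (@qre R)) => // x y; [have [] := qdiff2_comps (hp x y)|have [] := qdiff2_comps (hq x y)].
  - by apply: (comp (@qi R)) => // x y; [have [] := qdiff2_comps (hp x y)|have [] := qdiff2_comps (hq x y)].
  - by apply: (comp (@qj R)) => // x y; [have [] := qdiff2_comps (hp x y)|have [] := qdiff2_comps (hq x y)].
  - by apply: (comp (@qk R)) => // x y; [have [] := qdiff2_comps (hp x y)|have [] := qdiff2_comps (hq x y)].
have q0E : q 0 = (fun t => kappa t * f (circ t)).
  apply/funext => t; rewrite /q /form2 /cone /rho expr0n /= addr0 invr1 scale1r mul1r.
  by rewrite addrC subrK.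
rewrite -q0E -qintMr; last exact/qdiff1_cont/qdiff1_kappa.
have dq s : qdiff1 (q s).
  move=> t; exists (qy s t) => e e0; have [d d0 hd] := hq s t e e0.
  exists d => // x y _ yd; have := hd s y; rewrite !subrr normr0 !scale0r !add0r => /(_ d0 yd) h.
  by rewrite scaler0 add0r; apply: le_trans h _; rewrite ler_pM2l // lerDr.
have dka : qdiff1 (fun t => kappa t * f a) by exact/qdiff1M/qdiff1_cst/qdiff1_kappa.
have dkaN : qdiff1 (fun t => kappa t * (- f a)) by exact/qdiff1M/qdiff1_cst/qdiff1_kappa.
have [M hM] := qcont_bounded (qdiff1_cont qdiff1_kappa).
have aB : unit_ball a by exact: lt_trans ar r1.
apply/eqP; rewrite -subr_eq0 -normr_le0; apply/ler_addgt0Pr => e e0; rewrite add0r.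
have M0 : 0 <= M by apply: le_trans (hM 0 _); rewrite ?lexx ?T_ge0.
pose C := M * T *+ 4 + 1.
have C0 : 0 < C by rewrite ltr_wpDl // mulrn_wge0 // mulr_ge0 ?T_ge0.
have eC : 0 < e / C by rewrite divr_gt0.
have cf : f @ a --> f a by apply: differentiable_continuous; case: Hf => + _; exact.
have [d /= d0 hd] : exists2 d : R, 0 < d & forall z, `|z - a| < d -> `|f z - f a| < e / C.
  move/cvgrPdist_lt : cf => /(_ _ eC)/nbhs_ballP[d /= d0 hd].
  exists d => // z zd; rewrite distrC; apply: hd.
  by rewrite -ball_normE /= distrC.
(* Then [rho s = 1 / (1 + 2 / d)], and as [|circ t - a| < 2] the contracted circle stays within [d]
   of [a]. *)
pose s := Num.sqrt (2 / d).
have s0 : 0 <= s by exact: sqrtr_ge0.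
have close t : `|cone I a r s t - a| < d.
  rewrite /cone addrAC subrr add0r normqM norm_alg.
  have h2 : `|circ t - a| < 2.
    apply: le_lt_trans (ler_normB _ _) _; rewrite norm_circle //; have := ar; have := r1; lra.
  rewrite /rho sqr_sqrtr ?divr_ge0 ?(ltW d0) //.
  have n0 : 0 < 1 + 2 / d by rewrite addr_gt0 // divr_gt0.
  rewrite ger0_norm ?invr_ge0 ?(ltW n0) // mulrC ltr_pdivrMr //.
  rewrite mulrDr mulr1 mulrCA divff ?gt_eqF // mulr1; lra.
rewrite -(qs s s0).
have -> : qint (q s) - qint (fun t => kappa t * f a) = qint (fun t => q s t + kappa t * - f a).
  rewrite qintD ?(qdiff1_cont (dq s)) //; try exact: qdiff1_cont.
  rewrite !qintMr; try exact/qdiff1_cont/qdiff1_kappa.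
  by rewrite mulrN.
apply: le_trans (qint_le_norm (M := M * (e / C)) _ _) _.
- exact/qdiff1_cont/qdiff1D.
- move=> t ht; rewrite /q /form2 -mulrDr normqM ler_pM //; first exact: hM.
  exact/ltW/hd/close.
rewrite mulrAC -mulrnAl mulrA ler_pdivrMr // mulrC ler_pM2l //.
by rewrite /C lerDl.
Qed.

Lemma slice_qinv_circ t : slice I (w t).
Proof. by apply: slice_qinv => //; exact: slice_circ. Qed.

(** Inside the slice everything commutes and [kappa = I * (1 - a * w)^-1]; this is the finite
    geometric sum with its remainder. *)
Lemma kappa_geometric t N :
  kappa t = \sum_(0 <= n < N) I * (a ^+ n * w t ^+ n) + (a * w t) ^+ N * kappa t.
Proof.
pose u := a * w t.
have su : slice I u by apply: sliceM => //; exact: slice_qinv_circ.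
have kE : kappa t = I + u * kappa t.
  have E : I = (1 - u) * kappa t.
    have -> : 1 - u = w t * (circ t - a).
      by rewrite mulrBr mulqVl ?circ_neq0 // /u (slice_comm HI ha (slice_qinv_circ t)).
    rewrite -mulrA -(slice_comm HI (slice_kappa HI r ha t)); last first.
      by apply: sliceB => //; exact: slice_circ.
    rewrite (kappa_circ HI ar) -(slice_comm HI (slice_circ I r t) (slice_unit I)).
    by rewrite mulrA mulqVl ?circ_neq0 // mul1r.
  by rewrite [X in _ = X + _]E mulrBl mul1r subrK.
have uX n : a ^+ n * w t ^+ n = u ^+ n.
  by rewrite -exprMn_comm // /GRing.comm (slice_comm HI ha (slice_qinv_circ t)).
elim: N => [|N IH]; first by rewrite big_nil add0r expr0 mul1r.
rewrite big_nat_recr //= {1}IH -addrA; congr (_ + _).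
rewrite uX -/u {1}kE mulrDr mulrA -exprSr; congr (_ + _).
by rewrite (slice_comm HI (sliceX HI N su) (slice_unit I)).
Qed.

Lemma kernel_series (phi : R -> H) : qdiff1 phi ->
  series (fun n => a ^+ n * (I * qint (fun t => w t ^+ n * phi t))) @ \oo -->
  qint (fun t => kappa t * phi t).
Proof.
move=> dphi; have [M1 hM1] := qcont_bounded (qdiff1_cont qdiff1_kappa).
have [M2 hM2] := qcont_bounded (qdiff1_cont dphi).
pose M := M1 * M2; pose x := `|a| / r.
have x0 : 0 <= x by rewrite divr_ge0 // ltW.
have x1 : x < 1 by rewrite ltr_pdivrMr // mul1r.
have dX n : qdiff1 (fun t => w t ^+ n) by apply: qdiff1X; exact: qdiff1_qinv_circ.
have dT n : qdiff1 (fun t => a ^+ n * (I * (w t ^+ n * phi t))).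
  by apply: qdiff1M; [exact: qdiff1_cst|apply: qdiff1M; [exact: qdiff1_cst|exact: qdiff1M]].
have dS N : qdiff1 (fun t => \sum_(0 <= n < N) a ^+ n * (I * (w t ^+ n * phi t))).
  elim: N => [|N IH].
    rewrite (_ : (fun t => _) = (fun=> 0)); first exact: qdiff1_cst.
    by apply/funext => t; rewrite big_nil.
  rewrite (_ : (fun t => _) = (fun t => \sum_(0 <= n < N) a ^+ n * (I * (w t ^+ n * phi t)) +
    a ^+ N * (I * (w t ^+ N * phi t)))); first exact: qdiff1D.
  by apply/funext => t; rewrite big_nat_recr.
have SE N : series (fun n => a ^+ n * (I * qint (fun t => w t ^+ n * phi t))) N =
    qint (fun t => \sum_(0 <= n < N) a ^+ n * (I * (w t ^+ n * phi t))).
  rewrite /series /=; elim: N => [|N IH].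
    rewrite big_nil (_ : (fun t => _) = (fun=> 0%:A)).
      by rewrite (qint_real (fun=> 0)) itvint_cst ?T_ge0 // mul0r scale0r.
    by apply/funext => t; rewrite big_nil scale0r.
  rewrite big_nat_recr //= IH.
  rewrite [in RHS](_ : (fun t => _) =
    (fun t => \sum_(0 <= n < N) a ^+ n * (I * (w t ^+ n * phi t)) +
    a ^+ N * (I * (w t ^+ N * phi t)))); last by apply/funext => t; rewrite big_nat_recr.
  rewrite qintD; [|exact: qdiff1_cont..].
  have dwp := qdiff1M (dX N) dphi.
  rewrite [in RHS](qintMl (a ^+ N) (phi := fun t => I * (w t ^+ N * phi t))).
    by rewrite [in RHS](qintMl I (phi := fun t => w t ^+ N * phi t)) //; exact: qdiff1_cont.
  by apply/qdiff1_cont/qdiff1M => //; exact: qdiff1_cst.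
have dk := qdiff1M qdiff1_kappa dphi.
have dR N : qdiff1 (fun t => (a * w t) ^+ N * (kappa t * phi t)).
  apply: qdiff1M dk; apply: qdiff1X; apply: qdiff1M; first exact: qdiff1_cst.
  exact: qdiff1_qinv_circ.
have RE N : qint (fun t => kappa t * phi t) -
    series (fun n => a ^+ n * (I * qint (fun t => w t ^+ n * phi t))) N =
    qint (fun t => (a * w t) ^+ N * (kappa t * phi t)).
  rewrite SE; apply/eqP; rewrite subr_eq addrC -qintD; try exact: qdiff1_cont.
  apply/eqP; congr qint; apply/funext => t; rewrite {1}(kappa_geometric t N) mulrDl -mulrA.
  congr (_ + _); rewrite big_distrl /=; apply: eq_bigr => n _.
  rewrite [I * _]mulrA (slice_comm HI (slice_unit I) (sliceX HI n ha)).
  by rewrite -!mulrA.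
have cx : (fun N => M * T *+ 4 * x ^+ N) @ \oo --> (0 : R).
  rewrite -[X in _ --> X](mulr0 (M * T *+ 4)); apply: cvgM; first exact: cvg_cst.
  by apply: cvg_expr; rewrite ger0_norm.
apply/cvg_seqP => e e0; have [N hN] := (cvg_seqP _ _).1 cx e e0.
exists N => n /hN; rewrite subr0 => h; rewrite distrC RE.
apply: le_lt_trans h; apply: le_trans (ler_norm _).
have -> : M * T *+ 4 * x ^+ n = x ^+ n * M * T *+ 4.
  by rewrite mulrnAl; congr (_ *+ _); ring.
apply: qint_le_norm; first exact: qdiff1_cont.
move=> t ht; rewrite normqM normqX [`|a * _|]normqM norm_qinv norm_circle //.
rewrite [`|kappa t * _|]normqM.
rewrite ler_pM ?mulr_ge0 ?exprn_ge0 ?divr_ge0 ?(ltW r0) //.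
by apply: ler_pM => //; [exact: hM1|exact: hM2].
Qed.

(** Expand the kernel against the constant 1: the powers of [w] with positive exponent have integral
    0, so only the term of degree 0 remains. *)
Lemma qint_kappa : qint kappa = T *: I.
Proof.
have h := kernel_series (qdiff1_cst (1%:A : H)).
have E1 : (fun t => kappa t * 1%:A) = kappa.
  by apply/funext => t; rewrite scale1r mulr1.
rewrite E1 in h; apply: (cvg_uniq h).
apply/cvg_seqP => e e0; exists 1%N => -[//|n] _.
suff -> : series (fun n => a ^+ n * (I * qint (fun t => w t ^+ n * 1%:A))) n.+1 = T *: I.
  by rewrite subrr normr0.
have E m : qint (fun t => w t ^+ m * 1%:A) = if m is 0%N then T%:A else 0.
  rewrite (_ : (fun t => _) = (fun t => w t ^+ m)); first exact: qint_qinv_circX.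
  by apply/funext => t; rewrite scale1r mulr1.
rewrite /series /= big_nat_recl // E expr0 mul1r mulr_algr big1 ?addr0 // => m _.
by rewrite E !mulr0.
Qed.

Theorem slice_regular_expansion_slice f : slice_regular f ->
  series (fun n => a ^+ n * (T^-1 *: qint (fun t => w t ^+ n * f (circ t)))) @ \oo --> f a.
Proof.
move=> Hf; have T0 : T != 0 :> R by rewrite mulrn_eq0 /= gt_eqF // pi_gt0.
have df : qdiff1 (fun t => f (circ t)).
  move=> t; have cB : unit_ball (circ t) by rewrite /unit_ball /= norm_circle.
  have hs := slice_circ I r t.
  have h := qdiff2_comp (fun _ y => slice_circ I r y)
    (slice_regular_diff_along HI Hf hs cB) (circ_diff HI r 0 t).
  by eexists; apply: qdiff2_val h _ erefl; rewrite mul0r.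
have := kernel_series df; rewrite cauchy_formula // qint_kappa => h.
(* [- (T^-1 *: I)] is the inverse of [T *: I], the integral of the kernel. *)
have := series_cvgMl (q := - (T^-1 *: I)) h.
have II : I * I = -1 by rewrite -expr2.
rewrite mulNr mulrA -scalerAl -scalerAr scalerA mulVf // scale1r II mulN1r opprK => h2.
rewrite (_ : (fun n => _) = (fun n => - (T^-1 *: I) * (a ^+ n * (I * qint (fun t => w t ^+ n * f (circ t)))))).
  exact: h2.
apply/funext => n.
rewrite mulNr mulrA -scalerAl !mulrA (slice_comm HI (slice_unit I) (sliceX HI n ha)).
by rewrite -[_ * I * I]mulrA II mulrN1 mulNr scalerN opprK scalerAr.
Qed.

End Expansion.

End CauchyFormula.

(** * Quaternionic matrices and Leech's theorem *)

Section QuatMatrix.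
Variable R : realType.
Local Notation H := (quat R).

Definition adjq m n (A : 'M[H]_(m, n)) : 'M[H]_(n, m) :=
  \matrix_(i, j) quat_conj (A j i).

Lemma adjqK m n (A : 'M[H]_(m, n)) : adjq (adjq A) = A.
Proof. by apply/matrixP => i j; rewrite !mxE qconjK. Qed.

Lemma adjqM m n p (A : 'M[H]_(m, n)) (B : 'M[H]_(n, p)) :
  adjq (A *m B) = adjq B *m adjq A.
Proof.
apply/matrixP => i j; rewrite !mxE qconj_sum; apply: eq_bigr => k _.
by rewrite !mxE qconjM.
Qed.

Lemma adjqD m n (A B : 'M[H]_(m, n)) : adjq (A + B) = adjq A + adjq B.
Proof. by apply/matrixP => i j; rewrite !mxE qconjD. Qed.

Lemma adjqB m n (A B : 'M[H]_(m, n)) : adjq (A - B) = adjq A - adjq B.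
Proof. by apply/matrixP => i j; rewrite !mxE qconjB. Qed.

Lemma adjq0 m n : adjq (0 : 'M[H]_(m, n)) = 0.
Proof. by apply/matrixP => i j; rewrite !mxE qconj0. Qed.

Lemma adjq_scalar n (x : R) : adjq ((x%:A)%:M : 'M[H]_n) = (x%:A)%:M.
Proof.
apply/matrixP => i j; rewrite !mxE (eq_sym j).
by case: (i == j); rewrite ?mulr1n ?mulr0n ?qconj0 // qconjZ qconj1.
Qed.

Lemma adjq1 n : adjq (1%:M : 'M[H]_n) = 1%:M.
Proof. by have := adjq_scalar n 1; rewrite scale1r. Qed.

Lemma adjq_block m n p q (A : 'M[H]_(m, p)) (B : 'M[H]_(m, q))
    (C : 'M[H]_(n, p)) (D : 'M[H]_(n, q)) :
  adjq (block_mx A B C D) = block_mx (adjq A) (adjq C) (adjq B) (adjq D).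
Proof.
apply/matrixP => i j; rewrite mxE -(splitK i) -(splitK j).
by case: (fintype.split i) => i'; case: (fintype.split j) => j' /=;
  rewrite !(block_mxEul, block_mxEur, block_mxEdl, block_mxEdr) mxE.
Qed.

Lemma adjq_row m n p (A : 'M[H]_(m, n)) (B : 'M[H]_(m, p)) :
  adjq (row_mx A B) = col_mx (adjq A) (adjq B).
Proof.
apply/matrixP => i j; rewrite mxE -(splitK i).
by case: (fintype.split i) => i' /=; rewrite !(row_mxEl, row_mxEr, col_mxEu, col_mxEd) mxE.
Qed.

Lemma adjq_col m n p (A : 'M[H]_(m, n)) (B : 'M[H]_(p, n)) :
  adjq (col_mx A B) = row_mx (adjq A) (adjq B).
Proof. by rewrite -[RHS]adjqK adjq_row !adjqK. Qed.

Definition sqn n (v : 'cV[H]_n) : R := \sum_i `|v i 0| ^+ 2.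

Lemma sqn_ge0 n (v : 'cV[H]_n) : 0 <= sqn v.
Proof. by apply: sumr_ge0 => i _; exact: sqr_ge0. Qed.

Lemma sqnE n (v : 'cV[H]_n) : qre ((adjq v *m v) 0 0) = sqn v.
Proof.
rewrite mxE qre_sum; apply: eq_bigr => i _.
by rewrite mxE mul_conjq /= mulr1.
Qed.

Lemma sqn_col n m (v : 'cV[H]_n) (w : 'cV[H]_m) : sqn (col_mx v w) = sqn v + sqn w.
Proof.
by rewrite /sqn big_split_ord /=; congr (_ + _); apply: eq_bigr => i _;
  rewrite ?col_mxEu ?col_mxEd.
Qed.

Lemma mul_adjq_eq0 m n (A : 'M[H]_(m, n)) : A *m adjq A = 0 -> A = 0.
Proof.
move=> A0; apply/matrixP => i j; rewrite !mxE.
have: qre ((A *m adjq A) i i) = 0 by rewrite A0 mxE.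
rewrite mxE qre_sum (eq_bigr (fun k => `|A i k| ^+ 2)).
  move/psumr_eq0P => /(_ (fun k _ => sqr_ge0 _)) /(_ j isT) /eqP.
  by rewrite sqrf_eq0 normr_eq0 => /eqP.
by move=> k _; rewrite mxE mul_qconj /= mulr1.
Qed.

Definition psd n (P : 'M[H]_n) :=
  adjq P = P /\ forall v : 'cV[H]_n, 0 <= qre ((adjq v *m P *m v) 0 0).

Lemma psd_gram m n (A : 'M[H]_(m, n)) : psd (A *m adjq A).
Proof.
split=> [|v]; first by rewrite adjqM adjqK.
by rewrite mulmxA -mulmxA -{1}(adjqK A) -adjqM sqnE sqn_ge0.
Qed.

Lemma psd_congr m n (M : 'M[H]_(m, n)) (P : 'M[H]_n) :
  psd P -> psd (M *m P *m adjq M).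
Proof.
move=> [Ph Pp]; split=> [|v]; first by rewrite !adjqM adjqK Ph mulmxA.
by have := Pp (adjq M *m v); rewrite adjqM adjqK !mulmxA.
Qed.

(** The generalized inverse is given as [Y^* Y], which makes it hermitian and also yields a square
    root of a hermitian [P]: for [K = P Y^*] one has [K K^* = P Y^* Y P = P]. *)
Definition herm_pinv n (P Y : 'M[H]_n) :=
  P *m (adjq Y *m Y) *m P = P /\
  (adjq Y *m Y) *m P *m (adjq Y *m Y) = adjq Y *m Y.

Lemma herm_pinv_congr n (L Li P Y : 'M[H]_n) : L *m Li = 1%:M -> Li *m L = 1%:M ->
  herm_pinv (Li *m P *m adjq Li) Y -> herm_pinv P (Y *m Li).
Proof.
move=> LLi LiL [h1 h2].
have aLL : adjq Li *m adjq L = 1%:M by rewrite -adjqM LLi adjq1.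
set P1 := Li *m P *m adjq Li in h1 h2.
have e : P = L *m P1 *m adjq L.
  by rewrite /P1 !mulmxA LLi mul1mx -mulmxA aLL mulmx1.
split.
  transitivity (L *m (P1 *m (adjq Y *m Y) *m P1) *m adjq L); last by rewrite h1 -e.
  by rewrite /P1 adjqM !mulmxA LLi mul1mx -[_ *m adjq Li *m adjq L]mulmxA aLL mulmx1.
transitivity (adjq Li *m (adjq Y *m Y *m P1 *m (adjq Y *m Y)) *m Li).
  by rewrite /P1 adjqM !mulmxA.
by rewrite h2 adjqM !mulmxA.
Qed.

Lemma psd_scalar0 (P : 'M[H]_1) : psd P -> P 0 0 = (qre (P 0 0))%:A.
Proof.
move=> [/matrixP/(_ 0 0) + _]; rewrite mxE; case: (P 0 0) => a b c d E.
move: (congr1 (@qi R) E) (congr1 (@qj R) E) (congr1 (@qk R) E) => /= h1 h2 h3.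
by apply: quat_ext; rewrite /= ?mulr1 // mulr0; lra.
Qed.

Lemma psd_ul m n (P : 'M[H]_(m + n)) : psd P -> psd (ulsubmx P).
Proof.
move=> [Ph Pp]; split.
  apply/matrixP => i j; rewrite !mxE.
  by have := congr1 (fun X : 'M[H]_(m + n) => X (lshift n i) (lshift n j)) Ph; rewrite mxE.
move=> v; have := Pp (col_mx v 0).
rewrite -{1}(submxK P) adjq_col adjq0 mul_row_block mul_row_col.
by rewrite !mul0mx !mulmx0 !addr0.
Qed.

Lemma psd_dr m n (P : 'M[H]_(m + n)) : psd P -> psd (drsubmx P).
Proof.
move=> [Ph Pp]; split.
  apply/matrixP => i j; rewrite !mxE.
  by have := congr1 (fun X : 'M[H]_(m + n) => X (rshift m i) (rshift m j)) Ph; rewrite mxE.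
move=> v; have := Pp (col_mx 0 v).
rewrite -{1}(submxK P) adjq_col adjq0 mul_row_block mul_row_col.
by rewrite !mul0mx !mulmx0 !add0r.
Qed.

Lemma herm_block m n (P : 'M[H]_(m + n)) : adjq P = P ->
  P = block_mx (ulsubmx P) (adjq (dlsubmx P)) (dlsubmx P) (drsubmx P).
Proof.
move=> Ph; rewrite -{1}(submxK P); congr block_mx.
apply/matrixP => i j; rewrite !mxE.
by have := congr1 (fun X : 'M[H]_(m + n) => X (lshift n i) (rshift m j)) Ph; rewrite mxE.
Qed.

(** On the vectors [(x, b)] with [x] real and [b] the part of the first column below the corner, the
    form is [2 x |b|^2 + d]. It is affine in [x] and stays nonnegative only if [b = 0]. *)
Lemma psd_ul0 n (P : 'M[H]_(1 + n)) : psd P -> ulsubmx P = 0 -> dlsubmx P = 0.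
Proof.
move=> [Ph Pp] P0; have := herm_block Ph; rewrite P0.
set b := dlsubmx P; set D := drsubmx P => PE.
have BE : adjq b *m b = ((sqn b)%:A)%:M.
  apply/matrixP => i j; rewrite !ord1 !mxE mulr1n /sqn scaler_suml.
  by apply: eq_bigr => k _; rewrite mxE mul_conjq.
set d := qre ((adjq b *m D *m b) 0 0).
have quad (x : R) : 0 <= x * sqn b *+ 2 + d.
  have := Pp (col_mx ((x%:A)%:M) b).
  rewrite PE adjq_col mul_row_block mul_row_col mulmx0 add0r adjq_scalar.
  rewrite BE mulmxDl -(mulmxA _ (adjq b) b) BE addrA -!scalar_mxM -!alg_mul.
  rewrite /d; move: (adjq b *m D *m b) => Z; rewrite !mxE !mulr1n /= !mulr1.
  by rewrite [sqn b * x]mulrC mulr2n.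
have sb : sqn b = 0.
  apply/eqP; rewrite eq_le sqn_ge0 andbT leNgt; apply/negP => s0.
  (* At this point the form would equal -1. *)
  have := quad (- (d + 1) / 2 / sqn b); rewrite mulfVK ?gt_eqF //.
  rewrite -mulr_natr; have : - (d + 1) / 2 * 2 = - (d + 1) by rewrite mulfVK.
  lra.
have : adjq b *m adjq (adjq b) = 0.
  by rewrite adjqK BE sb scale0r; apply/matrixP => i j; rewrite !mxE mul0rn.
by move=> /mul_adjq_eq0/(congr1 (@adjq _ _)); rewrite adjqK adjq0.
Qed.

Lemma mul_block_diag_mx m n (a a' : 'M[H]_m) (b b' : 'M[H]_n) :
  block_mx a 0 0 b *m block_mx a' 0 0 b' = block_mx (a *m a') 0 0 (b *m b').
Proof. by rewrite mulmx_block !mulmx0 !mul0mx !addr0 !add0r. Qed.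

(** Block elimination: the triangular matrix [Li] turns [P] into the direct sum of the corner [al]
    and a Schur complement, to which the induction hypothesis applies. If [al = 0] then [b = 0] by
    [psd_ul0], and the convention [0^-1 = 0] lets both cases share the formulas for [c] and [y]. *)
Lemma psd_pinv_step n (P : 'M[H]_(1 + n)) :
  (forall P' : 'M[H]_n, psd P' -> exists Y, herm_pinv P' Y) -> psd P ->
  exists Y, herm_pinv P Y.
Proof.
move=> IH psdP; have [Ph _] := psdP; have := herm_block Ph.
set b := dlsubmx P; set D := drsubmx P.
set al := qre (ulsubmx P 0 0).
have alE : ulsubmx P = (al%:A)%:M.
  apply/matrixP => i j; rewrite !ord1 (psd_scalar0 (psd_ul psdP)) !mxE mulr1n.
  by rewrite /al !mxE.
have al0 : 0 <= al.
  have [_ /(_ 1%:M)] := psd_ul psdP.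
  by rewrite adjq1 mul1mx mulmx1.
have bE : b *m ((al^-1)%:A)%:M *m (al%:A)%:M = b.
  have [a0|a0] := eqVneq al 0.
    rewrite /b (psd_ul0 psdP) ?mul0mx // alE a0 scale0r.
    by apply/matrixP => i j; rewrite !mxE mul0rn.
  by rewrite -mulmxA -scalar_mxM -alg_mul mulVf // scale1r mulmx1.
rewrite alE => PE.
pose c := b *m ((al^-1)%:A)%:M.
pose Li : 'M[H]_(1 + n) := block_mx 1%:M 0 (- c) 1%:M.
pose L : 'M[H]_(1 + n) := block_mx 1%:M 0 c 1%:M.
have LLi : L *m Li = 1%:M.
  rewrite mulmx_block !mulmx0 !mul0mx !mul1mx !mulmx1 !addr0 add0r subrr.
  by rewrite -scalar_mx_block.
have LiL : Li *m L = 1%:M.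
  rewrite mulmx_block !mulmx0 !mul0mx !mul1mx !mulmx1 !addr0 add0r addNr.
  by rewrite -scalar_mx_block.
pose P1 := Li *m P *m adjq Li.
have psdP1 : psd P1 by exact: psd_congr.
have P1E : P1 = block_mx ((al%:A)%:M) 0 0 (drsubmx P1).
  have ul : ulsubmx P1 = (al%:A)%:M.
    rewrite /P1 PE /Li adjq_block !mulmx_block block_mxKul adjq1 adjq0.
    by rewrite !mul0mx !mulmx0 !mul1mx !mulmx1 !addr0.
  have dl : dlsubmx P1 = 0.
    rewrite /P1 PE /Li adjq_block !mulmx_block block_mxKdl adjq1 adjq0.
    rewrite !mul1mx !mulmx1 !mulmx0 addr0.
    by rewrite mulNmx bE addNr.
  have [P1h _] := psdP1.
  by rewrite {1}(herm_block P1h) ul dl adjq0.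
have [Y' [h1 h2]] := IH _ (psd_dr psdP1).
pose y := ((Num.sqrt al)^-1 : R).
exists (block_mx ((y%:A)%:M) 0 0 Y' *m Li : 'M[H]_(1 + n)).
apply: (herm_pinv_congr LLi LiL); rewrite -/P1 P1E /herm_pinv adjq_block !adjq0.
rewrite [adjq (y%:A)%:M]adjq_scalar !mul_block_diag_mx h1 h2 -!scalar_mxM -!alg_mul.
have yy : y * y = al^-1.
  by rewrite /y -invfM -expr2 sqr_sqrtr.
have aa : al * (y * y) * al = al.
  by rewrite yy; have [->|a0] := eqVneq al 0; rewrite ?mulr0 // divff // mul1r.
have ayy : y * y * al * (y * y) = y * y.
  by rewrite yy; have [->|a0] := eqVneq al 0; rewrite ?invr0 ?mulr0 // mulVf // mul1r.
by rewrite !mulrA in aa ayy *; rewrite aa ayy.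
Qed.

Lemma psd_pinv n (P : 'M[H]_n) : psd P -> exists Y, herm_pinv P Y.
Proof.
elim: n P => [P _|n IH P psdP]; first by exists 0; split; apply/matrixP; case.
exact: (psd_pinv_step IH psdP).
Qed.

Lemma herm_idem_le n (E : 'M[H]_n) (x : 'cV[H]_n) : adjq E = E -> E *m E = E ->
  qre ((adjq x *m E *m x) 0 0) <= sqn x.
Proof.
move=> Eh EE; have := sqn_ge0 (x - E *m x).
rewrite -sqnE adjqB adjqM Eh mulmxBr !mulmxBl !mulmxA -(mulmxA _ E E) EE.
rewrite (subrr (adjq x *m E *m x)) subr0.
have reB (a b : H) : qre (a - b) = qre a - qre b by [].
by rewrite mxE [X in _ + X]mxE reB subr_ge0 sqnE.
Qed.

(* W = M2^* Q M1 with Q the pseudo-inverse of M1 M1^* = M2 M2^*: then W^* W is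
   an orthogonal projection. *)
Lemma douglas n r s (M1 : 'M[H]_(n, r)) (M2 : 'M[H]_(n, s)) :
  M1 *m adjq M1 = M2 *m adjq M2 ->
  exists2 W : 'M[H]_(s, r), M2 *m W = M1 & forall x, sqn (W *m x) <= sqn x.
Proof.
move=> E12; have [Y [PQP QPQ]] := psd_pinv (psd_gram M1).
set Q := adjq Y *m Y in PQP QPQ.
have Qh : adjq Q = Q by rewrite adjqM adjqK.
clearbody Q; move: PQP QPQ; rewrite !mulmxA => PQP QPQ.
(* [M1 M1^* Q M1 - M1] has zero Gram matrix, by the identity [PQP] for the Gram matrix of [M1]. *)
have PQM : M1 *m adjq M1 *m Q *m M1 = M1.
  apply/eqP; rewrite -subr_eq0; apply/eqP/mul_adjq_eq0.
  rewrite adjqB !adjqM Qh adjqK mulmxBl !mulmxBr !mulmxA.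
  by rewrite !PQP !subrr.
exists (adjq M2 *m Q *m M1); first by rewrite !mulmxA -E12.
move=> x; rewrite -sqnE !adjqM adjqK Qh !mulmxA.
rewrite -[_ *m M2 *m adjq M2]mulmxA -E12 !mulmxA.
have QPQ' : Q *m M1 *m adjq M1 *m Q = Q by [].
have -> : adjq x *m adjq M1 *m Q *m M1 *m adjq M1 *m Q *m M1 *m x =
    adjq x *m (adjq M1 *m (Q *m M1 *m adjq M1 *m Q) *m M1) *m x by rewrite !mulmxA.
rewrite QPQ'; apply: herm_idem_le; first by rewrite !adjqM adjqK Qh mulmxA.
have -> : adjq M1 *m Q *m M1 *m (adjq M1 *m Q *m M1) =
  adjq M1 *m (Q *m M1 *m adjq M1 *m Q) *m M1 by rewrite !mulmxA.
by rewrite QPQ'.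
Qed.

End QuatMatrix.

(** * Leech's theorem for finite Toeplitz sections *)

Section Leech.
Variable R : realType.
Local Notation H := (quat R).
Implicit Types (a u : nat -> H).

Definition qconv a u m : H := \sum_(k < m.+1) a k * u (m - k)%N.

Lemma qconv_rev a u m : qconv a u m = \sum_(l < m.+1) a (m - l)%N * u l.
Proof.
rewrite /qconv (reindex_inj rev_ord_inj); apply: eq_bigr => k _ /=.
by rewrite subSS subKn // -ltnS.
Qed.

(* The adjoint of convolution by [a] followed by truncation to degrees [< N]. *)
Definition qcoconv N a u k : H := \sum_(m < N | (k <= m)%N) quat_conj (a (m - k)%N) * u m.

Definition toep N a : 'M[H]_N := \matrix_(m, k) if (k <= m)%N then a (m - k)%N else 0.

Definition shiftm N : 'M[H]_N := \matrix_(m, k) (m == k.+1 :> nat)%:R.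

Lemma shiftmE N p (X : 'M[H]_(N, p)) (F : nat -> 'I_p -> H) :
  (forall k j, X k j = F k j) ->
  forall m j, (shiftm N *m X) m j = if (m : nat) is m'.+1 then F m' j else 0.
Proof.
move=> XF [[|m] mN] j; rewrite mxE /=.
  by rewrite big1 // => k _; rewrite mxE mul0r.
rewrite (bigD1 (Ordinal (ltnW mN))) //= big1 ?addr0; last first.
  move=> k km; rewrite mxE /= eqSS; case: eqP => [mk|]; last by rewrite mul0r.
  by case/eqP: km; apply/val_inj.
by rewrite mxE eqxx mul1r XF.
Qed.

Lemma toep_shiftm N a : toep N a *m shiftm N = shiftm N *m toep N a.
Proof.
apply/matrixP => m k.
rewrite (@shiftmE N N _ (fun m k => if (k <= m)%N then a (m - k)%N else 0)); last first.
  by move=> ? ?; rewrite mxE.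
rewrite mxE; case: m => -[|m] mN /=.
  rewrite big1 // => l _; rewrite !mxE /= leqn0.
  by case: eqP => [->|_]; rewrite ?mul0r // mulr0.
case: ifP => km.
  have kN : (k.+1 < N)%N by apply: leq_ltn_trans mN.
  rewrite (bigD1 (Ordinal kN)) //= big1 ?addr0; last first.
    move=> l lk; rewrite !mxE /=; case: eqP => [E|]; last by rewrite mulr0.
    by case/eqP: lk; apply/val_inj.
  by rewrite !mxE /= eqxx mulr1 ltnS km subSS.
rewrite big1 // => l _; rewrite !mxE /=.
case: eqP => [->|_]; last by rewrite mulr0.
by rewrite ltnS km mul0r.
Qed.

Lemma shiftm_adj N : shiftm N.+1 *m adjq (shiftm N.+1) +
  delta_mx 0 0 *m adjq (delta_mx 0 0 : 'cV[H]_N.+1) = 1%:M.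
Proof.
apply/matrixP => m l; rewrite mxE.
rewrite (@shiftmE _ _ _ (fun k (l : 'I_N.+1) => (l == k.+1 :> nat)%:R)); last first.
  by move=> k j; rewrite !mxE; case: eqP; rewrite ?qconj1 ?qconj0.
rewrite !mxE big_ord1 !mxE !andbT.
case: m => -[|m] mN; case: l => -[|l] lN /=.
- by rewrite add0r qconj1 mulr1.
- by rewrite qconj0 mulr0 addr0.
- by rewrite qconj1 mul0r addr0.
- by rewrite qconj0 mul0r addr0 -val_eqE /= !eqSS eq_sym.
Qed.

Lemma toep_e0 N a m : (toep N.+1 a *m delta_mx 0 0 : 'cV_N.+1) m 0 = a m.
Proof.
rewrite mxE (bigD1 0) //= big1 ?addr0; first by rewrite !mxE eqxx mulr1 subn0.
by move=> k k0; rewrite !mxE (negPf k0) mulr0.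
Qed.

(** Displacement equation: [T] commutes with the shift [S] and [S S^* + e0 e0^* = 1], so
    [T T^* - S T T^* S^*] is the rank-one matrix built from the first column of [T]. *)
Lemma toep_gram N a : toep N.+1 a *m adjq (toep N.+1 a) =
  shiftm N.+1 *m (toep N.+1 a *m adjq (toep N.+1 a)) *m adjq (shiftm N.+1) +
  (toep N.+1 a *m delta_mx 0 0 : 'cV_N.+1) *m
    adjq (toep N.+1 a *m delta_mx 0 0 : 'cV_N.+1).
Proof.
rewrite -{1}[toep N.+1 a]mulmx1 -shiftm_adj mulmxDr mulmxDl !adjqM !mulmxA.
congr (_ + _); rewrite -(toep_shiftm _ a) -[in RHS]mulmxA -[in RHS]adjqM.
by rewrite -toep_shiftm adjqM !mulmxA.
Qed.

Lemma adj_toepE N a (u : 'cV[H]_N) k :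
  (adjq (toep N a) *m u) k 0 =
  \sum_(m < N | (k <= m)%N) quat_conj (a (m - k)%N) * u m 0.
Proof.
rewrite mxE [RHS]big_mkcond; apply: eq_bigr => m _ /=; rewrite !mxE.
by case: ifP; rewrite ?qconj0 ?mul0r.
Qed.

Lemma scalarq_comm m n (x : R) (A : 'M[H]_(m, n)) :
  (x%:A)%:M *m A = A *m (x%:A)%:M.
Proof.
apply/matrixP => i j; rewrite mul_scalar_mx !mxE (bigD1 j) //= big1 ?addr0.
  by rewrite mxE eqxx mulr1n algq_comm.
by move=> k kj; rewrite mxE (negPf kj) mulr0n mulr0.
Qed.

Lemma adjq_sum m n (I : Type) (r : seq I) (P : pred I) (F : I -> 'M[H]_(m, n)) :
  adjq (\sum_(i <- r | P i) F i) = \sum_(i <- r | P i) adjq (F i).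
Proof. exact: (big_morph _ (@adjqD R m n) (@adjq0 R m n)). Qed.

Definition shift_iter N k (Z : 'cV[H]_N) := iter k (mulmx (shiftm N)) Z.

Lemma shift_iterD N k (Z1 Z2 : 'cV[H]_N) :
  shift_iter k (Z1 + Z2) = shift_iter k Z1 + shift_iter k Z2.
Proof. by elim: k => //= k; rewrite /shift_iter /= => ->; rewrite mulmxDr. Qed.

Lemma shift_iterSr N k (Z : 'cV[H]_N) :
  shift_iter k.+1 Z = shift_iter k (shiftm N *m Z).
Proof. exact: iterSr. Qed.

Lemma shift_iterE N k (Z : 'cV[H]_N) (F : nat -> H) : (forall m, Z m 0 = F m) ->
  forall m, (shift_iter k Z) m 0 = if (k <= m)%N then F (m - k)%N else 0.
Proof.
move=> ZF; elim: k => [|k IH] m /=; first by rewrite subn0.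
rewrite /shift_iter /= -/(shift_iter k Z).
rewrite (@shiftmE N 1 _ (fun m _ => if (k <= m)%N then F (m - k)%N else 0)).
  by case: m => -[|m].
by move=> m' j; rewrite ord1 IH.
Qed.

(** The equation is solved up to degree [N] only, whereas the norm bound is for inputs of every
    length. Up to the factor [eta^-1], [c] is the impulse response of a linear system whose matrix
    is a contraction, and such a system never gives out more energy than it receives. *)
Lemma leech_fin N n (a : nat -> nat -> H) (eta : R) : 0 < eta ->
  (forall u, eta ^+ 2 * \sum_(m < N.+1) `|u m| ^+ 2 <=
    \sum_(j < n) \sum_(k < N.+1) `|qcoconv N.+1 (a j) u k| ^+ 2) ->
  exists c : nat -> nat -> H,
    (forall m, (m <= N)%N -> \sum_(j < n) qconv (a j) (c j) m = (m == 0%N)%:R) /\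
    forall u M, eta ^+ 2 * (\sum_(k < M) \sum_(j < n) `|qconv (c j) u k| ^+ 2) <=
      \sum_(k < M) `|u k| ^+ 2.
Proof.
move=> eta0 lb.
pose T j := toep N.+1 (a j); pose S := shiftm N.+1.
pose e0 : 'cV[H]_N.+1 := delta_mx 0 0.
pose P : 'M[H]_N.+1 := \sum_(j < n) T j *m adjq (T j) - ((eta ^+ 2)%:A)%:M.
have psdP : psd P.
  split=> [|v].
    rewrite adjqB adjq_sum adjq_scalar; congr (_ - _); apply: eq_bigr => j _.
    by rewrite adjqM adjqK.
  rewrite mulmxBr mulmxBl mulmx_sumr mulmx_suml -scalarq_comm -mulmxA.
  rewrite mul_scalar_mx mxE [X in _ + X]mxE summxE.
  have reB (x y : H) : qre (x - y) = qre x - qre y by [].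
  rewrite reB qre_sum subr_ge0 [X in qre X]mxE mulr_algl /= sqnE.
  have h := lb (fun m => v (inord m) 0).
  apply: le_trans (le_trans _ h) _.
    by rewrite ler_pM2l ?exprn_gt0 //; apply: ler_sum => i _; rewrite inord_val.
  apply: ler_sum => j _.
  rewrite mulmxA -mulmxA -{1}(adjqK (T j)) -adjqM sqnE /sqn; apply: ler_sum => k _.
  rewrite /T adj_toepE /qcoconv.
  by under eq_bigr do rewrite inord_val.
have [Y [PQP _]] := psd_pinv psdP; have [Ph _] := psdP.
pose K := P *m adjq Y.
have KK : K *m adjq K = P by rewrite /K adjqM adjqK Ph -[RHS]PQP !mulmxA.
clearbody K.
pose A0 : 'M[H]_(N.+1, n) := \matrix_(m, j) a j m.
have A0A0 : A0 *m adjq A0 = \sum_(j < n) (T j *m e0) *m adjq (T j *m e0).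
  apply/matrixP => m l; rewrite mxE summxE; apply: eq_bigr => j _.
  by rewrite [RHS]mxE big_ord1 [X in _ = _ * X]mxE !toep_e0 !mxE.
(* Lurking isometry: [P = T T^* - eta^2], [K K^* = P] and [S] the shift.  The
   power series of the transfer function of [W] is the solution [c]. *)
pose M1 := row_mx K (e0 *m (eta%:A)%:M); pose M2 := row_mx (S *m K) A0.
(* With [Q] the sum of the [T_j T_j^*], both sides equal [Q - eta^2 S S^*]: the left one by
   [S S^* + e0 e0^* = 1], the right one by the displacement equations. *)
have M12 : M1 *m adjq M1 = M2 *m adjq M2.
  have GE j : T j *m adjq (T j) = S *m (T j *m adjq (T j)) *m adjq S +
      (T j *m e0) *m adjq (T j *m e0) by exact: toep_gram.
  have SS : S *m adjq S + e0 *m adjq e0 = 1%:M by exact: shiftm_adj.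
  have -> : M2 *m adjq M2 = S *m P *m adjq S + A0 *m adjq A0.
    by rewrite adjq_row mul_row_col adjqM !mulmxA -[S *m K *m adjq K]mulmxA KK.
  rewrite adjq_row mul_row_col KK A0A0 adjqM adjq_scalar mulmxA.
  rewrite -[e0 *m _ *m _]mulmxA -scalar_mxM -alg_mul -expr2 -scalarq_comm.
  rewrite /P mulmxBr mulmxBl mulmx_sumr mulmx_suml -scalarq_comm.
  under eq_bigr do rewrite GE.
  rewrite big_split /= -mulmxA.
  rewrite -[X in _ - X + _]mulmx1 -SS mulmxDr -!mulmxA opprD.
  set X1 := \sum_(j < n) _; set X2 := \sum_(j < n) _.
  set Z1 := _ *m (S *m _); set Z2 := _ *m (e0 *m _).
  by rewrite addrA subrK [LHS]addrAC.
have [W WE Wc] := douglas M12.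
(* State-space reading of [W]: [W11] updates the state, [W12] feeds the input into it, [W21] and
   [W22] produce the output from state and input. *)
pose W11 := ulsubmx W; pose W12 := ursubmx W; pose W21 := dlsubmx W; pose W22 := drsubmx W.
have [KE eE] : K = S *m K *m W11 + A0 *m W21 /\
    e0 *m (eta%:A)%:M = S *m K *m W12 + A0 *m W22.
  by move: WE; rewrite /M2 /M1 -{1}(submxK W) mul_row_block => /eq_row_mx[-> ->].
pose X k := iter k (mulmx W11) W12.
pose c k : 'cV[H]_n := if k is k'.+1 then W21 *m X k' else W22.
(* [K = S K W11 + A0 W21] is substituted repeatedly into [eta e0 = S K W12 + A0 W22]. The remainder
   carries [M + 1] shifts, so for [M = N] it vanishes in all degrees up to [N]. *)
have expand M : e0 *m (eta%:A)%:M =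
    \sum_(k < M.+1) shift_iter k (A0 *m c k) + shift_iter M.+1 (K *m X M).
  elim: M => [|M IH]; first by rewrite big_ord1 eE addrC /shift_iter /= mulmxA.
  rewrite big_ord_recr -addrA /= IH; congr (_ + _).
  rewrite {1}KE mulmxDl [_ *m W11 *m _ + _]addrC shift_iterD; congr (_ + _).
    by rewrite -mulmxA.
  change (shift_iter M.+1 (S *m K *m W11 *m X M) = shift_iter M.+2 (K *m X M.+1)).
  by rewrite [RHS]shift_iterSr [X M.+1]/(W11 *m X M) !mulmxA.
pose cf j k : H := if insub j is Some i then c k (i : 'I_n) 0 else 0.
have cfE (j : 'I_n) k : cf j k = c k j 0 by rewrite /cf valK.
have sol m : (m <= N)%N -> \sum_(j < n) qconv (a j) (cf j) m = (m == 0%N)%:R * eta%:A.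
  move=> mN; have mN' : (m < N.+1)%N by rewrite ltnS.
  have := congr1 (fun Z : 'cV_N.+1 => Z (Ordinal mN') 0) (expand N).
  rewrite [RHS]mxE summxE.
  rewrite (@shift_iterE _ _ _ (fun m => (K *m X N) (inord m) 0)); last first.
    by move=> k; rewrite inord_val.
  rewrite /= ltnNge mN /= addr0 [LHS]mxE big_ord1 !mxE mulr1n andbT -val_eqE /= => ->.
  have AcE k : shift_iter k (A0 *m c k) (Ordinal mN') 0 =
      if (k < m.+1)%N then \sum_(j < n) a j (m - k)%N * c k j 0 else 0.
    rewrite ltnS (@shift_iterE _ _ _ (fun m => \sum_(j < n) a j m * c k j 0)) //.
    by move=> l; rewrite mxE; apply: eq_bigr => j _; rewrite mxE.
  under [RHS]eq_bigr do rewrite AcE.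
  rewrite -big_mkcond /=.
  rewrite -(big_ord_widen N.+1 (fun k => \sum_(j < n) a j (m - k)%N * c k j 0)) //.
  rewrite [RHS]exchange_big /=; apply: eq_bigr => j _.
  by rewrite qconv_rev; apply: eq_bigr => k _; rewrite cfE.
have en (u : nat -> H) M : \sum_(k < M) \sum_(j < n) `|qconv (cf j) u k| ^+ 2 <=
    \sum_(k < M) `|u k| ^+ 2.
  (* [x] is the state started at 0 and driven by [u]; the output [y] is the convolution of [cf] with
     [u]. Contractivity of [W] gives, by induction on time, that output energy plus state energy is
     at most input energy. *)
  pose x := fix x k : 'cV[H]_N.+1 :=
    if k is k'.+1 then W11 *m x k' + W12 *m (u k')%:M else 0.
  pose y k : 'cV[H]_n := W21 *m x k + W22 *m (u k)%:M.
  have xE k : x k = \sum_(l < k) X (k - l.+1)%N *m (u l)%:M.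
    elim: k => [|k IH]; first by rewrite big_ord0.
    rewrite big_ord_recr /= IH subnn mulmx_sumr; congr (_ + _).
    by apply: eq_bigr => l _; rewrite mulmxA subSS -(subnSK (ltn_ord l)).
  have yE k (j : 'I_n) : y k j 0 = qconv (cf j) u k.
    rewrite qconv_rev big_ord_recr /= subnn /y xE mulmx_sumr mxE summxE; congr (_ + _).
      apply: eq_bigr => l _; rewrite mulmxA mxE big_ord1 [X in _ * X]mxE mulr1n cfE.
      by rewrite -(subnSK (ltn_ord l)).
    by rewrite mxE big_ord1 [X in _ * X]mxE mulr1n cfE.
  suff: \sum_(k < M) \sum_(j < n) `|qconv (cf j) u k| ^+ 2 + sqn (x M) <=
      \sum_(k < M) `|u k| ^+ 2 by have := sqn_ge0 (x M); lra.
  elim: M => [|M IH].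
    by rewrite !big_ord0 add0r /sqn big1 // => i _; rewrite mxE normr0 expr0n.
  rewrite !big_ord_recr /=.
  have := Wc (col_mx (x M) ((u M)%:M)).
  rewrite -[in X in X -> _](submxK W) mul_block_col !sqn_col => h.
  have u1 : sqn ((u M)%:M : 'cV_1) = `|u M| ^+ 2.
    by rewrite /sqn big_ord1 mxE mulr1n.
  have y1 : sqn (y M) = \sum_(j < n) `|qconv (cf j) u M| ^+ 2.
    by apply: eq_bigr => j _; rewrite yE.
  rewrite u1 -/(y M) y1 in h.
  move: IH h; rewrite /x /= -/x; lra.
have convZ (b v : nat -> H) (t : R) m : qconv b (fun k => t *: v k) m = t *: qconv b v m.
  by rewrite /qconv scaler_sumr; apply: eq_bigr => k _; rewrite scalerAr.
have convZl (b v : nat -> H) (t : R) m : qconv (fun k => t *: b k) v m = t *: qconv b v m.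
  by rewrite /qconv scaler_sumr; apply: eq_bigr => k _; rewrite scalerAl.
exists (fun j k => eta^-1 *: cf j k); split.
  move=> m mN; under eq_bigr do rewrite convZ.
  by rewrite -scaler_sumr sol // mulr_algr scalerA mulVf ?scale1r // gt_eqF.
move=> u M; rewrite mulr_sumr; apply: le_trans (en u M); apply: ler_sum => k _.
rewrite mulr_sumr; apply: ler_sum => j _.
rewrite convZl normrZ exprMn mulrA normfV exprVn gtr0_norm //.
by rewrite divff ?mul1r // expf_eq0 gt_eqF.
Qed.

End Leech.

(** * Power series of a quaternionic variable *)

Section PowerSums.
Variable R : realType.
Local Notation H := (quat R).
Implicit Types (a b : nat -> H) (f g : H -> H) (q : H) (x y r : R).

Lemma geometric_sum_le y n : 0 <= y < 1 -> \sum_(0 <= k < n) y ^+ k <= (1 - y)^-1.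
Proof.
move=> /andP[y0 y1]; have d0 : 0 < 1 - y by rewrite subr_gt0.
rewrite -[leRHS]mul1r ler_pdivlMr //.
suff -> : (\sum_(0 <= k < n) y ^+ k) * (1 - y) = 1 - y ^+ n.
  by rewrite gerBl exprn_ge0.
elim: n => [|n IH]; first by rewrite big_nil mul0r expr0 subrr.
by rewrite big_nat_recr //= mulrDl IH exprS; ring.
Qed.

Lemma geometric_tail_le y k n : 0 <= y < 1 ->
  \sum_(k <= m < n) y ^+ m <= y ^+ k / (1 - y).
Proof.
move=> y01; have /andP[y0 _] := y01.
have -> : \sum_(k <= m < n) y ^+ m = y ^+ k * \sum_(0 <= m < n - k) y ^+ m.
  rewrite -{1}(add0n k) big_addn big_distrr /=; apply: eq_bigr => i _.
  by rewrite exprD mulrC.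
by rewrite ler_wpM2l ?exprn_ge0 // geometric_sum_le.
Qed.

Lemma series_terms_bounded (V : normedModType R) (u : nat -> V) (l : V) :
  series u @ \oo --> l -> exists2 M : R, 0 <= M & forall n, `|u n| <= M.
Proof.
move=> ul; have /cvg_seqP/(_ 1 ltr01)[N hN] := ul.
exists (\sum_(0 <= k < N) `|u k| + 2); first by rewrite addr_ge0 // sumr_ge0.
move=> n; have [nN|Nn] := ltnP n N.
  have : `|u n| <= \sum_(0 <= k < N) `|u k|.
    rewrite big_mkord (bigD1 (Ordinal nN)) //= lerDl sumr_ge0 //.
  lra.
have h1 := hN n Nn; have h2 := hN n.+1 (leqW Nn).
have E : u n = (series u n.+1 - l) - (series u n - l).
  by rewrite opprB addrA subrK /series /= big_nat_recr //= addrAC subrr add0r.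
have := ler_normB (series u n.+1 - l) (series u n - l); rewrite -E.
have : 0 <= \sum_(0 <= k < N) `|u k| by rewrite sumr_ge0.
lra.
Qed.

(** If the coefficients below [k] vanish, a sum equal to 0 bounds [x^k |c_k|] by the tail, so
    [|c_k|] is at most a constant times [x], with [x] as small as desired. Only real points are
    tested, as these belong to every slice. *)
Lemma power_series_zero (c : nat -> H) (eps : R) : 0 < eps ->
  (forall x, 0 < x < eps -> series (fun m => (x%:A) ^+ m * c m) @ \oo --> (0 : H)) ->
  forall m, c m = 0.
Proof.
move=> e0 hc; pose x0 := eps / 2.
have x00 : 0 < x0 by rewrite divr_gt0.
have xX x m : `|(x%:A : H) ^+ m * c m| = `|x| ^+ m * `|c m|.
  by rewrite normqM normqX norm_alg.
have [|M M0 hM] := series_terms_bounded (hc x0 _).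
  by rewrite x00 /= /x0; lra.
elim/ltn_ind => k IH; apply/eqP; rewrite -normr_le0.
apply/ler_addgt0Pr => d d0; rewrite add0r.
pose K := M / x0 ^+ k.+1 * 2 + 1.
have K0 : 0 < K by rewrite ltr_wpDl // mulr_ge0 // divr_ge0 // exprn_ge0 // ltW.
pose x := Num.min (x0 / 2) (d / K).
have xpos : 0 < x by rewrite lt_min !divr_gt0.
have xx0 : x <= x0 / 2 by rewrite ge_min lexx.
have xdK : x <= d / K by rewrite ge_min lexx orbT.
pose y := x / x0.
have y0 : 0 <= y by rewrite divr_ge0 // ltW.
have y12 : y <= 1 / 2 by rewrite ler_pdivrMr //; move: xx0; rewrite /x0; lra.
have y01 : 0 <= y < 1 by rewrite y0 /=; lra.
have xe : 0 < x < eps by rewrite xpos /=; move: xx0; rewrite /x0; lra.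
have ck : x ^+ k * `|c k| <= M * (y ^+ k.+1 / (1 - y)).
  have E n : `|series (fun m => (x%:A) ^+ m * c m) (k.+1 + n)%N - (x%:A) ^+ k * c k| <=
      M * (y ^+ k.+1 / (1 - y)).
    have -> : series (fun m => (x%:A) ^+ m * c m) (k.+1 + n)%N - (x%:A) ^+ k * c k =
        \sum_(k.+1 <= m < k.+1 + n) (x%:A) ^+ m * c m.
      rewrite /series /= (big_cat_nat (n := k.+1)) ?leq_addr //= big_nat_recr //=.
      rewrite big_nat big1 ?add0r; last by move=> i /andP[_ ik]; rewrite IH // mulr0.
      by rewrite addrAC subrr add0r.
    apply: le_trans (ler_norm_sum _ _ _) _.
    apply: le_trans (_ : _ <= \sum_(k.+1 <= m < k.+1 + n) M * y ^+ m) _.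
      apply: ler_sum => m _; rewrite xX gtr0_norm // /y expr_div_n.
      have := hM m; rewrite xX gtr0_norm // => h.
      rewrite mulrA ler_pdivlMr ?exprn_gt0 //.
      by have := ler_wpM2l (exprn_ge0 m (ltW xpos)) h; lra.
    by rewrite -big_distrr /= ler_wpM2l // geometric_tail_le.
  have h : `|0 - (x%:A : H) ^+ k * c k| <= M * (y ^+ k.+1 / (1 - y)).
    apply: (cvg_le_norm _ E); apply: cvgB; last exact: cvg_cst.
    have /cvg_seqP h0 := hc x xe; apply/cvg_seqP => e' /h0[N hN].
    by exists N => n Nn; apply: hN; apply: leq_trans Nn (leq_addl _ _).
  by move: h; rewrite sub0r normrN xX gtr0_norm.
have y2 : (1 - y)^-1 <= 2 by rewrite invf_ple ?posrE; lra.
have xk0 : 0 < x ^+ k by rewrite exprn_gt0.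
rewrite -(ler_pM2l xk0); apply: le_trans ck _.
apply: le_trans (_ : _ <= M * (y ^+ k.+1 * 2)) _.
  by rewrite ler_wpM2l // ler_wpM2l ?exprn_ge0.
have -> : M * (y ^+ k.+1 * 2) = x ^+ k * (M / x0 ^+ k.+1 * 2 * x).
  by rewrite /y expr_div_n [x ^+ k.+1]exprS; ring.
rewrite ler_pM2l //; apply: le_trans (_ : _ <= K * x) _.
  by rewrite ler_wpM2r ?(ltW xpos) // /K lerDl.
by rewrite mulrC -ler_pdivlMr.
Qed.

Definition power_sum a f :=
  forall q, unit_ball q -> series (fun m => q ^+ m * a m) @ \oo --> f q.

Lemma power_sum_uniq_real a b f g (eps : R) : 0 < eps ->
  (forall x, 0 < x < eps -> series (fun m => (x%:A) ^+ m * a m) @ \oo --> f (x%:A : H)) ->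
  (forall x, 0 < x < eps -> series (fun m => (x%:A) ^+ m * b m) @ \oo --> g (x%:A : H)) ->
  (forall x, 0 < x < eps -> f (x%:A : H) = g (x%:A : H)) -> a = b.
Proof.
move=> e0 ha hb fg; apply/funext => m; apply/eqP; rewrite -subr_eq0; apply/eqP.
apply: (power_series_zero (c := fun m => a m - b m) e0) => x xe.
have := series_cvgD (ha x xe) (series_cvgN (hb x xe)); rewrite fg // subrr.
by under eq_fun do rewrite -mulrBr.
Qed.

Lemma power_sum_uniq a b f : power_sum a f -> power_sum b f -> a = b.
Proof.
move=> ha hb; apply: (@power_sum_uniq_real a b f f 1 ltr01) => // x /andP[x0 x1].
  by apply: ha; rewrite /unit_ball /= norm_alg gtr0_norm.
by apply: hb; rewrite /unit_ball /= norm_alg gtr0_norm.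
Qed.

Lemma coeffsE a f : power_sum a f -> coeffs f = a.
Proof.
move=> ha; rewrite /coeffs; case: xgetP => [b _ hb|/(_ a)[]//].
exact: power_sum_uniq ha.
Qed.

Lemma quat_slice q : exists2 I : H, imag_unit I & slice I q.
Proof.
pose v := Quat 0 (qi q) (qj q) (qk q); pose s := qi q ^+ 2 + qj q ^+ 2 + qk q ^+ 2.
have s0 : 0 <= s by rewrite !addr_ge0 ?sqr_ge0.
have [sE|sN] := eqVneq s 0.
  have /andP[/andP[/eqP i0 /eqP j0] /eqP k0] : (qi q == 0) && (qj q == 0) && (qk q == 0).
    by move: sE => /eqP; rewrite /s !paddr_eq0 ?addr_ge0 ?sqr_ge0 // !sqrf_eq0.
  exists (Quat 0 1 0 0); first by apply: quat_ext; rewrite expr2 /=; ring.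
  exists (qre q), 0; rewrite /cslice scale0r mulr0 addr0.
  by apply: quat_ext; rewrite /= ?mulr1 ?mulr0.
have sp : 0 < s by rewrite lt_neqAle eq_sym sN.
pose d := Num.sqrt s; have d0 : d != 0 by rewrite gt_eqF // sqrtr_gt0.
have dd : d * d = s by rewrite -expr2 sqr_sqrtr.
exists (d^-1 *: v).
  rewrite /imag_unit expr2 -scalerAl -scalerAr scalerA.
  have -> : v * v = - s *: 1 by apply: quat_ext; rewrite /= /s; ring.
  by rewrite scalerA mulrN -invfM dd mulVf // scaleN1r.
exists (qre q), d; rewrite /cslice mulr_algr scalerA divff // scale1r.
by apply: quat_ext => /=; ring.
Qed.

(** Cauchy's formula gives coefficients that could depend on the slice and on the radius. All these
    expansions represent [f] on a common interval of real points, which forces them to agree. *)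
Theorem slice_regular_power_sum f : slice_regular f -> exists a, power_sum a f.
Proof.
move=> Hf; pose al I r n := (pi *+ 2 : R)^-1 *:
  qint (fun t => qinv (circ I r t) ^+ n * f (circ I r t)).
have hal I r q : imag_unit I -> slice I q -> `|q| < r -> r < 1 ->
    series (fun n => q ^+ n * al I r n) @ \oo --> f q.
  by move=> HI hq qr r1; exact: slice_regular_expansion_slice.
have [I0 HI0 _] := quat_slice 0.
have half1 : 1 / 2 < 1 :> R by lra.
have half0 : 0 < 1 / 2 :> R by lra.
exists (al I0 (1 / 2)) => q qB; have [I HI hq] := quat_slice q.
pose r := (1 + `|q|) / 2; have rq : `|q| < r by rewrite /r; move: qB; rewrite /unit_ball /=; lra.
have r1 : r < 1 by rewrite /r; move: qB; rewrite /unit_ball /=; lra.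
have r0 : 0 < r by exact: le_lt_trans rq.
suff <- : al I r = al I0 (1 / 2) by exact: hal.
have m0 : 0 < Num.min r (1 / 2) by rewrite lt_min r0 half0.
apply: (power_sum_uniq_real (f := f) (g := f) m0) => // x /andP[x0].
  rewrite lt_min => /andP[xr _]; apply: hal => //; first exact: slice_alg.
  by rewrite norm_alg gtr0_norm.
rewrite lt_min => /andP[_ xr]; apply: hal => //; first exact: slice_alg.
by rewrite norm_alg gtr0_norm.
Qed.

End PowerSums.

(** * Power series converging on the unit ball, and estimates for powers *)

Section Radius.
Variable R : realType.
Local Notation H := (quat R).
Implicit Types (a b : nat -> H) (f g : H -> H) (q h : H) (x y r : R).

Definition radius1 a :=
  forall r, 0 <= r < 1 -> exists C, forall n, \sum_(0 <= m < n) r ^+ m * `|a m| <= C.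

Lemma bounded_radius1 a : (forall r, 0 < r < 1 -> exists M, forall m, r ^+ m * `|a m| <= M) ->
  radius1 a.
Proof.
move=> hb r /andP[r0 r1]; pose s := (1 + r) / 2.
have s01 : 0 < s < 1 by rewrite /s; lra.
have /andP[s0 s1] := s01; have [M hM] := hb s s01.
have M0 : 0 <= M by apply: le_trans (hM 0%N); rewrite mulr_ge0.
pose y := r / s; have y0 : 0 <= y by rewrite divr_ge0 // ltW.
have y1 : y < 1 by rewrite ltr_pdivrMr // mul1r /s; lra.
exists (M * (1 - y)^-1) => n; apply: le_trans (_ : _ <= \sum_(0 <= m < n) M * y ^+ m) _.
  apply: ler_sum => m _; rewrite /y expr_div_n mulrA ler_pdivlMr ?exprn_gt0 //.
  by have := ler_wpM2l (exprn_ge0 m r0) (hM m); lra.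
by rewrite -big_distrr /= ler_wpM2l // geometric_sum_le // y0.
Qed.

Lemma power_sum_radius1 a f : power_sum a f -> radius1 a.
Proof.
move=> ha; apply: bounded_radius1 => r /andP[r0 r1].
have rB : unit_ball (r%:A : H) by rewrite /unit_ball /= norm_alg gtr0_norm.
have [M _ hM] := series_terms_bounded (ha _ rB).
by exists M => m; have := hM m; rewrite normqM normqX norm_alg gtr0_norm.
Qed.

Lemma radius1_terms a q : radius1 a -> unit_ball q ->
  exists C, abs_bounded (fun m => q ^+ m * a m) C.
Proof.
move=> ha qB; have [|C hC] := ha `|q|; first by rewrite normr_ge0.
exists C => n; apply: le_trans (hC n).
by under eq_bigr do rewrite normqM normqX.
Qed.

Definition psum a q : H := limn (series (fun m => q ^+ m * a m)).

Lemma radius1_psum a : radius1 a -> power_sum a (psum a).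
Proof.
move=> ha q qB; have [C hC] := radius1_terms ha qB.
have [l hl] := qseries_cvg hC.
by rewrite /psum (cvg_lim _ hl).
Qed.

(** The weight [m^2] is the one in the second-order Taylor bound of [q^m]. It is absorbed by passing
    from [r] to a larger [s < 1]: with [z^2 = r / s], the numbers [m z^m] are bounded. *)
Lemma radius1_weight a r : radius1 a -> 0 <= r < 1 ->
  exists C, forall n, \sum_(0 <= m < n) (m%:R ^+ 2 * r ^+ m) * `|a m| <= C.
Proof.
move=> ha /andP[r0 r1]; pose s := (1 + r) / 2.
have s0 : 0 < s by rewrite /s; lra.
have s1 : s < 1 by rewrite /s; lra.
pose z := Num.sqrt (r / s).
have y0 : 0 <= r / s by rewrite divr_ge0 // ltW.
have z0 : 0 <= z by rewrite sqrtr_ge0.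
have z1 : z < 1.
  by rewrite -sqrtr1 ltr_sqrt // ltr_pdivrMr // mul1r /s; lra.
have zz : z ^+ 2 = r / s by rewrite sqr_sqrtr.
(* Each of the [m] powers [z^k] with [k < m] is at least [z^m]. *)
have mz m : m%:R * z ^+ m <= (1 - z)^-1.
  apply: le_trans (geometric_sum_le m (_ : 0 <= z < 1)); last by rewrite z0.
  rewrite mulr_natl -[X in _ *+ X]subn0 -sumr_const_nat big_nat [leRHS]big_nat.
  apply: ler_sum => k /andP[_ km]; exact: (ler_wiXn2l z0 (ltW z1) (ltnW km)).
have [|C hC] := ha s; first by rewrite (ltW s0).
have z1' : 0 <= (1 - z)^-1 by rewrite invr_ge0; lra.
exists ((1 - z) ^- 1 ^+ 2 * C) => n.
apply: le_trans (_ : _ <= \sum_(0 <= m < n) (1 - z)^-1 ^+ 2 * (s ^+ m * `|a m|)) _.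
  apply: ler_sum => m _; rewrite mulrA; apply: ler_wpM2r => //.
  have -> : m%:R ^+ 2 * r ^+ m = (m%:R * z ^+ m) ^+ 2 * s ^+ m.
    by rewrite exprMn -exprM mulnC exprM zz expr_div_n -[RHS]mulrA divfK // gt_eqF // exprn_gt0.
  apply: ler_wpM2r; first by rewrite exprn_ge0 // ltW.
  by rewrite ler_pXn2r ?nnegrE // mulr_ge0 // exprn_ge0.
by rewrite -big_distrr /= ler_wpM2l ?exprn_ge0.
Qed.

Lemma sum_conv_le (u v : nat -> R) n : (forall k, 0 <= u k) -> (forall k, 0 <= v k) ->
  \sum_(0 <= m < n) \sum_(k < m.+1) u k * v (m - k)%N <=
  (\sum_(0 <= k < n) u k) * (\sum_(0 <= k < n) v k).
Proof.
move=> u0 v0.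
have -> : \sum_(0 <= m < n) \sum_(k < m.+1) u k * v (m - k)%N =
    \sum_(0 <= k < n) \sum_(0 <= l < n - k) u k * v l.
  elim: n => [|n IH]; first by rewrite !big_nil.
  rewrite !big_nat_recr //= IH subSnn big_nat1 big_ord_recr /= subnn addrA; congr (_ + _).
  rewrite -(big_mkord xpredT (fun k => u k * v (n - k)%N)) -big_split /=.
  rewrite big_nat [RHS]big_nat; apply: eq_bigr => k /andP[_ kn].
  by rewrite subSn ?(ltnW kn) // big_nat_recr.
rewrite big_distrl /=; apply: ler_sum => k _; rewrite -big_distrr /=.
apply: ler_wpM2l => //; rewrite (big_cat_nat (n := (n - k)%N) (p := n)) //=; last exact: leq_subr.
by rewrite lerDl sumr_ge0.
Qed.

Lemma radius1_qconv a b : radius1 a -> radius1 b -> radius1 (qconv a b).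
Proof.
move=> ha hb r r01; have [C hC] := ha r r01; have [D hD] := hb r r01.
have /andP[r0 _] := r01.
exists (C * D) => n.
apply: le_trans (_ : _ <= (\sum_(0 <= k < n) r ^+ k * `|a k|) * (\sum_(0 <= k < n) r ^+ k * `|b k|)) _.
  apply: le_trans (sum_conv_le n _ _); [|by move=> k; rewrite mulr_ge0 ?exprn_ge0..].
  apply: ler_sum => m _; apply: le_trans (_ : _ <= r ^+ m * \sum_(k < m.+1) `|a k * b (m - k)%N|) _.
    by apply: ler_wpM2l; [exact: exprn_ge0|exact: ler_norm_sum].
  rewrite big_distrr /=; apply: ler_sum => k _.
  rewrite normqM -[in r ^+ m](subnKC (ltn_ord k : (k <= m)%N)) exprD.
  by rewrite le_eqVlt; apply/orP; left; apply/eqP; ring.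
by apply: ler_pM => //; rewrite sumr_ge0 // => k _; rewrite mulr_ge0 ?exprn_ge0.
Qed.

Lemma power_sum_slice_mul a b f g : power_sum a f -> power_sum b g ->
  power_sum (qconv a b) (slice_mul f g).
Proof.
move=> ha hb; have rc := radius1_qconv (power_sum_radius1 ha) (power_sum_radius1 hb).
have := radius1_psum rc; rewrite /psum /slice_mul /power_sum /qconv.
by rewrite (coeffsE ha) (coeffsE hb).
Qed.

(* The differential of [q |-> q ^+ m] at [q] in the direction [h]. *)
Fixpoint dpow q m h : H := if m is m'.+1 then q * dpow q m' h + h * q ^+ m' else 0.

Lemma dpowD q m h k : dpow q m (h + k) = dpow q m h + dpow q m k.
Proof.
elim: m => [|m /= ->]; first by rewrite addr0.
by rewrite mulrDr mulrDl addrACA.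
Qed.

Lemma dpowZ q m (x : R) h : dpow q m (x *: h) = x *: dpow q m h.
Proof.
elim: m => [|m /= ->]; first by rewrite scaler0.
by rewrite scalerDr -scalerAr -scalerAl.
Qed.

Lemma dpow_comm q m h : q * h = h * q -> dpow q m h = h * (m%:R *: q ^+ m.-1).
Proof.
move=> qh; elim: m => [|m /= ->]; first by rewrite scale0r mulr0.
rewrite mulrA qh -mulrA -mulrDr; congr (_ * _).
case: m => [|m /=]; first by rewrite scale0r mulr0 add0r scale1r.
by rewrite -scalerAr -exprS -[in RHS]natr1 scalerDl scale1r.
Qed.

(** Multiplying by [r] replaces the natural [r^(m-1)] by [r^m], which avoids a predecessor and a
    division; [pow_taylor_le] does the same with [r^2]. *)
Lemma dpow_le q m h r : 0 <= r -> `|q| <= r -> r * `|dpow q m h| <= m%:R * r ^+ m * `|h|.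
Proof.
move=> r0 qr; elim: m => [|m IH] /=; first by rewrite normr0 mulr0 !mul0r.
apply: le_trans (_ : _ <= r * (r * `|dpow q m h|) + r * (`|h| * r ^+ m)) _.
  rewrite -mulrDr; apply: ler_wpM2l => //; apply: le_trans (ler_normD _ _) _.
  rewrite !normqM normqX; apply: lerD; first exact: ler_wpM2r.
  by apply: ler_wpM2l => //; apply: lerXn2r; rewrite ?nnegrE.
have := ler_wpM2l r0 IH; rewrite -[in X in _ -> X]natr1 exprS; lra.
Qed.

Lemma pow_taylor_le q m h r : 0 <= r -> `|q| <= r -> `|q + h| <= r ->
  r ^+ 2 * `|(q + h) ^+ m - q ^+ m - dpow q m h| <= m%:R ^+ 2 * r ^+ m * `|h| ^+ 2.
Proof.
move=> r0 qr qhr; elim: m => [|m IH] /=.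
  by rewrite !expr0 subrr subr0 normr0 mulr0 expr0n /= !mul0r.
set e := (q + h) ^+ m - _ - _ in IH.
have -> : (q + h) ^+ m.+1 - q ^+ m.+1 - (q * dpow q m h + h * q ^+ m) =
    h * dpow q m h + (q + h) * e.
  by rewrite !exprS /e !mulrBr !mulrDl; apply: quat_ext => /=; ring.
apply: le_trans (_ : _ <= r * `|h| * (r * `|dpow q m h|) + r * (r ^+ 2 * `|e|)) _.
  apply: le_trans (ler_wpM2l (exprn_ge0 2 r0) (ler_normD _ _)) _.
  rewrite !normqM mulrDr; apply: lerD; first by rewrite le_eqVlt; apply/orP; left; apply/eqP; ring.
  by have := ler_wpM2l (exprn_ge0 2 r0) (ler_wpM2r (normr_ge0 e) qhr); lra.
have h1 := ler_wpM2l (mulr_ge0 r0 (normr_ge0 h)) (dpow_le m h r0 qr).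
have h2 := ler_wpM2l r0 IH.
apply: le_trans (lerD h1 h2) _; rewrite -natr1 !exprS.
have : 0 <= m%:R * r ^+ m * r * `|h| ^+ 2 by rewrite !mulr_ge0 ?exprn_ge0.
have : 0 <= r ^+ m * r * `|h| ^+ 2 by rewrite !mulr_ge0 ?exprn_ge0.
by lra.
Qed.

End Radius.

(** * Differentiability of power series *)

Section Frechet.
Variable R : realType.
Local Notation H := (quat R).
Implicit Types (a b : nat -> H) (f g : H -> H) (q h : H) (x y r : R).

Lemma lipschitz_continuous (V W : normedModType R) (F : V -> W) (K : R) :
  (forall v w, `|F v - F w| <= K * `|v - w|) -> continuous F.
Proof.
move=> hF v; apply/cvgrPdist_lt => e e0.
have K1 : 0 < `|K| + 1 by rewrite ltr_wpDl.
apply/nbhs_ballP; exists (e / (`|K| + 1)); first by rewrite /= divr_gt0.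
move=> w; rewrite -ball_normE /= ltr_pdivlMr // => h.
apply: le_lt_trans (hF v w) _; apply: le_lt_trans h; rewrite mulrC.
by apply: ler_wpM2l => //; have := ler_norm K; lra.
Qed.

Lemma diff_of_quadratic (V W : normedModType R) (f : V -> W) (v : V) (D : {linear V -> W})
    (K d : R) : 0 < d -> continuous D ->
  (forall h : V, `|h| <= d -> `|f (v + h) - f v - D h| <= K * `|h| ^+ 2) ->
  differentiable f v /\ 'd f v = D :> (V -> W).
Proof.
move=> d0 cD hK.
have fD : f \o shift v = cst (f v) + D +o_ 0 id.
  apply/eqaddoP => e e0; apply/nbhs_ballP.
  have K1 : 0 < `|K| + 1 by rewrite ltr_wpDl.
  exists (Num.min d (e / (`|K| + 1))); first by rewrite /= lt_min d0 divr_gt0.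
  move=> h; rewrite -ball_normE /= sub0r normrN lt_min => /andP[hd he].
  have := hK h (ltW hd); rewrite [X in f X]addrC -addrA -opprD => /le_trans; apply.
  rewrite expr2 mulrA; apply: ler_wpM2r => //.
  apply: le_trans (_ : _ <= (`|K| + 1) * `|h|) _.
    by apply: ler_wpM2r => //; have := ler_norm K; lra.
  by rewrite mulrC -ler_pdivlMr // ltW.
have dE := diff_unique cD fD.
split=> //; apply/diff_locallyP; rewrite dE; split => //.
Qed.

(** Termwise differentiation: the series of differentials converges and the remainder is quadratic,
    both by [radius1_weight] at a radius [r] between [|q|] and 1. *)
Lemma power_sum_frechet a f q : power_sum a f -> unit_ball q ->
  exists D : {linear H -> H}, exists K d : R,
  [/\ 0 < d, continuous D,
      forall h, series (fun m => dpow q m h * a m) @ \oo --> D h &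
      forall h, `|h| <= d -> `|f (q + h) - f q - D h| <= K * `|h| ^+ 2].
Proof.
move=> ha qB; pose r := (1 + `|q|) / 2; pose d := r - `|q|.
have q1 : `|q| < 1 by [].
have r0 : 0 < r by rewrite /r; have := normr_ge0 q; lra.
have d0 : 0 < d by rewrite /d /r; lra.
have qr : `|q| <= r by rewrite /r; lra.
have r01 : 0 <= r < 1 by rewrite (ltW r0) /= /r; lra.
have [C hC] := radius1_weight (power_sum_radius1 ha) r01.
have bD h : abs_bounded (fun m => dpow q m h * a m) (C / r * `|h|).
  move=> n; apply: le_trans (_ : _ <= \sum_(0 <= m < n) (m%:R ^+ 2 * r ^+ m * `|a m|) * (`|h| / r)) _.
    apply: ler_sum => m _; rewrite normqM mulrA ler_pdivlMr //.
    have h1 := ler_wpM2r (normr_ge0 (a m)) (dpow_le m h (ltW r0) qr).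
    have h2 : 0 <= r ^+ m * `|h| * `|a m| by rewrite !mulr_ge0 ?exprn_ge0 ?(ltW r0).
    have hm : (m%:R : R) <= m%:R ^+ 2.
      by case: m {h1 h2} => [|m]; rewrite ?expr0n //= -natrX ler_nat -{1}(expn1 m.+1) leq_pexp2l.
    by have := ler_wpM2r h2 hm; lra.
  rewrite -big_distrl /=.
  have := ler_wpM2r (_ : 0 <= `|h| / r) (hC n) => /(_ (divr_ge0 _ (ltW r0))) h1.
  by apply: le_trans (h1 _) _ => //; rewrite mulrA mulrAC.
pose D h := psum (fun m => dpow q m h * a m) 1.
have hD h : series (fun m => dpow q m h * a m) @ \oo --> D h.
  have [l hl] := qseries_cvg (bD h); rewrite /D /psum.
  rewrite (_ : (fun m => 1 ^+ m * _) = (fun m => dpow q m h * a m)); last first.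
    by apply/funext => m; rewrite expr1n mul1r.
  by rewrite (cvg_lim _ hl).
have linD : linear D.
  move=> x h k; apply: (cvg_uniq (hD _)).
  have := series_cvgD (series_cvgMl (q := x%:A) (hD h)) (hD k).
  rewrite mulr_algl; under eq_fun do rewrite mulr_algl.
  rewrite (_ : (fun m => _) = (fun m => dpow q m (x *: h + k) * a m)) //.
  by apply/funext => m; rewrite dpowD dpowZ mulrDl scalerAl.
pose L : {linear H -> H} := HB.pack D (GRing.isLinear.Build R H H _ D linD).
have DE : L = D :> (H -> H) by [].
have nD h : `|D h| <= C / r * `|h| by exact: series_le_norm (bD h) (hD h).
exists L, (C / r ^+ 2), d; split => //.
  apply: (@lipschitz_continuous _ _ _ (C / r)) => v w.
  by rewrite -linearB DE; exact: nD.
move=> h hd; rewrite DE.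
have qhr : `|q + h| <= r by have := ler_normD q h; move: hd; rewrite /d; lra.
have qhB : unit_ball (q + h) by rewrite /unit_ball /=; case/andP: r01 => _; lra.
have hE := series_cvgD (series_cvgD (ha _ qhB) (series_cvgN (ha _ qB))) (series_cvgN (hD h)).
apply: (series_le_norm _ hE) => n.
apply: le_trans (_ : _ <= \sum_(0 <= m < n) (m%:R ^+ 2 * r ^+ m * `|a m|) * (`|h| ^+ 2 / r ^+ 2)) _.
  apply: ler_sum => m _; rewrite -!mulrBl normqM mulrA ler_pdivlMr ?exprn_gt0 //.
  have h1 := ler_wpM2r (normr_ge0 (a m)) (pow_taylor_le m (ltW r0) qr qhr).
  lra.
rewrite -big_distrl /= [leRHS]mulrAC -[leRHS]mulrA.
by apply: ler_wpM2r; rewrite ?divr_ge0 ?exprn_ge0 ?(ltW r0).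
Qed.

Lemma power_sum_slice_regular a f : power_sum a f -> slice_regular f.
Proof.
move=> ha; split=> [q qB|I HI x y zB].
  have [D [K [d [d0 cD _ hK]]]] := power_sum_frechet ha qB.
  by have [] := diff_of_quadratic d0 cD hK.
set q := x%:A + _ in zB *.
have [D [K [d [d0 cD hD hK]]]] := power_sum_frechet ha zB.
have [df dE] := diff_of_quadratic d0 cD hK.
rewrite !deriveE // dE.
have qI : q * I = I * q.
  by apply: (slice_comm HI); [exists x, y|exact: slice_unit].
(* [q] and [I] lie in one slice and commute, so on that slice each [dpow q m] is complex-linear. *)
suff -> : D I = I * D 1 by rewrite mulrA -expr2 HI mulN1r subrr scaler0.
apply: (cvg_uniq (hD I)); have := series_cvgMl (q := I) (hD 1).
rewrite (_ : (fun m => _) = (fun m => dpow q m I * a m)) //.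
apply/funext => m; rewrite mulrA; congr (_ * _).
by rewrite (dpow_comm m qI) (@dpow_comm _ q m 1) ?mulr1 ?mul1r.
Qed.

End Frechet.

(** * Coefficient bounds by means over roots of unity *)

Section Means.
Variable R : realType.
Local Notation H := (quat R).
Implicit Types (v u : nat -> H) (w z q : H) (r x : R).

Lemma series_shift (V : normedModType R) (u : nat -> V) (t : V) l :
  series u @ \oo --> t ->
  series (fun m => if (l <= m)%N then u (m - l)%N else 0) @ \oo --> t.
Proof.
move=> /cvg_seqP hu; apply/cvg_seqP => e /hu[N hN]; exists (N + l)%N => n Nln.
have ln : (l <= n)%N by apply: leq_trans Nln; exact: leq_addl.
suff -> : series (fun m => if (l <= m)%N then u (m - l)%N else 0) n = series u (n - l)%N.
  by apply: hN; rewrite leq_subRL // addnC.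
rewrite /series /= (big_cat_nat (n := l)) //= big_nat big1 ?add0r; last first.
  by move=> i /andP[_ il]; rewrite leqNgt il.
rewrite -{1}(add0n l) big_addn; apply: eq_bigr => i _.
by rewrite leq_addl addnK.
Qed.

Lemma series_cvg_sum (V : normedModType R) (T : nat -> nat -> V) (t : nat -> V) M :
  (forall l, series (T l) @ \oo --> t l) ->
  series (fun m => \sum_(l < M) T l m) @ \oo --> \sum_(l < M) t l.
Proof.
move=> hT; elim: M => [|M IH].
  rewrite big_ord0 (_ : series _ = cst 0); first exact: cvg_cst.
  by apply/funext => n; rewrite /series /= big1 // => i _; rewrite big_ord0.
rewrite big_ord_recr /= (_ : (fun m => _) = (fun m => \sum_(l < M) T l m + T M m)).
  exact: series_cvgD.
by apply/funext => m; rewrite big_ord_recr.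
Qed.

Lemma series_shift_sum (V : normedModType R) (T : nat -> nat -> V) (t : nat -> V) M :
  (forall l, series (T l) @ \oo --> t l) ->
  series (fun m => \sum_(l < M) if (l <= m)%N then T l (m - l)%N else 0) @ \oo -->
  \sum_(l < M) t l.
Proof.
by move=> hT; apply: (series_cvg_sum (T := fun l m => if (l <= m)%N then T l (m - l)%N else 0))
  => l; exact: series_shift.
Qed.

Lemma qconv_poly (a u : nat -> H) M m : (forall l, (M <= l)%N -> u l = 0) ->
  qconv a u m = \sum_(l < M) if (l <= m)%N then a (m - l)%N * u l else 0.
Proof.
move=> hu; rewrite qconv_rev -big_mkcond /=.
rewrite (big_ord_widen_cond (maxn M m.+1) xpredT (fun l => a (m - l)%N * u l)) ?leq_maxr //.
rewrite [RHS](big_ord_widen_cond (maxn M m.+1) (fun l => (l <= m)%N)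
  (fun l => a (m - l)%N * u l)) ?leq_maxl //=.
rewrite big_mkcond [RHS]big_mkcond; apply: eq_bigr => l _; rewrite ltnS.
by case: (ltnP l M) => [|/hu ->]; rewrite ?andbT ?andbF ?mulr0 //; case: ifP.
Qed.

Definition omega (I : H) (L : nat) : H :=
  cslice I (cos (pi *+ 2 / L%:R)) (sin (pi *+ 2 / L%:R)).

Lemma omegaX (I : H) L k : imag_unit I ->
  omega I L ^+ k = cslice I (cos (k%:R * (pi *+ 2 / L%:R))) (sin (k%:R * (pi *+ 2 / L%:R))).
Proof.
move=> HI; rewrite /omega; set x := _ / _; clearbody x.
elim: k => [|k IH].
  by rewrite expr0 mul0r cos0 sin0 /cslice scale0r mulr0 addr0 scale1r.
rewrite exprS IH csliceM // mulrS mulrDl mul1r.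
by congr (cslice _ _ _); rewrite ?cosD ?sinD; ring.
Qed.

Lemma omega_norm (I : H) L : imag_unit I -> `|omega I L| = 1.
Proof.
move=> HI; apply/eqP; rewrite -(eqrXn2 (n := 2)) // norm_cslice //.
by rewrite cos2Dsin2 expr1n.
Qed.

Lemma omegaL (I : H) L : imag_unit I -> (0 < L)%N -> omega I L ^+ L = 1.
Proof.
move=> HI L0; rewrite omegaX // mulrCA divff ?pnatr_eq0 -?lt0n // mulr1 cos2pi sin2pi.
by rewrite /cslice scale0r mulr0 addr0 scale1r.
Qed.

(** If the power were 1, its angle [x] would have [cos x = 1], hence [sin (x / 2) = 0] by the
    half-angle formula, whereas [0 < x / 2 < pi]. *)
Lemma omega_prim (I : H) L d : imag_unit I -> (0 < d < L)%N -> omega I L ^+ d != 1.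
Proof.
move=> HI /andP[d0 dL]; rewrite omegaX //; apply/eqP => E.
have L0 : 0 < L%:R :> R by rewrite ltr0n; exact: leq_trans dL.
set x := d%:R * _ in E.
have hc : cos x = 1.
  have := norm_cslice HI (cos x - 1) (sin x).
  have -> : cslice I (cos x - 1) (sin x) = 0.
    by rewrite /cslice scalerBl scale1r addrAC -/(cslice I (cos x) (sin x)) E subrr.
  rewrite normr0 expr0n /= => /esym/eqP; rewrite paddr_eq0 ?sqr_ge0 // => /andP[+ _].
  by rewrite sqrf_eq0 subr_eq0 => /eqP.
have hs : cos (x / 2) ^+ 2 = 1.
  have : cos (x / 2 + x / 2) = 1 by rewrite -splitr.
  by rewrite cosD -!expr2; have := cos2Dsin2 (x / 2); lra.
have : sin (x / 2) ^+ 2 = 0 by have := cos2Dsin2 (x / 2); rewrite hs; lra.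
move=> /eqP; rewrite sqrf_eq0; apply/negP; rewrite gt_eqF //.
have -> : x / 2 = pi * (d%:R / L%:R).
  by rewrite /x -[pi *+ 2]mulr_natr; field; rewrite gt_eqF.
apply: sin_gt0_pi; apply/andP; split.
  by apply: mulr_gt0; [exact: pi_gt0|rewrite divr_gt0 // ltr0n].
by rewrite gtr_pMr ?pi_gt0 // ltr_pdivrMr // mul1r ltr_nat.
Qed.

Lemma sum_unity w L : w ^+ L = 1 -> w != 1 -> \sum_(k < L) w ^+ k = 0.
Proof.
move=> wL w1; have := subrX1 w L; rewrite wL subrr => /esym/(congr1 Num.norm).
rewrite normqM normr0 => /eqP; rewrite mulf_eq0 normr_eq0 subr_eq0 (negPf w1) /=.
by rewrite normr_eq0 => /eqP.
Qed.

(** In the cross terms [conj(v_l) conj(w)^(kl) w^(km) v_m] the powers of [w] are adjacent, so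
    summing over [k] first leaves a real factor, [L] or 0; the coefficients never have to be moved
    across a power. *)
Lemma dft_parseval w L r v : `|w| = 1 -> w ^+ L = 1 ->
  (forall d, (0 < d < L)%N -> w ^+ d != 1) ->
  \sum_(k < L) `|\sum_(m < L) (r%:A * w ^+ k) ^+ m * v m| ^+ 2 =
  L%:R * \sum_(m < L) r ^+ m ^+ 2 * `|v m| ^+ 2.
Proof.
move=> w1 wL wd; set w' := quat_conj w.
have w'w : w' * w = 1 by rewrite /w' mul_conjq w1 expr1n scale1r.
have ww' : w * w' = 1 by rewrite /w' mul_qconj w1 expr1n scale1r.
have cw : GRing.comm w' w by rewrite /GRing.comm w'w ww'.
have cX k m : GRing.comm (w' ^+ k) (w ^+ m) by apply: commrX; apply/commr_sym/commrX/commr_sym.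
have w'L : w' ^+ L = 1 by rewrite /w' -qconjX wL qconj1.
pose z l m := w' ^+ l * w ^+ m.
have zX l m k : z l m ^+ k = w' ^+ (k * l) * w ^+ (k * m).
  by rewrite /z exprMn_comm // -!exprM !(mulnC k).
have zS (l m : 'I_L) : \sum_(k < L) z l m ^+ k = if l == m then L%:R else 0.
  have cancel i : w' ^+ i * w ^+ i = 1 by rewrite -exprMn_comm // w'w expr1n.
  case: eqP => [->|lm].
    rewrite (eq_bigr (fun=> 1)) ?sumr_const ?card_ord // => k _.
    by rewrite /z cancel expr1n.
  apply: sum_unity.
    by rewrite zX !exprM w'L wL !expr1n mulr1.
  have [ml|ml] := ltnP m l.
    rewrite /z -(subnK (ltnW ml)) exprD -mulrA cancel mulr1.
    have := wd (l - m)%N; rewrite subn_gt0 ml (leq_ltn_trans (leq_subr _ _)) // => /(_ isT).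
    apply: contra => /eqP/(congr1 (@quat_conj R)); rewrite -qconjX /w' qconjK qconj1.
    by move=> ->.
  have {}ml : (l < m)%N by rewrite ltn_neqAle ml andbT; apply/eqP => E; apply/lm/val_inj.
  rewrite /z -(subnKC (ltnW ml)) exprD mulrA cancel mul1r.
  by apply: wd; rewrite subn_gt0 ml (leq_ltn_trans (leq_subr _ _)).
pose u m := r ^+ m *: v m.
have E k : `|\sum_(m < L) (r%:A * w ^+ k) ^+ m * v m| ^+ 2 =
    qre (\sum_(l < L) \sum_(m < L) quat_conj (u l) * z l m ^+ k * u m).
  have -> : \sum_(m < L) (r%:A * w ^+ k) ^+ m * v m = \sum_(m < L) w ^+ (k * m) * u m.
    apply: eq_bigr => m _; rewrite mulr_algl exprZn -exprM /u -scalerAl scalerAr.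
    by [].
  have -> (q : H) : `|q| ^+ 2 = qre (quat_conj q * q) by rewrite mul_conjq /= mulr1.
  congr qre; rewrite qconj_sum big_distrl /=; apply: eq_bigr => l _.
  rewrite big_distrr /=; apply: eq_bigr => m _.
  by rewrite qconjM qconjX zX !mulrA.
have S (l m : 'I_L) : \sum_(k < L) quat_conj (u l) * z l m ^+ k * u m =
    quat_conj (u l) * (if l == m then L%:R else 0) * u m.
  by rewrite -zS mulr_sumr mulr_suml.
have SS (l : 'I_L) : \sum_(k < L) \sum_(m < L) quat_conj (u l) * z l m ^+ k * u m =
    quat_conj (u l) * L%:R * u l.
  rewrite exchange_big /=; under eq_bigr do rewrite S.
  rewrite (bigD1 l) //= big1 ?addr0 ?eqxx //.
  by move=> m ml; rewrite eq_sym (negPf ml) mulr0 mul0r.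
under eq_bigr do rewrite E.
rewrite -qre_sum exchange_big.
under eq_bigr do rewrite SS.
rewrite qre_sum mulr_sumr; apply: eq_bigr => l _.
have LA : (L%:R : H) = (L%:R)%:A by rewrite scaler_nat.
have uE : `|u l| ^+ 2 = r ^+ l ^+ 2 * `|v l| ^+ 2.
  by rewrite /u normrZ exprMn real_normK ?num_real.
have scal (x : R) (p q : H) : qre (x *: p * q) = x * qre (p * q) by rewrite -scalerAl.
by rewrite LA mulr_algr scal mul_conjq -uE; congr (_ * _); rewrite /= mulr1.
Qed.

Lemma sqr_normD_le (d : R) (p q : H) : 0 < d ->
  `|p + q| ^+ 2 <= (1 + d) * `|p| ^+ 2 + (1 + d^-1) * `|q| ^+ 2.
Proof.
move=> d0; have h := ler_normD p q.
apply: le_trans (_ : _ <= (`|p| + `|q|) ^+ 2) _.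
  by rewrite ler_pXn2r ?nnegrE ?addr_ge0.
rewrite -subr_ge0 (_ : _ - _ = d^-1 * (d * `|p| - `|q|) ^+ 2); last first.
  by field; rewrite gt_eqF.
by rewrite mulr_ge0 ?sqr_ge0 // invr_ge0 ltW.
Qed.

Lemma abs_bounded_tail (u : nat -> R) C : (forall k, 0 <= u k) ->
  (forall n, \sum_(0 <= k < n) u k <= C) -> forall t, 0 < t ->
  exists N, forall L, (N <= L)%N -> forall n, \sum_(L <= k < n) u k <= t.
Proof.
move=> u0 hC t t0.
have [l /cvg_seqP/(_ (t / 2))[|N hN]] : exists l : R, series u @ \oo --> l.
- apply: (@abs_bounded_cvg _ u C) => n; apply: le_trans (hC n).
  by apply: ler_sum => k _; rewrite ger0_norm.
- by rewrite divr_gt0.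
exists N => L NL n; have [nL|Ln] := leqP n L; first by rewrite big_geq ?ltW.
have h1 := hN L NL; have h2 := hN n (leq_trans NL (ltnW Ln)).
have -> : \sum_(L <= k < n) u k = (series u n - l) - (series u L - l).
  rewrite opprB addrA subrK /series /= (@big_cat_nat _ _ _ L 0 n) //= ?(ltnW Ln) //.
  by rewrite addrAC subrr add0r.
have := ler_normB (series u n - l) (series u L - l).
have := ler_norm (series u n - l - (series u L - l)); lra.
Qed.

Lemma series_tail_le (V : normedModType R) (u : nat -> V) (l : V) L t :
  series u @ \oo --> l -> (forall n, \sum_(L <= k < n) `|u k| <= t) ->
  `|l - \sum_(k < L) u k| <= t.
Proof.
move=> /cvg_seqP hu ht; apply/ler_addgt0Pr => e /hu[N hN].
pose n := maxn N L; have := hN n (leq_maxl _ _).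
have -> : series u n = \sum_(k < L) u k + \sum_(L <= k < n) u k.
  by rewrite /series /= (big_cat_nat (n := L)) ?leq_maxr //= big_mkord.
have := le_trans (ler_norm_sum _ _ _) (ht n).
set A := \sum_(k < L) u k; set B := \sum_(L <= k < n) u k => hB hA.
have -> : l - A = B - (A + B - l).
  by rewrite opprB opprD addrCA (addrCA B) subrr addr0.
have := ler_normB B (A + B - l); lra.
Qed.

Definition circle_pt I L r k : H := r%:A * omega I L ^+ k.

(* Coefficients are bounded through the means of |V|^2 over the L-th roots of
   unity, letting L go to infinity. *)
Lemma coef_mean_le (I : H) n (v : nat -> nat -> H) (V : nat -> H -> H) r (B : R) :
  imag_unit I -> 0 < r < 1 -> (forall j, radius1 (v j)) ->
  (forall j z, slice I z -> unit_ball z ->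
     series (fun m => z ^+ m * v j m) @ \oo --> V j z) ->
  (exists L0, forall L, (L0 <= L)%N ->
     \sum_(k < L) \sum_(j < n) `|V j (circle_pt I L r k)| ^+ 2 <= L%:R * B) ->
  forall M, \sum_(j < n) \sum_(m < M) r ^+ m ^+ 2 * `|v j m| ^+ 2 <= B.
Proof.
move=> HI r01 hv hV [L0 hL0] M; have /andP[r0 r1] := r01.
have r01' : 0 <= r < 1 by rewrite (ltW r0).
have zP L k : slice I (circle_pt I L r k) /\ `|circle_pt I L r k| = r.
  split; last by rewrite normqM norm_alg normqX omega_norm // expr1n mulr1 gtr0_norm.
  apply: sliceM => //; first exact: slice_alg.
  by apply: sliceX => //; do 2 eexists.
have B0 : 0 <= B.
  have h : 0 <= L0.+1%:R * B.
    apply: le_trans (hL0 L0.+1 (leqnSn _)).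
    by apply: sumr_ge0 => k _; apply: sumr_ge0 => j _; exact: sqr_ge0.
  by move: h; rewrite pmulr_rge0 // ltr0n.
have tail (t : R) : 0 < t -> exists L1, forall j, (j < n)%N -> forall L, (L1 <= L)%N ->
    forall z, slice I z -> `|z| = r -> `|V j z - \sum_(m < L) z ^+ m * v j m| <= t.
  move=> t0.
  have hj j : exists N, forall L, (N <= L)%N ->
      forall z, slice I z -> `|z| = r -> `|V j z - \sum_(m < L) z ^+ m * v j m| <= t.
    have [C hC] := hv j r r01'.
    have [|N hN] := @abs_bounded_tail (fun m => r ^+ m * `|v j m|) C _ hC _ t0.
      by move=> k; rewrite mulr_ge0 // exprn_ge0 // ltW.
    exists N => L NL z sz zr; apply: (series_tail_le (u := fun m => z ^+ m * v j m)).
      by apply: hV => //; rewrite /unit_ball /= zr.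
    move=> n'; apply: le_trans (hN L NL n').
    by apply: ler_sum => k _; rewrite normqM normqX zr.
  have [N hN] := choice hj.
  exists (\max_(j < n) N j)%N => j jn L NL; apply: hN.
  by apply: leq_trans NL; exact: (leq_bigmax (Ordinal jn)).
apply/ler_addgt0Pr => e e0.
(* [d] and [t2] are such that [(1 + d) B <= B + e / 2] and [(1 + 1 / d) n t2 <= e / 2]; [B + 1] and
   [n + 1] keep the denominators positive. *)
pose d := e / 2 / (B + 1); have d0 : 0 < d by rewrite !divr_gt0 // ltr_wpDl.
pose t2 := e / 2 / ((1 + d^-1) * (n%:R + 1)).
have den : 0 < (1 + d^-1) * (n%:R + 1).
  apply: mulr_gt0; last by rewrite ltr_wpDl.
  by rewrite addr_gt0 // invr_gt0.
have t20 : 0 < t2 by rewrite !divr_gt0.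
have [|L1 hL1] := tail (Num.sqrt t2); first by rewrite sqrtr_gt0.
pose L := (maxn (maxn L0 L1) M).+1.
have LL0 : (L0 <= L)%N by rewrite /L leqW // !leq_max leqnn.
have LL1 : (L1 <= L)%N by rewrite /L leqW // !leq_max leqnn orbT.
have LM : (M <= L)%N by rewrite /L leqW // !leq_max leqnn !orbT.
have Lpos : 0 < L%:R :> R by rewrite ltr0n.
apply: le_trans (_ : _ <= \sum_(j < n) \sum_(m < L) r ^+ m ^+ 2 * `|v j m| ^+ 2) _.
  apply: ler_sum => j _; rewrite (big_ord_widen L (fun m => r ^+ m ^+ 2 * `|v j m| ^+ 2)) //.
  rewrite [leRHS](bigID (fun m : 'I_L => (m < M)%N)) /= lerDl.
  by apply: sumr_ge0 => m _; rewrite mulr_ge0 ?sqr_ge0.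
rewrite -(ler_pM2l Lpos) mulr_sumr.
under eq_bigr => j _ do rewrite -(dft_parseval r (v j) (omega_norm L HI) (omegaL HI (ltn0Sn _)) (fun d => omega_prim HI)).
rewrite exchange_big /=.
apply: le_trans (_ : _ <= \sum_(k < L) \sum_(j < n) ((1 + d) * `|V j (circle_pt I L r k)| ^+ 2 + (1 + d^-1) * t2)) _.
  apply: ler_sum => k _; apply: ler_sum => j _; rewrite -/(circle_pt I L r k).
  have [sz nz] := zP L k; set z := circle_pt I L r k in sz nz *.
  have := hL1 j (ltn_ord j) L LL1 z sz nz; set P := \sum_(m < L) _ => h.
  have := sqr_normD_le (V j z) (P - V j z) d0; rewrite addrC subrK => /le_trans; apply.
  rewrite lerD2l; apply: ler_wpM2l; first by rewrite addr_ge0 ?invr_ge0 ?(ltW d0).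
  rewrite distrC -(sqr_sqrtr (ltW t20)) ler_pXn2r ?nnegrE ?sqrtr_ge0 //.
under eq_bigr do rewrite big_split /= -mulr_sumr sumr_const card_ord.
rewrite big_split /= -mulr_sumr sumr_const card_ord.
have h1 := ler_wpM2l (_ : 0 <= 1 + d) (hL0 L LL0).
have h2 : (1 + d^-1) * t2 *+ n <= e / 2.
  have X0 : 1 + d^-1 != 0 by rewrite gt_eqF // addr_gt0 // invr_gt0.
  have Y0 : n%:R + 1 != 0 :> R by rewrite gt_eqF // ltr_wpDl.
  have -> : (1 + d^-1) * t2 *+ n = e / 2 * (n%:R / (n%:R + 1)).
    rewrite -mulr_natr /t2; move: X0 Y0; move: (1 + d^-1) (n%:R + 1) => X Y X0 Y0.
    by field; rewrite X0 Y0.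
  rewrite -[leRHS]mulr1; apply: ler_wpM2l; first by rewrite divr_ge0 // ltW.
  by rewrite ler_pdivrMr ?ltr_wpDl // mul1r lerDl.
have h3 : (1 + d) * (L%:R * B) <= L%:R * (B + e / 2).
  rewrite mulrCA ler_pM2l // mulrDl mul1r lerD2l /d.
  rewrite mulrAC ler_pdivrMr ?ltr_wpDl //.
  by apply: ler_wpM2l; [rewrite divr_ge0 // ltW|rewrite lerDl].
rewrite -[_ *+ L]mulr_natl.
have -> : L%:R * (B + e) = L%:R * (B + e / 2) + L%:R * (e / 2) by field.
apply: lerD; last by rewrite ler_pM2l.
by apply: le_trans h3; apply: h1; rewrite addr_ge0 // ltW.
Qed.

End Means.

(** * Multiplier norms from pointwise bounds *)

Section MultiplierBounds.
Variable R : realType.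
Local Notation H := (quat R).
Implicit Types (v u : nat -> H) (w z q : H) (r x : R).

Lemma sum_CS n (al be : nat -> R) :
  (\sum_(j < n) al j * be j) ^+ 2 <= (\sum_(j < n) al j ^+ 2) * (\sum_(j < n) be j ^+ 2).
Proof.
elim: n => [|n IH]; first by rewrite !big_ord0 mul0r expr0n.
rewrite !big_ord_recr /=; move: IH.
set A := \sum_(j < n) _; set X := \sum_(j < n) _; set Y := \sum_(j < n) _ => IH.
have X0 : 0 <= X by apply: sumr_ge0 => j _; exact: sqr_ge0.
have Y0 : 0 <= Y by apply: sumr_ge0 => j _; exact: sqr_ge0.
set a := al n; set b := be n.
have h : A * a * b *+ 2 <= X * b ^+ 2 + Y * a ^+ 2.
  apply: le_trans (ler_norm _) _.
  have S0 : 0 <= X * b ^+ 2 + Y * a ^+ 2 by rewrite addr_ge0 // mulr_ge0 ?sqr_ge0.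
  rewrite -(ler_pXn2r (n := 2)) ?nnegrE // real_normK ?num_real //.
  have h2 : A ^+ 2 * (a * b) ^+ 2 <= X * Y * (a * b) ^+ 2 by rewrite ler_wpM2r ?sqr_ge0.
  have h3 := sqr_ge0 (X * b ^+ 2 - Y * a ^+ 2); lra.
lra.
Qed.

Lemma norm_sum_CS n (x y : nat -> H) : `|\sum_(j < n) x j * y j| ^+ 2 <=
  (\sum_(j < n) `|x j| ^+ 2) * (\sum_(j < n) `|y j| ^+ 2).
Proof.
apply: le_trans (sum_CS n (fun j => `|x j|) (fun j => `|y j|)).
rewrite ler_pXn2r ?nnegrE ?sumr_ge0 //; apply: le_trans (ler_norm_sum _ _ _) _.
by apply: ler_sum => j _; rewrite normqM.
Qed.

Lemma bernoulli_le (e : R) n : 0 <= e <= 1 -> 1 - n%:R * e <= (1 - e) ^+ n.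
Proof.
move=> /andP[e0 e1]; elim: n => [|n IH]; first by rewrite mul0r subr0.
rewrite exprS -natr1.
have h := ler_wpM2l (_ : 0 <= 1 - e) IH; have {}h := h (_ : 0 <= 1 - e).
apply: le_trans (h _); last by rewrite subr_ge0.
by have := mulr_ge0 (ler0n R n) (sqr_ge0 e); lra.
Qed.

(** Only finitely many coefficients occur, so [r] is sent to 1 by Bernoulli's inequality
    [(1 - e)^(2M) >= 1 - 2 M e], with [e] so small that the loss is at most [d]. *)
Lemma radial_limit n (v : nat -> nat -> H) M (B : R) :
  (forall r, 0 < r < 1 -> \sum_(j < n) \sum_(m < M) r ^+ m ^+ 2 * `|v j m| ^+ 2 <= B) ->
  \sum_(j < n) \sum_(m < M) `|v j m| ^+ 2 <= B.
Proof.
move=> hB; set S := \sum_(j < n) _.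
have S0 : 0 <= S by apply: sumr_ge0 => j _; apply: sumr_ge0 => m _; exact: sqr_ge0.
apply/ler_addgt0Pr => d d0.
pose N : R := (M * 2)%:R * S + d + 1.
have MS0 : 0 <= (M * 2)%:R * S by rewrite mulr_ge0.
have N0 : 0 < N by rewrite /N; lra.
pose e := d / N; have e0 : 0 < e by rewrite divr_gt0.
have e1 : e < 1 by rewrite ltr_pdivrMr // mul1r /N; lra.
have r01 : 0 < 1 - e < 1 by lra.
have /andP[r0 r1] := r01.
have h1 : (1 - e) ^+ (M * 2) * S <= B.
  apply: le_trans (hB _ r01); rewrite mulr_sumr; apply: ler_sum => j _.
  rewrite mulr_sumr; apply: ler_sum => m _; apply: ler_wpM2r; first exact: sqr_ge0.
  rewrite exprM ler_pXn2r ?nnegrE ?exprn_ge0 ?(ltW r0) //.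
  exact: (ler_wiXn2l (ltW r0) (ltW r1) (ltnW (ltn_ord m))).
have := bernoulli_le (M * 2) (_ : 0 <= e <= 1); rewrite (ltW e0) (ltW e1) => /(_ isT) h2.
have h3 := ler_wpM2r S0 h2.
have h4 : (M * 2)%:R * e * S <= d.
  rewrite mulrAC /e mulrA ler_pdivrMr // mulrC ler_pM2l // /N; lra.
lra.
Qed.

Lemma row_coef_le (I : H) (a : nat -> nat -> H) (f : nat -> H -> H) : imag_unit I ->
  (forall j, power_sum (a j) (f j)) ->
  (forall n q, unit_ball q -> \sum_(j < n) `|f j q| ^+ 2 <= 1) ->
  forall n M, \sum_(j < n) \sum_(m < M) `|a j m| ^+ 2 <= 1.
Proof.
move=> HI ha hf n M; apply: radial_limit => r r01.
apply: (coef_mean_le (V := f) HI r01) => [j|j z _ zB|].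
- exact: power_sum_radius1.
- exact: ha.
exists 0%N => L _; rewrite mulr1.
apply: le_trans (_ : _ <= \sum_(k < L) 1) _; last by rewrite sumr_const card_ord.
apply: ler_sum => k _; apply: hf.
have /andP[r0 r1] := r01.
by rewrite /unit_ball /= normqM norm_alg normqX omega_norm // expr1n mulr1 gtr0_norm.
Qed.

(** For an imaginary unit [I], [slice_part] and [orth_part] are the projections onto C_I and onto
    its orthogonal complement: elements of the first commute with [z] in the slice, those of the
    second turn it into its conjugate. *)
Definition slice_part (I a : H) : H := 2^-1 *: (a - I * a * I).
Definition orth_part (I a : H) : H := 2^-1 *: (a + I * a * I).

Lemma slice_orth_partE I a : slice_part I a + orth_part I a = a.
Proof. by apply: quat_ext; rewrite /=; field. Qed.

Lemma slice_part_le I a : imag_unit I -> `|slice_part I a| <= `|a|.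
Proof.
move=> HI; rewrite normrZ ger0_norm // ler_pdivrMl //.
apply: le_trans (ler_normB _ _) _; rewrite !normqM imag_unit_norm //; lra.
Qed.

Lemma orth_part_le I a : imag_unit I -> `|orth_part I a| <= `|a|.
Proof.
move=> HI; rewrite normrZ ger0_norm // ler_pdivrMl //.
apply: le_trans (ler_normD _ _) _; rewrite !normqM imag_unit_norm //; lra.
Qed.

Lemma slice_part_comm I a z : imag_unit I -> slice I z ->
  z * slice_part I a = slice_part I a * z.
Proof.
move=> HI [x [y ->]].
have II : I * I = -1 by rewrite -expr2.
have c : I * slice_part I a = slice_part I a * I.
  rewrite /slice_part -scalerAr -scalerAl mulrBr mulrBl !mulrA II mulN1r mulNr.
  by rewrite -!mulrA II mulrN1 !mulrN !opprK addrC.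
rewrite /cslice mulrDl mulrDr algq_comm; congr (_ + _).
by rewrite -mulrA algq_comm mulrA c mulrA.
Qed.

Lemma orth_part_comm I a z : imag_unit I -> slice I z ->
  z * orth_part I a = orth_part I a * quat_conj z.
Proof.
move=> HI [x [y ->]].
have II : I * I = -1 by rewrite -expr2.
have c : I * orth_part I a = - (orth_part I a * I).
  rewrite /orth_part -scalerAr -scalerAl -scalerN mulrDr mulrDl !mulrA II mulN1r.
  by rewrite -!mulrA II mulrN1 !(mulrN, mulNr) opprD opprK addrC.
rewrite cslice_conj // /cslice mulrDl mulrDr algq_comm; congr (_ + _).
by rewrite -mulrA algq_comm mulrA c scaleNr !mulrN mulNr mulrA.
Qed.

Lemma sum_circle_poly (I : H) L M r u : imag_unit I -> (M <= L)%N -> 0 < r < 1 ->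
  (forall l, (M <= l)%N -> u l = 0) ->
  \sum_(k < L) `|\sum_(l < M) circle_pt I L r k ^+ l * u l| ^+ 2 <=
  L%:R * \sum_(l < M) `|u l| ^+ 2.
Proof.
move=> HI ML /andP[r0 r1] hu; case: L ML => [|L] ML; first by rewrite big_ord0 mul0r.
have E z : \sum_(l < M) z ^+ l * u l = \sum_(l < L.+1) z ^+ l * u l.
  rewrite (big_ord_widen _ (fun l => z ^+ l * u l) ML) big_mkcond; apply: eq_bigr => l _.
  by case: ltnP => // /hu ->; rewrite mulr0.
under eq_bigr do rewrite E.
rewrite (dft_parseval r u (omega_norm _ HI) (omegaL HI (ltn0Sn _)) (fun d => omega_prim HI)).
apply: ler_wpM2l => //.
rewrite [leRHS](big_ord_widen _ (fun l => `|u l| ^+ 2) ML) [leRHS]big_mkcond.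
apply: ler_sum => l _; case: ltnP => [_|/hu ->]; last by rewrite normr0 expr0n mulr0.
rewrite -[leRHS]mul1r; apply: ler_wpM2r; first exact: sqr_ge0.
by rewrite -exprM exprn_ile1 ?(ltW r0) ?(ltW r1).
Qed.

Lemma circle_ptN (I : H) L r k : imag_unit I ->
  quat_conj (circle_pt I L r k) = circle_pt (- I) L r k.
Proof.
move=> HI; rewrite /circle_pt qconjM qconjX qconjZ qconj1 -algq_comm /omega cslice_conj //.
by rewrite /cslice mulNr scaleNr mulrN.
Qed.

Lemma imag_unitN (I : H) : imag_unit I -> imag_unit (- I).
Proof. by rewrite /imag_unit sqrrN. Qed.

Lemma circle_pt_slice (I : H) L r k : imag_unit I -> slice I (circle_pt I L r k).
Proof.
move=> HI; apply: sliceM => //; first exact: slice_alg.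
apply: sliceX => //; rewrite /omega.
by exists (cos (pi *+ 2 / L%:R)), (sin (pi *+ 2 / L%:R)).
Qed.

Lemma circle_pt_norm (I : H) L r k : imag_unit I -> 0 < r -> `|circle_pt I L r k| = r.
Proof.
by move=> HI r0; rewrite normqM norm_alg normqX omega_norm // expr1n mulr1 gtr0_norm.
Qed.

Definition trunc M (u : nat -> H) l : H := if (l < M)%N then u l else 0.

Lemma qconv_trunc a u M m : (m < M)%N -> qconv a (trunc M u) m = qconv a u m.
Proof.
move=> mM; rewrite !qconv_rev; apply: eq_bigr => l _; rewrite /trunc.
by rewrite (leq_trans (ltn_ord l) mM).
Qed.

Lemma trunc_ge M u l : (M <= l)%N -> trunc M u l = 0.
Proof. by rewrite /trunc ltnNge => ->. Qed.

Lemma radius1_trunc M u : radius1 (trunc M u).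
Proof.
move=> r /andP[r0 _]; exists (\sum_(0 <= m < M) r ^+ m * `|u m|) => n.
have pos m : 0 <= r ^+ m * `|u m| by rewrite mulr_ge0 ?exprn_ge0.
apply: le_trans (_ : _ <= \sum_(0 <= m < maxn n M | (m < M)%N) r ^+ m * `|u m|) _.
  rewrite [leRHS]big_mkcond (big_cat_nat (n := n) (p := maxn n M)) ?leq_maxl //= -[leLHS]addr0.
  apply: lerD.
    apply: ler_sum => m _; rewrite /trunc; case: ifP => // _; by rewrite normr0 mulr0.
  by apply: sumr_ge0 => m _; case: ifP.
rewrite (big_nat_widen 0 M (maxn n M)) ?leq_maxr // big_mkcondl; apply: ler_sum => m _.
Qed.

Lemma radius1_sum n (v : nat -> nat -> H) : (forall j, radius1 (v j)) ->
  radius1 (fun m => \sum_(j < n) v j m).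
Proof.
move=> hv r r01; have [C hC] := choice (fun j => hv j r r01).
have /andP[r0 _] := r01.
exists (\sum_(j < n) C j) => N.
apply: le_trans (_ : _ <= \sum_(j < n) \sum_(0 <= m < N) r ^+ m * `|v j m|) _; last first.
  by apply: ler_sum => j _; exact: hC.
rewrite exchange_big /=; apply: ler_sum => m _; rewrite -mulr_sumr.
by apply: ler_wpM2l; [exact: exprn_ge0|exact: ler_norm_sum].
Qed.

(** At [z] in the slice, the product of [f_j] and [h_j] takes the value [sum z^l f_j(z) h_j,l]. The
    C_I part of [f_j(z)] commutes with [z^l], the other part conjugates it; so the polynomials [p_j]
    at [z] and at its conjugate are multiplied by quaternions whose squared moduli add up to at most
    1 over [j]. Squaring the sum of the two contributions costs 2 for each, hence 4. *)
Lemma row_conv_le (I : H) (a : nat -> nat -> H) (f : nat -> H -> H) : imag_unit I ->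
  (forall j, power_sum (a j) (f j)) ->
  (forall n q, unit_ball q -> \sum_(j < n) `|f j q| ^+ 2 <= 1) ->
  forall (h : nat -> nat -> H) n M,
  \sum_(m < M) `|\sum_(j < n) qconv (a j) (h j) m| ^+ 2 <=
  4 * \sum_(j < n) \sum_(l < M) `|h j l| ^+ 2.
Proof.
move=> HI ha hf h n M; pose h' j := trunc M (h j).
have -> : \sum_(j < n) \sum_(l < M) `|h j l| ^+ 2 = \sum_(j < n) \sum_(l < M) `|h' j l| ^+ 2.
  by apply: eq_bigr => j _; apply: eq_bigr => l _; rewrite /h' /trunc ltn_ord.
(* [coef_mean_le] is applied to a family with a single member, whence the ignored index. *)
pose v (_ : nat) m := \sum_(j < n) qconv (a j) (h' j) m.
have -> : \sum_(m < M) `|\sum_(j < n) qconv (a j) (h j) m| ^+ 2 =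
    \sum_(j < 1) \sum_(m < M) `|v j m| ^+ 2.
  rewrite big_ord1; apply: eq_bigr => m _; congr (`|_| ^+ 2); apply: eq_bigr => j _.
  by rewrite qconv_trunc.
apply: radial_limit => r r01; have /andP[r0 r1] := r01.
pose p j z := \sum_(l < M) z ^+ l * h' j l.
pose V (_ : nat) z := \sum_(j < n) (slice_part I (f j z) * p j z + orth_part I (f j z) * p j (quat_conj z)).
apply: (coef_mean_le (V := V) HI r01) => [i0|i0 z sz zB|].
- apply: (@radius1_sum n (fun j => qconv (a j) (h' j))) => j; apply: radius1_qconv; first exact: power_sum_radius1.
  exact: radius1_trunc.
- rewrite (_ : V i0 z = \sum_(j < n) \sum_(l < M) z ^+ l * f j z * h' j l); last first.
    apply: eq_bigr => j _; rewrite /p !big_distrr -big_split /=; apply: eq_bigr => l _.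
    rewrite -[X in _ = _ * X * _](slice_orth_partE I) mulrDr mulrDl !mulrA.
    rewrite (slice_part_comm _ HI (sliceX HI l sz)) (orth_part_comm _ HI (sliceX HI l sz)).
    by rewrite qconjX.
  rewrite (_ : (fun m => _) = (fun m => \sum_(j < n) z ^+ m * qconv (a j) (h' j) m)); last first.
    by apply/funext => m; rewrite /v mulr_sumr.
  apply: (series_cvg_sum (T := fun j m => z ^+ m * qconv (a j) (h' j) m)
    (t := fun j => \sum_(l < M) z ^+ l * f j z * h' j l)) => j.
  rewrite (_ : (fun m => _) = (fun m => \sum_(l < M)
      if (l <= m)%N then (fun l k => z ^+ l * (z ^+ k * a j k) * h' j l) l (m - l)%N else 0)); last first.
    apply/funext => m; rewrite (qconv_poly _ _ (@trunc_ge M (h j))) mulr_sumr.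
    apply: eq_bigr => l _; case: ifP => lm; last by rewrite mulr0.
    by rewrite !mulrA -exprD subnKC.
  apply: (series_shift_sum (T := fun l k => z ^+ l * (z ^+ k * a j k) * h' j l)
    (t := fun l => z ^+ l * f j z * h' j l)) => l.
  by apply/series_cvgMr/series_cvgMl/ha.
exists M => L ML.
under eq_bigr do rewrite big_ord1.
pose S := \sum_(j < n) \sum_(l < M) `|h' j l| ^+ 2.
have bound z : unit_ball z -> `|V 0%N z| ^+ 2 <= 2 * \sum_(j < n) `|p j z| ^+ 2 +
    2 * \sum_(j < n) `|p j (quat_conj z)| ^+ 2.
  move=> zB; rewrite /V big_split /=.
  apply: le_trans (sqr_normD_le _ _ ltr01) _; rewrite invr1.
  have part (P : H -> H) y : (forall q, `|P q| <= `|q|) ->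
      `|\sum_(j < n) P (f j z) * p j y| ^+ 2 <= \sum_(j < n) `|p j y| ^+ 2.
    move=> hP; apply: le_trans (norm_sum_CS n (fun j => P (f j z)) (fun j => p j y)) _.
    rewrite -[leRHS]mul1r; apply: ler_wpM2r; first by apply: sumr_ge0 => j _; exact: sqr_ge0.
    apply: le_trans (hf n z zB); apply: ler_sum => j _.
    by rewrite ler_pXn2r ?nnegrE.
  by apply: lerD; apply: ler_wpM2l => //; apply: part => q; [exact: slice_part_le|exact: orth_part_le].
apply: le_trans (_ : _ <= \sum_(k < L) (2 * \sum_(j < n) `|p j (circle_pt I L r k)| ^+ 2 +
    2 * \sum_(j < n) `|p j (circle_pt (- I) L r k)| ^+ 2)) _.
  apply: ler_sum => k _; rewrite -circle_ptN //; apply: bound.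
  by rewrite /unit_ball /= circle_pt_norm.
have lin2 (A B : nat -> R) : \sum_(k < L) (2 * A k + 2 * B k) =
    2 * (\sum_(k < L) A k) + 2 * (\sum_(k < L) B k).
  by rewrite big_split /= -!mulr_sumr.
rewrite (lin2 (fun k => \sum_(j < n) `|p j (circle_pt I L r k)| ^+ 2)
  (fun k => \sum_(j < n) `|p j (circle_pt (- I) L r k)| ^+ 2)).
have mean I' : imag_unit I' ->
    \sum_(k < L) \sum_(j < n) `|p j (circle_pt I' L r k)| ^+ 2 <= L%:R * S.
  move=> HI'; rewrite exchange_big mulr_sumr; apply: ler_sum => j _.
  by apply: sum_circle_poly => // l; exact: trunc_ge.
move: (mean _ HI) (mean _ (imag_unitN HI)); rewrite -/S.
set X := \sum_(k < L) _; set Y := \sum_(k < L) _ => hX hY.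
by move: X Y hX hY => X Y; lra.
Qed.

Definition right_eval (c : nat -> H) (z b : H) : H := limn (series (fun m => c m * b * z ^+ m)).

Lemma right_eval_cvg c z b : radius1 c -> unit_ball z ->
  series (fun m => c m * b * z ^+ m) @ \oo --> right_eval c z b.
Proof.
move=> hc zB; have [|C hC] := hc `|z|; first by rewrite normr_ge0.
have [|l hl] := @qseries_cvg R (fun m => c m * b * z ^+ m) (C * `|b|).
  move=> n; apply: le_trans (ler_wpM2r (normr_ge0 b) (hC n)); rewrite mulr_suml.
  by apply: ler_sum => m _; rewrite !normqM normqX le_eqVlt; apply/orP; left; apply/eqP; ring.
by rewrite /right_eval (cvg_lim _ hl).
Qed.

Lemma right_eval_sum c z n (b : nat -> H) : radius1 c -> unit_ball z ->
  right_eval c z (\sum_(l < n) b l) = \sum_(l < n) right_eval c z (b l).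
Proof.
move=> hc zB; apply: (cvg_uniq (right_eval_cvg hc zB)).
rewrite (_ : (fun m => _) = (fun m => \sum_(l < n) (fun l m => c m * b l * z ^+ m) l m)).
  by apply: (series_cvg_sum (T := fun l m => c m * b l * z ^+ m)
    (t := fun l => right_eval c z (b l))) => l; exact: right_eval_cvg.
by apply/funext => m; rewrite mulr_sumr mulr_suml.
Qed.

(** Right linearity over the slice of [z], which makes [right_eval] comparable with multiplication
    by a complex matrix. *)
Lemma right_evalMr c z w b : radius1 c -> unit_ball z -> z * w = w * z ->
  right_eval c z (b * w) = right_eval c z b * w.
Proof.
move=> hc zB zw; apply: (cvg_uniq (right_eval_cvg hc zB)).
rewrite (_ : (fun m => _) = (fun m => c m * b * z ^+ m * w)).
  by apply: series_cvgMr; exact: right_eval_cvg.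
by apply/funext => m; rewrite -!mulrA (commrX m (esym zw : GRing.comm w z)).
Qed.

(** For [b = sum u_l z^l] the evaluation returns [sum (c * u)_m z^m], so the hypothesis bounds the
    output by the input at each point of a circle, and averaging compares the coefficients.
    Conjugation moves the powers from the right to the left, where [coef_mean_le] expects them. *)
Lemma col_conv_le (I : H) (c : nat -> nat -> H) (K : R) : imag_unit I ->
  (forall j, radius1 (c j)) -> 0 <= K ->
  (forall n z b, slice I z -> unit_ball z ->
     \sum_(j < n) `|right_eval (c j) z b| ^+ 2 <= K * `|b| ^+ 2) ->
  forall u n M, \sum_(j < n) \sum_(m < M) `|qconv (c j) u m| ^+ 2 <=
    K * \sum_(m < M) `|u m| ^+ 2.
Proof.
move=> HI hc K0 hE u n M; pose u' := trunc M u.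
have -> : \sum_(l < M) `|u l| ^+ 2 = \sum_(l < M) `|quat_conj (u' l)| ^+ 2.
  by apply: eq_bigr => l _; rewrite norm_qconj /u' /trunc ltn_ord.
pose v j m := quat_conj (qconv (c j) u' m).
have -> : \sum_(j < n) \sum_(m < M) `|qconv (c j) u m| ^+ 2 =
    \sum_(j < n) \sum_(m < M) `|v j m| ^+ 2.
  by apply: eq_bigr => j _; apply: eq_bigr => m _; rewrite /v norm_qconj qconv_trunc.
apply: radial_limit => r r01; have /andP[r0 r1] := r01.
pose V j z := quat_conj (right_eval (c j) (quat_conj z) (\sum_(l < M) u' l * quat_conj z ^+ l)).
apply: (coef_mean_le (V := V) HI r01) => [j|j z sz zB|].
- move=> s s01; have [C hC] := radius1_qconv (hc j) (radius1_trunc M u) s01.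
  by exists C => N; under eq_bigr do rewrite /v norm_qconj; exact: hC.
- have zB' : unit_ball (quat_conj z) by rewrite /unit_ball /= norm_qconj.
  set y := quat_conj z in zB'.
  rewrite (_ : (fun m => _) = (fun m => quat_conj (qconv (c j) u' m * y ^+ m))); last first.
    by apply/funext => m; rewrite qconjM qconjX /y qconjK.
  rewrite /V -/y (@right_eval_sum (c j) y M (fun l => u' l * y ^+ l) (hc j) zB').
  apply: series_cvg_conj.
  rewrite (_ : (fun m => _) = (fun m => \sum_(l < M)
      if (l <= m)%N then (fun l k => c j k * (u' l * y ^+ l) * y ^+ k) l (m - l)%N else 0)); last first.
    apply/funext => m; rewrite (qconv_poly _ _ (@trunc_ge M u)) mulr_suml.
    apply: eq_bigr => l _; case: ifP => lm; last by rewrite mul0r.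
    by rewrite -!mulrA -exprD subnKC.
  apply: (series_shift_sum (T := fun l k => c j k * (u' l * y ^+ l) * y ^+ k)
    (t := fun l => right_eval (c j) y (u' l * y ^+ l))) => l.
  exact: right_eval_cvg.
exists M => L ML.
apply: le_trans (_ : _ <= \sum_(k < L) K * `|\sum_(l < M) circle_pt I L r k ^+ l * quat_conj (u' l)| ^+ 2) _.
  apply: ler_sum => k _; set z := circle_pt I L r k.
  have -> : `|\sum_(l < M) z ^+ l * quat_conj (u' l)| = `|\sum_(l < M) u' l * quat_conj z ^+ l|.
    rewrite -[RHS]norm_qconj qconj_sum; congr (`|_|); apply: eq_bigr => l _.
    by rewrite qconjM qconjX qconjK.
  have sz : slice I z by exact: circle_pt_slice.
  have sz' : slice I (quat_conj z).
    by case: sz => x [y ->]; rewrite cslice_conj //; exists x, (- y).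
  have zB' : unit_ball (quat_conj z) by rewrite /unit_ball /= norm_qconj circle_pt_norm.
  apply: le_trans (hE n _ _ sz' zB'); apply: ler_sum => j _.
  by rewrite /V norm_qconj.
rewrite -mulr_sumr mulrCA; apply: ler_wpM2l => //.
apply: (@sum_circle_poly I L M r (fun l => quat_conj (u' l))) => // l Ml.
by rewrite /u' trunc_ge // qconj0.
Qed.

End MultiplierBounds.

(** * Coefficients of a corona solution *)

Section UltraLimits.
Variable R : realType.
Local Notation H := (quat R).

(** One ultrafilter serves all coefficients at once, which spares a diagonal extraction. *)
Lemma ultra_bounded_cvg (U : set_system nat) (UU : UltraFilter U) (y : nat -> R) M :
  (forall N, `|y N| <= M) -> exists l : R, y @ U --> l.
Proof.
move=> yM; have UP : ProperFilter U by exact: ultra_proper.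
have cM : compact (`[- M, M] : set R) by exact: segment_compact.
have [|l [_ cl]] := cM (y @ U) (fmap_proper_filter _ UP).
  suff: U (y @^-1` `[- M, M]) by []; apply: filterE => N.
  by rewrite /= in_itv /= -ler_norml; exact: yM.
exists l => B lB; have [//|nB] := @in_ultra_setVsetC _ _ (y @^-1` B) UU.
by have [z [/= + zB]] := cl (~` B) B nB lB.
Qed.

Lemma cvg_filter_quat (T : Type) (F : set_system T) (FF : Filter F) (u : T -> H) (a b c d : R) :
  @qre R \o u @ F --> a -> @qi R \o u @ F --> b ->
  @qj R \o u @ F --> c -> @qk R \o u @ F --> d -> u @ F --> Quat a b c d.
Proof.
move=> /cvgrPdist_lt ha /cvgrPdist_lt hb /cvgrPdist_lt hc /cvgrPdist_lt hd.
apply/cvgrPdist_lt => e e0; have e40 : 0 < e / 4 by rewrite divr_gt0.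
near=> n; have := normq_le_comps (Quat a b c d - u n) => /=.
have : `|a - qre (u n)| < e / 4 by near: n; exact: ha.
have : `|b - qi (u n)| < e / 4 by near: n; exact: hb.
have : `|c - qj (u n)| < e / 4 by near: n; exact: hc.
have : `|d - qk (u n)| < e / 4 by near: n; exact: hd.
lra.
Unshelve. all: by end_near. Qed.

Lemma ultra_bounded_qcvg (U : set_system nat) (UU : UltraFilter U) (y : nat -> H) M :
  (forall N, `|y N| <= M) -> exists l : H, y @ U --> l.
Proof.
move=> yM; have UP : ProperFilter U by exact: ultra_proper.
have hc (k : H -> R) : (forall q, `|k q| <= `|q|) -> exists l : R, k \o y @ U --> l.
  by move=> kq; apply: (@ultra_bounded_cvg U UU (k \o y) M) => N; exact: le_trans (kq _) (yM N).
have [|a ha] := hc (@qre R); first by move=> q; have [] := normq_comps q.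
have [|b hb] := hc (@qi R); first by move=> q; have [] := normq_comps q.
have [|c hc'] := hc (@qj R); first by move=> q; have [] := normq_comps q.
have [|d hd] := hc (@qk R); first by move=> q; have [] := normq_comps q.
by exists (Quat a b c d); exact: cvg_filter_quat.
Qed.

Lemma cvg_filterMl (T : Type) (F : set_system T) (FF : Filter F) (q : H) (u : T -> H) (l : H) :
  u @ F --> l -> (fun n => q * u n) @ F --> q * l.
Proof.
move=> /cvgrPdist_lt ul; apply/cvgrPdist_lt => e e0.
have q1 : 0 < `|q| + 1 by rewrite ltr_wpDl.
apply: filterS (ul _ (divr_gt0 e0 q1)) => n h.
rewrite -mulrBr normqM; apply: le_lt_trans (_ : _ <= (`|q| + 1) * `|l - u n|) _.
  by rewrite ler_wpM2r // lerDl.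
by rewrite mulrC -ltr_pdivlMr.
Qed.

Lemma cvg_filterMr (T : Type) (F : set_system T) (FF : Filter F) (q : H) (u : T -> H) (l : H) :
  u @ F --> l -> (fun n => u n * q) @ F --> l * q.
Proof.
move=> /cvgrPdist_lt ul; apply/cvgrPdist_lt => e e0.
have q1 : 0 < `|q| + 1 by rewrite ltr_wpDl.
apply: filterS (ul _ (divr_gt0 e0 q1)) => n h.
rewrite -mulrBl normqM mulrC; apply: le_lt_trans (_ : _ <= (`|q| + 1) * `|l - u n|) _.
  by rewrite ler_wpM2r // lerDl.
by rewrite mulrC -ltr_pdivlMr.
Qed.

Lemma cvg_filter_sum (V : normedModType R) (T : Type) (F : set_system T) (FF : Filter F) n
    (u : nat -> T -> V) (l : nat -> V) : (forall k, (k < n)%N -> u k @ F --> l k) ->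
  (fun x => \sum_(k < n) u k x) @ F --> \sum_(k < n) l k.
Proof.
elim: n => [|n IH] hu.
  rewrite big_ord0 (_ : (fun x => _) = cst 0); first exact: cvg_cst.
  by apply/funext => x; rewrite big_ord0.
rewrite big_ord_recr /= (_ : (fun x => _) = (fun x => \sum_(k < n) u k x) \+ u n).
  by apply: cvgD; [apply: IH => k kn; apply: hu; exact: ltnW|exact: hu].
by apply/funext => x; rewrite big_ord_recr.
Qed.

Lemma ultra_le (U : set_system nat) (UU : UltraFilter U) (y : nat -> R) (l b : R) :
  y @ U --> l -> (forall e, 0 < e -> \forall N \near U, y N <= b + e) -> l <= b.
Proof.
move=> /cvgrPdist_lt yl hb; have UP : ProperFilter U by exact: ultra_proper.
apply/ler_addgt0Pr => e e0; have e20 : 0 < e / 2 by rewrite divr_gt0.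
have [N []] := filter_ex (filterI (yl _ e20) (hb _ e20)).
by move=> /= h1 h2; have := ler_norm (l - y N); lra.
Qed.

End UltraLimits.

(** * Truncated solutions and their limit *)

Section CoronaCoefficients.
Variable R : realType.
Local Notation H := (quat R).
Variables (A : nat -> nat -> H) (eta : R).
Hypothesis eta0 : 0 < eta.
Hypothesis A1 : forall n M, \sum_(j < n) \sum_(m < M) `|A j m| ^+ 2 <= 1.
Hypothesis LB : forall N (u : nat -> H) e, 0 < e -> exists n,
  eta ^+ 2 * \sum_(m < N) `|u m| ^+ 2 <=
  \sum_(j < n) \sum_(k < N) `|qcoconv N (A j) u k| ^+ 2 + e.

Lemma row_tail N e : 0 < e -> exists n0, forall n, (n0 <= n)%N -> forall n',
  \sum_(n <= j < n') \sum_(m < N) `|A j m| ^+ 2 <= e.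
Proof.
move=> e0; apply: (@abs_bounded_tail R (fun j => \sum_(m < N) `|A j m| ^+ 2) 1) => // [k|n].
  by apply: sumr_ge0 => m _; exact: sqr_ge0.
by rewrite big_mkord.
Qed.

Lemma qcoconv_le N (a u : nat -> H) k : `|qcoconv N a u k| ^+ 2 <=
  (\sum_(m < N) `|a m| ^+ 2) * \sum_(m < N) `|u m| ^+ 2.
Proof.
rewrite /qcoconv big_mkcond /=.
pose x m := if (k <= m)%N then quat_conj (a (m - k)%N) else 0.
have -> : \sum_(m < N) (if (k <= m)%N then quat_conj (a (m - k)%N) * u m else 0) =
    \sum_(m < N) x m * u m.
  by apply: eq_bigr => m _; rewrite /x; case: ifP; rewrite ?mul0r.
apply: le_trans (norm_sum_CS N x u) _; apply: ler_wpM2r.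
  by apply: sumr_ge0 => m _; exact: sqr_ge0.
rewrite -(big_mkord xpredT (fun m => `|x m| ^+ 2)) -(big_mkord xpredT (fun m => `|a m| ^+ 2)).
have [kN|Nk] := leqP k N; last first.
  rewrite big_nat big1; first by apply: sumr_ge0 => m _; exact: sqr_ge0.
  move=> m /andP[_ mN]; rewrite /x leqNgt (ltn_trans mN Nk) /= normr0 expr0n //.
rewrite (@big_cat_nat _ _ _ k 0 N) //= [X in X + _]big_nat big1 ?add0r; last first.
  by move=> m /andP[_ mk]; rewrite /x leqNgt mk /= normr0 expr0n.
rewrite -{1}(add0n k) big_addn.
apply: le_trans (_ : _ <= \sum_(0 <= m < N - k) `|a m| ^+ 2) _.
  by apply: ler_sum => m _; rewrite /x leq_addl addnK norm_qconj.
rewrite (@big_cat_nat _ _ _ (N - k) 0 N) //= ?leq_subr // lerDl.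
by apply: sumr_ge0 => m _; exact: sqr_ge0.
Qed.

(** [LB] lets the number of rows depend on [u]. The tail of the row coefficients is small
    independently of [u], so one number of rows works for all [u], at the cost of [d]. *)
Lemma finite_lower_bound N d : 0 < d -> exists n, forall u : nat -> H,
  (eta ^+ 2 - d) * \sum_(m < N) `|u m| ^+ 2 <=
  \sum_(j < n) \sum_(k < N) `|qcoconv N (A j) u k| ^+ 2.
Proof.
move=> d0; have N0 : 0 < N%:R + 1 :> R by rewrite ltr_wpDl.
have [n hn] := row_tail N (divr_gt0 d0 N0).
exists n => u; set S := \sum_(m < N) _.
have S0 : 0 <= S by apply: sumr_ge0 => m _; exact: sqr_ge0.
apply/ler_addgt0Pr => e e0; have [n' hn'] := LB N u e0.
rewrite -/S in hn'; rewrite mulrBl.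
pose g j := \sum_(k < N) `|qcoconv N (A j) u k| ^+ 2.
have g0 j : 0 <= g j by apply: sumr_ge0 => k _; exact: sqr_ge0.
have gle j : g j <= N%:R * ((\sum_(m < N) `|A j m| ^+ 2) * S).
  rewrite /g mulr_natl -[X in _ *+ X](card_ord N) -sumr_const.
  by apply: ler_sum => k _; exact: qcoconv_le.
have tail : \sum_(j < n') g j <= \sum_(j < n) g j + d * S.
  have dS : 0 <= d * S by rewrite mulr_ge0 // ltW.
  rewrite -!(big_mkord xpredT g).
  have [n'n|/ltnW nn'] := leqP n' n.
    rewrite (@big_cat_nat _ _ _ n' 0 n) //=.
    have : 0 <= \sum_(n' <= j < n) g j by apply: sumr_ge0.
    lra.
  rewrite (@big_cat_nat _ _ _ n 0 n') //= lerD2l.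
  apply: le_trans (_ : _ <= \sum_(n <= j < n') N%:R * ((\sum_(m < N) `|A j m| ^+ 2) * S)) _.
    by apply: ler_sum => j _; exact: gle.
  rewrite -mulr_sumr -mulr_suml mulrA; apply: ler_wpM2r => //.
  apply: le_trans (_ : _ <= N%:R * (d / (N%:R + 1))) _.
    by apply: ler_wpM2l => //; exact: hn.
  by rewrite mulrCA -[leRHS]mulr1 ler_pM2l // ler_pdivrMr // mul1r lerDl.
rewrite -/(g _) in hn'; move: hn' tail; rewrite /g.
move: (\sum_(j < n') _) (\sum_(j < n) _) => X Y; lra.
Qed.

Lemma qconv_delta (c : nat -> H) k :
  qconv c (fun m => if m is 0%N then 1 else 0) k = c k.
Proof.
rewrite /qconv big_ord_recr /= subnn mulr1 big1 ?add0r // => i _.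
by rewrite -(subnSK (ltn_ord i)) mulr0.
Qed.

(** Bound for the squared coefficients of the approximate columns, uniform in [N] because
    [(N + 1) / (N + 2) >= 1 / 2]. *)
Let K := 2 / eta ^+ 2.

Lemma approximate_solution N : exists c : nat -> nat -> H,
  [/\ forall m, (m <= N)%N -> exists n, forall n', (n <= n')%N ->
        \sum_(j < n') qconv (A j) (c j) m = (m == 0%N)%:R,
      forall u n M, (eta ^+ 2 * (N.+1%:R / N.+2%:R)) *
        (\sum_(k < M) \sum_(j < n) `|qconv (c j) u k| ^+ 2) <= \sum_(k < M) `|u k| ^+ 2 &
      forall n k, \sum_(j < n) `|c j k| ^+ 2 <= K].
Proof.
have N2 : 0 < N.+2%:R :> R by rewrite ltr0n.
(* Then [eta^2 - d = eta^2 (N + 1) / (N + 2)], which is positive and tends to [eta^2]. *)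
pose d := eta ^+ 2 / N.+2%:R; have d0 : 0 < d by rewrite divr_gt0 // exprn_gt0.
have [n hn] := finite_lower_bound N.+1 d0.
pose t : R := N.+1%:R / N.+2%:R; have t0 : 0 < t by rewrite divr_gt0 // ltr0n.
have eE : eta ^+ 2 - d = (eta * Num.sqrt t) ^+ 2.
  have x0 : N.+1%:R + 1 != 0 :> R by rewrite natr1 pnatr_eq0.
  rewrite exprMn sqr_sqrtr ?(ltW t0) // /d /t -[N.+2%:R]natr1.
  by move: x0; move: (N.+1%:R) => x x0; field.
have et0 : 0 < eta * Num.sqrt t by rewrite mulr_gt0 ?sqrtr_gt0.
have [|c [c1 c2]] := @leech_fin R N n A (eta * Num.sqrt t) et0.
  by move=> u; rewrite -eE; exact: hn.
have eE' : (eta * Num.sqrt t) ^+ 2 = eta ^+ 2 * t by rewrite exprMn sqr_sqrtr // ltW.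
rewrite eE' in c2.
pose c' j := if (j < n)%N then c j else fun=> 0.
have q0 (a : nat -> H) m : qconv a (fun=> 0) m = 0.
  by rewrite /qconv big1 // => k _; rewrite mulr0.
have q0' (a : nat -> H) m : qconv (fun=> 0) a m = 0.
  by rewrite /qconv big1 // => k _; rewrite mul0r.
have energy u n' M : (eta ^+ 2 * t) * (\sum_(k < M) \sum_(j < n') `|qconv (c' j) u k| ^+ 2) <=
    \sum_(k < M) `|u k| ^+ 2.
  apply: le_trans (c2 u M); apply: ler_wpM2l; first by rewrite mulr_ge0 ?exprn_ge0 ?(ltW eta0) ?(ltW t0).
  apply: ler_sum => k _.
  rewrite -(big_mkord xpredT (fun j => `|qconv (c' j) u k| ^+ 2)).
  apply: le_trans (_ : _ <= \sum_(0 <= j < maxn n' n) `|qconv (c' j) u k| ^+ 2) _.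
    rewrite [leRHS](@big_cat_nat _ _ _ n' 0) ?leq_maxl //= lerDl.
    by apply: sumr_ge0 => j _; exact: sqr_ge0.
  rewrite (@big_cat_nat _ _ _ n 0) ?leq_maxr //= [X in _ + X]big_nat [X in _ + X]big1 ?addr0.
    rewrite big_mkord; apply: ler_sum => j _; by rewrite /c' ltn_ord.
  by move=> j /andP[nj _]; rewrite /c' ltnNge nj /= q0' normr0 expr0n.
exists c'; split => // [m mN|n' k].
  exists n => n' nn'; rewrite -(c1 m mN).
  rewrite -(big_mkord xpredT (fun j => qconv (A j) (c' j) m)).
  rewrite (@big_cat_nat _ _ _ n 0) //= [X in _ + X]big_nat [X in _ + X]big1 ?addr0.
    by rewrite big_mkord; apply: eq_bigr => j _; rewrite /c' ltn_ord.
  by move=> j /andP[nj _]; rewrite /c' ltnNge nj /= q0.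
(* The input 1 returns the column itself, so the energy bound limits its coefficients. *)
have := energy (fun m => if m is 0%N then 1 else 0) n' k.+1.
rewrite [X in _ <= X -> _]big_ord_recl [X in _ + X]big1 ?addr0; last first.
  by move=> [i hi] _; rewrite /= normr0 expr0n.
rewrite normq1 expr1n big_ord_recr /= mulrDr => h.
have h0 : 0 <= eta ^+ 2 * t * \sum_(i < k) \sum_(j < n')
   `|qconv (c' j) (fun m => if m is 0%N then 1 else 0) i| ^+ 2.
  apply: mulr_ge0; first by rewrite mulr_ge0 ?exprn_ge0 ?(ltW eta0) ?(ltW t0).
  by apply: sumr_ge0 => i _; apply: sumr_ge0 => j _; exact: sqr_ge0.
have {}h : eta ^+ 2 * t * \sum_(j < n') `|c' j k| ^+ 2 <= 1.
  under eq_bigr do rewrite -qconv_delta.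
  lra.
rewrite /K ler_pdivlMr ?exprn_gt0 //.
have t2 : 1 / 2 <= t.
  rewrite /t ler_pdivlMr // -[N.+2%:R]natr1.
  have h1 : 1 <= N.+1%:R :> R by rewrite ler1n.
  move: h1; move: (N.+1%:R) => x h1; lra.
have S0 : 0 <= eta ^+ 2 * \sum_(j < n') `|c' j k| ^+ 2.
  by apply: mulr_ge0; [rewrite exprn_ge0 // ltW|apply: sumr_ge0 => j _; exact: sqr_ge0].
have := ler_wpM2r S0 t2; move: h; move: (\sum_(j < n') _) => X; lra.
Qed.

(** The norm bound involves finitely many coefficients and passes to the limit directly. In the
    equation the number of rows grows with [N]; the tail of the sum over [j] is small uniformly in
    [N], since the row coefficients have small tails and the columns obey the bound [K]. *)
Theorem corona_coefficients : exists c : nat -> nat -> H,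
  (forall m, (fun n => \sum_(j < n) qconv (A j) (c j) m) @ \oo --> ((m == 0%N)%:R : H)) /\
  forall u n M, eta ^+ 2 * (\sum_(k < M) \sum_(j < n) `|qconv (c j) u k| ^+ 2) <=
    \sum_(k < M) `|u k| ^+ 2.
Proof.
have [C hC] := choice approximate_solution.
have [U [UU oU]] := ultraFilterLemma (eventually_filter : ProperFilter \oo).
have UP : ProperFilter U by exact: ultra_proper.
have K0 : 0 <= K by rewrite divr_ge0 // exprn_ge0 // ltW.
have Cb N j k : `|C N j k| <= Num.sqrt K.
  have [_ _ /(_ j.+1 k)] := hC N; rewrite big_ord_recr /= => h.
  rewrite -[leLHS]ger0_norm // -sqrtr_sqr ler_wsqrtr //.
  have : 0 <= \sum_(i < j) `|C N i k| ^+ 2 by apply: sumr_ge0 => i _; exact: sqr_ge0.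
  lra.
have lim j : exists c : nat -> H, forall k, (fun N => C N j k) @ U --> c k.
  have [c hc] := choice (fun k => ultra_bounded_qcvg UU (fun N => Cb N j k)).
  by exists c.
have [c hc] := choice lim.
have qc j u k : (fun N => qconv (C N j) u k) @ U --> qconv (c j) u k.
  apply: (@cvg_filter_sum _ _ _ _ _ _ (fun l N => C N j l * u (k - l)%N)
    (fun l => c j l * u (k - l)%N)) => l _.
  exact: cvg_filterMr.
have qc' j a k : (fun N => qconv a (C N j) k) @ U --> qconv a (c j) k.
  apply: (@cvg_filter_sum _ _ _ _ _ _ (fun l N => a l * C N j (k - l)%N)
    (fun l => a l * c j (k - l)%N)) => l _.
  exact: cvg_filterMl.
have near_ge n0 : \forall N \near U, (n0 <= N)%N by apply: oU; exists n0.
exists c; split; last first.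
  move=> u n M; set S := \sum_(k < M) `|u k| ^+ 2.
  have S0 : 0 <= S by apply: sumr_ge0 => k _; exact: sqr_ge0.
  pose y N := eta ^+ 2 * (\sum_(k < M) \sum_(j < n) `|qconv (C N j) u k| ^+ 2).
  have cy : y @ U --> eta ^+ 2 * (\sum_(k < M) \sum_(j < n) `|qconv (c j) u k| ^+ 2).
    apply: cvgM; first exact: cvg_cst.
    apply: (@cvg_filter_sum _ _ _ _ _ _ (fun k N => \sum_(j < n) `|qconv (C N j) u k| ^+ 2)
      (fun k => \sum_(j < n) `|qconv (c j) u k| ^+ 2)) => k _.
    apply: (@cvg_filter_sum _ _ _ _ _ _ (fun j N => `|qconv (C N j) u k| ^+ 2)
      (fun j => `|qconv (c j) u k| ^+ 2)) => j _.
    have h : (fun N => `|qconv (C N j) u k| : R) @ U --> (`|qconv (c j) u k| : R).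
      by apply: cvg_norm; exact: qc.
    rewrite expr2 (_ : (fun N => _) = (fun N => `|qconv (C N j) u k|) \* (fun N => `|qconv (C N j) u k|)).
      have := cvgM h h; exact.
    by apply/funext => N; rewrite expr2.
  apply: (ultra_le UU cy) => e e0.
  have [n0 hn0] : exists n0 : nat, S / e < n0%:R.
    exists (Num.Def.archi_bound (S / e)).
    by apply: archi_boundP; rewrite divr_ge0 // ltW.
  apply: filterS (near_ge n0) => N n0N.
  have [_ /(_ u n M) h _] := hC N; rewrite -/S in h.
  have N1 : 0 < N.+1%:R :> R by rewrite ltr0n.
  have N2 : 0 < N.+2%:R :> R by rewrite ltr0n.
  have yN : N.+1%:R * y N <= N.+2%:R * S.
    have := ler_wpM2l (ltW N2) h; rewrite /y.
    move: (\sum_(k < M) _) => X.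
    have -> // : N.+2%:R * (eta ^+ 2 * (N.+1%:R / N.+2%:R) * X) = N.+1%:R * (eta ^+ 2 * X).
    by move: N2; move: (N.+1%:R) (N.+2%:R) => x1 x2 x20; field; rewrite gt_eqF.
  have Se : S <= N.+1%:R * e.
    rewrite -ler_pdivrMr //; apply/ltW/(lt_le_trans hn0); rewrite ler_nat.
    exact: leq_trans n0N (leqnSn N).
  rewrite -(ler_pM2l N1); apply: le_trans yN _.
  by rewrite -[N.+2%:R]natr1 mulrDl mul1r mulrDr lerD2l.
move=> m; apply/cvg_seqP => e e0.
pose e1 := e / 2 / m.+1%:R.
have m0 : 0 < m.+1%:R :> R by rewrite ltr0n.
have e10 : 0 < e1 by rewrite !divr_gt0.
(* Weight in [2 |a| |c| <= t |a|^2 + |c|^2 / t]: it makes the column part at most [e1] in each of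
   the [m + 1] degrees, after which [row_tail] makes the row part at most [e1]. *)
pose t := (K + 1) / e1; have t0 : 0 < t by rewrite divr_gt0 // ltr_wpDl.
have [n0 hn0] := row_tail m.+1 (divr_gt0 e10 t0).
exists n0 => n n0n.
suff : `|\sum_(j < n) qconv (A j) (c j) m - (m == 0%N)%:R| <= e / 2 by lra.
have cs : (fun N => `|\sum_(j < n) qconv (A j) (C N j) m - (m == 0%N)%:R|) @ U -->
    `|\sum_(j < n) qconv (A j) (c j) m - (m == 0%N)%:R|.
  apply: cvg_norm; apply: cvgB; last exact: cvg_cst.
  by apply: (@cvg_filter_sum _ _ _ _ _ _ (fun j N => qconv (A j) (C N j) m)
    (fun j => qconv (A j) (c j) m)) => j _.
apply: (ultra_le UU cs) => e2 e20; apply: filterS (near_ge m) => N mN.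
have [/(_ m mN)[n1 hn1] _ hK] := hC N.
pose n' := maxn n n1; rewrite -(hn1 n' (leq_maxr _ _)).
rewrite -!(big_mkord xpredT (fun j => qconv (A j) (C N j) m)).
rewrite (@big_cat_nat _ _ _ n 0 n') ?leq_maxl //= opprD addrA subrr add0r normrN.
apply: le_trans (ler_norm_sum _ _ _) _.
apply: le_trans (_ : _ <= \sum_(n <= j < n') \sum_(k < m.+1)
    (t * `|A j k| ^+ 2 + t^-1 * `|C N j (m - k)%N| ^+ 2) / 2) _.
  apply: ler_sum => j _; apply: le_trans (ler_norm_sum _ _ _) _.
  apply: ler_sum => k _; rewrite normqM ler_pdivlMr //.
  rewrite -subr_ge0 (_ : _ - _ = t^-1 * (t * `|A j k| - `|C N j (m - k)%N|) ^+ 2).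
    by rewrite mulr_ge0 ?sqr_ge0 // invr_ge0 ltW.
  by field; rewrite gt_eqF.
have cK k : \sum_(n <= j < n') `|C N j k| ^+ 2 <= K.
  apply: le_trans (hK n' k); rewrite -(big_mkord xpredT (fun j => `|C N j k| ^+ 2)).
  rewrite [leRHS](@big_cat_nat _ _ _ n 0 n') ?leq_maxl //= lerDr.
  by apply: sumr_ge0 => j _; exact: sqr_ge0.
have -> : \sum_(n <= j < n') \sum_(k < m.+1)
    (t * `|A j k| ^+ 2 + t^-1 * `|C N j (m - k)%N| ^+ 2) / 2 =
    (t * (\sum_(n <= j < n') \sum_(k < m.+1) `|A j k| ^+ 2) +
     t^-1 * \sum_(k < m.+1) \sum_(n <= j < n') `|C N j (m - k)%N| ^+ 2) / 2.
  rewrite [X in _ = (_ + _ * X) / _]exchange_big /=.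
  rewrite (eq_bigr (fun j => (t * (\sum_(k < m.+1) `|A j k| ^+ 2) +
      t^-1 * (\sum_(k < m.+1) `|C N j (m - k)%N| ^+ 2)) / 2)); last first.
    by move=> j _; rewrite -mulr_suml big_split /= -!mulr_sumr.
  by rewrite -mulr_suml big_split /= -!mulr_sumr.
have h1 : t * (\sum_(n <= j < n') \sum_(k < m.+1) `|A j k| ^+ 2) <= e1.
  by rewrite mulrC -ler_pdivlMr //; exact: hn0.
have h2 : t^-1 * \sum_(k < m.+1) \sum_(n <= j < n') `|C N j (m - k)%N| ^+ 2 <= m.+1%:R * e1.
  apply: le_trans (_ : _ <= t^-1 * \sum_(k < m.+1) K) _.
    by apply: ler_wpM2l; [rewrite invr_ge0 ltW|apply: ler_sum => k _; exact: cK].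
  rewrite sumr_const card_ord -[K *+ _]mulr_natl mulrCA ler_pM2l //.
  rewrite /t invf_div mulrC mulrA ler_pdivrMr ?ltr_wpDl // mulrC ler_pM2l // lerDl //.
have h3 : m.+1%:R * e1 = e / 2 by rewrite /e1 mulrC divfK // gt_eqF.
have h4 : e1 <= e / 2.
  rewrite -h3 -[leLHS]mul1r ler_pM2r // ler1n //.
move: h1 h2; move: (_ * \sum_(n <= j < n') _) (_ * \sum_(k < m.+1) _) => X Y.
rewrite h3; lra.
Qed.

End CoronaCoefficients.

(** * The row multiplier and its adjoint on coefficients *)

Section SquareSummable.
Variable R : realType.
Local Notation H := (quat R).
Implicit Types (a b u v w : nat -> H) (C D : R).

Definition l2_le a C := forall M, \sum_(m < M) `|a m| ^+ 2 <= C.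

Definition inner a b : H := limn (series (fun m => quat_conj (a m) * b m)).

Lemma l2_le0 a C : l2_le a C -> 0 <= C.
Proof. by move=> /(_ 0%N); rewrite big_ord0. Qed.

Lemma l2_term a C m : l2_le a C -> `|a m| ^+ 2 <= C.
Proof.
move=> /(_ m.+1); rewrite big_ord_recr /= => h.
have : 0 <= \sum_(i < m) `|a i| ^+ 2 by apply: sumr_ge0 => i _; exact: sqr_ge0.
lra.
Qed.

Lemma l2_abs_bounded a b C D : l2_le a C -> l2_le b D ->
  abs_bounded (fun m => quat_conj (a m) * b m) ((C + D) / 2).
Proof.
move=> ha hb n; rewrite big_mkord.
apply: le_trans (_ : _ <= \sum_(m < n) (`|a m| ^+ 2 + `|b m| ^+ 2) / 2) _.
  apply: ler_sum => m _; rewrite normqM norm_qconj ler_pdivlMr //.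
  by have := sqr_ge0 (`|a m| - `|b m|); lra.
rewrite -mulr_suml big_split /=; apply: ler_wpM2r => //.
by apply: lerD; [exact: ha|exact: hb].
Qed.

Lemma inner_cvg a b C D : l2_le a C -> l2_le b D ->
  series (fun m => quat_conj (a m) * b m) @ \oo --> inner a b.
Proof.
move=> ha hb; have [l hl] := qseries_cvg (l2_abs_bounded ha hb).
by rewrite /inner (cvg_lim _ hl).
Qed.

Lemma inner_le a b C D : l2_le a C -> l2_le b D -> `|inner a b| ^+ 2 <= C * D.
Proof.
move=> ha hb.
have CD0 : 0 <= C * D by rewrite mulr_ge0 // ?(l2_le0 ha) // (l2_le0 hb).
rewrite -(sqr_sqrtr CD0) ler_pXn2r ?nnegrE ?sqrtr_ge0 //.
apply: (cvg_le_norm (inner_cvg ha hb)) => n.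
rewrite -[leLHS]ger0_norm // -sqrtr_sqr ler_wsqrtr // /series /= big_mkord.
apply: le_trans (norm_sum_CS n (fun m => quat_conj (a m)) b) _.
apply: ler_pM; [exact: sumr_ge0|exact: sumr_ge0| |exact: hb].
by under eq_bigr do rewrite norm_qconj; exact: ha.
Qed.

Lemma l2_le_D a b C D : l2_le a C -> l2_le b D ->
  l2_le (fun m => a m + b m) (2 * C + 2 * D).
Proof.
move=> ha hb M.
apply: le_trans (_ : _ <= \sum_(m < M) (2 * `|a m| ^+ 2 + 2 * `|b m| ^+ 2)) _.
  apply: ler_sum => m _; apply: le_trans (sqr_normD_le _ _ ltr01) _.
  by rewrite invr1.
rewrite big_split /= -!mulr_sumr; apply: lerD; apply: ler_wpM2l => //.
  exact: ha.
exact: hb.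
Qed.

Lemma l2_le_N a C : l2_le a C -> l2_le (fun m => - a m) C.
Proof. by move=> ha M; under eq_bigr do rewrite normrN; exact: ha. Qed.

Lemma innerBl a b u C D E : l2_le a C -> l2_le b D -> l2_le u E ->
  inner (fun m => a m - b m) u = inner a u - inner b u.
Proof.
move=> ha hb hu; have hab := l2_le_D ha (l2_le_N hb).
apply: (cvg_uniq (inner_cvg hab hu)).
have := series_cvgD (inner_cvg ha hu) (series_cvgN (inner_cvg hb hu)).
rewrite (_ : (fun m => _ - _) = (fun m => quat_conj (a m - b m) * u m)) //.
by apply/funext => m; rewrite qconjB mulrBl.
Qed.

Lemma inner_suml n (a : nat -> nat -> H) (C : nat -> R) u E :
  (forall j, l2_le (a j) (C j)) -> l2_le u E ->
  inner (fun m => \sum_(j < n) a j m) u = \sum_(j < n) inner (a j) u.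
Proof.
move=> ha hu.
have h : series (fun m => \sum_(j < n) (fun j m => quat_conj (a j m) * u m) j m) @ \oo -->
    \sum_(j < n) inner (a j) u.
  apply: (series_cvg_sum (T := fun j m => quat_conj (a j m) * u m)
    (t := fun j => inner (a j) u)) => j.
  exact: inner_cvg (ha j) hu.
rewrite /inner (cvg_lim _ (_ : _ --> \sum_(j < n) inner (a j) u)) //.
rewrite (_ : (fun m => _) = (fun m => \sum_(j < n) quat_conj (a j m) * u m)) //.
by apply/funext => m; rewrite qconj_sum mulr_suml.
Qed.

Lemma inner_self a C : l2_le a C ->
  exists2 s : R, inner a a = s%:A & series (fun m => `|a m| ^+ 2) @ \oo --> s.
Proof.
move=> ha; have [|s hs] := @abs_bounded_cvg R (fun m => `|a m| ^+ 2) C.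
  by move=> n; rewrite big_mkord; under eq_bigr do rewrite ger0_norm ?sqr_ge0 //; exact: ha.
exists s => //; apply: (cvg_uniq (inner_cvg ha ha)).
move/cvg_seqP: hs => hs; apply/cvg_seqP => e /hs[N hN]; exists N => n /hN.
rewrite (_ : series (fun m => quat_conj (a m) * a m) n = (series (fun m => `|a m| ^+ 2) n)%:A).
  by rewrite -scalerBl norm_alg.
by rewrite /series /= scaler_suml; apply: eq_bigr => m _; rewrite mul_conjq.
Qed.

Lemma series_ge_partial (x : nat -> R) s n : (forall m, 0 <= x m) ->
  series x @ \oo --> s -> \sum_(m < n) x m <= s.
Proof.
move=> x0 /cvg_seqP hs; apply/ler_addgt0Pr => e /hs[N hN].
have := hN (maxn n N) (leq_maxr _ _).
have : \sum_(m < n) x m <= series x (maxn n N).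
  rewrite /series /= (@big_cat_nat _ _ _ n 0) ?leq_maxl //= big_mkord lerDl.
  exact: sumr_ge0.
have := ler_norm (series x (maxn n N) - s); lra.
Qed.

Lemma series_le_bound (x : nat -> R) s C :
  (forall n, \sum_(m < n) x m <= C) -> series x @ \oo --> s -> s <= C.
Proof.
move=> xC /cvg_seqP hs; apply/ler_addgt0Pr => e /hs[N /(_ N (leqnn N))].
have := xC N; rewrite /series /= big_mkord.
have := ler_norm (s - \sum_(m < N) x m); rewrite distrC; lra.
Qed.

Definition sqsum a : R := qre (inner a a).

Lemma sqsum_cvg a C : l2_le a C -> series (fun m => `|a m| ^+ 2) @ \oo --> sqsum a.
Proof. by move=> /inner_self[s E hs]; rewrite /sqsum E /= mulr1. Qed.

Lemma inner_sqsum a C : l2_le a C -> inner a a = (sqsum a)%:A.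
Proof. by move=> /inner_self[s E hs]; rewrite /sqsum E /= mulr1. Qed.

Lemma l2_le_sqsum a C : l2_le a C -> l2_le a (sqsum a).
Proof.
by move=> /sqsum_cvg ha M; apply: (series_ge_partial _ _ ha) => m; exact: sqr_ge0.
Qed.

Lemma sqsum_ge0 a C : l2_le a C -> 0 <= sqsum a.
Proof. by move=> /l2_le_sqsum/l2_le0. Qed.

Lemma sqsum_le a C : l2_le a C -> sqsum a <= C.
Proof. by move=> ha; exact: (series_le_bound ha (sqsum_cvg ha)). Qed.

Lemma l2_tail a C e : l2_le a C -> 0 < e ->
  exists N0, forall N, (N0 <= N)%N -> l2_le (fun m => a m - trunc N a m) e.
Proof.
move=> ha e0.
have [|N0 hN0] := @abs_bounded_tail R (fun m => `|a m| ^+ 2) C (fun m => sqr_ge0 _) _ e e0.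
  by move=> n; rewrite big_mkord; exact: ha.
exists N0 => N NN M; apply: le_trans (hN0 N NN M).
rewrite -(big_mkord xpredT (fun m => `|a m - trunc N a m| ^+ 2)).
have [MN|NM] := leqP M N.
  rewrite [leRHS]big_geq // big_nat big1 // => m /andP[_ mM].
  by rewrite /trunc (leq_trans mM MN) subrr normr0 expr0n.
rewrite (@big_cat_nat _ _ _ N 0) ?(ltnW NM) //= [X in X + _]big_nat [X in X + _]big1 ?add0r.
  rewrite [leLHS]big_nat [leRHS]big_nat; apply: ler_sum => m /andP[Nm _].
  by rewrite /trunc ltnNge Nm /= subr0.
by move=> m /andP[_ mN]; rewrite /trunc mN subrr normr0 expr0n.
Qed.

Lemma l2_le_trunc a C N : l2_le a C -> l2_le (trunc N a) C.
Proof.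
move=> ha M; apply: le_trans (ha M); apply: ler_sum => m _.
by rewrite /trunc; case: ifP => // _; rewrite normr0 expr0n sqr_ge0.
Qed.

Lemma l2_le_shift a C k : l2_le a C -> l2_le (fun l => a (k + l)%N) C.
Proof.
move=> ha M; apply: le_trans (ha (k + M)%N).
by rewrite big_split_ord /= lerDr; apply: sumr_ge0 => m _; exact: sqr_ge0.
Qed.

(** Degree [m] sees only the coefficients up to [m], so associativity is inherited from polynomials
    cut off after that degree. *)
Lemma qconvA a b u m : qconv (qconv a b) u m = qconv a (qconv b u) m.
Proof.
pose N := m.+1.
pose P (x : nat -> H) := \poly_(i < N) x i.
have hP x i : (i < N)%N -> (P x)`_i = x i by move=> iN; rewrite coef_poly iN.
have hM x y i : (i < N)%N -> (P x * P y)`_i = qconv x y i.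
  move=> iN; rewrite coefM; apply: eq_bigr => k _; rewrite !hP //.
    exact: leq_ltn_trans (leq_subr _ _) iN.
  exact: leq_trans (ltn_ord k) iN.
have lt (k : 'I_m.+1) : (m - k < N)%N by rewrite /N ltnS leq_subr.
transitivity ((P a * P b * P u)`_m).
  by rewrite coefM; apply: eq_bigr => k _; rewrite hM // hP.
by rewrite -mulrA coefM; apply: eq_bigr => k _; rewrite hM // hP.
Qed.

(** Coefficient [k] of the adjoint of convolution by [a]; it is the limit of [qcoconv M a u k] as
    [M] grows. *)
Definition coadj a u k : H := inner a (fun l => u (k + l)%N).

Lemma qcoconvE M a u k : qcoconv M a u k =
  \sum_(0 <= l < M - k) quat_conj (a l) * u (k + l)%N.
Proof.
rewrite /qcoconv -(big_mkord (fun m => (k <= m)%N) (fun m => quat_conj (a (m - k)%N) * u m)).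
have [Mk|kM] := leqP M k.
  rewrite (eqP (Mk : (M - k)%N == 0%N)) [RHS]big_geq // big_nat_cond big1 // => m.
  by case/andP => /andP[_ mM] km; move: (leq_trans mM Mk); rewrite ltnNge km.
rewrite (@big_cat_nat _ _ _ k 0) ?(ltnW kM) //= [X in X + _]big_nat_cond.
rewrite [X in X + _]big1 ?add0r; last first.
  by move=> m /andP[/andP[_ mk]]; rewrite leqNgt mk.
rewrite -{1}[k]add0n big_addn big_nat_cond [RHS]big_nat_cond.
apply: congr_big => // [l|l _]; first by rewrite leq_addl andbT.
by rewrite addnK addnC.
Qed.

Lemma coadj_cvg a u C D k : l2_le a C -> l2_le u D ->
  (fun M => qcoconv M a u k) @ \oo --> coadj a u k.
Proof.
move=> ha hu; have /cvg_seqP h := inner_cvg ha (l2_le_shift k hu).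
apply/cvg_seqP => e /h[N hN]; exists (N + k)%N => n nN.
by rewrite qcoconvE; apply: hN; rewrite leq_subRL ?(leq_trans (leq_addl N k) nN) // addnC.
Qed.

Lemma qcoconv_trunc n M a u k : (M <= n)%N -> qcoconv n a (trunc M u) k = qcoconv M a u k.
Proof.
move=> Mn; rewrite /qcoconv.
rewrite -(big_mkord (fun m => (k <= m)%N) (fun m => quat_conj (a (m - k)%N) * trunc M u m)).
rewrite (@big_cat_nat _ _ _ M 0) //= [X in _ + X]big_nat_cond [X in _ + X]big1 ?addr0.
  rewrite big_mkord; apply: eq_bigr => m _; by rewrite /trunc ltn_ord.
by move=> m /andP[/andP[Mm _] _]; rewrite trunc_ge // mulr0.
Qed.

Lemma qcoconv_ge N a u k : (N <= k)%N -> qcoconv N a u k = 0.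
Proof.
move=> Nk; rewrite /qcoconv big1 // => m km.
by move: (leq_trans (ltn_ord m) Nk); rewrite ltnNge km.
Qed.

Lemma coadj_of_trunc a u C D M k : l2_le a C -> l2_le (trunc M u) D ->
  coadj a (trunc M u) k = qcoconv M a u k.
Proof.
move=> ha hu; apply: (cvg_uniq (coadj_cvg (k:=k) ha hu)).
apply/cvg_seqP => e e0; exists M => n Mn.
by rewrite qcoconv_trunc // subrr normr0.
Qed.

Lemma l2_le_finite a N : (forall k, (N <= k)%N -> a k = 0) ->
  l2_le a (\sum_(k < N) `|a k| ^+ 2).
Proof.
move=> a0 M; have [NM|MN] := leqP N M.
  rewrite -(big_mkord xpredT (fun m => `|a m| ^+ 2)) (@big_cat_nat _ _ _ N 0) //=.
  rewrite [X in _ + X]big_nat [X in _ + X]big1 ?addr0 ?big_mkord //.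
  by move=> m /andP[Nm _]; rewrite a0 // normr0 expr0n.
rewrite -[leRHS](big_mkord xpredT (fun m => `|a m| ^+ 2)) (@big_cat_nat _ _ _ M 0) ?(ltnW MN) //=.
by rewrite big_mkord lerDl; apply: sumr_ge0 => m _; exact: sqr_ge0.
Qed.

Lemma coadj_trunc a u C D M k : l2_le a C -> l2_le u D ->
  coadj a (fun m => u m - trunc M u m) k = coadj a u k - qcoconv M a u k.
Proof.
move=> ha hu.
have hd : l2_le (fun m => u m - trunc M u m) (2 * D + 2 * D).
  exact: l2_le_D hu (l2_le_N (l2_le_trunc M hu)).
apply: (cvg_uniq (coadj_cvg (k:=k) ha hd)).
have h := coadj_cvg (k:=k) ha hu.
have h' : (fun=> qcoconv M a u k) @ \oo --> qcoconv M a u k by exact: cvg_cst.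
have h2 : (fun M' => qcoconv M' a u k - qcoconv M a u k) @ \oo -->
    coadj a u k - qcoconv M a u k by exact: (cvgB h h').
apply/cvg_seqP => e /((cvg_seqP _ _).1 h2)[N hN].
exists (maxn N M) => n; rewrite geq_max => /andP[Nn Mn]; have := hN n Nn.
rewrite (_ : qcoconv n a (fun m => u m - trunc M u m) k = qcoconv n a u k - qcoconv M a u k) //.
rewrite -(qcoconv_trunc a u k Mn) /qcoconv; under eq_bigr do rewrite mulrBr.
by rewrite sumrB.
Qed.

(** Convolution is lower triangular, so the adjoint relation is exact on each finite section. *)
Lemma qconv_qcoconv a h u M :
  \sum_(m < M) quat_conj (qconv a h m) * u m =
  \sum_(k < M) quat_conj (h k) * qcoconv M a u k.
Proof.
have E (m : 'I_M) : qconv a h m = \sum_(k < M | (k <= m)%N) a (m - k)%N * h k.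
  rewrite qconv_rev (big_ord_widen M (fun l => a (m - l)%N * h l)) //; exact: eq_bigl.
under eq_bigr do rewrite E qconj_sum mulr_suml big_mkcond /=.
rewrite exchange_big /=; apply: eq_bigr => k _.
rewrite /qcoconv mulr_sumr [RHS]big_mkcond /=; apply: eq_bigr => m _.
by case: ifP => //; rewrite qconjM mulrA.
Qed.

End SquareSummable.

(** * Limits and duality for the row operator *)

Section RowOperator.
Variable R : realType.
Local Notation H := (quat R).
Implicit Types (a b u v w : nat -> H) (C D : R).
Variable A : nat -> nat -> H.
Hypothesis A1 : forall n M, \sum_(j < n) \sum_(m < M) `|A j m| ^+ 2 <= 1.
Hypothesis RB : forall (h : nat -> nat -> H) n M,
  \sum_(m < M) `|\sum_(j < n) qconv (A j) (h j) m| ^+ 2 <=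
  4 * \sum_(j < n) \sum_(l < M) `|h j l| ^+ 2.

Definition fam_le (h : nat -> nat -> H) C :=
  forall n M, \sum_(j < n) \sum_(l < M) `|h j l| ^+ 2 <= C.

Lemma fam_le_l2 h C j : fam_le h C -> l2_le (h j) C.
Proof.
move=> hC M; have := hC j.+1 M; rewrite big_ord_recr /=.
have : 0 <= \sum_(i < j) \sum_(l < M) `|h i l| ^+ 2.
  by apply: sumr_ge0 => i _; apply: sumr_ge0 => l _; exact: sqr_ge0.
move: (\sum_(i < j) _) (\sum_(l < M) _) => X Y; lra.
Qed.

Lemma fam_le_sqsum h C n : fam_le h C -> \sum_(j < n) sqsum (h j) <= C.
Proof.
move=> hC.
have hsum : (fun M => \sum_(j < n) series (fun m => `|h j m| ^+ 2) M) @ \oo -->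
    \sum_(j < n) sqsum (h j).
  apply: (cvg_filter_sum _ (u := fun j => series (fun m => `|h j m| ^+ 2))
    (l := fun j => sqsum (h j))) => j _.
  exact: sqsum_cvg (fam_le_l2 j hC).
apply/ler_addgt0Pr => d /((cvg_seqP _ _).1 hsum)[N /(_ N (leqnn N))].
have := hC n N; rewrite (_ : \sum_(j < n) series _ N = \sum_(j < n) \sum_(l < N) `|h j l| ^+ 2).
  set Y := \sum_(j < n) \sum_(l < N) _; set X := \sum_(j < n) sqsum _.
  have := ler_norm (X - Y); rewrite distrC; lra.
by apply: eq_bigr => j _; rewrite /series /= big_mkord.
Qed.

Lemma A_l2 j : l2_le (A j) 1. Proof. exact: (fam_le_l2 j A1). Qed.

Lemma row_abs_summable h C m : fam_le h C ->
  abs_bounded (fun j => qconv (A j) (h j) m) (m.+1%:R * ((1 + C) / 2)).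
Proof.
move=> hC n; rewrite big_mkord mulr_natl -[m.+1 in leRHS]card_ord -sumr_const.
apply: le_trans (_ : _ <= \sum_(j < n) \sum_(k < m.+1) (`|A j k| ^+ 2 + `|h j (m - k)%N| ^+ 2) / 2) _.
  apply: ler_sum => j _; apply: le_trans (ler_norm_sum _ _ _) _; apply: ler_sum => k _.
  by rewrite normqM ler_pdivlMr //; have := sqr_ge0 (`|A j k| - `|h j (m - k)%N|); lra.
rewrite exchange_big /=; apply: ler_sum => k _; rewrite -mulr_suml big_split /=.
apply: ler_wpM2r => //; apply: lerD.
  apply: le_trans (A1 n k.+1); apply: ler_sum => j _.
  by rewrite big_ord_recr /= lerDr; apply: sumr_ge0 => l _; exact: sqr_ge0.
apply: le_trans (hC n (m - k).+1); apply: ler_sum => j _.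
by rewrite big_ord_recr /= lerDr; apply: sumr_ge0 => l _; exact: sqr_ge0.
Qed.

Lemma fam_tail h C e :  fam_le h C -> 0 < e -> exists N0, forall N, (N0 <= N)%N ->
  forall n M, \sum_(N <= j < n) \sum_(l < M) `|h j l| ^+ 2 <= e.
Proof.
move=> hC e0.
have hl j := fam_le_l2 j hC.
have hs n : \sum_(0 <= j < n) sqsum (h j) <= C by rewrite big_mkord; exact: (fam_le_sqsum n hC).
have [N0 hN0] := @abs_bounded_tail R (fun j => sqsum (h j)) C (fun j => sqsum_ge0 (hl j)) hs e e0.
exists N0 => N NN n M; apply: le_trans (hN0 N NN n); apply: ler_sum => j _.
exact: l2_le_sqsum (hl j) M.
Qed.

(** The limit is formed degree by degree, where convergence is absolute; [RB], applied to the family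
    with its first [N] members removed, then gives convergence in norm. *)
Lemma row_limit h C : fam_le h C -> exists s : nat -> H,
  (forall m, series (fun j => qconv (A j) (h j) m) @ \oo --> s m) /\
  forall e, 0 < e -> exists N0, forall N, (N0 <= N)%N ->
    l2_le (fun m => \sum_(j < N) qconv (A j) (h j) m - s m) e.
Proof.
move=> hC.
have [s hs] := choice (fun m => qseries_cvg (row_abs_summable m hC)).
exists s; split => // e e0.
have e8 : 0 < e / 4 by rewrite divr_gt0.
have [N0 hN0] := fam_tail hC e8; exists N0 => N NN M.
have cs : (fun n => \sum_(m < M) `|\sum_(j < N) qconv (A j) (h j) m - series (fun j => qconv (A j) (h j) m) n| ^+ 2) @ \oo -->
    \sum_(m < M) `|\sum_(j < N) qconv (A j) (h j) m - s m| ^+ 2.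
  apply: (cvg_filter_sum _ (u := fun m n => `|\sum_(j < N) qconv (A j) (h j) m -
     series (fun j => qconv (A j) (h j) m) n| ^+ 2)
     (l := fun m => `|\sum_(j < N) qconv (A j) (h j) m - s m| ^+ 2)) => m _.
  pose g n := `|\sum_(j < N) qconv (A j) (h j) m - series (fun j => qconv (A j) (h j) m) n|.
  have cg : (g : nat -> R) @ \oo --> (`|\sum_(j < N) qconv (A j) (h j) m - s m| : R).
    by apply: cvg_norm; apply: cvgB; [exact: cvg_cst|exact: hs].
  rewrite expr2 (_ : (fun n => _) = g \* g); first by have := cvgM cg cg; exact.
  by apply/funext => n; rewrite expr2.
apply/ler_addgt0Pr => d /((cvg_seqP _ _).1 cs)[N1 hN1].
have := hN1 (maxn N N1) (leq_maxr _ _).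
set n := maxn N N1; have Nn : (N <= n)%N by exact: leq_maxl.
have : \sum_(m < M) `|\sum_(j < N) qconv (A j) (h j) m - series (fun j => qconv (A j) (h j) m) n| ^+ 2 <= e.
  pose h' j := if (N <= j)%N then h j else fun=> 0.
  have q0 (a : nat -> H) m : qconv a (fun=> 0) m = 0.
    by rewrite /qconv big1 // => k _; rewrite mulr0.
  have E m : \sum_(j < N) qconv (A j) (h j) m - series (fun j => qconv (A j) (h j) m) n =
      - \sum_(j < n) qconv (A j) (h' j) m.
    rewrite /series /= (@big_cat_nat _ _ _ N 0) //= big_mkord opprD addrA subrr add0r.
    rewrite -(big_mkord xpredT (fun j => qconv (A j) (h' j) m)) (@big_cat_nat _ _ _ N 0) //=.
    rewrite [X in _ = - (X + _)]big_nat [X in _ = - (X + _)]big1 ?add0r.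
      congr (- _); rewrite big_nat [RHS]big_nat; apply: eq_bigr => j /andP[Nj _].
      by rewrite /h' Nj.
    by move=> j /andP[_ jN]; rewrite /h' leqNgt jN /= q0.
  under eq_bigr do rewrite E normrN.
  apply: le_trans (RB h' n M) _.
  rewrite mulrC -ler_pdivlMr //.
  apply: le_trans (hN0 N NN n M).
  rewrite -(big_mkord xpredT (fun j => \sum_(l < M) `|h' j l| ^+ 2)) (@big_cat_nat _ _ _ N 0) //=.
  rewrite [X in X + _]big_nat [X in X + _]big1 ?add0r; last first.
    by move=> j /andP[_ jN]; rewrite /h' leqNgt jN /= big1 // => l _; rewrite normr0 expr0n.
  rewrite big_nat [leRHS]big_nat; apply: ler_sum => j /andP[Nj _].
  by rewrite /h' Nj.
set X := \sum_(m < M) _; set Y := \sum_(m < M) _ => h1 h2.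
have := ler_norm (Y - X); rewrite distrC; lra.
Qed.

(** Duality: feeding the row with the adjoint image of [u] gives [s] with [<s, u> = X] and, by [RB],
    [|s|^2 <= 4 X]; hence [X^2 <= 4 X U]. *)
Lemma qcoconv_row_le u n M :
  \sum_(j < n) \sum_(k < M) `|qcoconv M (A j) u k| ^+ 2 <= 4 * \sum_(m < M) `|u m| ^+ 2.
Proof.
set X := \sum_(j < n) _; set U := \sum_(m < M) _.
pose h j := qcoconv M (A j) u.
pose s m := \sum_(j < n) qconv (A j) (h j) m.
have X0 : 0 <= X by apply: sumr_ge0 => j _; apply: sumr_ge0 => k _; exact: sqr_ge0.
have U0 : 0 <= U by apply: sumr_ge0 => k _; exact: sqr_ge0.
have E : \sum_(m < M) quat_conj (s m) * u m = X%:A.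
  under eq_bigr do rewrite qconj_sum mulr_suml.
  rewrite exchange_big /= scaler_suml; apply: eq_bigr => j _.
  rewrite qconv_qcoconv scaler_suml; apply: eq_bigr => k _.
  by rewrite mul_conjq.
have := norm_sum_CS M (fun m => quat_conj (s m)) u.
rewrite /= E norm_alg ger0_norm //; under [X in _ <= X * _]eq_bigr do rewrite norm_qconj.
have := RB h n M; rewrite -/X -/U.
set S := \sum_(m < M) `|_| ^+ 2 => hS hX.
have : X ^+ 2 <= 4 * X * U by apply: le_trans hX _; apply: ler_wpM2r.
have [->|Xn] := eqVneq X 0; first by move=> _; lra.
have Xp : 0 < X by rewrite lt_def Xn.
by rewrite expr2 (_ : 4 * X * U = X * (4 * U)) ?ler_pM2l //; ring.
Qed.

Lemma coadj_fam_le u C : l2_le u C -> fam_le (fun j => coadj (A j) u) (4 * C).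
Proof.
move=> hu n M.
have cs : (fun M' => \sum_(j < n) \sum_(k < M) `|qcoconv M' (A j) u k| ^+ 2) @ \oo -->
   \sum_(j < n) \sum_(k < M) `|coadj (A j) u k| ^+ 2.
  apply: (cvg_filter_sum _ (u := fun j M' => \sum_(k < M) `|qcoconv M' (A j) u k| ^+ 2)
     (l := fun j => \sum_(k < M) `|coadj (A j) u k| ^+ 2)) => j _.
  apply: (cvg_filter_sum _ (u := fun k M' => `|qcoconv M' (A j) u k| ^+ 2)
     (l := fun k => `|coadj (A j) u k| ^+ 2)) => k _.
  have cg : ((fun M' => `|qcoconv M' (A j) u k|) : nat -> R) @ \oo --> (`|coadj (A j) u k| : R).
    by apply: cvg_norm; exact: coadj_cvg (A_l2 j) hu.
  by have := cvgM cg cg; exact.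
apply/ler_addgt0Pr => d /((cvg_seqP _ _).1 cs)[N /(_ (maxn N M) (leq_maxl _ _))].
have : \sum_(j < n) \sum_(k < M) `|qcoconv (maxn N M) (A j) u k| ^+ 2 <= 4 * C.
  apply: le_trans (_ : _ <= 4 * \sum_(m < maxn N M) `|u m| ^+ 2) _; last first.
    by apply: ler_wpM2l => //; exact: hu.
  apply: le_trans (qcoconv_row_le u n (maxn N M)); apply: ler_sum => j _.
  rewrite -[leRHS](big_mkord xpredT (fun k => `|qcoconv (maxn N M) (A j) u k| ^+ 2)).
  rewrite (@big_cat_nat _ _ _ M 0) ?leq_maxr //= big_mkord lerDl.
  by apply: sumr_ge0 => k _; exact: sqr_ge0.
set X := \sum_(j < n) _; set Y := \sum_(j < n) _ => h1 h2.
have := ler_norm (Y - X); rewrite distrC; lra.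
Qed.

Lemma qconv_l2_le j h C : l2_le h C -> l2_le (qconv (A j) h) (4 * C).
Proof.
move=> hh M; pose h' i := if i == j then h else fun=> 0.
have q0 (a : nat -> H) m : qconv a (fun=> 0) m = 0.
  by rewrite /qconv big1 // => k _; rewrite mulr0.
have Z (F : nat -> R) : (forall i, i != j -> F i = 0) -> \sum_(i < j.+1) F i = F j.
  by move=> F0; rewrite big_ord_recr /= big1 ?add0r // => i _; rewrite F0 // ltn_eqF.
have ZH (F : nat -> H) : (forall i, i != j -> F i = 0) -> \sum_(i < j.+1) F i = F j.
  by move=> F0; rewrite big_ord_recr /= big1 ?add0r // => i _; rewrite F0 // ltn_eqF.
have := RB h' j.+1 M.
rewrite (Z (fun i => \sum_(l < M) `|h' i l| ^+ 2)); last first.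
  by move=> i /negPf ij; rewrite /h' ij big1 // => l _; rewrite normr0 expr0n.
under eq_bigr => m _.
  rewrite (ZH (fun i => qconv (A i) (h' i) m)); last first.
    by move=> i /negPf ij; rewrite /h' ij q0.
  over.
rewrite /h' eqxx => hM; apply: le_trans hM _; apply: ler_wpM2l => //; exact: hh.
Qed.

(** [qconv_qcoconv] settles the identity on finite sections; what is left pairs [h] with the adjoint
    image of the tail of [u], which is small by [coadj_fam_le]. *)
Lemma inner_coadj j h u C D : l2_le h C -> l2_le u D ->
  inner (qconv (A j) h) u = inner h (coadj (A j) u).
Proof.
move=> hh hu; have hw := fam_le_l2 j (coadj_fam_le hu).
have c1 := inner_cvg (qconv_l2_le j hh) hu; have c2 := inner_cvg hh hw.
apply: (cvg_uniq c1); apply/cvg_seqP => e e0.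
have e20 : 0 < e / 2 by rewrite divr_gt0.
have C1 : 0 < C + 1 by rewrite ltr_wpDl // (l2_le0 hh).
pose t := (e / 2) ^+ 2 / (8 * (C + 1)).
have t0 : 0 < t by rewrite divr_gt0 ?exprn_gt0 // mulr_gt0.
have [N0 hN0] := l2_tail hu t0.
have /cvg_seqP/(_ _ e20)[N1 hN1] := c2.
exists (maxn N0 N1) => n; rewrite geq_max => /andP[n0 n1].
have h1 := hN1 n n1.
have hd := fam_le_l2 j (coadj_fam_le (hN0 n n0)).
have E : series (fun m => quat_conj (qconv (A j) h m) * u m) n -
    series (fun m => quat_conj (h m) * coadj (A j) u m) n =
    - \sum_(k < n) quat_conj (h k) * coadj (A j) (fun m => u m - trunc n u m) k.
  rewrite /series /= !big_mkord qconv_qcoconv -sumrB -sumrN; apply: eq_bigr => k _.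
  by rewrite (coadj_trunc n k (A_l2 j) hu) -mulrBr -mulrN opprB.
have h2 : `|\sum_(k < n) quat_conj (h k) * coadj (A j) (fun m => u m - trunc n u m) k| < e / 2.
  rewrite -(ltr_pXn2r (n := 2)) ?nnegrE //; last exact: ltW.
  apply: le_lt_trans (norm_sum_CS n (fun k => quat_conj (h k)) _) _.
  under [X in X * _]eq_bigr do rewrite norm_qconj.
  apply: le_lt_trans (_ : _ <= C * (4 * t)) _.
    by apply: ler_pM; [exact: sumr_ge0|exact: sumr_ge0|exact: hh|exact: hd].
  apply: lt_le_trans (_ : _ < (C + 1) * (8 * t)) _.
    apply: le_lt_trans (_ : _ <= C * (8 * t)) _.
      apply: ler_wpM2l; [exact: l2_le0 hh|lra].
    by rewrite ltr_pM2r ?ltrDl // mulr_gt0.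
  by rewrite /t (_ : _ * _ = (e / 2) ^+ 2) //; field; rewrite gt_eqF.
have -> : series (fun m => quat_conj (qconv (A j) h m) * u m) n - inner h (coadj (A j) u) =
   (series (fun m => quat_conj (qconv (A j) h m) * u m) n -
    series (fun m => quat_conj (h m) * coadj (A j) u m) n) +
   (series (fun m => quat_conj (h m) * coadj (A j) u m) n - inner h (coadj (A j) u)).
  by rewrite addrA subrK.
rewrite E (splitr e); apply: le_lt_trans (ler_normD _ _) _; rewrite normrN.
exact: ltrD.
Qed.

Lemma l2_of_approx s x e D : l2_le (fun m => x m - s m) e -> l2_le x D ->
  l2_le s (2 * D + 2 * e).
Proof.
move=> hs hx; have := l2_le_D hx (l2_le_N hs).
by rewrite (_ : (fun m => _) = s) //; apply/funext => m; rewrite opprB addrCA subrr addr0.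
Qed.

Lemma row_sum_l2 h C N : fam_le h C ->
  l2_le (fun m => \sum_(j < N) qconv (A j) (h j) m) (4 * C).
Proof.
by move=> hC M; apply: le_trans (RB h N M) _; apply: ler_wpM2l => //; exact: hC.
Qed.

Lemma row_limit_l2 h C s : fam_le h C ->
  (forall e, 0 < e -> exists N0, forall N, (N0 <= N)%N ->
    l2_le (fun m => \sum_(j < N) qconv (A j) (h j) m - s m) e) ->
  l2_le s (8 * C + 2).
Proof.
move=> hC /(_ 1 ltr01)[N0 /(_ N0 (leqnn _)) hs].
by have := l2_of_approx hs (row_sum_l2 N0 hC); rewrite mulrA mulr1 -natrM.
Qed.

Lemma inner_row_limit h C s u D : fam_le h C ->
  (forall e, 0 < e -> exists N0, forall N, (N0 <= N)%N ->
    l2_le (fun m => \sum_(j < N) qconv (A j) (h j) m - s m) e) ->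
  l2_le u D ->
  series (fun j => inner (h j) (coadj (A j) u)) @ \oo --> inner s u.
Proof.
move=> hC hs hu; have sl2 := row_limit_l2 hC hs.
apply/cvg_seqP => e e0.
have D1 : 0 < D + 1 by rewrite ltr_wpDl // (l2_le0 hu).
have t0 : 0 < e ^+ 2 / (D + 1) by rewrite divr_gt0 ?exprn_gt0.
have [N0 hN0] := hs _ t0; exists N0 => N NN.
have -> : series (fun j => inner (h j) (coadj (A j) u)) N =
    inner (fun m => \sum_(j < N) qconv (A j) (h j) m) u.
  rewrite (inner_suml (a := fun j => qconv (A j) (h j)) (C := fun=> 4 * C) N _ hu).
    rewrite /series /= big_mkord; apply: eq_bigr => j _.
    by rewrite (inner_coadj j (fam_le_l2 j hC) hu).
  by move=> j; exact: qconv_l2_le (fam_le_l2 j hC).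
rewrite -(innerBl (row_sum_l2 N hC) sl2 hu) -(ltr_pXn2r (n := 2)) ?nnegrE //; last exact: ltW.
apply: le_lt_trans (inner_le (hN0 N NN) hu) _.
rewrite mulrAC ltr_pdivrMr // ltr_pM2l ?exprn_gt0 //; lra.
Qed.

(** [W] stands for [|M^* u|^2], of which only the partial sums enter. With [U = |u|^2], pairing the
    [c_j * u] with the adjoint image gives [U^2 <= (U / eta^2) W] by Cauchy-Schwarz within each
    component and then over [j]. *)
Lemma row_lower_bound (c : nat -> nat -> H) (eta : R) u C : 0 < eta ->
  (forall m, (fun n => \sum_(j < n) qconv (A j) (c j) m) @ \oo --> ((m == 0%N)%:R : H)) ->
  (forall u n M, eta ^+ 2 * (\sum_(k < M) \sum_(j < n) `|qconv (c j) u k| ^+ 2) <=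
    \sum_(k < M) `|u k| ^+ 2) ->
  l2_le u C -> forall W, (forall n, \sum_(j < n) sqsum (coadj (A j) u) <= W) ->
  eta ^+ 2 * sqsum u <= W.
Proof.
move=> eta0 hsum hc hu W hW; have e20 : 0 < eta ^+ 2 by exact: exprn_gt0.
pose v j := qconv (c j) u; pose U := sqsum u.
have U0 : 0 <= U := sqsum_ge0 hu.
have hv : fam_le v (U / eta ^+ 2).
  move=> n M; rewrite exchange_big /= ler_pdivlMr // mulrC.
  by apply: le_trans (hc u n M) _; exact: (l2_le_sqsum hu).
have [s [s1 s2]] := row_limit hv.
(* Associativity moves [u] out of the sum: [sum_j a_j * (c_j * u) = (sum_j a_j * c_j) * u = u]. *)
have su : s = u.
  apply/funext => m; apply: (cvg_uniq (s1 m)).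
  have : (fun n => \sum_(k < m.+1) (\sum_(j < n) qconv (A j) (c j) k) * u (m - k)%N) @ \oo -->
      \sum_(k < m.+1) ((k == 0%N :> nat)%:R : H) * u (m - k)%N.
    apply: (cvg_filter_sum _ (u := fun k n => (\sum_(j < n) qconv (A j) (c j) k) * u (m - k)%N)
      (l := fun k => ((k == 0%N :> nat)%:R : H) * u (m - k)%N)) => k _.
    by apply: cvg_filterMr; exact: hsum.
  rewrite big_ord_recl /= mul1r subn0 big1 ?addr0; last by move=> k _; rewrite mul0r.
  rewrite (_ : (fun n => _) = series (fun j => qconv (A j) (v j) m)) //.
  apply/funext => n; rewrite /series /= big_mkord.
  under [RHS]eq_bigr do rewrite -qconvA /qconv.
  rewrite exchange_big /=; apply: eq_bigr => k _; by rewrite mulr_suml.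
rewrite su in s2.
have cv := inner_row_limit hv s2 hu.
have hw := coadj_fam_le hu.
have W0 : 0 <= W by have := hW 0%N; rewrite big_ord0.
have key : U ^+ 2 <= U / eta ^+ 2 * W.
  have UW0 : 0 <= U / eta ^+ 2 * W by rewrite mulr_ge0 // divr_ge0 // ltW.
  have Ue : U = `|inner u u| by rewrite (inner_sqsum hu) norm_alg ger0_norm.
  rewrite -(sqr_sqrtr UW0) ler_pXn2r ?nnegrE ?sqrtr_ge0 // Ue.
  apply: (cvg_le_norm cv) => n; rewrite -[leLHS]ger0_norm // -sqrtr_sqr ler_wsqrtr //.
  rewrite /series /= big_mkord.
  pose w j := coadj (A j) u.
  apply: le_trans (_ : _ <= (\sum_(j < n) Num.sqrt (sqsum (v j)) * Num.sqrt (sqsum (w j))) ^+ 2) _.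
    rewrite ler_pXn2r ?nnegrE //; last first.
      by apply: sumr_ge0 => j _; rewrite mulr_ge0 ?sqrtr_ge0.
    apply: le_trans (ler_norm_sum _ _ _) _; apply: ler_sum => j _.
    have vj := l2_le_sqsum (fam_le_l2 j hv); have wj := l2_le_sqsum (fam_le_l2 j hw).
    rewrite -sqrtrM ?(l2_le0 vj) // -[leLHS]ger0_norm // -sqrtr_sqr ler_wsqrtr //.
    exact: inner_le vj wj.
  apply: le_trans (sum_CS n (fun j => Num.sqrt (sqsum (v j))) (fun j => Num.sqrt (sqsum (w j)))) _.
  under eq_bigr do rewrite sqr_sqrtr ?(sqsum_ge0 (fam_le_l2 _ hv)) //.
  under [X in _ * X]eq_bigr do rewrite sqr_sqrtr ?(sqsum_ge0 (fam_le_l2 _ hw)) //.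
  apply: ler_pM; [| |rewrite -Ue; exact: (fam_le_sqsum n hv)|exact: hW].
    by apply: sumr_ge0 => j _; exact: sqsum_ge0 (fam_le_l2 j hv).
  by apply: sumr_ge0 => j _; exact: sqsum_ge0 (fam_le_l2 j hw).
have [U00|Un] := eqVneq U 0; first by rewrite -/U U00 mulr0.
have Up : 0 < U by rewrite lt_def Un.
move: key; rewrite expr2 -mulrA ler_pM2l // mulrC ler_pdivlMr // mulrC; exact.
Qed.

End RowOperator.

(** * The Hardy space *)

Section ExtendedSums.
Variable R : realType.

Lemma nneseries_fin_leP (P : pred nat) (x : nat -> R) C : (forall i, 0 <= x i) ->
  (\sum_(0 <= i <oo | P i) (x i)%:E <= C%:E)%E <-> forall n, \sum_(0 <= i < n | P i) x i <= C.
Proof.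
move=> x0; have x0' i : (0 <= i)%N -> P i -> (0%R <= (x i)%:E)%E by rewrite lee_fin.
split=> h.
  move=> n; rewrite -lee_fin -sumEFin; apply: le_trans h.
  exact: nneseries_lim_ge.
apply: lime_le; first exact: is_cvg_nneseries.
by apply: nearW => n; rewrite sumEFin lee_fin.
Qed.

Lemma nneseries_fin_ltyP (P : pred nat) (x : nat -> R) : (forall i, 0 <= x i) ->
  (\sum_(0 <= i <oo | P i) (x i)%:E < +oo)%E <-> exists C, forall n, \sum_(0 <= i < n | P i) x i <= C.
Proof.
move=> x0; split=> [h|[C hC]].
  have f : (\sum_(0 <= i <oo | P i) (x i)%:E)%E \is a fin_num.
    by rewrite ge0_fin_numE // nneseries_ge0 // => i _ _; rewrite lee_fin.
  exists (fine (\sum_(0 <= i <oo | P i) (x i)%:E)%E).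
  by apply/nneseries_fin_leP => //; rewrite fineK.
apply: le_lt_trans (ltry C); exact/nneseries_fin_leP.
Qed.

Lemma cvge0P (T : Type) (F : set_system T) (FF : Filter F) (x : T -> \bar R) :
  (forall t, (0 <= x t)%E) ->
  x @ F --> 0%E <-> forall e : R, 0 < e -> \forall t \near F, (x t <= e%:E)%E.
Proof.
move=> x0; split=> [/fine_cvgP[ff /cvgrPdist_le h] e e0|h].
  move: (h e e0); apply: filterS2 ff => t ft; rewrite sub0r normrN => xe.
  by rewrite -(fineK ft) lee_fin (le_trans (ler_norm _) xe).
have fin e t : (x t <= e%:E)%E -> x t \is a fin_num.
  by move=> xe; rewrite ge0_fin_numE // (le_lt_trans xe (ltry e)).
apply/fine_cvgP; split; first by apply: filterS (h 1 ltr01) => t; exact: fin.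
apply/cvgrPdist_le => e e0; apply: filterS (h e e0) => t xe.
by rewrite sub0r normrN /= ger0_norm ?fine_ge0 // -lee_fin fineK // (fin e).
Qed.

End ExtendedSums.

Section HardySpace.
Variable R : realType.
Local Notation H := (quat R).
Implicit Types (a b : nat -> H) (f h u : H -> H) (Lambda : set nat).

Lemma inner_delta k (v : nat -> H) : inner (fun m => (m == k)%:R : H) v = v k.
Proof.
rewrite /inner; apply: (cvg_lim _) => //; apply/cvg_seqP => e e0; exists k.+1 => n kn.
rewrite (_ : series _ n = v k) ?subrr ?normr0 // /series /= big_mkord.
rewrite (bigD1 (Ordinal kn)) //= eqxx qconj1 mul1r big1 ?addr0 // => i ik.
by rewrite (negPf (_ : (i != k :> nat))) ?qconj0 ?mul0r.
Qed.

Lemma delta_l2 k : l2_le (fun m => (m == k)%:R : H) 1.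
Proof.
move=> M; have [kM|Mk] := ltnP k M.
  rewrite (bigD1 (Ordinal kM)) //= eqxx normq1 expr1n big1 ?addr0 // => i ik.
  by rewrite (negPf (_ : (i != k :> nat))) // normr0 expr0n.
rewrite big1 // => i _; rewrite ltn_eqF ?normr0 ?expr0n //; exact: leq_trans (ltn_ord i) Mk.
Qed.

Lemma zero_l2 : l2_le (fun=> 0 : H) 0.
Proof. by move=> M; rewrite big1 // => l _; rewrite normr0 expr0n. Qed.

Lemma inner0l (v : nat -> H) : inner (fun=> 0 : H) v = 0.
Proof.
rewrite /inner (_ : series _ = (fun=> 0)); first by apply: (cvg_lim _) => //; exact: cvg_cst.
by apply/funext => n; rewrite /series /= big1 // => l _; rewrite qconj0 mul0r.
Qed.

Lemma l2_radius1 a C : l2_le a C -> radius1 a.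
Proof.
move=> ha; apply: bounded_radius1 => r /andP[r0 r1]; exists (1 + C) => m.
have h := l2_term m ha; have := sqr_ge0 (`|a m| - 1); have C0 := l2_le0 ha.
have : r ^+ m * `|a m| <= `|a m|.
  by rewrite ler_piMl // exprn_ile1 // ltW.
have := normr_ge0 (a m); nra.
Qed.

Lemma coeffs_slice_regular f : slice_regular f -> power_sum (coeffs f) f.
Proof. by move=> /slice_regular_power_sum[a ha]; rewrite (coeffsE ha). Qed.

Lemma H2P h : H2 h <-> exists2 a, power_sum a h & exists C, l2_le a C.
Proof.
split=> [[hr]|[a ha [C hC]]].
  rewrite /H2_sqnorm => /(nneseries_fin_ltyP _ (fun m => sqr_ge0 _))[C hC].
  exists (coeffs h); first exact: coeffs_slice_regular.
  by exists C => M; have := hC M; rewrite big_mkord.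
split; first exact: power_sum_slice_regular ha.
rewrite /H2_sqnorm; apply/(nneseries_fin_ltyP _ (fun m => sqr_ge0 _)).
by exists C => M; rewrite big_mkord (coeffsE ha); exact: hC.
Qed.

Lemma H2_coeffs h : H2 h -> power_sum (coeffs h) h /\ exists C, l2_le (coeffs h) C.
Proof. by move=> /H2P[a ha hC]; rewrite (coeffsE ha). Qed.

Lemma H2_psum a C : l2_le a C -> H2 (psum a) /\ coeffs (psum a) = a.
Proof.
move=> ha; have pa := radius1_psum (l2_radius1 ha).
by split; [apply/H2P; exists a => //; exists C|exact: coeffsE].
Qed.

Lemma H2_sqnormE h C : l2_le (coeffs h) C -> H2_sqnorm h = (sqsum (coeffs h))%:E.
Proof.
move=> hC; have x0 m : 0 <= `|coeffs h m| ^+ 2 by exact: sqr_ge0.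
have le1 : (H2_sqnorm h <= (sqsum (coeffs h))%:E)%E.
  by apply/nneseries_fin_leP => // n; rewrite big_mkord; exact: l2_le_sqsum hC n.
have fin : H2_sqnorm h \is a fin_num.
  rewrite ge0_fin_numE; first exact: le_lt_trans le1 (ltry _).
  by apply: nneseries_ge0 => m _ _; rewrite lee_fin.
apply/eqP; rewrite eq_le le1 /= -(fineK fin) lee_fin; apply: sqsum_le => n.
rewrite -(big_mkord xpredT (fun m => `|coeffs h m| ^+ 2)).
by move: n; apply/nneseries_fin_leP; rewrite ?fineK.
Qed.

(** Zero outside [Lambda], so that sums over the index set become sums over all naturals. *)
Definition family_coeffs Lambda (h : nat -> H -> H) j :=
  if j \in Lambda then coeffs (h j) else fun=> 0.

Lemma H2l2P Lambda (h : nat -> H -> H) : H2l2 Lambda h <->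
  (forall j, Lambda j -> power_sum (coeffs (h j)) (h j)) /\
  exists C, fam_le (family_coeffs Lambda h) C.
Proof.
have sq0 (x : nat -> H) M : 0 <= \sum_(l < M) `|x l| ^+ 2.
  by apply: sumr_ge0 => l _; exact: sqr_ge0.
pose x j := sqsum (family_coeffs Lambda h j).
split=> [[h1 h2]|[h1 [C hC]]].
  split=> [j /h1/H2_coeffs[]//|].
  have hl j : exists C, l2_le (family_coeffs Lambda h j) C.
    rewrite /family_coeffs; case: ifP => [/set_mem/h1/H2_coeffs[_ []]//|_].
      by move=> C; exists C.
    by exists 0 => M; rewrite big1 // => l _; rewrite normr0 expr0n.
  have x0 j : 0 <= x j by have [C hC] := hl j; exact: sqsum_ge0 hC.
  move: h2; rewrite (eq_eseriesr (g := fun j => (x j)%:E)); last first.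
    move=> j jL; have [C hC] := hl j; rewrite /x; move: hC; rewrite /family_coeffs jL => hC.
    exact: H2_sqnormE hC.
  move=> /(nneseries_fin_ltyP _ x0)[C hC]; exists C => n M.
  apply: le_trans (hC n); rewrite big_mkord [leRHS]big_mkcond /=; apply: ler_sum => j _.
  case: ifP => jL; first by have [D hD] := hl j; exact: l2_le_sqsum hD M.
  by rewrite /family_coeffs jL big1 // => l _; rewrite normr0 expr0n.
have hl j : Lambda j -> l2_le (coeffs (h j)) C.
  by move=> jL; have := fam_le_l2 j hC; rewrite /family_coeffs mem_set.
split=> [j jL|]; first by apply/H2P; exists (coeffs (h j)); [exact: h1|exists C; exact: hl].
have x0 j : 0 <= x j := sqsum_ge0 (fam_le_l2 j hC).
rewrite (eq_eseriesr (g := fun j => (x j)%:E)); last first.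
  by move=> j jL; rewrite /x /family_coeffs jL; apply: (H2_sqnormE (hl j _)); exact: set_mem.
apply/(nneseries_fin_ltyP _ x0); exists C => n.
apply: le_trans (fam_le_sqsum n hC); rewrite big_mkord big_mkcond /=; apply: ler_sum => j _.
by case: ifP => // _; exact: x0.
Qed.

Lemma H2l2_innerE Lambda (h w : nat -> H -> H) :
  H2l2_inner Lambda h w =
  limn (series (fun j => inner (family_coeffs Lambda h j) (family_coeffs Lambda w j))).
Proof.
rewrite /H2l2_inner; congr (limn _); apply/funext => N; rewrite /series /= big_mkcond /=.
apply: eq_bigr => j _; rewrite /family_coeffs; case: ifP => // _.
by rewrite inner0l.
Qed.

Lemma power_sum_row Lambda (f h : nat -> H -> H) N :
  (forall j, Lambda j -> power_sum (coeffs (f j)) (f j)) ->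
  (forall j, Lambda j -> power_sum (coeffs (h j)) (h j)) ->
  power_sum (fun m => \sum_(j < N) qconv (family_coeffs Lambda f j) (family_coeffs Lambda h j) m)
    (fun q => \sum_(0 <= j < N | j \in Lambda) slice_mul (f j) (h j) q).
Proof.
move=> hf hh q qB; rewrite big_mkcond big_mkord.
pose T j m := q ^+ m * qconv (family_coeffs Lambda f j) (family_coeffs Lambda h j) m.
have : series (fun m => \sum_(j < N) T j m) @ \oo -->
    \sum_(j < N) (if nat_of_ord j \in Lambda then slice_mul (f j) (h j) q else 0).
  apply: (series_cvg_sum (T := T)
    (t := fun j => if j \in Lambda then slice_mul (f j) (h j) q else 0)) => j.
  rewrite /T /family_coeffs; case: ifP => [/set_mem jL|_].
    exact: power_sum_slice_mul (hf j jL) (hh j jL) q qB.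
  have : (fun=> 0 : H) @ \oo --> (0 : H) by exact: cvg_cst.
  rewrite (_ : series _ = (fun=> 0)) //.
  apply/funext => n; rewrite /series /= big1 // => l _.
  by rewrite /qconv big1 ?mulr0 // => k _; rewrite mulr0.
rewrite (_ : (fun m => _) = (fun m => q ^+ m *
  \sum_(j < N) qconv (family_coeffs Lambda f j) (family_coeffs Lambda h j) m)) //.
by apply/funext => m; rewrite mulr_sumr.
Qed.

Lemma power_sumB a b f h : power_sum a f -> power_sum b h ->
  power_sum (fun m => a m - b m) (fun q => f q - h q).
Proof.
move=> ha hb q qB; have := series_cvgD (ha q qB) (series_cvgN (hb q qB)).
rewrite (_ : (fun n => _) = (fun m => q ^+ m * (a m - b m))) //.
by apply/funext => m; rewrite mulrBr.
Qed.

Section Row.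
Variables (Lambda : set nat) (f : nat -> H -> H).
Hypothesis Hf : forall j, Lambda j -> Hinf (f j).
Hypothesis Hf1 : forall q, unit_ball q ->
  (\sum_(0 <= j <oo | j \in Lambda) (`|f j q| ^+ 2)%:E <= 1)%E.
Variable I : H.
Hypothesis HI : imag_unit I.
Let A := family_coeffs Lambda f.

Lemma row_power_sum j : Lambda j -> power_sum (coeffs (f j)) (f j).
Proof. by move=> /Hf[/coeffs_slice_regular]. Qed.

Let ff j := if j \in Lambda then f j else fun=> 0.

Let ff_power_sum j : power_sum (A j) (ff j).
Proof.
rewrite /A /ff /family_coeffs; case: ifP => [/set_mem/row_power_sum//|_ q _].
have : (fun=> 0 : H) @ \oo --> (0 : H) by exact: cvg_cst.
rewrite (_ : series _ = (fun=> 0)) //.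
by apply/funext => n; rewrite /series /= big1 // => l _; rewrite mulr0.
Qed.

Let ff_le n q : unit_ball q -> \sum_(j < n) `|ff j q| ^+ 2 <= 1.
Proof.
move=> qB; have /nneseries_fin_leP h := Hf1 qB.
have := h (fun j => sqr_ge0 _) n; rewrite big_mkord big_mkcond /=.
rewrite (eq_bigr (fun j : 'I_n => `|ff j q| ^+ 2)) // => j _; rewrite /ff.
by case: ifP => // _; rewrite normr0 expr0n.
Qed.

Lemma row_coeffs_le n M : \sum_(j < n) \sum_(m < M) `|A j m| ^+ 2 <= 1.
Proof. exact: (row_coef_le HI ff_power_sum ff_le). Qed.

Lemma row_multiplier_le (h : nat -> nat -> H) n M :
  \sum_(m < M) `|\sum_(j < n) qconv (A j) (h j) m| ^+ 2 <=
  4 * \sum_(j < n) \sum_(l < M) `|h j l| ^+ 2.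
Proof. exact: (row_conv_le HI ff_power_sum ff_le). Qed.

(** [row_mult] selects some limit in norm. [psum s] shows that one exists, and any limit has the
    coefficients [s], because each coefficient is bounded by the norm. *)
Lemma row_mult_coeffs (h : nat -> H -> H) C s : H2l2 Lambda h -> fam_le (family_coeffs Lambda h) C ->
  (forall e, 0 < e -> exists N0, forall N, (N0 <= N)%N ->
    l2_le (fun m => \sum_(j < N) qconv (A j) (family_coeffs Lambda h j) m - s m) e) ->
  H2 (row_mult Lambda f h) /\ coeffs (row_mult Lambda f h) = s.
Proof.
move=> /H2l2P[hh _] hC hs.
have sl2 := row_limit_l2 row_multiplier_le hC hs.
pose P : set (H -> H) := [set u | H2 u /\
  H2_sqnorm (fun q => \sum_(0 <= j < N | j \in Lambda) slice_mul (f j) (h j) q - u q)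
    @[N --> \oo] --> 0%E].
have PS N u : power_sum (coeffs u) u ->
    coeffs (fun q => \sum_(0 <= j < N | j \in Lambda) slice_mul (f j) (h j) q - u q) =
    (fun m => \sum_(j < N) qconv (A j) (family_coeffs Lambda h j) m - coeffs u m).
  by move=> pu; apply: coeffsE; apply: power_sumB pu; exact: (power_sum_row row_power_sum hh).
have sq0 u : (0 <= H2_sqnorm u)%E by apply: nneseries_ge0 => m _ _; rewrite lee_fin sqr_ge0.
have ex : exists u, P u.
  have [H2s cs] := H2_psum sl2; exists (psum s); split=> //.
  apply/cvge0P => // e e0; have [N0 hN0] := hs e e0; exists N0 => // N /= NN.
  apply/nneseries_fin_leP => [m|n]; first exact: sqr_ge0.
  rewrite PS ?cs; last by have [] := H2_coeffs H2s; rewrite cs.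
  by rewrite big_mkord; exact: hN0.
have [H2r /cvge0P hr] := xgetPex (fun=> 0) ex; split=> //.
have [pr _] := H2_coeffs H2r.
apply/funext => m; apply/eqP; rewrite -subr_eq0 -normr_le0; apply/ler_addgt0Pr => e e0.
have e4 : 0 < (e / 2) ^+ 2 by rewrite exprn_gt0 // divr_gt0.
have [N1 _ hN1] := hr (fun N => sq0 _) _ e4.
have [N2 hN2] := hs _ e4.
pose N := maxn N1 N2.
have h1 := l2_term m (hN2 N (leq_maxr _ _)).
have hr2 : l2_le (fun m => \sum_(j < N) qconv (A j) (family_coeffs Lambda h j) m -
    coeffs (row_mult Lambda f h) m) ((e / 2) ^+ 2).
  move=> n; have /nneseries_fin_leP hh2 := hN1 N (leq_maxl _ _).
  by have := hh2 (fun=> sqr_ge0 _) n; rewrite PS // big_mkord.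
have {h1} := h1; have := l2_term m hr2.
rewrite !ler_pXn2r ?nnegrE ?divr_ge0 ?(ltW e0) //.
set S := \sum_(j < N) _ => h3 h4.
have -> : coeffs (row_mult Lambda f h) m - s m = (S - s m) - (S - coeffs (row_mult Lambda f h) m).
  by rewrite opprB [RHS]addrC addrA subrK.
apply: le_trans (ler_normB _ _) _; lra.
Qed.

(** Any adjoint is determined: pairing with the monomial [q^k0] placed in slot [j0] reads off one
    coefficient of [Mstar u]. Outside [Lambda] both sides are zero. *)
Lemma adjoint_coeffs Mstar u C : is_adjoint Lambda (row_mult Lambda f) Mstar ->
  H2 u -> l2_le (coeffs u) C -> forall j,
  family_coeffs Lambda (Mstar u) j = coadj (A j) (coeffs u).
Proof.
move=> adj Hu hu j0.
have [_ hadj] := adj u Hu.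
have [jL|jL] := boolP (j0 \in Lambda); last first.
  rewrite /A /family_coeffs (negPf jL); apply/funext => k.
  by rewrite /coadj inner0l.
apply/funext => k0.
pose d : nat -> H := fun m => (m == k0)%:R.
pose h j := psum (if j == j0 then d else fun=> 0).
have hl2 j : l2_le (if j == j0 then d else fun=> 0) 1.
  case: ifP => _; first exact: delta_l2.
  by move=> M; apply: le_trans (zero_l2 M) ler01.
have ch j : coeffs (h j) = if j == j0 then d else fun=> 0 by have [_ ->] := H2_psum (hl2 j).
have fch j : family_coeffs Lambda h j = if j == j0 then d else fun=> 0.
  rewrite /family_coeffs ch; case: ifP => // jL'; case: eqP => // jj.
  by move: jL'; rewrite jj jL.
have hfam : fam_le (family_coeffs Lambda h) 1.
  move=> n M; have [jn|nj] := ltnP j0 n.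
    rewrite (bigD1 (Ordinal jn)) //= [X in _ + X]big1 ?addr0.
      by rewrite fch eqxx; exact: delta_l2.
    move=> i ij; rewrite fch (negPf (_ : (i != j0 :> nat))) //.
    by rewrite big1 // => l _; rewrite normr0 expr0n.
  rewrite big1 ?ler01 // => i _; rewrite fch ltn_eqF ?(leq_trans (ltn_ord i) nj) //.
  by rewrite big1 // => l _; rewrite normr0 expr0n.
have Hh : H2l2 Lambda h.
  by apply/H2l2P; split; [move=> j _; have [/H2_coeffs[]] := H2_psum (hl2 j)|exists 1].
have [s [s1 s2]] := row_limit row_coeffs_le row_multiplier_le hfam.
have [_ cs] := row_mult_coeffs Hh hfam s2.
have := hadj h Hh; rewrite H2l2_innerE /H2_inner -/(inner _ _) cs.
have := inner_row_limit row_coeffs_le row_multiplier_le hfam s2 hu.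
have single (w : nat -> nat -> H) : series (fun j => inner (family_coeffs Lambda h j) (w j)) @ \oo -->
    w j0 k0.
  apply/cvg_seqP => e e0; exists j0.+1 => n jn.
  rewrite (_ : series _ n = w j0 k0) ?subrr ?normr0 // /series /= big_mkord.
  rewrite (bigD1 (Ordinal jn)) //= fch eqxx inner_delta big1 ?addr0 // => i ij.
  by rewrite fch (negPf (_ : (i != j0 :> nat))) // inner0l.
move=> h1; rewrite -(cvg_uniq (single (fun j => coadj (A j) (coeffs u))) h1).
by rewrite (cvg_lim _ (single (family_coeffs Lambda (Mstar u)))).
Qed.

Theorem toeplitz_lower_boundP (eta : R) : 0 < eta ->
  toeplitz_lower_bound Lambda f eta <-> exists c : nat -> nat -> H,
    (forall m, (fun n => \sum_(j < n) qconv (A j) (c j) m) @ \oo --> ((m == 0%N)%:R : H)) /\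
    forall (u : nat -> H) n M, eta ^+ 2 * (\sum_(k < M) \sum_(j < n) `|qconv (c j) u k| ^+ 2) <=
      \sum_(k < M) `|u k| ^+ 2.
Proof.
move=> eta0; split=> [[Mstar adj lb]|[c [hsum hc]]].
  (* For a polynomial [u] the form [<M M^* u, u>] is the sum over [j] of the squared norms of the
     components of [M^* u], which are given by finite sections; the slack [e] pays for stopping the
     sum at [n]. *)
  apply: (corona_coefficients eta0 row_coeffs_le) => N u e e0.
  have hU : l2_le (trunc N u) (\sum_(m < N) `|u m| ^+ 2).
    rewrite (_ : \sum_(m < N) _ = \sum_(m < N) `|trunc N u m| ^+ 2).
      by apply: l2_le_finite => k Nk; exact: trunc_ge.
    by apply: eq_bigr => m _; rewrite /trunc ltn_ord.
  have [HU cU] := H2_psum hU; have hcU := hU; rewrite -cU in hcU.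
  have wE := adjoint_coeffs adj HU hcU; rewrite cU in wE.
  have [HW _] := adj _ HU; have hw := coadj_fam_le row_coeffs_le row_multiplier_le hU.
  have hw' : fam_le (family_coeffs Lambda (Mstar (psum (trunc N u)))) (4 * \sum_(m < N) `|u m| ^+ 2).
    by move=> n M; under eq_bigr do rewrite wE; exact: hw.
  have [s [s1 s2]] := row_limit row_coeffs_le row_multiplier_le hw'.
  have [_ cs] := row_mult_coeffs HW hw' s2.
  have := lb _ HU; rewrite /H2_inner -!/(inner _ _) cs cU.
  have := inner_row_limit row_coeffs_le row_multiplier_le hw' s2 hU.
  rewrite (inner_sqsum hU) /= mulr1 => /cvg_seqP/(_ e e0)[n /(_ n (leqnn n))].
  have -> : series (fun j => inner (family_coeffs Lambda (Mstar (psum (trunc N u))) j)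
      (coadj (A j) (trunc N u))) n = (\sum_(j < n) sqsum (coadj (A j) (trunc N u)))%:A.
    rewrite /series /= big_mkord scaler_suml; apply: eq_bigr => j _.
    by rewrite wE (inner_sqsum (fam_le_l2 j hw)).
  set X := \sum_(j < n) _ => h1 h2; exists n.
  have h3 : \sum_(m < N) `|u m| ^+ 2 <= sqsum (trunc N u).
    apply: le_trans (l2_le_sqsum hU N); apply: ler_sum => m _.
    by rewrite /trunc ltn_ord.
  have h4 : X <= \sum_(j < n) \sum_(k < N) `|qcoconv N (A j) u k| ^+ 2.
    apply: ler_sum => j _; apply: sqsum_le.
    have E k : coadj (A j) (trunc N u) k = qcoconv N (A j) u k.
      exact: coadj_of_trunc (fam_le_l2 j row_coeffs_le) hU.
    rewrite (_ : \sum_(k < N) _ = \sum_(k < N) `|coadj (A j) (trunc N u) k| ^+ 2).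
      by apply: l2_le_finite => k Nk; rewrite E qcoconv_ge.
    by apply: eq_bigr => k _; rewrite E.
  have h5 : qre (inner s (trunc N u)) <= X + e.
    have [h5 _ _ _] := normq_comps (X%:A - inner s (trunc N u)).
    have := ler_norm (- qre (X%:A - inner s (trunc N u))); move: h5; rewrite normrN /= mulr1; lra.
  have := ler_wpM2l (sqr_ge0 eta) h3; lra.
have cadj (u : H -> H) C : l2_le (coeffs u) C -> fam_le (fun j => coadj (A j) (coeffs u)) (4 * C).
  by move=> hu; exact: (coadj_fam_le row_coeffs_le row_multiplier_le hu).
(* The adjoint has to be exhibited; it is defined by its coefficients, which vanish in the slots
   outside [Lambda]. *)
pose Mstar (u : H -> H) j := psum (coadj (A j) (coeffs u)).
have cM (u : H -> H) C : l2_le (coeffs u) C -> forall j, coeffs (Mstar u j) = coadj (A j) (coeffs u).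
  by move=> hu j; have [_ ->] := H2_psum (fam_le_l2 j (cadj u C hu)).
have fM (u : H -> H) C : l2_le (coeffs u) C -> family_coeffs Lambda (Mstar u) = (fun j => coadj (A j) (coeffs u)).
  move=> hu; apply/funext => j; rewrite /family_coeffs (cM _ _ hu) /A /family_coeffs.
  by case: (j \in Lambda) => //; apply/funext => k; rewrite /coadj inner0l.
have H2M (u : H -> H) C : l2_le (coeffs u) C -> H2l2 Lambda (Mstar u).
  move=> hu; apply/H2l2P; split; last by exists (4 * C); rewrite (fM _ _ hu); exact: cadj.
  by move=> j _; have [/H2_coeffs[]] := H2_psum (fam_le_l2 j (cadj u C hu)).
exists Mstar => [u Hu|u Hu]; have [_ [C hC]] := H2_coeffs Hu.
  split; first exact: H2M hC.
  move=> h Hh; have [_ [D hD]] := (H2l2P _ _).1 Hh.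
  have [s [s1 s2]] := row_limit row_coeffs_le row_multiplier_le hD.
  have [_ cs] := row_mult_coeffs Hh hD s2.
  rewrite H2l2_innerE /H2_inner -/(inner _ _) cs (fM _ _ hC).
  by rewrite (cvg_lim _ (inner_row_limit row_coeffs_le row_multiplier_le hD s2 hC)).
have hD : fam_le (family_coeffs Lambda (Mstar u)) (4 * C) by rewrite (fM _ _ hC); exact: cadj.
have [s [s1 s2]] := row_limit row_coeffs_le row_multiplier_le hD.
have [_ cs] := row_mult_coeffs (H2M _ _ hC) hD s2.
rewrite /H2_inner -!/(inner _ _) cs (inner_sqsum hC) /= mulr1.
apply: (row_lower_bound row_coeffs_le row_multiplier_le eta0 hsum hc hC) => n.
have := inner_row_limit row_coeffs_le row_multiplier_le hD s2 hC.
rewrite (fM _ _ hC) => /cvg_seqP hl; apply/ler_addgt0Pr => e /hl[N /(_ (maxn n N) (leq_maxr _ _))].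
have wj j : 0 <= sqsum (coadj (A j) (coeffs u)) := sqsum_ge0 (fam_le_l2 j (cadj u C hC)).
have -> : series (fun j => inner (coadj (A j) (coeffs u)) (coadj (A j) (coeffs u))) (maxn n N) =
    (\sum_(0 <= j < maxn n N) sqsum (coadj (A j) (coeffs u)))%:A.
  rewrite /series /= scaler_suml; apply: eq_bigr => j _.
  by rewrite (inner_sqsum (fam_le_l2 j (cadj u C hC))).
set X := \sum_(0 <= j < _) _ => h1.
have h3 : \sum_(j < n) sqsum (coadj (A j) (coeffs u)) <= X.
  rewrite /X (@big_cat_nat _ _ _ n 0) ?leq_maxl //= big_mkord lerDl.
  exact: sumr_ge0.
have [h5 _ _ _] := normq_comps (X%:A - inner s (coeffs u)).
have := ler_norm (qre (X%:A - inner s (coeffs u))); move: h5; rewrite /= mulr1; lra.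
Qed.

End Row.
End HardySpace.

(** * The column multiplier *)

Section ColumnMultiplier.
Variable R : realType.
Local Notation H := (quat R).

Lemma cvg_sum_sqr_le n (u : nat -> nat -> H) (l : nat -> H) (B : R) N0 :
  (forall j, u j @ \oo --> l j) ->
  (forall M, (N0 <= M)%N -> \sum_(j < n) `|u j M| ^+ 2 <= B) ->
  \sum_(j < n) `|l j| ^+ 2 <= B.
Proof.
move=> ul uB.
have cs : (fun M => \sum_(j < n) `|u j M| ^+ 2) @ \oo --> \sum_(j < n) `|l j| ^+ 2.
  apply: (cvg_filter_sum _ (u := fun j M => `|u j M| ^+ 2) (l := fun j => `|l j| ^+ 2)) => j _.
  have cg : ((fun M => `|u j M|) : nat -> R) @ \oo --> (`|l j| : R).
    by apply: cvg_norm; exact: ul.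
  by have := cvgM cg cg; exact.
apply/ler_addgt0Pr => d /((cvg_seqP _ _).1 cs)[N /(_ (maxn N N0) (leq_maxl _ _))].
have := uB _ (leq_maxr N N0).
set X := \sum_(j < n) _; set Y := \sum_(j < n) _ => h1 h2.
have := ler_norm (Y - X); rewrite distrC; lra.
Qed.

Lemma radius1_cst : radius1 (fun=> 1 : H).
Proof.
by apply: bounded_radius1 => r /andP[r0 r1]; exists 1 => m; rewrite normq1 mulr1 exprn_ile1 // ltW.
Qed.

Lemma linear_weight_le (r : R) : 0 <= r < 1 ->
  exists C, forall n, \sum_(0 <= m < n) r ^+ m * m.+1%:R <= C.
Proof.
move=> r01; have /andP[r0 _] := r01.
have [C hC] := radius1_weight radius1_cst r01; have [D hD] := radius1_cst r01.
exists (C + D) => n; apply: le_trans (lerD (hC n) (hD n)); rewrite -big_split /=.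
apply: ler_sum => m _; rewrite normq1 !mulr1 -natr1 mulrDr mulr1 lerD2r mulrC.
apply: ler_wpM2r; first exact: exprn_ge0.
by case: m => [|m]; rewrite ?expr0n //= -natrX ler_nat -{1}(expn1 m.+1) leq_pexp2l.
Qed.

(** Dominated convergence: beyond a fixed degree [L] both sums are small because of the majorant
    [D], and below [L] finitely many terms converge. *)
Lemma dominated_power_sum (d : nat -> nat -> H) (l : nat -> H) (D : nat -> R) (C : R) (q : H) (F : nat -> H) (G : H) :
  (forall N m, `|d N m| <= D m) -> (forall m, d^~ m @ \oo --> l m) ->
  (forall n, \sum_(0 <= m < n) `|q| ^+ m * D m <= C) ->
  (forall N, series (fun m => q ^+ m * d N m) @ \oo --> F N) ->
  series (fun m => q ^+ m * l m) @ \oo --> G -> F @ \oo --> G.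
Proof.
move=> dD dl hC dF lG; apply/cvg_seqP => e e0.
have e4 : 0 < e / 4 by rewrite divr_gt0.
have D0 m : 0 <= D m by apply: le_trans (dD 0%N m).
have lD m : `|l m| <= D m by apply: (cvg_le_norm (dl m)) => N; exact: dD.
have [L hL] := @abs_bounded_tail R (fun m => `|q| ^+ m * D m) C
  (fun m => mulr_ge0 (exprn_ge0 m (normr_ge0 q)) (D0 m)) hC _ e4.
have tail (a : nat -> H) S : (forall m, `|a m| <= D m) ->
    series (fun m => q ^+ m * a m) @ \oo --> S -> `|S - \sum_(m < L) q ^+ m * a m| <= e / 4.
  move=> aD aS; apply: (series_tail_le aS) => n; apply: le_trans (hL L (leqnn L) n).
  by apply: ler_sum => m _; rewrite normqM normqX ler_wpM2l ?exprn_ge0.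
have cf : (fun N => \sum_(m < L) q ^+ m * d N m) @ \oo --> \sum_(m < L) q ^+ m * l m.
  apply: (cvg_filter_sum _ (u := fun m N => q ^+ m * d N m) (l := fun m => q ^+ m * l m)) => m _.
  exact: cvgqMl.
have /cvg_seqP/(_ _ e4)[N0 hN0] := cf; exists N0 => N /hN0.
have h1 := tail (d N) (F N) (dD N) (dF N); have h2 := tail l G lD lG.
move: h1 h2; set P := \sum_(m < L) q ^+ m * d N m; set Q := \sum_(m < L) q ^+ m * l m => h1 h2 h3.
have -> : F N - G = (F N - P) + (P - Q) - (G - Q) by rewrite subrKA opprB subrKA.
apply: le_lt_trans (ler_normB _ _) _.
have := ler_normD (F N - P) (P - Q); lra.
Qed.

Variables (c : nat -> nat -> H) (K : R).
Hypothesis K0 : 0 <= K.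
Hypothesis hc : forall (u : nat -> H) n M,
  \sum_(j < n) \sum_(m < M) `|qconv (c j) u m| ^+ 2 <= K * \sum_(m < M) `|u m| ^+ 2.

(** The input 1 returns the columns themselves. *)
Lemma column_fam_le : fam_le c K.
Proof.
move=> n M.
have := hc (fun m => if m is 0%N then 1 else 0) n M.
under eq_bigr do under eq_bigr do rewrite qconv_delta.
move=> h; apply: le_trans h _; rewrite -[leRHS]mulr1; apply: ler_wpM2l => //.
case: M => [|M]; first by rewrite big_ord0.
by rewrite big_ord_recl /= normq1 expr1n big1 ?addr0 // => m _; rewrite normr0 expr0n.
Qed.

Lemma column_radius1 j : radius1 (c j).
Proof. exact: (l2_radius1 (fam_le_l2 j column_fam_le)). Qed.

(** Absolutely summable weights [t] take the place of the powers of [z]. The cases in view are the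
    derivative, with [m z^(m-1)], and the error of a difference quotient. The proof is
    Cauchy-Schwarz with respect to the weights [|t m|]. *)
Lemma column_weight_le n (b : H) (t x : nat -> H) T : abs_bounded t T ->
  (forall j, series (fun m => c j m * b * t m) @ \oo --> x j) ->
  \sum_(j < n) `|x j| ^+ 2 <= K * T ^+ 2 * `|b| ^+ 2.
Proof.
move=> tT cx; apply: (cvg_sum_sqr_le (N0 := 0) cx) => M _.
pose TM := \sum_(m < M) `|t m|.
have TM0 : 0 <= TM by exact: sumr_ge0.
have TMT : TM <= T by have := tT M; rewrite big_mkord.
have bnd j : `|series (fun m => c j m * b * t m) M| ^+ 2 <=
    TM * (\sum_(m < M) `|t m| * `|c j m| ^+ 2) * `|b| ^+ 2.
  rewrite /series /= big_mkord.
  have := sum_CS M (fun m => Num.sqrt `|t m|) (fun m => Num.sqrt `|t m| * (`|c j m| * `|b|)).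
  rewrite /=; under eq_bigr do rewrite mulrA -expr2 sqr_sqrtr //.
  under [X in X * _]eq_bigr do rewrite sqr_sqrtr //.
  under [X in _ <= _ * X]eq_bigr do rewrite !exprMn sqr_sqrtr // mulrA.
  rewrite -mulr_suml mulrA; apply: le_trans.
  rewrite ler_pXn2r ?nnegrE //; last by apply: sumr_ge0 => m _; rewrite !mulr_ge0.
  apply: le_trans (ler_norm_sum _ _ _) _; apply: ler_sum => m _.
  by rewrite !normqM mulrC mulrA.
apply: le_trans (_ : _ <= \sum_(j < n)
    TM * (\sum_(m < M) `|t m| * `|c j m| ^+ 2) * `|b| ^+ 2) _.
  by apply: ler_sum => j _; exact: bnd.
rewrite -mulr_suml; apply: ler_wpM2r; first exact: sqr_ge0.
rewrite -mulr_sumr exchange_big /=.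
apply: le_trans (_ : _ <= TM * (TM * K)) _.
  apply: ler_wpM2l => //; rewrite [leRHS]mulr_suml; apply: ler_sum => m _.
  rewrite -mulr_sumr; apply: ler_wpM2l => //.
  apply: le_trans (column_fam_le n m.+1); apply: ler_sum => j _.
  by rewrite big_ord_recr /= lerDr; apply: sumr_ge0 => l _; exact: sqr_ge0.
rewrite mulrA mulrC -expr2; apply: ler_wpM2l => //.
by rewrite ler_pXn2r ?nnegrE //; exact: le_trans TMT.
Qed.

(** If the limit exceeded [B], each late term would raise the sum of the [y m * (X m - B)] by at
    least [e], since the weights are at least 1, and this sum would become positive. *)
Lemma weighted_average_le (y X : nat -> R) (x B : R) : (forall m, 1 <= y m) ->
  (forall M, \sum_(m < M) y m * X m <= B * \sum_(m < M) y m) -> X @ \oo --> x -> x <= B.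
Proof.
move=> y1 hM hX; rewrite leNgt; apply/negP => Bx.
pose e := (x - B) / 2; have e0 : 0 < e by rewrite /e; lra.
have /cvg_seqP/(_ e e0)[m0 hm0] := hX.
have big m : (m0 <= m)%N -> e <= y m * (X m - B).
  move=> /hm0 h; have h1 : e <= X m - B.
    by have := ler_norm (x - X m); rewrite distrC /e; move: h; rewrite /e; lra.
  apply: (le_trans h1); rewrite ler_peMl //; exact: le_trans (ltW e0) h1.
pose S := \sum_(m < m0) y m * (X m - B).
have tot M : \sum_(m < M) y m * (X m - B) <= 0.
  under eq_bigr do rewrite mulrBr; rewrite sumrB -mulr_suml mulrC subr_le0 mulrC.
  by have := hM M; rewrite mulrC.
have grow k : S + k%:R * e <= \sum_(m < m0 + k) y m * (X m - B).
  elim: k => [|k IH]; first by rewrite mul0r addr0 addn0.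
  rewrite addnS big_ord_recr /= -natr1 mulrDl mul1r addrA.
  by apply: lerD => //; apply: big; exact: leq_addr.
have [k hk] : exists k : nat, - S / e < k%:R.
  exists (Num.bound `|- S / e|); apply: le_lt_trans (ler_norm _) _; exact: archi_boundP.
have := le_trans (grow k) (tot _); rewrite leNgt => /negP; apply.
by rewrite ltr_pdivrMr // in hk; lra.
Qed.

(* Tested on the inputs [b z^(-l)], the column multiplier returns
   [z^(-m)] times the partial sums of the evaluation at [z]. *)
Lemma column_eval_le n z b : unit_ball z ->
  \sum_(j < n) `|right_eval (c j) z b| ^+ 2 <= K * `|b| ^+ 2.
Proof.
(* The inputs [b z^(-l)] need [z != 0]; at 0 the input [b] in degree 0 is enough. For the other
   points [|z| < 1] makes the weights [|z|^(-2m)] at least 1. *)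
move=> zB; have [->|z0] := eqVneq z 0.
  have E j : right_eval (c j) 0 b = c j 0%N * b.
    apply: (cvg_uniq (right_eval_cvg (column_radius1 j) _)).
      by rewrite /unit_ball /= normr0.
    apply/cvg_seqP => e e0; exists 1%N => m m0.
    rewrite (_ : series _ m = c j 0%N * b) ?subrr ?normr0 // /series /= big_ltn //.
    rewrite expr0 mulr1 big_nat big1 ?addr0 // => i /andP[i0 _].
    by rewrite expr0n gtn_eqF // mulr0.
  have := hc (fun=> b) n 1; rewrite big_ord1; apply: le_trans.
  by apply: ler_sum => j _; rewrite big_ord1 E /qconv big_ord1.
pose w := qinv z; pose u l := b * w ^+ l.
have wz : w * z = 1 by exact: mulqVl.
have zw : z * w = 1 by exact: mulqVr.
have nz : 0 < `|z| by rewrite normr_gt0.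
have nw : `|w| * `|z| = 1 by rewrite -normqM wz normq1.
pose P j m := series (fun k => c j k * b * z ^+ k) m.+1.
have PE j m : qconv (c j) u m = P j m * w ^+ m.
  rewrite /P /series /= big_mkord mulr_suml; apply: eq_bigr => k _.
  have km : (k <= m)%N by rewrite -ltnS.
  have -> : w ^+ m = w ^+ k * w ^+ (m - k) by rewrite -exprD subnKC.
  rewrite /u [in RHS]mulrA -(mulrA (c j k * b)).
  rewrite -(exprMn_comm k (_ : GRing.comm z w)) ?zw ?expr1n ?mulr1 ?mulrA //.
  by rewrite /GRing.comm zw wz.
apply: (@weighted_average_le (fun m => (`|w| ^+ m) ^+ 2) (fun m => \sum_(j < n) `|P j m| ^+ 2)).
- move=> m; rewrite exprn_ege1 // exprn_ege1 //.
  by rewrite -nw ler_piMr //; exact: ltW.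
- move=> M; have := hc u n M.
  rewrite exchange_big /= (_ : \sum_(m < M) `|u m| ^+ 2 = `|b| ^+ 2 * \sum_(m < M) (`|w| ^+ m) ^+ 2).
    rewrite mulrA; apply: le_trans; apply: ler_sum => m _; rewrite mulr_sumr.
    by apply: ler_sum => j _; rewrite PE normqM normqX exprMn mulrC.
  by rewrite mulr_sumr; apply: eq_bigr => m _; rewrite /u normqM normqX exprMn.
apply: (cvg_filter_sum _ (u := fun j m => `|P j m| ^+ 2)
  (l := fun j => `|right_eval (c j) z b| ^+ 2)) => j _.
have cg : ((fun m => `|P j m|) : nat -> R) @ \oo --> (`|right_eval (c j) z b| : R).
  apply: cvg_norm; apply/cvg_seqP => e e0.
  have /cvg_seqP/(_ e e0)[N hN] := right_eval_cvg (b := b) (column_radius1 j) zB.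
  by exists N => m Nm; apply: hN; exact: leqW.
by have := cvgM cg cg; exact.
Qed.

End ColumnMultiplier.

(** * Matrix realizations *)

Section SliceCoordinates.
Import ComplexField Normc.
Variable R : realType.
Local Notation H := (quat R).
Local Notation C := R[i].
Variables (I J : H).
Hypotheses (HI : imag_unit I) (HJ : imag_unit J) (HIJ : slice_orth J I).
Local Notation emb := (slice_emb I).

Lemma embD z w : emb (z + w) = emb z + emb w.
Proof. by case: z w => a b [c d]; rewrite /slice_emb /= -!/(cslice _ _ _) csliceD. Qed.

Lemma embN z : emb (- z) = - emb z.
Proof. by case: z => a b; rewrite /slice_emb /= -!/(cslice _ _ _) csliceN. Qed.

Lemma embB z w : emb (z - w) = emb z - emb w. Proof. by rewrite embD embN. Qed.

Lemma embM z w : emb (z * w) = emb z * emb w.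
Proof. by case: z w => a b [c d]; rewrite /slice_emb /= -!/(cslice _ _ _) csliceM. Qed.

Lemma emb1 : emb 1 = 1.
Proof. by rewrite /slice_emb /= scale1r scale0r mulr0 addr0. Qed.

Lemma emb_conj z : emb (z^*)%C = quat_conj (emb z).
Proof. by case: z => a b; rewrite /slice_emb /= -!/(cslice _ _ _) cslice_conj. Qed.

Lemma emb_slice z : slice I (emb z). Proof. by exists (complex.Re z), (complex.Im z). Qed.

Lemma norm_emb z : `|emb z| = normc z.
Proof.
by case: z => a b; rewrite /slice_emb /= -(norm_cslice HI) sqrtr_sqr ger0_norm.
Qed.

Lemma unit_disc_emb z : unit_disc z <-> unit_ball (emb z).
Proof. by rewrite /unit_disc /unit_ball /= norm_emb -ltcR. Qed.

Lemma emb_comm z w : emb z * emb w = emb w * emb z.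
Proof. exact: (slice_comm HI (emb_slice z) (emb_slice w)). Qed.

Lemma qconj_real (q : H) : quat_conj q = q -> q = (qre q)%:A.
Proof.
case: q => a b c d [] hb hc hd.
by apply: quat_ext => /=; rewrite ?mulr1 ?mulr0 //; lra.
Qed.

Lemma qconj_imag (q : H) : qre q = 0 -> quat_conj q = - q.
Proof. by case: q => a b c d /= ->; apply: quat_ext => //=; rewrite oppr0. Qed.

Lemma qre_conj (q : H) : quat_conj q = - q -> qre q = 0.
Proof. by move=> /(congr1 (@qre R)) /=; lra. Qed.

(** If [q = x + I y] then [- I q] has real part [y]. *)
Definition slice_coord (q : H) : C := Complex (qre q) (qre (- (I * q))).

Let II : I * I = -1. Proof. by rewrite -expr2. Qed.

(** The difference [r] has real part 0 and commutes with [I], so [I * r] is its own conjugate, hence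
    real; its real part is 0 as well, so [r = 0]. *)
Lemma emb_slice_coord (q : H) : I * q = q * I -> emb (slice_coord q) = q.
Proof.
move=> Iq; pose r := q - emb (slice_coord q); suff : r = 0 by move/eqP; rewrite subr_eq0 => /eqP.
have Ir : I * r = r * I.
  by rewrite mulrBr mulrBl Iq (slice_comm HI (slice_unit I) (emb_slice _)).
have cI : quat_conj I = - I := imag_unit_conj HI.
have I0 : qre I = 0 := qre_conj cI.
have qD (p s : H) : qre (p + s) = qre p + qre s by [].
have qN (p : H) : qre (- p) = - qre p by [].
have qZ (y : R) (p : H) : qre (y *: p) = y * qre p by [].
have q1 : qre (1 : H) = 1 by [].
have rE : r = q - (qre q *: 1 + qre (- (I * q)) *: I) by rewrite /r -[_ *: I]mulr_algr.
have r0 : qre r = 0 by rewrite rE !(qD, qN, qZ) I0 q1; lra.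
have r1 : qre (I * r) = 0.
  by rewrite rE mulrBr mulrDr -!scalerAr II mulr1 !(qD, qN, qZ) I0 q1; lra.
have : I * r = 0.
  rewrite (@qconj_real (I * r)) ?r1 ?scale0r //.
  by rewrite qconjM cI (qconj_imag r0) mulrNN Ir.
by move=> /(congr1 (fun x => I * x)); rewrite mulrA II mulN1r mulr0 => /eqP; rewrite oppr_eq0 => /eqP.
Qed.

Lemma mulJ_emb z : J * emb z = emb (z^*)%C * J.
Proof.
rewrite emb_conj /slice_emb -/(cslice _ _ _) cslice_conj // /cslice mulrDr mulrDl.
rewrite algq_comm; congr (_ + _).
rewrite !mulr_algr -scalerAr scaleNr mulNr -scalerAl.
by have := HIJ; rewrite /slice_orth => ->; rewrite scalerN opprK.
Qed.

Lemma slice_part_emb z : slice_part I (emb z) = emb z.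
Proof.
rewrite /slice_part -(slice_comm HI (emb_slice z) (slice_unit I)) -mulrA II mulrN1 opprK.
by rewrite scalerDr -scalerDl (_ : 2^-1 + 2^-1 = 1 :> R) ?scale1r //; field.
Qed.

Lemma slice_part_embJ z : slice_part I (emb z * J) = 0.
Proof.
rewrite /slice_part mulrA -(slice_comm HI (emb_slice z) (slice_unit I)) -!mulrA.
have -> : I * (J * I) = J.
  by have := HIJ; rewrite /slice_orth => h; rewrite mulrA h mulNr -mulrA II mulrN1 opprK.
by rewrite subrr scaler0.
Qed.

Lemma slice_partD p q : slice_part I (p + q) = slice_part I p + slice_part I q.
Proof. by rewrite /slice_part mulrDr mulrDl opprD addrACA scalerDr. Qed.

(* Under this identification of C_I^2 with the quaternions, the matrix
   realization of [sum q^m c_m] at [z] acts as [b |-> sum c_m b z^m]. *)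
Definition quat_of_col (v : 'cV[C]_2) : H := emb (v 0 0) - emb ((v 1 0)^*)%C * J.

Lemma quat_of_colD v w : quat_of_col (v + w) = quat_of_col v + quat_of_col w.
Proof. by rewrite /quat_of_col !mxE rmorphD /= !embD mulrDl opprD addrACA. Qed.

Lemma quat_of_colN v : quat_of_col (- v) = - quat_of_col v.
Proof. by rewrite /quat_of_col !mxE rmorphN /= !embN mulNr !opprB opprK addrC. Qed.

Lemma quat_of_colZ l v : quat_of_col (l *: v) = quat_of_col v * emb l.
Proof.
rewrite /quat_of_col !mxE rmorphM /= !embM mulrBl -(mulrA _ J) mulJ_emb; congr (_ - _).
  exact: emb_comm.
by rewrite mulrA emb_comm -!mulrA.
Qed.

Lemma normq_sqrB (p q : H) :
  `|p - q| ^+ 2 = `|p| ^+ 2 + `|q| ^+ 2 - 2 * qre (quat_conj p * q).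
Proof. by rewrite !normq_sqr /=; ring. Qed.

Lemma norm_quat_of_col v : `|quat_of_col v| ^+ 2 = cV_sqnorm v.
Proof.
rewrite /quat_of_col normq_sqrB normqM (imag_unit_norm HJ) mulr1 !norm_emb.
rewrite -emb_conj mulrA -embM.
have -> (z : C) : qre (emb z * J) = 0.
  apply: qre_conj; rewrite qconjM (imag_unit_conj HJ) mulNr -emb_conj mulJ_emb.
  by rewrite conjcK.
rewrite mulr0 subr0 /cV_sqnorm big_ord_recl big_ord1 (_ : lift _ _ = 1); last exact: val_inj.
by congr (_ + _ ^+ 2); case: (v 1 0) => a b /=; rewrite sqrrN.
Qed.

Lemma quat_of_col_surj b : exists v, quat_of_col v = b.
Proof.
have JJ : J * J = -1 by rewrite -expr2.
have [p hp] : exists p, emb p = slice_part I b.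
  exists (slice_coord (slice_part I b)); apply: emb_slice_coord.
  exact: (slice_part_comm b HI (slice_unit I)).
have [q hq] : exists q, emb q = orth_part I b * J.
  exists (slice_coord (orth_part I b * J)); apply: emb_slice_coord.
  rewrite mulrA (orth_part_comm b HI (slice_unit I)) (imag_unit_conj HI) -!mulrA mulNr.
  by have := HIJ; rewrite /slice_orth => ->; rewrite opprK.
exists (\matrix_(i, j) if nat_of_ord i is 0%N then p else (q^*)%C).
rewrite /quat_of_col !mxE /= conjcK hp hq.
by rewrite -mulrA JJ mulrN1 opprK slice_orth_partE.
Qed.

End SliceCoordinates.

(** * Splittings, and realizations as evaluations *)

Section Realization.
Import ComplexField Normc.
Variable R : realType.
Local Notation H := (quat R).
Local Notation C := R[i].
Variables (I J : H).
Hypotheses (HI : imag_unit I) (HJ : imag_unit J) (HIJ : slice_orth J I).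
Local Notation emb := (slice_emb I).
Local Notation col := (quat_of_col I J).

Lemma near_punctured (P : C -> Prop) (z : C) (d : R) : 0 < d ->
  (forall w, w != z -> normc (w - z) < d -> P w) -> \forall w \near (z : C^o)^', P w.
Proof.
move=> d0 hP; apply/nbhs_ballP; exists d%:C%C => /=; first by rewrite ltcR.
move=> w /= bw wz; apply: hP => //.
by move: bw; rewrite /ball /= distrC -ltcR.
Qed.

Lemma quadratic_derivable (F : C -> C) z D (K d : R) : 0 < d ->
  (forall h, normc h < d -> normc (F (z + h) - F z - h * D) <= K * normc h ^+ 2) ->
  derivable (F : C^o -> C^o) z 1.
Proof.
move=> d0 hF; apply/cvg_ex; exists D; apply/cvgrPdist_le => /= e e0.
have eE : e = (complex.Re e)%:C%C by rewrite RRe_real // ger0_real // ltW.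
have re0 : 0 < complex.Re e by rewrite -ltcR -eE.
have K1 : 0 < `|K| + 1 by rewrite ltr_wpDl.
apply: (@near_punctured _ 0 (Num.min d (complex.Re e / (`|K| + 1)))).
  by rewrite lt_min d0 divr_gt0.
move=> h h0; rewrite subr0 lt_min => /andP[hd he].
have nh : 0 < normc h.
  by rewrite lt_def; apply/andP; split; [apply: contraNneq h0 => /eq0_normc ->|case: (h) => a b; exact: sqrtr_ge0].
rewrite eE; suff : normc (D - h^-1 * (F (h * 1 + z) - F z)) <= complex.Re e by rewrite -lecR.
have -> : D - h^-1 * (F (h * 1 + z) - F z) = - (h^-1 * (F (z + h) - F z - h * D)).
  rewrite mulr1 [h + z]addrC !mulrBr !mulrA mulVf // mul1r !opprB; ring.
rewrite normcN normcM normcV mulrC ler_pdivrMr //.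
apply: le_trans (hF h hd) _; rewrite expr2 mulrA; apply: ler_wpM2r; first exact: ltW.
apply: le_trans (_ : _ <= (`|K| + 1) * normc h) _.
  by apply: ler_wpM2r; [exact: ltW|have := ler_norm K; lra].
by rewrite mulrC -ler_pdivlMr // ltW.
Qed.

Lemma slice_coord_emb z : slice_coord I (emb z) = z.
Proof.
have inj z' w' : emb z' = emb w' -> z' = w'.
  move=> zw; apply/eqP; rewrite -subr_eq0; apply/eqP; apply: eq0_normc.
  by rewrite -(norm_emb HI) embB zw subrr normr0.
apply: inj; apply: (emb_slice_coord HI).
exact: (slice_comm HI (slice_unit I) (emb_slice I z)).
Qed.

Lemma norm_slice_coord q : I * q = q * I -> normc (slice_coord I q) = `|q|.
Proof. by move=> Iq; rewrite -(norm_emb HI) (emb_slice_coord HI). Qed.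

Lemma slice_coordM z q : I * q = q * I -> slice_coord I (emb z * q) = z * slice_coord I q.
Proof.
by move=> Iq; rewrite -{1}(emb_slice_coord HI Iq) -(embM HI) slice_coord_emb.
Qed.

Lemma slice_coordB p q : slice_coord I (p - q) = slice_coord I p - slice_coord I q.
Proof. by rewrite /slice_coord mulrBr opprB; apply/eqP; rewrite eq_complex /=; apply/andP; split; apply/eqP; ring. Qed.

(** [P] is abstract so that one argument covers both components of the splitting: [slice_part], and
    the coordinate of [orth_part] along [J]. *)
Lemma slice_coord_holomorphic (P : H -> H) g : slice_regular g ->
  (forall p q, P (p - q) = P p - P q) -> (forall q, `|P q| <= `|q|) ->
  (forall q, I * P q = P q * I) -> (forall z q, P (emb z * q) = emb z * P q) ->
  holomorphic_on_disc (fun z => slice_coord I (P (g (emb z)))).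
Proof.
move=> /coeffs_slice_regular hg PB Pn PI PZ z /(unit_disc_emb HI) zB.
have [D [K [d [d0 _ hD hK]]]] := power_sum_frechet hg zB.
have DE h : D (emb h) = emb h * D 1.
  apply: (cvg_uniq (hD (emb h))); have := series_cvgMl (q := emb h) (hD 1).
  rewrite (_ : (fun m => _) = (fun m => dpow (emb z) m (emb h) * coeffs g m)) //.
  apply/funext => m; rewrite mulrA; congr (_ * _).
  by rewrite (dpow_comm m (emb_comm HI z h)) (@dpow_comm _ (emb z) m 1) ?mulr1 ?mul1r.
apply: (@quadratic_derivable _ z (slice_coord I (P (D 1))) K d d0) => h hd.
have -> : h * slice_coord I (P (D 1)) = slice_coord I (P (D (emb h))).
  by rewrite DE PZ slice_coordM.
rewrite -!slice_coordB -!PB norm_slice_coord // (le_trans (Pn _)) //.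
by rewrite embD -(norm_emb HI); apply: hK; rewrite (norm_emb HI) ltW.
Qed.

Let II : I * I = -1. Proof. by rewrite -expr2. Qed.
Let JJ : J * J = -1. Proof. by rewrite -expr2. Qed.

Lemma slice_part_emb_mul z q : slice_part I (emb z * q) = emb z * slice_part I q.
Proof.
rewrite /slice_part -scalerAr mulrBr; congr (_ *: (_ - _)).
by rewrite !mulrA (slice_comm HI (slice_unit I) (emb_slice I z)).
Qed.

Lemma orth_part_emb_mul z q : orth_part I (emb z * q) = emb z * orth_part I q.
Proof.
rewrite /orth_part -scalerAr mulrDr; congr (_ *: (_ + _)).
by rewrite !mulrA (slice_comm HI (slice_unit I) (emb_slice I z)).
Qed.

Lemma slice_partB p q : slice_part I (p - q) = slice_part I p - slice_part I q.
Proof. by rewrite /slice_part -scalerBr mulrBr mulrBl !opprD !opprK addrACA. Qed.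

Lemma orth_partB p q : orth_part I (p - q) = orth_part I p - orth_part I q.
Proof. by rewrite /orth_part -scalerBr mulrBr mulrBl opprD addrACA. Qed.

Lemma orth_partJ_comm q : I * (orth_part I q * J) = orth_part I q * J * I.
Proof.
rewrite mulrA (orth_part_comm q HI (slice_unit I)) (imag_unit_conj HI) -!mulrA mulNr.
by have := HIJ; rewrite /slice_orth => ->; rewrite opprK.
Qed.

Lemma splitting_ex g : slice_regular g -> exists FG, is_splitting I J g FG.
Proof.
move=> hg.
pose P q := - (orth_part I q * J).
exists (fun z => slice_coord I (slice_part I (g (emb z))), fun z => slice_coord I (P (g (emb z)))).
split=> /=.
- apply: (slice_coord_holomorphic hg) => [p q|q|q|z q].
  + exact: slice_partB.
  + exact: slice_part_le.
  + exact: (slice_part_comm q HI (slice_unit I)).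
  + exact: slice_part_emb_mul.
- apply: (slice_coord_holomorphic hg) => [p q|q|q|z q]; rewrite /P.
  + by rewrite orth_partB mulrBl opprB opprK addrC.
  + by rewrite normrN normqM (imag_unit_norm HJ) mulr1; exact: orth_part_le.
  + by rewrite mulrN mulNr orth_partJ_comm.
  + by rewrite orth_part_emb_mul mulrN mulrA.
move=> z _; rewrite !(emb_slice_coord HI).
- by rewrite /P mulNr -mulrA JJ mulrN1 opprK slice_orth_partE.
- by rewrite /P mulrN mulNr orth_partJ_comm.
- exact: (slice_part_comm _ HI (slice_unit I)).
Qed.

(** [splitting] selects some pair; the projections onto C_I and C_I J determine its values on the
    disc. *)
Lemma splitting_parts g z : slice_regular g -> unit_disc z ->
  emb ((splitting I J g).1 z) = slice_part I (g (emb z)) /\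
  emb ((splitting I J g).2 z) * J = orth_part I (g (emb z)).
Proof.
move=> /splitting_ex ex zB; have [_ _ /(_ z zB) E] := xgetPex (fun=> 0, fun=> 0) ex.
rewrite -/(splitting I J g) in E.
have s1 : emb ((splitting I J g).1 z) = slice_part I (g (emb z)).
  by rewrite E slice_partD (slice_part_emb HI) (slice_part_embJ HI HIJ) addr0.
split=> //; apply: (addrI (emb ((splitting I J g).1 z))).
by rewrite -E s1 slice_orth_partE.
Qed.

Lemma right_evalD (c : nat -> H) z b b' : radius1 c -> unit_ball z ->
  right_eval c z (b + b') = right_eval c z b + right_eval c z b'.
Proof.
move=> hc zB; apply: (cvg_uniq (right_eval_cvg hc zB)).
have := series_cvgD (right_eval_cvg (b := b) hc zB) (right_eval_cvg (b := b') hc zB).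
rewrite (_ : (fun n => _ + _) = (fun m => c m * (b + b') * z ^+ m)) //.
by apply/funext => m; rewrite mulrDr mulrDl.
Qed.

(** Of the two parts of [c_m], one commutes with [z^m] and the other turns it into the power of the
    conjugate; so right powers of [z] become left powers of [z] and of its conjugate, which sum to
    values of [g]. *)
Lemma right_eval1 c g z : power_sum c g -> unit_disc z ->
  right_eval c (emb z) 1 = slice_part I (g (emb z)) + orth_part I (g (emb (z^*)%C)).
Proof.
move=> hc /(unit_disc_emb HI) zB; have rc := power_sum_radius1 hc.
have zB' : unit_ball (quat_conj (emb z)) by rewrite /unit_ball /= norm_qconj.
apply: (cvg_uniq (right_eval_cvg rc zB)); rewrite (emb_conj HI).
have lin (k : R) (w q : H) (T : H -> H) : unit_ball w ->
    (forall q, T q = 2^-1 *: (q + k *: (I * q * I))) ->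
    series (fun m => T (w ^+ m * c m)) @ \oo --> T (g w).
  move=> wB hT; rewrite hT.
  have h1 := series_cvgMl (q := I) (hc w wB).
  have h2 := series_cvgMl (q := k%:A) (series_cvgMr (q := I) h1).
  have h3 := series_cvgMl (q := (2^-1)%:A) (series_cvgD (hc w wB) h2).
  rewrite !mulr_algl in h3; rewrite (_ : (fun m => _) = (fun n =>
    2^-1%:A * (w ^+ n * c n + k%:A * (I * (w ^+ n * c n) * I)))) //.
  by apply/funext => m; rewrite hT !mulr_algl.
have h1 := lin (-1) _ 0 (slice_part I) zB (fun q => ltac:(by rewrite scaleN1r)).
have h2 := lin 1 _ 0 (orth_part I) zB' (fun q => ltac:(by rewrite scale1r)).
have := series_cvgD h1 h2.
rewrite (_ : (fun n => _ + _) = (fun m => c m * 1 * emb z ^+ m)) //.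
apply/funext => m; rewrite mulr1.
have sl : slice I (emb z ^+ m) := sliceX HI m (emb_slice I z).
have [w wE] : exists w, emb z ^+ m = emb w by have [x [y ->]] := sl; exists (Complex x y).
have cE : quat_conj (emb z) ^+ m = emb (w^*)%C by rewrite -qconjX wE (emb_conj HI).
rewrite wE cE slice_part_emb_mul orth_part_emb_mul.
rewrite (slice_part_comm (c m) HI (emb_slice I w)) (orth_part_comm (c m) HI (emb_slice I (w^*)%C)).
by rewrite (emb_conj HI) qconjK -mulrDl slice_orth_partE.
Qed.

Lemma right_evalJ (c : nat -> H) z : radius1 c -> unit_disc z ->
  right_eval c (emb z) J = right_eval c (emb (z^*)%C) 1 * J.
Proof.
move=> rc /(unit_disc_emb HI) zB.
have zB' : unit_ball (emb (z^*)%C) by rewrite (emb_conj HI) /unit_ball /= norm_qconj.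
apply: (cvg_uniq (right_eval_cvg rc zB)).
have := series_cvgMr (q := J) (right_eval_cvg (b := 1) rc zB').
rewrite (_ : (fun n => _ * J) = (fun m => c m * J * emb z ^+ m)) //.
apply/funext => m; rewrite mulr1 -!mulrA; congr (_ * _).
elim: m => [|m IH]; first by rewrite !expr0 mulr1 mul1r.
by rewrite exprS -mulrA IH mulrA -(mulJ_emb HI HIJ) -mulrA -exprS.
Qed.

Lemma mulmx2E (M : 'M[C]_2) (v : 'cV[C]_2) i :
  (M *m v) i 0 = M i 0 * v 0 0 + M i 1 * v 1 0.
Proof.
by rewrite mxE big_ord_recl big_ord1 (_ : lift _ _ = 1) //; exact: val_inj.
Qed.

Lemma realizationE g z (v : 'cV[C]_2) : let: (F, G) := splitting I J g in
  (realization I J g z *m v) 0 0 = F z * v 0 0 + G z * v 1 0 /\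
  (realization I J g z *m v) 1 0 = - sharp G z * v 0 0 + sharp F z * v 1 0.
Proof.
rewrite /realization; case: (splitting I J g) => F G.
have e0 : (0 : 'I_2) = lshift 1 (0 : 'I_1) by exact: val_inj.
have e1 : (1 : 'I_2) = rshift 1 (0 : 'I_1) by exact: val_inj.
split; rewrite mulmx2E; congr (_ * _ + _ * _); rewrite ?e0 ?e1.
- by apply: (etrans (block_mxEul _ _ _ _ _ _)); rewrite mxE eqxx.
- by apply: (etrans (block_mxEur _ _ _ _ _ _)); rewrite mxE eqxx.
- by apply: (etrans (block_mxEdl _ _ _ _ _ _)); rewrite mxE eqxx.
- by apply: (etrans (block_mxEdr _ _ _ _ _ _)); rewrite mxE eqxx.
Qed.

(** Both sides are right linear over C_I and [col v = 1 * v_0 - J * v_1], so it is enough to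
    evaluate at 1 and at [J], by [right_eval1] and [right_evalJ]. *)
Lemma realization_eval g c z v : power_sum c g -> unit_disc z ->
  col (realization I J g z *m v) = right_eval c (emb z) (col v).
Proof.
move=> hc zD; have hg := power_sum_slice_regular hc; have rc := power_sum_radius1 hc.
have zD' : unit_disc (z^*)%C.
  by apply/(unit_disc_emb HI); rewrite (emb_conj HI) /unit_ball /= norm_qconj; apply/(unit_disc_emb HI).
have zB := (unit_disc_emb HI z).1 zD.
have [F1 G1] := splitting_parts hg zD; have [F2 G2] := splitting_parts hg zD'.
have := realizationE g z v; move: F1 G1 F2 G2; case: (splitting I J g) => F G /= F1 G1 F2 G2 [E0 E1].
have -> : col v = 1 * emb (v 0 0) + J * emb (- v 1 0).
  by rewrite /quat_of_col mul1r embN mulrN (mulJ_emb HI HIJ).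
rewrite right_evalD // !right_evalMr //; try exact: (emb_comm HI).
rewrite right_evalJ // !(right_eval1 hc) // conjcK -F1 -F2 -G1 -G2.
rewrite /quat_of_col E0 E1 /sharp rmorphD rmorphM rmorphM rmorphN /= !conjcK.
rewrite !embD !embN !(embM HI) !embN.
have := mulJ_emb HI HIJ (v 0 0); have := mulJ_emb HI HIJ (v 1 0).
move: (emb (F z)) (emb (G z)) (emb (F (z^*)%C)) (emb (G (z^*)%C)) => f1 g1 f2 g2.
move: (emb (v 0 0)) (emb (v 1 0)) (emb ((v 0 0)^*)%C) (emb ((v 1 0)^*)%C) => a b a' b' Jb Ja.
rewrite !mulrDl !mulrN !mulNr -!mulrA -Ja -Jb (mulrA J J) JJ mulN1r mulrN.
move: (f1 * a) (g1 * b) (g2 * _) (f2 * _) => x y p q.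
rewrite !opprD !opprK -!addrA; congr (_ + _).
by rewrite [LHS]addrC addrA.
Qed.

End Realization.

(** * Operator norms of block columns, and their holomorphy *)

Section OperatorNorm.
Import ComplexField Normc.
Variable R : realType.
Local Notation H := (quat R).
Local Notation C := R[i].
Variables (I J : H).
Hypotheses (HI : imag_unit I) (HJ : imag_unit J) (HIJ : slice_orth J I).
Local Notation emb := (slice_emb I).
Local Notation col := (quat_of_col I J).
Variable Lambda : set nat.

Lemma cV_sqnorm_ge0 n (v : 'cV[C]_n) : 0 <= cV_sqnorm v.
Proof. by apply: sumr_ge0 => i _; exact: sqr_ge0. Qed.

Lemma op_norm_ge0 (A : nat -> 'M[C]_2) : (0 <= op_norm Lambda A)%E.
Proof.
apply: le_trans (sqrte_ge0 (l2_sqnorm Lambda (fun j => A j *m 0))) _.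
apply: ereal_sup_ubound; exists 0 => //=.
by rewrite /cV_sqnorm big1 ?ler01 // => i _; rewrite mxE normc0 expr0n.
Qed.

Lemma op_norm_le (A : nat -> 'M[C]_2) k : 0 <= k ->
  (forall n v, \sum_(0 <= j < n | j \in Lambda) cV_sqnorm (A j *m v) <= k ^+ 2 * cV_sqnorm v) ->
  (op_norm Lambda A <= k%:E)%E.
Proof.
move=> k0 hA; apply: ge_ereal_sup => _ [v /= v1 <-].
have -> : k%:E = sqrte (k%:E ^+ 2)%E by rewrite sqrte_sqr gee0_abs.
rewrite lee_sqrt ?sqre_ge0 // -EFin_expe.
apply/nneseries_fin_leP => [j|n]; first exact: cV_sqnorm_ge0.
by apply: le_trans (hA n v) _; rewrite ler_piMr ?sqr_ge0.
Qed.

Lemma op_norm_bound (A : nat -> 'M[C]_2) k : 0 <= k -> (op_norm Lambda A <= k%:E)%E ->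
  forall n v, cV_sqnorm v <= 1 -> \sum_(0 <= j < n | j \in Lambda) cV_sqnorm (A j *m v) <= k ^+ 2.
Proof.
move=> k0 hA n v v1.
have : (sqrte (l2_sqnorm Lambda (fun j => A j *m v)) <= k%:E)%E.
  by apply: le_trans hA; apply: ereal_sup_ubound; exists v.
have -> : k%:E = sqrte (k%:E ^+ 2)%E by rewrite sqrte_sqr gee0_abs.
rewrite lee_sqrt ?sqre_ge0 // -EFin_expe => h.
by move: n; apply/nneseries_fin_leP => // j; exact: cV_sqnorm_ge0.
Qed.

Lemma op_norm_eval_le (A : nat -> 'M[C]_2) (e : nat -> H -> H) k : 0 <= k ->
  (forall j v, Lambda j -> col (A j *m v) = e j (col v)) ->
  (forall n b, \sum_(j < n) `|e j b| ^+ 2 <= k ^+ 2 * `|b| ^+ 2) ->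
  (op_norm Lambda A <= k%:E)%E.
Proof.
move=> k0 hA he; apply: op_norm_le => // n v.
rewrite -(norm_quat_of_col HI HJ HIJ) big_mkcond big_mkord /=.
apply: le_trans (he n (col v)); apply: ler_sum => j _.
case: ifP => [/set_mem jL|_]; last exact: sqr_ge0.
by rewrite -(norm_quat_of_col HI HJ HIJ) hA.
Qed.

(** [op_norm] tests vectors of norm at most 1, so a general [b] is first scaled to norm 1 and
    [b = 0] is treated apart. *)
Lemma op_sup_norm_eval (g : nat -> H -> H) (c : nat -> nat -> H) k : 0 <= k ->
  (forall j, Lambda j -> power_sum (c j) (g j)) ->
  (forall j, ~ Lambda j -> c j = fun=> 0) ->
  (op_sup_norm Lambda (block_column I J g) <= k%:E)%E ->
  forall n z b, slice I z -> unit_ball z ->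
  \sum_(j < n) `|right_eval (c j) z b| ^+ 2 <= k ^+ 2 * `|b| ^+ 2.
Proof.
move=> k0 hg c0 hk n z b [x [y zE]] zB.
have [w wE] : exists w, z = emb w by exists (Complex x y).
have rc j : radius1 (c j).
  have [jL|jL] := pselect (Lambda j); first exact: power_sum_radius1 (hg j jL).
  by rewrite c0 //; exact: l2_radius1 (@zero_l2 R).
have wD : unit_disc w by apply/(unit_disc_emb HI); rewrite -wE.
have hop : (op_norm Lambda (block_column I J g w) <= k%:E)%E.
  by apply: le_trans hk; apply: ereal_sup_ubound; exists w.
have eval0 j : right_eval (c j) z 0 = 0.
  by rewrite -[X in right_eval _ _ X](mulr0 1) right_evalMr ?mulr0 ?mul0r.
have [->|b0] := eqVneq b 0.
  by rewrite normr0 expr0n mulr0 big1 // => j _; rewrite eval0 normr0 expr0n.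
have nb : 0 < `|b| by rewrite normr_gt0.
pose s := `|b|^-1; have s0 : 0 < s by rewrite invr_gt0.
have [v vE] := quat_of_col_surj HI HJ HIJ (b * s%:A).
have v1 : cV_sqnorm v <= 1.
  rewrite -(norm_quat_of_col HI HJ HIJ) vE normqM norm_alg (gtr0_norm s0).
  by rewrite mulfV ?gt_eqF // expr1n.
have := op_norm_bound k0 hop n v1; rewrite big_mkcond big_mkord /=.
have -> : \sum_(j < n) (if nat_of_ord j \in Lambda then cV_sqnorm (block_column I J g w j *m v) else 0) =
    \sum_(j < n) `|right_eval (c j) z b| ^+ 2 * s ^+ 2.
  apply: eq_bigr => j _; case: ifP => [/set_mem jL|jL].
    rewrite -(norm_quat_of_col HI HJ HIJ) (realization_eval HI HJ HIJ v (hg j jL) wD) -wE vE.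
    by rewrite right_evalMr ?algq_comm // normqM norm_alg (gtr0_norm s0) exprMn.
  rewrite (_ : right_eval (c j) z b = 0) ?normr0 ?expr0n ?mul0r // c0; last first.
    by move=> /mem_set; rewrite jL.
  apply: (cvg_uniq (right_eval_cvg (l2_radius1 (@zero_l2 R)) zB)).
  rewrite (_ : series _ = fun=> 0); first exact: cvg_cst.
  by apply/funext => m; rewrite /series /= big1 // => i _; rewrite !mul0r.
by rewrite -mulr_suml /s exprVn ler_pdivrMr // exprn_gt0.
Qed.

Variables (c : nat -> nat -> H) (g : nat -> H -> H) (k : R).
Hypothesis k0 : 0 <= k.
Hypothesis hc : forall (u : nat -> H) n M,
  \sum_(j < n) \sum_(m < M) `|qconv (c j) u m| ^+ 2 <= k ^+ 2 * \sum_(m < M) `|u m| ^+ 2.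
Hypothesis hg : forall j, Lambda j -> power_sum (c j) (g j).

Lemma column_op_norm_le z : unit_disc z -> (op_norm Lambda (block_column I J g z) <= k%:E)%E.
Proof.
move=> zD; have zB := (unit_disc_emb HI z).1 zD.
apply: (op_norm_eval_le (e := fun j => right_eval (c j) (emb z))) => // [j v jL|n b].
  exact: (realization_eval HI HJ HIJ v (hg jL) zD).
exact: (column_eval_le (sqr_ge0 k) hc).
Qed.

Let K0 : 0 <= k ^+ 2. Proof. exact: sqr_ge0. Qed.

Definition derived_coeffs (a : nat -> H) m : H := m.+1%:R *: a m.+1.

Lemma derived_radius1 j : radius1 (derived_coeffs (c j)).
Proof.
apply: bounded_radius1 => r /andP[r0 r1].
have r01 : 0 <= r < 1 by rewrite ltW.
have [D hD] := linear_weight_le r01.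
have a0 i : 0 <= r ^+ i * i.+1%:R by rewrite mulr_ge0 ?exprn_ge0 ?(ltW r0).
exists (D * (1 + k ^+ 2)) => m; rewrite normrZ mulrA ger0_norm ?ler0n //.
have := l2_term m.+1 (fam_le_l2 j (column_fam_le K0 hc)) => h.
apply: ler_pM => //.
  have := hD m.+1; rewrite big_nat_recr //=; apply: le_trans; rewrite lerDr; exact: sumr_ge0.
have := sqr_ge0 (`|c j m.+1| - 1); have := normr_ge0 (c j m.+1); nra.
Qed.

(** The term of degree 0 carries the factor 0, so the two series agree after a shift of the index by
    one. *)
Lemma derived_eval_cvg j z b : unit_ball z ->
  series (fun m => c j m * b * (m%:R *: z ^+ m.-1)) @ \oo --> right_eval (derived_coeffs (c j)) z b.
Proof.
move=> zB; have /cvg_seqP h := right_eval_cvg (b := b) (derived_radius1 j) zB.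
apply/cvg_seqP => e /h[N hN]; exists N.+1 => -[//|n] Nn; have := hN n Nn.
rewrite /series /= (@big_nat_recl _ _ _ n 0) //= scale0r mulr0 add0r.
rewrite (eq_bigr (fun m => c j m.+1 * b * (m.+1%:R *: z ^+ m))) // => m _.
by rewrite /derived_coeffs -!scalerAl -scalerAr.
Qed.

Lemma difference_weight_le (z h : H) r m : 0 < r -> `|z| <= r -> `|z + h| <= r ->
  z * h = h * z -> h != 0 ->
  `|((z + h) ^+ m - z ^+ m) * qinv h - m%:R *: z ^+ m.-1| <= m%:R ^+ 2 * r ^+ m * (`|h| / r ^+ 2).
Proof.
move=> r0 zr hr zh h0.
have -> : ((z + h) ^+ m - z ^+ m) * qinv h - m%:R *: z ^+ m.-1 =
    ((z + h) ^+ m - z ^+ m - dpow z m h) * qinv h.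
  rewrite [RHS]mulrBl (dpow_comm m zh); congr (_ - _).
  have : GRing.comm h (m%:R *: z ^+ m.-1).
    by rewrite /GRing.comm -scalerAl -scalerAr (commrX m.-1 (esym zh : GRing.comm h z)).
  by move=> ->; rewrite -mulrA mulqVr // mulr1.
have nh : 0 < `|h| by rewrite normr_gt0.
rewrite normqM norm_qinv ler_pdivrMr //.
have -> : m%:R ^+ 2 * r ^+ m * (`|h| / r ^+ 2) * `|h| = m%:R ^+ 2 * r ^+ m * `|h| ^+ 2 / r ^+ 2.
  by move: (r ^+ 2)^-1 (r ^+ m) (m%:R) => x y w; ring.
by rewrite ler_pdivlMr ?exprn_gt0 // mulrC; exact: pow_taylor_le (ltW r0) zr hr.
Qed.

(** Both the boundedness of the derivative and the convergence of the difference quotient in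
    operator norm follow from [column_weight_le]; for the latter the weights are Taylor remainders
    divided by [h], with sum at most [D |h| / r^2]. *)
Lemma column_op_holomorphic : op_holomorphic Lambda (block_column I J g).
Proof.
move=> z zD; have zB := (unit_disc_emb HI z).1 zD.
have z1 : `|emb z| < 1 by [].
pose r := (1 + `|emb z|) / 2; pose d := (1 - `|emb z|) / 2.
have r0 : 0 < r by rewrite /r; have := normr_ge0 (emb z); lra.
have d0 : 0 < d by rewrite /d; lra.
have zr : `|emb z| <= r by rewrite /r; lra.
have r01 : 0 <= r < 1 by rewrite (ltW r0) /= /r; lra.
have [D hD] := radius1_weight (@radius1_cst R) r01.
have D0 : 0 <= D by have := hD 0%N; rewrite big_geq.
pose A' j := realization I J (psum (derived_coeffs (c j))) z.
have A'E j v : col (A' j *m v) = right_eval (derived_coeffs (c j)) (emb z) (col v).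
  exact: (realization_eval HI HJ HIJ v (radius1_psum (derived_radius1 j)) zD).
have t0 : abs_bounded (fun m => m%:R *: emb z ^+ m.-1) (D / r).
  move=> n; rewrite ler_pdivlMr // mulr_suml; apply: le_trans (hD n).
  apply: ler_sum => m _; rewrite normq1 mulr1 normrZ ger0_norm ?ler0n // normqX.
  case: m => [|m] /=; first by rewrite !mul0r mulr_ge0 ?sqr_ge0 ?exprn_ge0 ?(ltW r0).
  rewrite expr2 -!mulrA; apply: ler_wpM2l; first exact: ler0n.
  apply: le_trans (_ : _ <= r ^+ m.+1) _.
    rewrite exprSr; apply: ler_wpM2r; first exact: ltW.
    by apply: lerXn2r; rewrite ?nnegrE ?(ltW r0).
  by rewrite ler_peMl ?exprn_ge0 ?(ltW r0) // ler1n.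
exists A'.
  apply: le_lt_trans (ltry (k * (D / r))).
  apply: (op_norm_eval_le (e := fun j => right_eval (derived_coeffs (c j)) (emb z))) => [|j v _|n b].
  - by rewrite mulr_ge0 // divr_ge0 // ltW.
  - exact: A'E.
  rewrite exprMn /=; apply: (column_weight_le K0 hc
    (x := fun j => right_eval (derived_coeffs (c j)) (emb z) b) _ t0) => j.
  exact: derived_eval_cvg.
apply/cvge0P => [w|e e0]; first exact: op_norm_ge0.
pose T := k * (D / r ^+ 2); have T0 : 0 <= T by rewrite mulr_ge0 // divr_ge0 // exprn_ge0 // ltW.
have T1 : 0 < T + 1 by rewrite ltr_wpDl.
apply: (@near_punctured R _ z (Num.min d (e / (T + 1)))).
  by rewrite lt_min d0 divr_gt0.
move=> w wz; rewrite lt_min => /andP[wd we].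
pose h := emb (w - z).
have nh : `|h| = normc (w - z) by rewrite (norm_emb HI).
have h0 : h != 0.
  rewrite -normr_eq0 nh; apply: contraNneq wz => /eq0_normc/eqP.
  by rewrite subr_eq0.
have wE : emb w = emb z + h by rewrite /h -embD addrC subrK.
have zh : emb z * h = h * emb z by exact: (emb_comm HI).
have hr : `|emb z + h| <= r by have := ler_normD (emb z) h; rewrite nh /r; move: wd; rewrite /d; lra.
have wB : unit_ball (emb w).
  by rewrite /unit_ball /= wE; case/andP: r01 => _; exact: le_lt_trans.
have wD : unit_disc w by apply/(unit_disc_emb HI).
have hinv : emb ((w - z)^-1) = qinv h.
  have wz0 : w - z != 0 by rewrite subr_eq0.
  have : emb ((w - z)^-1) * h = 1 by rewrite /h -(embM HI) mulVf // (emb1 I).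
  by move=> /(congr1 (fun x => x * qinv h)); rewrite -mulrA mulqVr // mulr1 mul1r.
pose t m := ((emb z + h) ^+ m - emb z ^+ m) * qinv h - m%:R *: emb z ^+ m.-1.
have tT : abs_bounded t (D * (`|h| / r ^+ 2)).
  move=> n; apply: le_trans (ler_wpM2r _ (hD n)); last by rewrite divr_ge0 ?exprn_ge0 ?(ltW r0).
  rewrite mulr_suml; apply: ler_sum => m _; rewrite normq1 mulr1.
  exact: difference_weight_le.
apply: le_trans (_ : _ <= (T * normc (w - z))%:E)%E _; last first.
  rewrite lee_fin; move: we; rewrite ltr_pdivlMr // => we.
  by have : 0 <= normc (w - z); [rewrite -nh|nra].
apply: (op_norm_eval_le (e := fun j b => (right_eval (c j) (emb w) b - right_eval (c j) (emb z) b) * qinv h -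
    right_eval (derived_coeffs (c j)) (emb z) b)) => [|j v jL|n b].
- by rewrite mulr_ge0 // -nh.
- rewrite mulmxBl -scalemxAl mulmxBl quat_of_colD quat_of_colN (quat_of_colZ HI HIJ).
  rewrite quat_of_colD quat_of_colN hinv A'E.
  by rewrite !(realization_eval HI HJ HIJ v (hg jL)).
have -> : (T * normc (w - z)) ^+ 2 * `|b| ^+ 2 = k ^+ 2 * (D * (`|h| / r ^+ 2)) ^+ 2 * `|b| ^+ 2.
  congr (_ * _); rewrite -exprMn; congr (_ ^+ 2).
  by rewrite /T -nh -!mulrA; congr (_ * (_ * _)); exact: mulrC.
apply: (column_weight_le K0 hc (x := fun j => (right_eval (c j) (emb w) b -
  right_eval (c j) (emb z) b) * qinv h - right_eval (derived_coeffs (c j)) (emb z) b) _ tT) => j.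
have rc := column_radius1 K0 hc j.
have := series_cvgD (series_cvgMr (q := qinv h) (series_cvgD (right_eval_cvg (b := b) rc wB)
  (series_cvgN (right_eval_cvg (b := b) rc zB)))) (series_cvgN (derived_eval_cvg (j := j) (b := b) zB)).
rewrite (_ : (fun m => _ + _) = (fun m => c j m * b * t m)) //.
by apply/funext => m; rewrite /t mulrBr mulrA mulrBr wE.
Qed.

Lemma column_op_Hinf : op_Hinf Lambda (block_column I J g) /\
  (op_sup_norm Lambda (block_column I J g) <= k%:E)%E.
Proof.
have sup : (op_sup_norm Lambda (block_column I J g) <= k%:E)%E.
  by apply: ge_ereal_sup => _ [z zD <-]; exact: column_op_norm_le.
split=> //; split; [|exact: column_op_holomorphic|exact: le_lt_trans sup (ltry _)].
by move=> z zD; exact: le_lt_trans (column_op_norm_le zD) (ltry _).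
Qed.

(** In the slice of [q], applying [right_eval] to 1 at [q] and at its conjugate gives quaternions of
    modulus at most [k] that contain, respectively, the slice part and the orthogonal part of the
    value at [q]. The slice is that of [q], not the fixed one: [column_eval_le] holds at every point
    of the ball. *)
Lemma column_psum_le j q : unit_ball q -> `|psum (c j) q| <= 2 * k.
Proof.
move=> qB; have [I' HI' [x [y qE]]] := quat_slice q.
have [w wE] : exists w : C, q = slice_emb I' w by exists (Complex x y).
have rc := column_radius1 K0 hc j; have pc := radius1_psum rc.
have ev z : unit_ball z -> `|right_eval (c j) z 1| <= k.
  move=> zB; rewrite -(ler_pXn2r (n := 2)) ?nnegrE //.
  have := column_eval_le K0 hc j.+1 1 zB; rewrite normq1 expr1n mulr1; apply: le_trans.
  by rewrite big_ord_recr /= lerDr; apply: sumr_ge0 => i _; exact: sqr_ge0.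
have wD : unit_disc w by apply/(unit_disc_emb HI'); rewrite -wE.
have wB' : unit_ball (slice_emb I' (w^*)%C).
  by rewrite (emb_conj HI') -wE /unit_ball /= norm_qconj.
have wD' : unit_disc (w^*)%C by apply/(unit_disc_emb HI').
have I'I : I' * I' = -1 by rewrite -expr2.
have hs p : I' * slice_part I' p * I' = - slice_part I' p.
  by rewrite (slice_part_comm p HI' (slice_unit I')) -mulrA I'I mulrN1.
have ho p : I' * orth_part I' p * I' = orth_part I' p.
  by rewrite (orth_part_comm p HI' (slice_unit I')) (imag_unit_conj HI') mulrN mulNr -mulrA I'I mulrN1 opprK.
have half (p : H) : 2^-1 *: (p + p) = p.
  by rewrite scalerDr -scalerDl (_ : 2^-1 + 2^-1 = 1 :> R) ?scale1r //; field.
have ss p : slice_part I' (slice_part I' p) = slice_part I' p.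
  by rewrite [LHS]/slice_part hs opprK half.
have so p : slice_part I' (orth_part I' p) = 0 by rewrite /slice_part ho subrr scaler0.
have os p : orth_part I' (slice_part I' p) = 0 by rewrite {1}/orth_part hs subrr scaler0.
have oo p : orth_part I' (orth_part I' p) = orth_part I' p by rewrite [LHS]/orth_part ho half.
have oD p p' : orth_part I' (p + p') = orth_part I' p + orth_part I' p'.
  by rewrite /orth_part mulrDr mulrDl addrACA scalerDr.
have E1 := right_eval1 HI' pc wD; have E2 := right_eval1 HI' pc wD'.
rewrite conjcK -wE in E1 E2.
rewrite -(slice_orth_partE I' (psum (c j) q)).
have -> : slice_part I' (psum (c j) q) = slice_part I' (right_eval (c j) q 1).
  by rewrite E1 slice_partD ss so addr0.
have -> : orth_part I' (psum (c j) q) = orth_part I' (right_eval (c j) (slice_emb I' (w^*)%C) 1).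
  by rewrite E2 oD os oo add0r.
apply: le_trans (ler_normD _ _) _; rewrite mulr_natl mulr2n; apply: lerD.
  by apply: le_trans (slice_part_le _ HI') _; exact: ev.
by apply: le_trans (orth_part_le _ HI') _; exact: ev.
Qed.

End OperatorNorm.

(** * Corona solutions *)

Section Corona.
Variable R : realType.
Local Notation H := (quat R).
Variables (Lambda : set nat) (I : H) (f : nat -> H -> H).
Hypotheses (HI : imag_unit I)
  (Hf : forall j, Lambda j -> Hinf (f j))
  (Hf1 : forall q, unit_ball q ->
    (\sum_(0 <= j <oo | j \in Lambda) (`|f j q| ^+ 2)%:E <= 1)%E).
Let A := family_coeffs Lambda f.
Let A1 := row_coeffs_le Hf Hf1 HI.

Lemma row_coeff_le c K N m : fam_le c K ->
  `|\sum_(j < N) qconv (A j) (c j) m| <= m.+1%:R * ((1 + K) / 2).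
Proof.
move=> hc; apply: le_trans (ler_norm_sum _ _ _) _.
by have := row_abs_summable A1 m hc N; rewrite big_mkord.
Qed.

Lemma qconv_mask (c : nat -> nat -> H) (g : nat -> H -> H) j :
  (forall j, Lambda j -> coeffs (g j) = c j) ->
  qconv (A j) (family_coeffs Lambda g j) = qconv (A j) (c j).
Proof.
move=> gc; rewrite /A /family_coeffs; case: ifP => [/set_mem jL|_]; first by rewrite gc.
by apply/funext => m; rewrite /qconv !big1 // => k _; rewrite mul0r.
Qed.

Lemma linear_weight_scaled (q : H) (K : R) : 0 <= K -> unit_ball q ->
  exists C, forall n, \sum_(0 <= m < n) `|q| ^+ m * (m.+1%:R * K) <= C.
Proof.
move=> K0 qB; have [|C hC] := @linear_weight_le R `|q|; first by rewrite normr_ge0.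
exists (C * K) => n; apply: le_trans (ler_wpM2r K0 (hC n)).
by rewrite mulr_suml; apply: ler_sum => m _; rewrite mulrA.
Qed.

(** The sum over [j] and the power series are exchanged by [dominated_power_sum]: the partial sums
    over [j] have coefficients at most [(m + 1) (1 + K) / 2]. *)
Lemma row_pointwise_cvg (c : nat -> nat -> H) (g : nat -> H -> H) K (s : nat -> H) (G q : H) : fam_le c K ->
  (forall j, Lambda j -> power_sum (c j) (g j)) ->
  (forall m, (fun N => \sum_(j < N) qconv (A j) (c j) m) @ \oo --> s m) ->
  unit_ball q -> series (fun m => q ^+ m * s m) @ \oo --> G ->
  \sum_(0 <= j < N | j \in Lambda) slice_mul (f j) (g j) q @[N --> \oo] --> G.
Proof.
move=> hc hg hs qB hG.
have K2 : 0 <= (1 + K) / 2.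
  by have := hc 0%N 0%N; rewrite big_ord0 => K0; rewrite divr_ge0 // addr_ge0.
have [C hC] := linear_weight_scaled K2 qB.
have gc j : Lambda j -> coeffs (g j) = c j by move=> /hg/coeffsE.
have hgc j : Lambda j -> power_sum (coeffs (g j)) (g j) by move=> jL; rewrite gc //; exact: hg.
apply: (dominated_power_sum (d := fun N m => \sum_(j < N) qconv (A j) (c j) m) _ hs hC _ hG) => N.
  by move=> m; exact: row_coeff_le.
have := power_sum_row (N := N) (row_power_sum Hf) hgc qB.
rewrite (_ : (fun m => _) = (fun m => q ^+ m * \sum_(j < N) qconv (A j) (c j) m)) //.
by apply/funext => m; congr (_ * _); apply: eq_bigr => j _; rewrite (qconv_mask j gc).
Qed.

Lemma power_sum1 : power_sum (fun m => (m == 0%N)%:R : H) (fun=> 1).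
Proof.
move=> q _; apply/cvg_seqP => e e0; exists 1%N => n n0.
rewrite (_ : series _ n = 1) ?subrr ?normr0 // /series /= big_ltn // expr0 mulr1.
rewrite big_nat big1 ?addr0 // => i /andP[i0 _].
by rewrite gtn_eqF // mulr0.
Qed.

(** Majorants for the Weierstrass test on the ball of radius [r]: [x j] is the sum over [m] of
    [r^m |(a_j * c_j)_m|]. Their sum is finite because [sum_j |(a_j * c_j)_m|] grows at most
    linearly in [m]. *)
Lemma row_terms_le (c : nat -> nat -> H) (g : nat -> H -> H) (K r : R) : fam_le c K ->
  (forall j, Lambda j -> power_sum (c j) (g j)) -> 0 <= r < 1 ->
  exists (x : nat -> R) (B : R), [/\ forall j, 0 <= x j, forall n, \sum_(j < n) x j <= B &
    forall j q, Lambda j -> `|q| <= r -> `|slice_mul (f j) (g j) q| <= x j].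
Proof.
move=> hc hg r01; have /andP[r0 r1] := r01.
have K2 : 0 <= (1 + K) / 2.
  by have := hc 0%N 0%N; rewrite big_ord0 => K0; rewrite divr_ge0 // addr_ge0.
have [C hC] := linear_weight_le r01.
pose y j m := r ^+ m * `|qconv (A j) (c j) m|.
have y0 j m : 0 <= y j m by rewrite mulr_ge0 ?exprn_ge0.
have total n M : \sum_(j < n) \sum_(0 <= m < M) y j m <= C * ((1 + K) / 2).
  rewrite exchange_big /=; apply: le_trans (ler_wpM2r K2 (hC M)); rewrite mulr_suml.
  apply: ler_sum => m _; rewrite -mulr_sumr -mulrA; apply: ler_wpM2l; first exact: exprn_ge0.
  by have := row_abs_summable A1 m hc n; rewrite big_mkord.
have bj j : abs_bounded (y j) (C * ((1 + K) / 2)).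
  move=> M; apply: le_trans (total j.+1 M); rewrite big_ord_recr /=.
  under eq_bigr do rewrite ger0_norm //.
  by rewrite lerDr; apply: sumr_ge0 => i _; apply: sumr_ge0 => m _.
have [x hx] := choice (fun j => abs_bounded_cvg (bj j)).
have part j M : \sum_(m < M) y j m <= x j by exact: (series_ge_partial M (y0 j) (hx j)).
exists x, (C * ((1 + K) / 2)); split=> [j|n|j q jL qr].
- by have := part j 0%N; rewrite big_ord0.
- have cs : (fun M => \sum_(j < n) series (y j) M) @ \oo --> \sum_(j < n) x j.
    by apply: (cvg_filter_sum _ (u := fun j => series (y j)) (l := x)) => j _.
  have := cvg_le_norm cs (C := C * ((1 + K) / 2)); rewrite ger0_norm; last first.
    by apply: sumr_ge0 => j _; have := part j 0%N; rewrite big_ord0.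
  apply=> M; rewrite ger0_norm //; first exact: total.
  by apply: sumr_ge0 => j _; apply: sumr_ge0 => m _.
have qB : unit_ball q by exact: le_lt_trans qr r1.
have := power_sum_slice_mul (row_power_sum Hf jL) (hg j jL) qB.
apply: series_le_norm => M; apply: le_trans (part j M); rewrite big_mkord; apply: ler_sum => m _.
rewrite normqM normqX /y /A /family_coeffs mem_set //; apply: ler_wpM2r => //.
by apply: lerXn2r; rewrite ?nnegrE.
Qed.

End Corona.

Lemma uniform_cvg_on (R : realType) (K : set (quat R)) (F : nat -> quat R -> quat R) G :
  (forall e : R, 0 < e -> exists N, forall n, (N <= n)%N -> forall q, K q -> `|G q - F n q| < e) ->
  {uniform K, F @ \oo --> G}.
Proof.
move=> h P /uniform_nbhs[E [entE sub]].
have [e e0 eE] : exists2 e : R, 0 < e & forall x y : quat R, `|x - y| < e -> E (x, y).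
  move: entE; rewrite -entourage_ballE => -[e /= e0 he]; exists e => // x y xy.
  by apply: he; rewrite /= -ball_normE.
have [N hN] := h e e0; exists N => // n /= Nn; apply: sub => q Kq /=.
by apply: eE; exact: hN.
Qed.

Lemma compact_in_ball (R : realType) (K : set (quat R)) : compact K -> K `<=` @unit_ball R ->
  exists2 r : R, 0 <= r < 1 & forall q, K q -> `|q| <= r.
Proof.
move=> cK KB; have [[q0 Kq0]|K0] := pselect (K !=set0); last first.
  by exists 0 => [|q Kq]; [rewrite lexx ltr01|case: K0; exists q].
have cn : {within K, continuous (fun q : quat R => `|q| : R)}.
  by apply: continuous_subspaceT => q; exact: norm_continuous.
have [|c cK' hc] := compact_EVT_max _ cK cn; first by exists q0.
exists `|c| => [|q Kq]; last by apply: hc; exact: mem_set.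
by rewrite normr_ge0; exact: KB (set_mem cK').
Qed.

Theorem theorem1p3 (R : realType) (Lambda : set nat)
    (HLambda : (exists2 n, (1 <= n)%N & Lambda = `I_n) \/ Lambda = [set: nat])
    (I J : quat R) (HI : imag_unit I) (HJ : imag_unit J) (HIJ : slice_orth J I)
    (f : nat -> quat R -> quat R)
    (Hf : forall j, Lambda j -> Hinf (f j))
    (Hf1 : forall q, unit_ball q ->
      (\sum_(0 <= j <oo | j \in Lambda) (`|f j q| ^+ 2)%:E <= 1)%E)
    (eta : R) (Heta : 0 < eta) :
  (toeplitz_lower_bound Lambda f eta <->
     exists g, corona_solution Lambda I J f g eta) /\
  (Lambda = [set: nat] -> forall g, corona_solution Lambda I J f g eta ->
     (forall q, unit_ball q ->
        (\sum_(0 <= j <oo) `|slice_mul (f j) (g j) q|%:E < +oo)%E) /\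
     (forall K, compact K -> K `<=` @unit_ball R ->
        {uniform K, (fun N q => \sum_(0 <= j < N) slice_mul (f j) (g j) q) @ \oo
           --> (fun=> 1 : quat R)})).
Proof.
have e2 : 0 < eta ^+ 2 by exact: exprn_gt0.
pose k := eta^-1; have k0 : 0 <= k by rewrite invr_ge0 ltW.
have K0 : 0 <= k ^+ 2 by exact: sqr_ge0.
have kE : k ^+ 2 = (eta ^+ 2)^-1 by rewrite exprVn.
pose A := family_coeffs Lambda f.
(* Passage from the operator norm to the multiplier norm, shared by the converse implication and the
   convergence of the series. *)
have solution_column g : corona_solution Lambda I J f g eta ->
    let c := family_coeffs Lambda g in
    (forall j, Lambda j -> power_sum (c j) (g j)) /\
    forall (u : nat -> quat R) n M, \sum_(j < n) \sum_(m < M) `|qconv (c j) u m| ^+ 2 <=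
      k ^+ 2 * \sum_(m < M) `|u m| ^+ 2.
  move=> [hg _ _ hk] c.
  have hc j : Lambda j -> power_sum (c j) (g j).
    by move=> jL; rewrite /c /family_coeffs mem_set //; have [/coeffs_slice_regular] := hg j jL.
  have c0 j : ~ Lambda j -> c j = fun=> 0.
    by move=> jL; rewrite /c /family_coeffs memNset.
  have rc j : radius1 (c j).
    have [jL|jL] := pselect (Lambda j); first exact: power_sum_radius1 (hc j jL).
    by rewrite c0 //; exact: l2_radius1 (@zero_l2 R).
  split=> //; apply: (col_conv_le HI rc K0) => n z b.
  exact: (op_sup_norm_eval HI HJ HIJ k0 hc c0 hk).
split; last first.
  move=> LT g hg; have [hc hcol] := solution_column g hg.
  have fc := column_fam_le K0 hcol.
  have LTj j : Lambda j by rewrite LT.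
  have terms r : 0 <= r < 1 -> _ := row_terms_le HI Hf Hf1 fc hc.
  split=> [q qB|K cK KB].
    have [|x [B [x0 xB xq]]] := terms `|q|; first by rewrite normr_ge0.
    apply/nneseries_fin_ltyP => //; exists B => n; rewrite big_mkord.
    by apply: le_trans (xB n); apply: ler_sum => j _; exact: xq.
  have [r r01 hr] := compact_in_ball cK KB.
  have [x [B [x0 xB xq]]] := terms r r01.
  apply: uniform_cvg_on => e e0.
  have e20 : 0 < e / 2 by rewrite divr_gt0.
  have [N hN] := @abs_bounded_tail R x B x0
    (fun n => ltac:(by rewrite big_mkord)) _ e20.
  exists N => n Nn q Kq; apply: le_lt_trans (_ : _ <= e / 2) _; last by lra.
  have [_ sum1 _ _] := hg.
  have : series (fun j => slice_mul (f j) (g j) q) @ \oo --> (1 : quat R).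
    have := sum1 q (KB q Kq); rewrite (_ : (fun N => _) = series (fun j => slice_mul (f j) (g j) q)) //.
    by apply/funext => m; rewrite /series /=; apply: eq_bigl => j; rewrite mem_set.
  move=> /series_tail_le tl; rewrite big_mkord; apply: tl => m.
  by apply: le_trans (hN n Nn m); apply: ler_sum => j _; apply: xq => //; exact: hr.
apply: (iff_trans (toeplitz_lower_boundP Hf Hf1 HI Heta)); split=> [[c [hsum hc']]|[g hg]].
  have hc (u : nat -> quat R) n M : \sum_(j < n) \sum_(m < M) `|qconv (c j) u m| ^+ 2 <=
      k ^+ 2 * \sum_(m < M) `|u m| ^+ 2.
    by rewrite kE mulrC ler_pdivlMr // mulrC exchange_big /=; exact: hc'.
  have pc j : power_sum (c j) (psum (c j)) := radius1_psum (column_radius1 K0 hc j).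
  have [h1 h2] := column_op_Hinf HI HJ HIJ k0 hc (fun j (_ : Lambda j) => pc j).
  exists (fun j => psum (c j)); split=> // [j _|q qB].
    split; first exact: power_sum_slice_regular (pc j).
    by exists (2 * k) => q; exact: (column_psum_le k0 hc).
  exact: (row_pointwise_cvg HI Hf Hf1 (column_fam_le K0 hc) (fun j _ => pc j) hsum qB (power_sum1 qB)).
have [hc hcol] := solution_column g hg; have fc := column_fam_le K0 hcol.
exists (family_coeffs Lambda g); split; last first.
  by move=> u n M; rewrite mulrC -ler_pdivlMr // mulrC -kE exchange_big /=; exact: hcol.
have A1 := row_coeffs_le Hf Hf1 HI; have RB := row_multiplier_le Hf Hf1 HI.
have [s [s1 s2]] := row_limit A1 RB fc.
have s1' m : (fun n => \sum_(j < n) qconv (A j) (family_coeffs Lambda g j) m) @ \oo --> s m.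
  have := s1 m; rewrite (_ : series _ =
    (fun n => \sum_(j < n) qconv (A j) (family_coeffs Lambda g j) m)) //.
  by apply/funext => n; rewrite /series /= big_mkord.
have ps := radius1_psum (l2_radius1 (row_limit_l2 RB fc s2)).
(* The pointwise identity [sum_j f_j * g_j = 1] becomes an identity of coefficients by uniqueness of
   power series. *)
have sE : (fun m : nat => (m == 0%N)%:R : quat R) = s.
  apply: (power_sum_uniq (@power_sum1 R)) => q qB.
  have [_ /(_ q qB) sum1 _ _] := hg.
  by rewrite -(cvg_uniq (row_pointwise_cvg HI Hf Hf1 fc hc s1' qB (ps q qB)) sum1); exact: ps.
by move=> m; have := s1' m; rewrite -sE.
Qed.
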